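(* Let $X=\mathbb{R}^{2n}/\mathbb{Z}^{2n}$ with symplectic form $\omega=\sum_{i=1}^n dy^i\wedge dx^i$, let $Q^\hbar$ and $\check Q^\hbar$ be the Toeplitz operators for the pairs of polarizations $(\mathcal{P}^{\check T},\mathcal{P}^T)$ and $(\mathcal{P}^T,\mathcal{P}^{\check T})$, acting on $\mathcal{H}^\hbar$ and $\check{\mathcal{H}}^\hbar$ respectively, let $\mathcal{F}^{\mathrm{GQ}}:\operatorname{End}_{\mathbb{C}}\check{\mathcal{H}}^\hbar\to\operatorname{End}_{\mathbb{C}}\mathcal{H}^\hbar$ be $A\mapsto B^\hbar A(B^\hbar)^{-1}$, and let $\mathcal{F}^{\mathrm{DQ}}_N=\sum_{i=0}^N\frac{1}{i!}(-\hbar\Delta)^i$ with $\Delta=\frac{\sqrt{-1}}{2\pi}\sum_{i=1}^n\frac{\partial^2}{\partial x^i\partial y^i}$. For all $f\in\mathcal{C}^\infty(X,\mathbb{C})$ and $N\in\mathbb{N}\cup\{0\}$, there exists $K>0$ such that $$\left\lVert(\mathcal{F}^{\mathrm{GQ}}\circ\check Q^\hbar)(f)-(Q^\hbar\circ\mathcal{F}^{\mathrm{DQ}}_N)(f)\right\rVert\le K\hbar^{N+1}$$ for all $k\in\mathbb{N}$, where $\hbar=\tfrac1k$ and $\lVert\cdot\rVert$ is the operator norm with respect to the inner product of $\mathcal{H}^\hbar$.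
   Context: Setting. Let $n\ge 1$, $\mathbb{N}=\{1,2,\dots\}$, $T=\check T=\mathbb{R}^n/\mathbb{Z}^n$, $X=T\times\check T=\mathbb{R}^{2n}/\mathbb{Z}^{2n}$ with periodic coordinates $(x,y)$, $x,y\in\mathbb{R}^n$, and $\omega=\sum_{i=1}^n dy^i\wedge dx^i$. $\mathcal{C}^\infty(X,\mathbb{C})$ is identified with the smooth $\mathbb{Z}^{2n}$-periodic functions on $\mathbb{R}^{2n}$. $\mathcal{P}^T$ is the complex span of the $\partial_{x^i}$ and $\mathcal{P}^{\check T}$ the complex span of the $\partial_{y^i}$. For $k\in\mathbb{N}$ put $\hbar=1/k$ and $\mathbb{Z}_k^n=\mathbb{Z}^n/k\mathbb{Z}^n$; $[m]$ is the class of $m\in\mathbb{Z}^n$. Line bundle. Smooth sections of the prequantum bundle $L^{\otimes k}$ are identified with smooth $s:\mathbb{R}^{2n}\to\mathbb{C}$ satisfying $s(u+\lambda)=\alpha(\lambda)^ke^{-k\pi\sqrt{-1}\,\omega(u,\lambda)}s(u)$ for $\lambda\in\mathbb{Z}^{2n}$, where $\alpha(\lambda)=(-1)^{\sum_i\lambda_i\lambda_{n+i}}$ and $\omega(u,v)=\sum_i(u_{n+i}v_i-u_iv_{n+i})$. The connection is $\nabla^\hbar=d-k\pi\sqrt{-1}\sum_i(y^idx^i-x^idy^i)$, and $\langle s,t\rangle_{L^2}=\int_{[0,1]^{2n}}s\bar t\,d^nx\,d^ny$. A distributional section $s\in\Gamma^{-\infty}(X,L^{\otimes k})$ is a continuous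 linear functional $t\mapsto s(\bar t)=:\langle s,t\rangle$ of $\bar t$, $t$ smooth, with smooth sections embedded via $\langle\cdot,\cdot\rangle_{L^2}$; products with functions and $\nabla^\hbar$ extend by duality. Weil-Brezin transform. For smooth $s$ and $[m]\in\mathbb{Z}_k^n$ let $(s)_{[m]}(y)=\int_{[0,1]^n}\tilde s(x,y+\hbar m)e^{-2\pi\sqrt{-1}m\cdot x}d^nx$, where $\tilde s(x,y)=e^{k\pi\sqrt{-1}x\cdot y}s(x,y)$. This gives isomorphisms $\Gamma^\infty(X,L^{\otimes k})\cong\prod_{\mathbb{Z}_k^n}\mathcal{S}(\mathbb{R}^n)$ and, by extension, $\Gamma^{-\infty}(X,L^{\otimes k})\cong\prod_{\mathbb{Z}_k^n}\mathcal{S}'(\mathbb{R}^n)$, with $\langle a,b\rangle_{L^2}=\sum_{[m]}\int_{\mathbb{R}^n}(a)_{[m]}\overline{(b)_{[m]}}\,d^ny$. Quantum Hilbert spaces. $\mathcal{H}^\hbar=\{s\in\Gamma^{-\infty}(X,L^{\otimes k}):\nabla^\hbar_{\bar\xi}s=0\ \forall\xi\in\Gamma^\infty(X,\mathcal{P}^T)\}\otimes\mathbb{C}\rho$, and $\check{\mathcal{H}}^\hbar$ is defined likewise with $\mathcal{P}^{\check T}$ and $\check\rho$ in place of $\mathcal{P}^T$ and $\rho$. Here $\rho,\check\rho$ are the chosen half-form generators (square roots of $\bigwedge^n(-2\sqrt{-1}dy)$ and $\bigwedge^n(2dx)$), paired by $\langle\rho,\check\rho\rangle=2^{n/2}k^{-n/2}$.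 Bases indexed by $m\in\mathbb{Z}_k^n$ are $\sigma_\hbar^m=2^{n/4}k^{n/2}\vartheta_\hbar^m\otimes\rho$ of $\mathcal{H}^\hbar$ and $\check\sigma_\hbar^m=2^{n/4}k^{n/2}\check\vartheta_\hbar^m\otimes\check\rho$ of $\check{\mathcal{H}}^\hbar$, where the Weil-Brezin coefficients are $(\vartheta_\hbar^m)_{m'}(\varphi)=\delta_{m,m'}(2k)^{-n/2}\varphi(0)$ for $\varphi\in\mathcal{S}(\mathbb{R}^n)$, and $(\check\vartheta_\hbar^m)_{m'}$ is the constant function $\delta_{m,m'}2^{-n/2}$. The inner products on $\mathcal{H}^\hbar$ and $\check{\mathcal{H}}^\hbar$ (boundary limits of the Blattner-Kostant-Sternberg pairing) are those for which $\{\sigma_\hbar^m\}$, respectively $\{\check\sigma_\hbar^m\}$, is orthonormal. $B^\hbar:\check{\mathcal{H}}^\hbar\to\mathcal{H}^\hbar$ is the unitary map with $B^\hbar(\check\sigma_\hbar^m)=\sigma_\hbar^m$ for all $m\in\mathbb{Z}_k^n$. Pairing and Toeplitz operators. Let $\mathrm{WF}^\hbar$, $\check{\mathrm{WF}}^\hbar$ be the unions of wavefront sets of (the section parts of) elements of $\mathcal{H}^\hbar$, $\check{\mathcal{H}}^\hbar$. They are disjoint, so by Hörmander's criterion $\langle\cdot,\cdot\rangle_{L^2}$ extends to a sesquilinear pairing (linear in the first slot) of distributional sections with wavefront set in $\mathrm{WF}^\hbar$ against those with wavefront set in $\check{\mathrm{WF}}^\hbar$; it is tensored with $\langle\rho,\check\rho\rangle$.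 Concretely, for smooth $f$, $\langle f\vartheta_\hbar^a,\check\vartheta_\hbar^b\rangle=\langle\vartheta_\hbar^a,\bar f\check\vartheta_\hbar^b\rangle=\sum_{c\in\mathbb{Z}_k^n}(\vartheta_\hbar^a)_c\big(\overline{(\bar f\check\vartheta_\hbar^b)_c}\big)$, the pairing of compactly supported distributions with smooth functions on $\mathbb{R}^n$. In the reverse order put $\langle b,a\rangle=\overline{\langle a,b\rangle}$. Then $\langle\sigma_\hbar^m,\check\sigma_\hbar^{m'}\rangle=\delta_{m,m'}$. The Toeplitz operator for $(\mathcal{P}^{\check T},\mathcal{P}^T)$ is $Q_f^\hbar s=\sum_{m\in\mathbb{Z}_k^n}\langle fs,\check\sigma_\hbar^m\rangle\sigma_\hbar^m$ for $s\in\mathcal{H}^\hbar$; the Toeplitz operator for $(\mathcal{P}^T,\mathcal{P}^{\check T})$ is $\check Q_f^\hbar s=\sum_{m\in\mathbb{Z}_k^n}\langle fs,\sigma_\hbar^m\rangle\check\sigma_\hbar^m$ for $s\in\check{\mathcal{H}}^\hbar$; here $f\in\mathcal{C}^\infty(X,\mathbb{C})$. *)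

(* Defs.v *)
From HB Require Import structures.
From mathcomp Require Import all_boot all_order all_algebra.
From mathcomp Require Import complex.
From mathcomp Require Import all_classical all_reals all_analysis.
From mathcomp Require Import ring.

Set Implicit Arguments.
Unset Strict Implicit.
Unset Printing Implicit Defensive.

Import Order.TTheory GRing.Theory Num.Theory.
Import numFieldNormedType.Exports.

Local Open Scope classical_set_scope.
Local Open Scope complex_scope.
Local Open Scope ring_scope.

Section ComplexCalculus.
Variable R : realType.

Definition cis (a : R) : R[i] := cos a +i* sin a.

Definition cabs (z : R[i]) : R := ComplexField.Normc.normc z.

Definition cconj (T : Type) (f : T -> R[i]) : T -> R[i] := fun u => (f u)^*.

Section PartialDerivatives.
Variable m : nat.
Implicit Types f g : 'rV[R]_m -> R[i].

Definition pderiv (j : 'I_m) f : 'rV[R]_m -> R[i] := fun u =>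
  'D_(delta_mx 0 j) (fun v => complex.Re (f v)) u
  +i* 'D_(delta_mx 0 j) (fun v => complex.Im (f v)) u.

Definition pderivs (l : seq 'I_m) f : 'rV[R]_m -> R[i] := foldr pderiv f l.

Definition real_regular (h : 'rV[R]_m -> R) : Prop :=
  continuous h /\ forall j u, derivable h u (delta_mx 0 j).

Definition regular1 f : Prop :=
  real_regular (fun u => complex.Re (f u)) /\ real_regular (fun u => complex.Im (f u)).

(* C^oo : every iterated partial derivative exists and is continuous *)
Definition smooth f : Prop := forall l, regular1 (pderivs l f).

Lemma smoothS f :
  smooth f <-> regular1 f /\ forall j, smooth (pderiv j f).
Proof.
have E l j : pderivs (rcons l j) f = pderivs l (pderiv j f).
  by rewrite /pderivs foldr_rcons.
split=> [sf|[rf sf] l].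
  by split=> [|j l]; [exact: (sf [::])|rewrite -E; exact: sf].
by case/lastP: l => [//|l j]; rewrite E; exact: sf.
Qed.

Lemma smooth_coind (F : set ('rV[R]_m -> R[i])) :
  (forall f, F f -> regular1 f /\ forall j, F (pderiv j f)) ->
  forall f, F f -> smooth f.
Proof.
move=> FP f Ff l; elim/last_ind: l f Ff => [|l j IH] f Ff.
  by have [] := FP f Ff.
by rewrite /pderivs foldr_rcons; apply: IH; have [_] := FP f Ff.
Qed.

Lemma real_regularD (h1 h2 : 'rV[R]_m -> R) :
  real_regular h1 -> real_regular h2 -> real_regular (h1 + h2).
Proof.
move=> [c1 d1] [c2 d2]; split=> [u|j u]; last exact: derivableD.
exact: continuousD (c1 u) (c2 u).
Qed.

Lemma real_regularN (h : 'rV[R]_m -> R) : real_regular h -> real_regular (- h).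
Proof.
move=> [c d]; split=> [u|j u]; last exact: derivableN.
exact: continuousN (c u).
Qed.

Lemma real_regularM (h1 h2 : 'rV[R]_m -> R) :
  real_regular h1 -> real_regular h2 -> real_regular (h1 * h2).
Proof.
move=> [c1 d1] [c2 d2]; split=> [u|j u]; last exact: derivableM.
exact: continuousM (c1 u) (c2 u).
Qed.

Lemma ReD (z w : R[i]) : complex.Re (z + w) = complex.Re z + complex.Re w.
Proof. by case: z w => [a b] [c d]. Qed.

Lemma ImD (z w : R[i]) : complex.Im (z + w) = complex.Im z + complex.Im w.
Proof. by case: z w => [a b] [c d]. Qed.

Lemma ReM (z w : R[i]) :
  complex.Re (z * w) = complex.Re z * complex.Re w - complex.Im z * complex.Im w.
Proof. by case: z w => [a b] [c d]. Qed.

Lemma ImM (z w : R[i]) :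
  complex.Im (z * w) = complex.Re z * complex.Im w + complex.Im z * complex.Re w.
Proof. by case: z w => [a b] [c d]. Qed.

Lemma fReD f g : (fun u => complex.Re ((f + g) u))
  = (fun u => complex.Re (f u)) + (fun u => complex.Re (g u)).
Proof. by apply/funext => u; rewrite ReD. Qed.

Lemma fImD f g : (fun u => complex.Im ((f + g) u))
  = (fun u => complex.Im (f u)) + (fun u => complex.Im (g u)).
Proof. by apply/funext => u; rewrite ImD. Qed.

Lemma fReM f g : (fun u => complex.Re ((f * g) u))
  = (fun u => complex.Re (f u)) * (fun u => complex.Re (g u))
    - (fun u => complex.Im (f u)) * (fun u => complex.Im (g u)).
Proof. by apply/funext => u; rewrite ReM. Qed.

Lemma fImM f g : (fun u => complex.Im ((f * g) u))
  = (fun u => complex.Re (f u)) * (fun u => complex.Im (g u))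
    + (fun u => complex.Im (f u)) * (fun u => complex.Re (g u)).
Proof. by apply/funext => u; rewrite ImM. Qed.

Lemma regular1D f g : regular1 f -> regular1 g -> regular1 (f + g).
Proof.
by move=> [rf If] [rg Ig]; split; rewrite ?fReD ?fImD; exact: real_regularD.
Qed.

Lemma pderivD j f g : regular1 f -> regular1 g ->
  pderiv j (f + g) = pderiv j f + pderiv j g.
Proof.
move=> [[_ rf] [_ If]] [[_ rg] [_ Ig]]; apply/funext => u.
by rewrite /pderiv fReD fImD !deriveD.
Qed.

Lemma regular1M f g : regular1 f -> regular1 g -> regular1 (f * g).
Proof.
move=> [rf If] [rg Ig]; split; rewrite ?fReM ?fImM.
  by apply: real_regularD; [|apply: real_regularN]; exact: real_regularM.
by apply: real_regularD; exact: real_regularM.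
Qed.

Lemma pderivM j f g : regular1 f -> regular1 g ->
  pderiv j (f * g) = pderiv j f * g + f * pderiv j g.
Proof.
move=> [[_ rf] [_ If]] [[_ rg] [_ Ig]]; apply/funext => u.
have dM (a b : 'rV[R]_m -> R) : derivable a u (delta_mx 0 j) ->
    derivable b u (delta_mx 0 j) -> derivable (a * b) u (delta_mx 0 j).
  exact: derivableM.
rewrite /pderiv fReM fImM deriveB ?deriveD ?deriveM//; [|exact: dM..].
rewrite -[RHS]/(pderiv j f u * g u + f u * pderiv j g u) /pderiv.
case: (f u) (g u) => [a b] [c d].
apply/eqP; rewrite eq_complex !(ReD, ImD, ReM, ImM) /=.
by rewrite /GRing.scale /=; apply/andP; split; apply/eqP; ring.
Qed.

Lemma fRe_conj f : (fun u => complex.Re (cconj f u)) = (fun u => complex.Re (f u)).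
Proof. by apply/funext => u; rewrite /cconj; case: (f u). Qed.

Lemma fIm_conj f :
  (fun u => complex.Im (cconj f u)) = - (fun u => complex.Im (f u)).
Proof. by apply/funext => u; rewrite /cconj -[RHS]/(- _); case: (f u). Qed.

Lemma regular1_conj f : regular1 f -> regular1 (cconj f).
Proof.
by move=> [rf If]; split; rewrite ?fRe_conj ?fIm_conj//; exact: real_regularN.
Qed.

Lemma pderiv_conj j f : regular1 f -> pderiv j (cconj f) = cconj (pderiv j f).
Proof.
move=> [_ [_ dI]]; apply/funext => u.
by rewrite /pderiv fRe_conj fIm_conj deriveN.
Qed.

Lemma real_regular_cst (a : R) : real_regular (cst a : 'rV[R]_m -> R).
Proof. by split=> [u|j u]; [exact: cst_continuous|exact: derivable_cst]. Qed.

Lemma regular1_cst (a : R[i]) : regular1 (cst a : 'rV[R]_m -> R[i]).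
Proof. by split; exact: real_regular_cst. Qed.

Lemma pderiv_cst j (a : R[i]) : pderiv j (cst a) = cst 0.
Proof.
apply/funext => u; rewrite /pderiv /cst /=.
by rewrite (derive_cst (complex.Re a)) (derive_cst (complex.Im a)).
Qed.

Lemma smooth_regular1 f : smooth f -> regular1 f.
Proof. by move=> sf; exact: (sf [::]). Qed.

Lemma smooth_pderiv j f : smooth f -> smooth (pderiv j f).
Proof. by move=> /smoothS[]. Qed.

Lemma smooth_cst (a : R[i]) : smooth (cst a : 'rV[R]_m -> R[i]).
Proof.
apply: (@smooth_coind [set f | exists b, f = cst b]); last by exists a.
move=> _ [b ->]; split; first exact: regular1_cst.
by move=> j; exists 0; exact: pderiv_cst.
Qed.

Lemma smoothD f g : smooth f -> smooth g -> smooth (f + g).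
Proof.
move=> sf sg; apply: (@smooth_coind
  [set h | exists a b, [/\ smooth a, smooth b & h = a + b]]); last by exists f, g.
move=> _ [a [b [sa sb ->]]]; have [ra rb] := (smooth_regular1 sa, smooth_regular1 sb).
split=> [|j]; first exact: regular1D.
exists (pderiv j a), (pderiv j b); split; [exact: smooth_pderiv..|].
exact: pderivD.
Qed.

Inductive sum_of_products : ('rV[R]_m -> R[i]) -> Prop :=
| sop_mul f g of smooth f & smooth g : sum_of_products (f * g)
| sop_add f g of sum_of_products f & sum_of_products g :
    sum_of_products (f + g).

Lemma smoothM f g : smooth f -> smooth g -> smooth (f * g).
Proof.
move=> sf sg; apply: (@smooth_coind sum_of_products); last exact: sop_mul.
move=> h; elim=> {f g sf sg h} [f g sf sg|f g _ [rf hf] _ [rg hg]].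
  have [rf rg] := (smooth_regular1 sf, smooth_regular1 sg).
  split=> [|j]; first exact: regular1M.
  by rewrite pderivM//; apply: sop_add; apply: sop_mul => //; exact: smooth_pderiv.
split=> [|j]; first exact: regular1D.
by rewrite pderivD//; exact: sop_add.
Qed.

Lemma smoothZ (a : R[i]) f : smooth f -> smooth (a *: f).
Proof. by move=> sf; apply: (smoothM (smooth_cst a) sf). Qed.

Lemma smooth_conj f : smooth f -> smooth (cconj f).
Proof.
move=> sf; apply: (@smooth_coind [set h | exists2 a, smooth a & h = cconj a]).
  move=> _ [a sa ->]; have ra := smooth_regular1 sa.
  split=> [|j]; first exact: regular1_conj.
  by exists (pderiv j a); [exact: smooth_pderiv|exact: pderiv_conj].
by exists f.
Qed.

Section LinearForms.
Variable h : 'rV[R]_m -> R.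
Hypotheses (hD : forall u v, h (u + v) = h u + h v)
  (hZ : forall a u, h (a *: u) = a * h u) (hc : continuous h).

Lemma derive_comp_form (F : R -> R) (u v : 'rV[R]_m) :
  (fun t : R => t^-1 *: (F (h (t *: v + u)) - F (h u))) =
  (fun t : R => t^-1 *: (F (t *: h v + h u) - F (h u))).
Proof. by apply/funext => t; rewrite hD hZ. Qed.

Lemma is_derive_comp_form (F : R -> R) (u v : 'rV[R]_m) (dF : R) :
  is_derive (h u) (1 : R) F dF -> is_derive u v (F \o h) (h v * dF).
Proof.
move=> dFu; have Fh : is_derive (h u) (h v) F (h v * dF).
  have Fd : differentiable F (h u) by apply/derivable1_diffP; case: dFu.
  split; first exact: diff_derivable.
  rewrite deriveE// -[h v in LHS]mulr1 -[h v * 1]/(h v *: 1) linearZ /=.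
  by rewrite -deriveE//; case: dFu => _ ->.
case: Fh => dF1 dF2; split.
  by move: dF1; rewrite /derivable /= -derive_comp_form.
by rewrite -dF2 /derive /= -derive_comp_form.
Qed.

Lemma real_regular_form : real_regular h.
Proof.
split=> // j u; have [] := @is_derive_comp_form id u (delta_mx 0 j) 1 _ => //.
Qed.

Lemma regular1_cis : regular1 (fun u => cis (h u)).
Proof.
split; split=> [u|j u].
- apply: continuous_comp; [exact: hc|exact: continuous_cos].
- by have [] := is_derive_comp_form (delta_mx 0 j) (is_derive_cos (h u)).
- apply: continuous_comp; [exact: hc|exact: continuous_sin].
- by have [] := is_derive_comp_form (delta_mx 0 j) (is_derive_sin (h u)).
Qed.

Lemma pderiv_cis j : pderiv j (fun u => cis (h u)) =
  (0 +i* h (delta_mx 0 j)) *: (fun u => cis (h u)).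
Proof.
apply/funext => u; rewrite /pderiv.
have [_ /= ->] := is_derive_comp_form (delta_mx 0 j) (is_derive_cos (h u)).
have [_ /= ->] := is_derive_comp_form (delta_mx 0 j) (is_derive_sin (h u)).
rewrite -[RHS]/((0 +i* _) * cis (h u)) /cis.
by apply/eqP; rewrite eq_complex !(ReM, ImM) /=; apply/andP; split; apply/eqP; ring.
Qed.

Lemma smooth_form : smooth (fun u => (h u)%:C).
Proof.
apply/smoothS; split=> [|j].
  by split; [exact: real_regular_form|exact: real_regular_cst].
suff -> : pderiv j (fun u => (h u)%:C) = cst (h (delta_mx 0 j))%:C.
  exact: smooth_cst.
apply/funext => u; rewrite /pderiv (derive_cst (0 : R)).
have [_] := @is_derive_comp_form id u (delta_mx 0 j) 1 _.
by rewrite mulr1 => ->.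
Qed.

End LinearForms.

Lemma pderiv_translate j f (a : 'rV[R]_m) :
  pderiv j (fun u => f (u + a)) = fun u => pderiv j f (u + a).
Proof.
apply/funext => u; rewrite /pderiv /derive /=.
have E (F : 'rV[R]_m -> R) : (fun h : R => h^-1 *: (F (h *: delta_mx 0 j + u + a) - F (u + a)))
    = (fun h : R => h^-1 *: (F (h *: delta_mx 0 j + (u + a)) - F (u + a))).
  by apply/funext => h; rewrite addrA.
by rewrite (E (fun v => complex.Re (f v))) (E (fun v => complex.Im (f v))).
Qed.

End PartialDerivatives.
End ComplexCalculus.

Definition lattice (R : realType) m (l : 'rV[int]_m) : 'rV[R]_m :=
  map_mx intr l.

(* Smooth functions on R^m with multipliers c: f (u + l) = c l u * f u.
   Both functions on the torus and sections of L^k are of this form. *)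
Section QuasiPeriodic.
Variables (R : realType) (m : nat) (c : 'rV[int]_m -> 'rV[R]_m -> R[i]).

Definition quasi_periodic : {pred 'rV[R]_m -> R[i]} := fun f =>
  `[< smooth f /\ forall l u, f (u + lattice R l) = c l u * f u >].

Lemma quasi_periodic_submod : GRing.submod_closed quasi_periodic.
Proof.
split=> [|a f g /asboolP[sf cf] /asboolP[sg cg]]; apply/asboolP; split.
- exact: smooth_cst.
- by move=> l u; rewrite mulr0.
- by apply: smoothD => //; exact: smoothZ.
- move=> l u; rewrite -[LHS]/(a * f _ + g _) -[X in c l u * X]/(a * f u + g u).
  by rewrite cf cg mulrDr mulrCA.
Qed.

HB.instance Definition _ := GRing.isSubmodClosed.Build R[i] ('rV[R]_m -> R[i])
  quasi_periodic quasi_periodic_submod.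

Record qper := QPer {
  qper_val :> 'rV[R]_m -> R[i];
  qperP : qper_val \in quasi_periodic }.

HB.instance Definition _ := [isSub for qper_val].
HB.instance Definition _ := [Choice of qper by <:].
HB.instance Definition _ := [SubChoice_isSubLmodule of qper by <:].

Lemma qper_smooth (t : qper) : smooth t.
Proof. by case: t => t /= /asboolP[]. Qed.

Lemma qper_quasi (t : qper) l u : t (u + lattice R l) = c l u * t u.
Proof. by case: t => t /= /asboolP[]. Qed.

End QuasiPeriodic.

Section Torus.
Variables (R : realType) (n : nat).

(* coordinates on R^(2n) are u = (x, y) *)
Definition xc (u : 'rV[R]_(n + n)) (i : 'I_n) : R := u 0 (lshift n i).
Definition yc (u : 'rV[R]_(n + n)) (i : 'I_n) : R := u 0 (rshift n i).

Definition omega (u v : 'rV[R]_(n + n)) : R :=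
  \sum_i (yc u i * xc v i - xc u i * yc v i).

Definition mult1 (_ : 'rV[int]_(n + n)) (_ : 'rV[R]_(n + n)) : R[i] := 1.

(* C^oo(X, C), X = R^(2n) / Z^(2n) *)
Definition torus_fun := qper mult1.

Lemma torus_conj_subproof (f : torus_fun) :
  cconj f \in quasi_periodic mult1.
Proof.
apply/asboolP; split=> [|l u]; first exact/smooth_conj/qper_smooth.
by rewrite /cconj qper_quasi !mul1r.
Qed.
Definition torus_conj (f : torus_fun) : torus_fun := QPer (torus_conj_subproof f).

Lemma torus_pderiv_subproof j (f : torus_fun) :
  pderiv j f \in quasi_periodic mult1.
Proof.
apply/asboolP; split=> [|l u]; first exact/smooth_pderiv/qper_smooth.
have E : (fun v => f (v + lattice R l)) = f :> ('rV[R]_(n + n) -> R[i]).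
  by apply/funext => v; rewrite qper_quasi mul1r.
have /(congr1 (fun g : 'rV[R]_(n + n) -> R[i] => g u)) :=
  pderiv_translate j f (lattice R l).
by rewrite E mul1r => ->.
Qed.
Definition torus_pderiv j (f : torus_fun) : torus_fun :=
  QPer (torus_pderiv_subproof j f).

Definition Delta (f : torus_fun) : torus_fun :=
  (0 +i* (2 * pi)^-1) *:
    \sum_i torus_pderiv (lshift n i) (torus_pderiv (rshift n i) f).

Section Prequantum.
Variable k : nat.

Definition hbar : R := k%:R^-1.

Definition alpha (l : 'rV[int]_(n + n)) : R[i] :=
  (-1) ^ (\sum_i l 0 (lshift n i) * l 0 (rshift n i)).

Definition multiplier (l : 'rV[int]_(n + n)) (u : 'rV[R]_(n + n)) : R[i] :=
  alpha l ^+ k * cis (- (k%:R * pi * omega u (lattice R l))).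

Definition section := qper multiplier.

Lemma section_mul_subproof (f : torus_fun) (t : section) :
  (f : _ -> _) * (t : _ -> _) \in quasi_periodic multiplier.
Proof.
apply/asboolP; split=> [|l u]; first by apply: smoothM; exact: qper_smooth.
rewrite -[LHS]/(f _ * t _) -[X in multiplier l u * X]/(f u * t u).
by rewrite !qper_quasi mul1r mulrCA.
Qed.
Definition section_mul (f : torus_fun) (t : section) : section :=
  QPer (section_mul_subproof f t).

(* the components of sum_i (y^i dx^i - x^i dy^i) *)
Definition conn_form (j : 'I_(n + n)) (u : 'rV[R]_(n + n)) : R :=
  match fintype.split j with inl i => yc u i | inr i => - xc u i end.

Definition nabla_fun (j : 'I_(n + n)) (t : 'rV[R]_(n + n) -> R[i]) :
    'rV[R]_(n + n) -> R[i] :=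
  fun u => pderiv j t u - (0 +i* (k%:R * pi)) * (conn_form j u)%:C * t u.

Lemma conn_formD j u v : conn_form j (u + v) = conn_form j u + conn_form j v.
Proof.
by rewrite /conn_form; case: (fintype.split j) => i; rewrite /xc /yc !mxE ?opprD.
Qed.

Lemma conn_formZ j a u : conn_form j (a *: u) = a * conn_form j u.
Proof.
by rewrite /conn_form; case: (fintype.split j) => i; rewrite /xc /yc !mxE ?mulrN.
Qed.

Lemma conn_form_continuous j : continuous (conn_form j).
Proof.
rewrite /conn_form; case: (fintype.split j) => i u; first exact: coord_continuous.
by apply: continuousN; exact: coord_continuous.
Qed.

Lemma omegaDl u v w : omega (u + v) w = omega u w + omega v w.
Proof.
rewrite /omega -big_split; apply: eq_bigr => i _ /=.
by rewrite /xc /yc !mxE; ring.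
Qed.

Lemma omegaZl a u w : omega (a *: u) w = a * omega u w.
Proof.
rewrite /omega mulr_sumr; apply: eq_bigr => i _ /=.
by rewrite /xc /yc !mxE; ring.
Qed.

Lemma omega_continuous w : continuous (omega ^~ w).
Proof.
rewrite /omega; apply: continuous_big => [|i _ u].
  by move=> u; exact: add_continuous.
apply: (@continuousB _ _ _ (fun v => yc v i * xc w i) (fun v => xc v i * yc w i)).
  by apply: (@continuousM _ _ (yc^~ i) (cst _));
    [exact: coord_continuous|exact: cst_continuous].
by apply: (@continuousM _ _ (xc^~ i) (cst _));
  [exact: coord_continuous|exact: cst_continuous].
Qed.


Lemma omega_delta j w : omega (delta_mx 0 j) w = - conn_form j w.
Proof.
rewrite /conn_form -{1}(splitK j) /omega; case: (fintype.split j) => i /=.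
  rewrite (bigD1 i) //= big1 => [|i' ne]; rewrite /xc /yc !mxE !eqxx /=.
    rewrite eq_rlshift mulr0n; ring.
  rewrite eq_rlshift (inj_eq (@lshift_inj _ _)) (negbTE ne) !mulr0n; ring.
rewrite (bigD1 i) //= big1 => [|i' ne]; rewrite /xc /yc !mxE !eqxx /=.
  rewrite eq_lrshift mulr0n; ring.
rewrite eq_lrshift (inj_eq (@rshift_inj _ _)) (negbTE ne) !mulr0n; ring.
Qed.


Lemma multiplierE l : multiplier l =
  (alpha l ^+ k) *: (fun u => cis (- (k%:R * pi * omega u (lattice R l)))).
Proof. by []. Qed.

Lemma pderiv_multiplier j l : regular1 (multiplier l) /\
  pderiv j (multiplier l) =
  (0 +i* (k%:R * pi * conn_form j (lattice R l))) *: multiplier l.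
Proof.
set w := lattice R l; set h := fun u => - (k%:R * pi * omega u w).
have hD u v : h (u + v) = h u + h v by rewrite /h omegaDl; ring.
have hZ a u : h (a *: u) = a * h u by rewrite /h omegaZl; ring.
have hc : continuous h.
  move=> u; apply: (@continuousN _ _ _ (fun u => k%:R * pi * omega u w)).
  by apply: (@continuousM _ _ (cst _) (omega^~ w));
    [exact: cst_continuous|exact: omega_continuous].
have rc := regular1_cis hD hZ hc.
have ra := regular1_cst (n + n) (alpha l ^+ k).
have E : multiplier l = cst (alpha l ^+ k) * (fun u => cis (h u)) by [].
rewrite E; split; first exact: regular1M.
rewrite pderivM// pderiv_cst (pderiv_cis hD hZ) /h omega_delta.
apply/funext => u.
rewrite -[LHS]/(0 * cis (h u) + alpha l ^+ k * ((0 +i* _) * cis (h u))).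
by rewrite -[RHS]/((0 +i* _) * (alpha l ^+ k * cis (h u))) mul0r add0r mulrCA mulrN opprK.
Qed.

Lemma nabla_subproof j (t : section) :
  nabla_fun j t \in quasi_periodic multiplier.
Proof.
apply/asboolP; split=> [|l u].
  have -> : nabla_fun j t = pderiv j t + (- (0 +i* (k%:R * pi))) *:
      ((fun u => (conn_form j u)%:C) * (t : _ -> _)).
    apply/funext => u; rewrite /nabla_fun -mulrA -mulNr.
    by rewrite -[RHS]/(pderiv j t u + - (0 +i* (k%:R * pi)) *
      ((conn_form j u)%:C * t u)).
  apply: smoothD; first exact/smooth_pderiv/qper_smooth.
  apply: smoothZ; apply: smoothM; last exact: qper_smooth.
  exact: smooth_form (conn_formD j) (conn_formZ j) (@conn_form_continuous j).
have [rm dm] := pderiv_multiplier j l.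
have E : (fun v => t (v + lattice R l)) = multiplier l * (t : _ -> _).
  by apply/funext => v; rewrite qper_quasi.
have := pderiv_translate j t (lattice R l).
rewrite E pderivM ?dm//; last exact/smooth_regular1/qper_smooth.
move=> dE; have {dE} H : (0 +i* (k%:R * pi * conn_form j (lattice R l)))
    * multiplier l u * t u + multiplier l u * pderiv j t u
    = pderiv j t (u + lattice R l).
  by have := congr1 (fun g : 'rV[R]_(n + n) -> R[i] => g u) dE.
rewrite /nabla_fun -H qper_quasi conn_formD.
have -> : 0 +i* (k%:R * pi * conn_form j (lattice R l)) =
    (0 +i* (k%:R * pi)) * (conn_form j (lattice R l))%:C.
  by apply/eqP; rewrite eq_complex /= !mulr0 !mul0r subrr add0r !eqxx.
rewrite rmorphD /=; ring.
Qed.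
Definition nabla j (t : section) : section := QPer (nabla_subproof j t).

(* A functional s represents t |-> <s, t> = s(conj t), antilinear in t. *)
Definition functional := section -> R[i].

(* continuity in the C^oo topology, by seminorms over a fundamental cube *)
Definition distributional (s : functional) : Prop :=
  (forall (a : R[i]) t1 t2, s (a *: t1 + t2) = a^* * s t1 + s t2) /\
  exists (M : nat) (C : R), forall (t : section) (B : R),
    (forall (l : seq 'I_(n + n)) (u : 'rV[R]_(n + n)), (size l <= M)%N ->
       (forall j, 0 <= u 0 j <= 1) ->
       cabs (pderivs l t u) <= B) ->
    cabs (s t) <= C * B.

Definition dist_mul (f : torus_fun) (s : functional) : functional :=
  fun t => s (section_mul (torus_conj f) t).

(* each nabla_j is formally skew-adjoint *)
Definition dist_nabla (j : 'I_(n + n)) (s : functional) : functional :=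
  fun t => - s (nabla j t).

(* complex vector field sum_j (xi j) d/du_j on X *)
Definition vector_field := 'I_(n + n) -> torus_fun.

Definition vf_conj (xi : vector_field) : vector_field :=
  fun j => torus_conj (xi j).

Definition dist_nabla_vf (xi : vector_field) (s : functional) : functional :=
  \sum_j dist_mul (xi j) (dist_nabla j s).

Definition PT : set vector_field := [set xi | forall i, xi (rshift n i) = 0].
Definition PTcheck : set vector_field :=
  [set xi | forall i, xi (lshift n i) = 0].

(* The half-form lines are trivialised by rho, rho-check: an element
   s (x) rho is represented by s, and the factor <rho, rho-check> is
   inserted in [bks]. *)
Definition polarized (P : set vector_field) : set functional :=
  [set s | distributional s /\
    forall xi, P xi -> dist_nabla_vf (vf_conj xi) s = 0].

Definition Hsp : set functional := polarized PT.
Definition Hsp_check : set functional := polarized PTcheck.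

(* Z_k^n, by representatives *)
Definition Zkn := {ffun 'I_n -> 'I_k}.

Fixpoint iterated_integral (D : set R) (d : nat) : ('rV[R]_d -> R) -> R :=
  match d with
  | 0 => fun h => h 0
  | d'.+1 => fun h => \int[lebesgue_measure]_(a in D)
      iterated_integral D (fun v : 'rV[R]_d' => h (row_mx (const_mx a : 'rV_1) v))
  end.

Definition cintegral (D : set R) (g : 'rV[R]_n -> R[i]) : R[i] :=
  iterated_integral D (fun v => complex.Re (g v))
  +i* iterated_integral D (fun v => complex.Im (g v)).

Definition tilde (t : section) (x y : 'rV[R]_n) : R[i] :=
  cis (k%:R * pi * \sum_i x 0 i * y 0 i) * t (row_mx x y).

Definition weil_brezin (t : section) (m : Zkn) (y : 'rV[R]_n) : R[i] :=
  cintegral `[0, 1] (fun x =>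
    tilde t x (y + hbar *: \row_i (m i)%:R)
    * cis (- (2 * pi * \sum_i (m i)%:R * x 0 i))).

(* functionals phi |-> U(phi) on functions on R^n *)
Definition functional_Rn := ('rV[R]_n -> R[i]) -> R[i].

Definition linear_on (P : set ('rV[R]_n -> R[i])) (U : functional_Rn) : Prop :=
  forall a phi psi, P phi -> P psi -> U (a *: phi + psi) = a * U phi + U psi.

Definition monomial (b : seq 'I_n) (y : 'rV[R]_n) : R :=
  \prod_(i <- b) y 0 i.

Definition schwartz : set ('rV[R]_n -> R[i]) :=
  [set phi | smooth phi /\ forall b l, exists B, forall y,
    cabs ((monomial b y)%:C * pderivs l phi y) <= B].

Definition tempered (U : functional_Rn) : Prop :=
  linear_on schwartz U /\
  exists (M : nat) (C : R), forall phi (B : R), schwartz phi ->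
    (forall b l y, (size b <= M)%N -> (size l <= M)%N ->
       cabs ((monomial b y)%:C * pderivs l phi y) <= B) ->
    cabs (U phi) <= C * B.

(* elements of E'(R^n), evaluated on all smooth functions *)
Definition compactly_supported (U : functional_Rn) : Prop :=
  linear_on (@smooth R n) U /\
  exists (M : nat) (C : R) (K : set 'rV[R]_n), compact K /\
    forall phi (B : R), smooth phi ->
    (forall l y, (size l <= M)%N -> K y -> cabs (pderivs l phi y) <= B) ->
    cabs (U phi) <= C * B.

Definition regular (g : 'rV[R]_n -> R[i]) : functional_Rn :=
  fun phi => cintegral setT (fun y => g y * phi y).

(* <s, t> = sum_[m] (s)_[m] (conj (t)_[m]) *)
Definition of_weil_brezin (U : Zkn -> functional_Rn) : functional :=
  fun t => \sum_m U m (cconj (weil_brezin t m)).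

Definition has_weil_brezin (s : functional) (U : Zkn -> functional_Rn) : Prop :=
  (forall m, tempered (U m)) /\ s = of_weil_brezin U.

Definition theta (m : Zkn) : functional := of_weil_brezin (fun m' phi =>
  (m == m')%:R * ((2 * k%:R) `^ (- (n%:R / 2)))%:C * phi 0).

Definition theta_check (m : Zkn) : functional := of_weil_brezin (fun m' =>
  regular (cst ((m == m')%:R * (2 `^ (- (n%:R / 2)))%:C))).

(* Extension of the L^2 pairing to a pair of distributional sections, the
   first with Weil-Brezin coefficients in E'(R^n), the second with smooth ones:
   <a, b> = sum_c (a)_c (conj (b)_c). On Hsp against f Hsp_check, f smooth,
   this is the extension given by disjointness of wavefront sets. *)
Definition is_pairing (a b : functional) (z : R[i]) : Prop :=
  exists (A : Zkn -> functional_Rn) (g : Zkn -> 'rV[R]_n -> R[i]),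
    [/\ has_weil_brezin a A, forall c, compactly_supported (A c),
        has_weil_brezin b (fun c => regular (g c)), forall c, smooth (g c) &
        z = \sum_c A c (cconj (g c))].

Definition pairing (a b : functional) : R[i] := xget 0 (is_pairing a b).

(* <rho, rho-check> *)
Definition rho_pairing : R := 2 `^ (n%:R / 2) * k%:R `^ (- (n%:R / 2)).

Definition bks (a b : functional) : R[i] := pairing a b * rho_pairing%:C.

Definition sigma (m : Zkn) : functional :=
  (2 `^ (n%:R / 4) * k%:R `^ (n%:R / 2))%:C *: theta m.
Definition sigma_check (m : Zkn) : functional :=
  (2 `^ (n%:R / 4) * k%:R `^ (n%:R / 2))%:C *: theta_check m.

(* Operators on Hsp (Hsp_check) are functions on all functionals, of which
   only the values on Hsp (Hsp_check) matter.
   In [toeplitz], <f s, sigma_check m> means <s, conj(f) sigma_check m>. *)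
Definition toeplitz (f : torus_fun) (s : functional) : functional :=
  \sum_m bks s (dist_mul (torus_conj f) (sigma_check m)) *: sigma m.

Definition toeplitz_check (f : torus_fun) (s : functional) : functional :=
  \sum_m (bks (sigma m) (dist_mul f s))^* *: sigma_check m.

Definition coords (e : Zkn -> functional) (s : functional) : Zkn -> R[i] :=
  xget (fun=> 0) [set c | s = \sum_m c m *: e m].

(* inner product of Hsp, for which sigma is orthonormal *)
Definition inner (s s' : functional) : R[i] :=
  \sum_m coords sigma s m * (coords sigma s' m)^*.

Definition hnorm (s : functional) : R := Num.sqrt (complex.Re (inner s s)).

Definition opnorm (A : functional -> functional) : \bar R :=
  ereal_sup [set (hnorm (A s))%:E | s in [set s | Hsp s /\ hnorm s <= 1]].

(* For a basis e of V, the linear map sending e to e'. Hence B_inv below, which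
   exchanges the two bases in B_map, is the inverse of B_map. *)
Definition basis_map (V : set functional) (e e' : Zkn -> functional) :
    functional -> functional :=
  patch (fun=> 0) V (fun s => \sum_m coords e s m *: e' m).

Definition B_map : functional -> functional :=
  basis_map Hsp_check sigma_check sigma.
Definition B_inv : functional -> functional :=
  basis_map Hsp sigma sigma_check.

Definition F_GQ (A : functional -> functional) : functional -> functional :=
  B_map \o A \o B_inv.

Definition F_DQ (N : nat) (f : torus_fun) : torus_fun :=
  \sum_(i < N.+1) (i`!%:R)^-1 *: iter i (fun g => (- hbar%:C) *: Delta g) f.

End Prequantum.
End Torus.

(* Main.v *)
Require Import Defs.
From mathcomp Require Import all_boot all_order all_algebra.
From mathcomp Require Import complex.
From mathcomp Require Import all_classical all_reals all_analysis.
From mathcomp Require Import measurable_realfun.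
From mathcomp Require Import ring lra zify.
Set Implicit Arguments.
Unset Strict Implicit.
Unset Printing Implicit Defensive.
Import Order.TTheory GRing.Theory Num.Theory.
Import numFieldNormedType.Exports.
Local Open Scope classical_set_scope.
Local Open Scope complex_scope.
Local Open Scope ring_scope.

(** The two Toeplitz operators become matrices indexed by the points of order
    [k], and their entries differ by a Taylor remainder.

    Multiplied by the phase [gauge], a section becomes periodic in [x] and
    twisted-periodic in [y], and its Weil-Brezin coefficient of index [m] is the
    Fourier coefficient of frequency [m] in [x], shifted by [m / k] in [y]. On these
    coefficients the covariant derivative along [y] is the plain one, and the
    one along [x] is multiplication by a multiple of [y]. The sections [sigma m] are Dirac
    distributions at [y = 0], the sections [sigma_check m] are constants.

    Two facts about the transform carry the computation of the matrices. Poisson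
    summation ([integral_weil_brezin]) writes the integral of a coefficient over
    the whole space as a sum of means of the section over the fibres above the
    points [j / k]. Hence multiplication by a function acts on [sigma_check] by
    discrete Fourier coefficients ([integral_weil_brezin_mul]). Conversely
    the coefficients can be prescribed ([exists_section]), so that the [sigma m]
    are independent, and so that a polarized functional with compactly
    supported coefficients is a combination of them: its coefficients are
    killed by the coordinates, and such distributions are multiples of Dirac's by
    Hadamard's lemma ([point_support]). The pairing is therefore well defined and
    computable ([bks_span]), and [toeplitz_span], [toeplitz_check_span] give the
    entries: for the function [f], with [e s] for [cis (2 * pi * s)],
      [toeplitz]       : the mean over [j] of [e (- (m - c) * j / k) * f (j / k, c / k)],
      [toeplitz_check] : the mean over [j] of [e (- (m - c) * j / k) * f (j / k, m / k)].

    Such a mean is the sum of the Fourier coefficients in [x] of frequencies [p]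
    congruent to [m - c] modulo [k] ([phase_sum_fourier]). For these [p] the
    heights [m / k] and [c / k] differ by [p / k] modulo 1 ([wb_shift_alias]).
    On the Fourier coefficient of frequency [p] the operator [- hbar Delta] is the
    derivative along [p / k] ([fourier_Delta]). So [F_DQ] is the Taylor expansion
    that moves the height from [c / k] to [m / k], and the contribution of [p] to
    the difference is a remainder of order [hbar ^+ N.+1], with a constant that
    is summable in [p] because [f] is smooth ([fourier_taylor]). In a row or
    a column each frequency occurs at most once, so that row and column sums are
    bounded by a multiple of [hbar ^+ N.+1] that does not depend on [k], and Schur's
    test ([schur_test]) bounds the operator norm.

    Convergence of Fourier series enters only through Fejer's theorem with a rate
    ([fejer_rate]), which is uniform in parameters. It yields both Poisson
    summation and the summation of aliased frequencies, one coordinate at a time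
    ([dir_ops_rate]). *)

(** * Complex numbers and complex-valued integrals on the line *)

Section ComplexNumbers.
Variable R : realType.
Implicit Types (z w : R[i]) (a b : R).

Lemma cabsM z w : cabs (z * w) = cabs z * cabs w.
Proof. exact: ComplexField.Normc.normcM. Qed.

Lemma cabs0 : cabs (0 : R[i]) = 0.
Proof. exact: ComplexField.Normc.normc0. Qed.

Lemma cabs1 : cabs (1 : R[i]) = 1.
Proof. exact: ComplexField.Normc.normc1. Qed.

Lemma cabs_eq0 z : cabs z = 0 -> z = 0.
Proof. exact: ComplexField.Normc.eq0_normc. Qed.

Lemma cabsV z : cabs z^-1 = (cabs z)^-1.
Proof. exact: ComplexField.Normc.normcV. Qed.

Lemma cabsD z w : cabs (z + w) <= cabs z + cabs w.
Proof. exact: le_normcD. Qed.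

Lemma cabsN z : cabs (- z) = cabs z.
Proof. exact: normcN. Qed.

Lemma cabsB z w : cabs (z - w) <= cabs z + cabs w.
Proof. by rewrite -(cabsN w); exact: cabsD. Qed.

Lemma cabs_distC z w : cabs (z - w) = cabs (w - z).
Proof. by rewrite -cabsN opprB. Qed.

Lemma cabs_ge0 z : 0 <= cabs z.
Proof. by case: z => a b; rewrite /cabs /= sqrtr_ge0. Qed.

Lemma cabs_sqr z : cabs z ^+ 2 = complex.Re z ^+ 2 + complex.Im z ^+ 2.
Proof. by case: z => a b; rewrite /cabs /= sqr_sqrtr// addr_ge0// sqr_ge0. Qed.

Lemma cabs_sqrC z : (cabs z ^+ 2)%:C = z * z^*.
Proof.
rewrite cabs_sqr; case: z => a b /=; apply/eqP; rewrite eq_complex /=.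
by apply/andP; split; apply/eqP; ring.
Qed.

Lemma Re_le_cabs z : `|complex.Re z| <= cabs z.
Proof.
rewrite -(@ler_pXn2r _ 2) ?nnegrE ?cabs_ge0 ?normr_ge0// real_normK ?num_real//.
by rewrite cabs_sqr lerDl sqr_ge0.
Qed.

Lemma Im_le_cabs z : `|complex.Im z| <= cabs z.
Proof.
rewrite -(@ler_pXn2r _ 2) ?nnegrE ?cabs_ge0 ?normr_ge0// real_normK ?num_real//.
by rewrite cabs_sqr lerDr sqr_ge0.
Qed.

Lemma cabs_le z : cabs z <= `|complex.Re z| + `|complex.Im z|.
Proof.
rewrite -(@ler_pXn2r _ 2) ?nnegrE ?cabs_ge0 ?addr_ge0 ?normr_ge0//.
rewrite cabs_sqr sqrrD !real_normK ?num_real// -addrA lerD2l lerDr.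
by rewrite mulrn_wge0// mulr_ge0.
Qed.

Lemma cabs_real a : cabs a%:C = `|a|.
Proof. by rewrite /cabs /= expr0n addr0 sqrtr_sqr. Qed.

Lemma cabs_imag a : cabs (0 +i* a) = `|a|.
Proof. by rewrite /cabs /= expr0n add0r sqrtr_sqr. Qed.

Lemma cabs_conj z : cabs z^* = cabs z.
Proof. by case: z => a b; rewrite /cabs /= sqrrN. Qed.

Lemma cabs_sum (I : Type) (r : seq I) (P : pred I) (F : I -> R[i]) :
  cabs (\sum_(i <- r | P i) F i) <= \sum_(i <- r | P i) cabs (F i).
Proof.
elim/big_ind2 : _ => [|x1 x2 y1 y2 h1 h2|//]; first by rewrite cabs0.
exact: le_trans (cabsD _ _) (lerD h1 h2).
Qed.

Lemma cisD a b : cis (a + b) = cis a * cis b.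
Proof.
by rewrite /cis cosD sinD; apply/eqP; rewrite eq_complex /= addrC eqxx/= addrC eqxx.
Qed.

Lemma cis0 : cis (0 : R) = 1.
Proof. by rewrite /cis cos0 sin0. Qed.

Lemma cisN a : cis (- a) = (cis a)^*.
Proof. by rewrite /cis cosN sinN. Qed.

Lemma cabs_cis a : cabs (cis a) = 1.
Proof. by rewrite /cabs /cis /= cos2Dsin2 sqrtr1. Qed.

Lemma cis_sum (I : Type) (r : seq I) (P : pred I) (F : I -> R) :
  cis (\sum_(i <- r | P i) F i) = \prod_(i <- r | P i) cis (F i).
Proof.
elim/big_ind2 : _ => [|x1 x2 y1 y2 h1 h2|//]; first exact: cis0.
by rewrite cisD h1 h2.
Qed.

Lemma cisXn a n : cis (n%:R * a) = cis a ^+ n.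
Proof.
elim: n => [|n IH]; first by rewrite mul0r cis0 expr0.
by rewrite -natr1 mulrDl mul1r cisD IH exprSr.
Qed.

Lemma cis_nat n : cis (2 * pi * n%:R : R) = 1.
Proof.
rewrite mulrC cisXn; suff -> : cis (2 * pi : R) = 1 by rewrite expr1n.
by rewrite /cis mulr_natl cos2pi sin2pi.
Qed.

Lemma cis_int (p : int) : cis (2 * pi * p%:~R : R) = 1.
Proof.
case: p => n; first exact: cis_nat.
by rewrite NegzE mulrNz mulrN cisN -[_%:~R]/(n.+1%:R) cis_nat rmorph1.
Qed.

Lemma cis_pi : cis (pi : R) = -1.
Proof. by rewrite /cis cospi sinpi; apply/eqP; rewrite eq_complex /= oppr0 !eqxx. Qed.

End ComplexNumbers.

#[local] Arguments cabs {R} z : simpl never.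

Section ComplexContinuity.
Variables (R : realType) (T : topologicalType).
Implicit Types f g : T -> R[i].

(** Continuity is stated for the two components, which is the form in which
    smoothness and the integrals are given; it spares a topology on the
    complex numbers. *)
Definition ccont f : Prop :=
  continuous (fun u => complex.Re (f u)) /\ continuous (fun u => complex.Im (f u)).

Lemma ccont_cst (a : R[i]) : ccont (fun=> a).
Proof. by split; exact: cst_continuous. Qed.

Lemma ccontD f g : ccont f -> ccont g -> ccont (fun u => f u + g u).
Proof.
move=> [f1 f2] [g1 g2]; split=> u.
  by under eq_fun do rewrite ReD; exact: continuousD (f1 u) (g1 u).
by under eq_fun do rewrite ImD; exact: continuousD (f2 u) (g2 u).
Qed.

Lemma ccontM f g : ccont f -> ccont g -> ccont (fun u => f u * g u).
Proof.
move=> [f1 f2] [g1 g2]; split=> u.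
  under eq_fun do rewrite Defs.ReM.
  exact: (continuousB (continuousM (f1 u) (g1 u)) (continuousM (f2 u) (g2 u))).
under eq_fun do rewrite Defs.ImM.
exact: (continuousD (continuousM (f1 u) (g2 u)) (continuousM (f2 u) (g1 u))).
Qed.

Lemma ccontN f : ccont f -> ccont (fun u => - f u).
Proof.
move=> cf; have -> : (fun u => - f u) = (fun u => (-1) * f u).
  by apply/funext => u; rewrite mulN1r.
exact: ccontM (ccont_cst _) cf.
Qed.

Lemma ccontB f g : ccont f -> ccont g -> ccont (fun u => f u - g u).
Proof. by move=> cf /ccontN; exact: ccontD. Qed.

Lemma ccont_sum (I : Type) (r : seq I) (P : pred I) (F : I -> T -> R[i]) :
  (forall i, P i -> ccont (F i)) -> ccont (fun u => \sum_(i <- r | P i) F i u).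
Proof.
move=> cF; elim: r => [|i r IH].
  by under eq_fun do rewrite big_nil; exact: ccont_cst.
under eq_fun do rewrite big_cons.
by case: (boolP (P i)) => // Pi; exact: ccontD (cF i Pi) IH.
Qed.

Lemma ccont_prod (I : Type) (r : seq I) (P : pred I) (F : I -> T -> R[i]) :
  (forall i, P i -> ccont (F i)) -> ccont (fun u => \prod_(i <- r | P i) F i u).
Proof.
move=> cF; elim: r => [|i r IH].
  by under eq_fun do rewrite big_nil; exact: ccont_cst.
under eq_fun do rewrite big_cons.
by case: (boolP (P i)) => // Pi; exact: ccontM (cF i Pi) IH.
Qed.

Lemma ccont_conj f : ccont f -> ccont (fun u => (f u)^*).
Proof.
move=> [f1 f2]; split=> u.
  have -> : (fun u => complex.Re (f u)^*) = (fun u => complex.Re (f u)).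
    by apply/funext => v; case: (f v).
  exact: f1.
have -> : (fun u => complex.Im (f u)^*) = (fun u => - complex.Im (f u)).
  by apply/funext => v; case: (f v).
exact: continuousN (f2 u).
Qed.

Lemma ccont_cis (h : T -> R) : continuous h -> ccont (fun u => cis (h u)).
Proof.
move=> ch; split=> u; first exact: continuous_comp (ch u) (@continuous_cos R _).
exact: continuous_comp (ch u) (@continuous_sin R _).
Qed.

Lemma ccont_real (h : T -> R) : continuous h -> ccont (fun u => (h u)%:C).
Proof. by move=> ch; split=> //; exact: cst_continuous. Qed.

Lemma ccont_cabs f : ccont f -> continuous (fun u => cabs (f u)).
Proof.
move=> [f1 f2] u; rewrite /cabs.
have -> : (fun u => ComplexField.Normc.normc (f u)) =
    (fun u => Num.sqrt (complex.Re (f u) ^+ 2 + complex.Im (f u) ^+ 2)).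
  by apply/funext => v; case: (f v).
have c := continuousD (continuousM (f1 u) (f1 u)) (continuousM (f2 u) (f2 u)).
exact: (continuous_comp c (@sqrt_continuous R _)).
Qed.

End ComplexContinuity.

Lemma ccont_comp (R : realType) (S T : topologicalType) (h : S -> T) (f : T -> R[i]) :
  continuous h -> ccont f -> ccont (f \o h).
Proof.
move=> ch [f1 f2]; split=> u.
  exact: (continuous_comp (ch u) (f1 (h u))).
exact: (continuous_comp (ch u) (f2 (h u))).
Qed.

Section ComplexIntegral.
Variable R : realType.
Local Notation mu := (@lebesgue_measure R).
Implicit Types (D : set R) (f g : R -> R[i]).

Definition cint D g : R[i] :=
  \int[mu]_(a in D) complex.Re (g a) +i* \int[mu]_(a in D) complex.Im (g a).

Definition cintegrable D g : Prop :=
  mu.-integrable D (EFin \o (fun a => complex.Re (g a))) /\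
  mu.-integrable D (EFin \o (fun a => complex.Im (g a))).

Lemma eq_cint D f g : {in D, f =1 g} -> cint D f = cint D g.
Proof.
by move=> fg; congr (_ +i* _); apply: eq_Rintegral => x Dx; rewrite fg.
Qed.

Section Measurable.
Variable D : set R.
Hypothesis mD : measurable (D : set (measurableTypeR R)).

Lemma cintegrableD f g : cintegrable D f -> cintegrable D g ->
  cintegrable D (fun a => f a + g a).
Proof.
move=> [f1 f2] [g1 g2]; split.
  under eq_fun do rewrite ReD.
  by have := integrableD mD f1 g1; apply: eq_integrable.
under eq_fun do rewrite ImD.
by have := integrableD mD f2 g2; apply: eq_integrable.
Qed.

Lemma cintegrableZ (c : R[i]) f : cintegrable D f ->
  cintegrable D (fun a => c * f a).
Proof.
move=> [f1 f2]; split.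
  under eq_fun do rewrite Defs.ReM.
  have := integrableB mD (integrableZl mD (complex.Re c) f1) (integrableZl mD (complex.Im c) f2).
  by apply: eq_integrable.
under eq_fun do rewrite Defs.ImM.
have := integrableD mD (integrableZl mD (complex.Re c) f2) (integrableZl mD (complex.Im c) f1).
by apply: eq_integrable.
Qed.

Lemma cintD f g : cintegrable D f -> cintegrable D g ->
  cint D (fun a => f a + g a) = cint D f + cint D g.
Proof.
move=> [f1 f2] [g1 g2]; rewrite /cint.
under eq_Rintegral do rewrite ReD.
under [X in _ +i* X]eq_Rintegral do rewrite ImD.
by rewrite !RintegralD.
Qed.

Lemma cintZ (c : R[i]) f : cintegrable D f ->
  cint D (fun a => c * f a) = c * cint D f.
Proof.
move=> [f1 f2]; rewrite /cint.
under eq_Rintegral do rewrite Defs.ReM.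
under [X in _ +i* X]eq_Rintegral do rewrite Defs.ImM.
have Z r (h : R -> R) : mu.-integrable D (EFin \o h) ->
  mu.-integrable D (EFin \o (fun x => r * h x)).
  by move=> ih; have := integrableZl mD r ih; apply: eq_integrable.
rewrite RintegralB ?RintegralD ?RintegralZl//; do ?exact: Z.
by case: c.
Qed.

Lemma cintegrable0 : cintegrable D (fun=> 0).
Proof. by split; exact: integrable0. Qed.

Lemma cint0 : cint D (fun=> 0) = 0.
Proof.
have := cintZ 0 cintegrable0; rewrite [RHS]mul0r => E; rewrite -[RHS]E.
by apply: eq_cint => x _; rewrite mul0r.
Qed.

Lemma cintegrable_sum (I : Type) (r : seq I) (P : pred I) (F : I -> R -> R[i]) :
  (forall i, P i -> cintegrable D (F i)) ->
  cintegrable D (fun a => \sum_(i <- r | P i) F i a).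
Proof.
move=> iF; elim: r => [|i r IH].
  by under eq_fun do rewrite big_nil; exact: cintegrable0.
under eq_fun do rewrite big_cons.
by case: (boolP (P i)) => // Pi; exact: cintegrableD (iF i Pi) IH.
Qed.

Lemma cint_sum (I : Type) (r : seq I) (P : pred I) (F : I -> R -> R[i]) :
  (forall i, P i -> cintegrable D (F i)) ->
  cint D (fun a => \sum_(i <- r | P i) F i a) = \sum_(i <- r | P i) cint D (F i).
Proof.
move=> iF; elim: r => [|i r IH].
  rewrite big_nil -[RHS]cint0; apply: eq_cint => x _; exact: big_nil.
rewrite big_cons; case: ifPn => Pi; last first.
  by rewrite -IH; apply: eq_cint => x _; rewrite big_cons (negbTE Pi).
rewrite -IH -cintD; [|exact: iF|exact: cintegrable_sum].
by apply: eq_cint => x _; rewrite big_cons Pi.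
Qed.

Lemma cintB f g : cintegrable D f -> cintegrable D g ->
  cint D (fun a => f a - g a) = cint D f - cint D g.
Proof.
move=> jf jg; rewrite -mulN1r -cintZ// -cintD//; last exact: cintegrableZ.
by apply: eq_cint => x _; rewrite mulN1r.
Qed.

Lemma cintegrable_le f (G : R -> R) : ccont f -> mu.-integrable D (EFin \o G) ->
  (forall a, D a -> cabs (f a) <= G a) -> cintegrable D f.
Proof.
move=> [f1 f2] iG fG.
have H (h : R -> R) : continuous h -> (forall a, D a -> `|h a| <= G a) ->
    mu.-integrable D (EFin \o h).
  move=> ch hG; apply: (le_integrable mD) (iG).
    apply/measurable_EFinP; apply: (measurable_funS measurableT) => //.
    exact: continuous_measurable_fun.
  by move=> x Dx /=; rewrite lee_fin; exact: le_trans (hG _ Dx) (ler_norm _).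
split; apply: H => // a Da; apply: le_trans (fG a Da).
  exact: Re_le_cabs.
exact: Im_le_cabs.
Qed.

(** The factor 2 comes from treating the real and imaginary parts separately. *)
Lemma cabs_cint_le f (G : R -> R) : cintegrable D f ->
  mu.-integrable D (EFin \o G) ->
  (forall a, D a -> cabs (f a) <= G a) -> cabs (cint D f) <= 2 * \int[mu]_(a in D) G a.
Proof.
move=> [f1 f2] iG fG; apply: le_trans (cabs_le _) _; rewrite mulr_natl mulr2n /=.
have H (h : R -> R) : mu.-integrable D (EFin \o h) ->
    (forall a, D a -> `|h a| <= G a) -> `|\int[mu]_(a in D) h a| <= \int[mu]_(a in D) G a.
  move=> ih hG; apply: le_trans (le_normr_Rintegral mD ih) _.
  apply: le_Rintegral => //.
  by have := integrable_norm ih; apply: eq_integrable.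
apply: lerD; apply: H => // a Da; apply: le_trans (fG a Da).
  exact: Re_le_cabs.
exact: Im_le_cabs.
Qed.

End Measurable.
End ComplexIntegral.

(** * Integrals depending on a parameter *)

Section ParametricIntegral.
Variable R : realType.
Local Notation mu := (@lebesgue_measure R).

Lemma measurable_cc (a b : R) : measurable (`[a, b]%classic : set (measurableTypeR R)).
Proof. exact: measurable_itv. Qed.

Lemma continuous_integrable_cc (a b : R) (h : R -> R) : continuous h ->
  mu.-integrable `[a, b] (EFin \o h).
Proof.
move=> ch; apply: continuous_compact_integrable; first exact: segment_compact.
exact: continuous_subspaceT.
Qed.

(** Compactness of the interval makes continuity in the parameter uniform in
    the variable of integration; continuity and differentiability of the
    integral both rest on this. *)
Lemma near_uniform_cc (T : topologicalType) (F : T -> R -> R) (a b : R) t0 e :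
  continuous (fun z : T * R => F z.1 z.2) -> 0 < e ->
  \forall t \near t0, forall x, `[a, b]%classic x -> `|F t x - F t0 x| < e.
Proof.
move=> cF e0; have e20 : 0 < e / 2 by rewrite divr_gt0.
have := @segment_compact R a b; rewrite compact_near_coveringP => /(_ T (nbhs t0)
  (fun t x => `|F t x - F t0 x| < e)); apply => x _.
have c1 := cF (t0, x); have /cvgrPdist_lt/(_ _ e20)/= := c1.
move=> [[U V] /= [Ut Vx] UV]; exists (V, U); first by [].
move=> [y t] /= [Vy Ut'].
have h1 := UV (t, y) (conj Ut' Vy); have h2 := UV (t0, y) (conj (nbhs_singleton Ut) Vy).
rewrite /= in h1 h2; rewrite -(subrKA (F t0 x)) (splitr e).
by rewrite (le_lt_trans (ler_normD _ _))// ltrD// distrC.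
Qed.

Lemma continuous_slice (T : topologicalType) (F : T -> R -> R) t :
  continuous (fun z : T * R => F z.1 z.2) -> continuous (F t).
Proof.
move=> cF x; apply: (@continuous_comp _ _ _ (fun y : R => (t, y)) (fun z : T * R => F z.1 z.2)).
  exact: (cvg_pair (cvg_cst t) (@cvg_id _ _)).
exact: cF.
Qed.

Lemma le_norm_Rintegral_cc (a b : R) (h : R -> R) (B : R) : a <= b -> continuous h ->
  (forall x, `[a, b]%classic x -> `|h x| <= B) ->
  `|\int[mu]_(x in `[a, b]) h x| <= B * (b - a).
Proof.
move=> ab ch hB; have ih := continuous_integrable_cc a b ch.
apply: le_trans (le_normr_Rintegral (measurable_cc a b) ih) _.
have -> : B * (b - a) = \int[mu]_(x in `[a, b]) B.
  have -> : \int[mu]_(x in `[a, b]) B = B * fine (lebesgue_measure (`[a, b]%classic : set R)).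
    exact: (Rintegral_cst mu (measurable_cc a b)).
  rewrite lebesgue_measure_itv /= lte_fin.
  case: ltP => [//|ba]; have -> : a = b by apply/eqP; rewrite eq_le ab ba.
  by rewrite subrr.
apply: le_Rintegral => //.
  by have := integrable_norm ih; apply: eq_integrable.
by apply: continuous_integrable_cc => x; exact: cst_continuous.
Qed.

Lemma continuous_param_integral (T : topologicalType) (F : T -> R -> R) (a b : R) :
  a <= b -> continuous (fun z : T * R => F z.1 z.2) ->
  continuous (fun t => \int[mu]_(x in `[a, b]) F t x).
Proof.
move=> ab cF t0; apply/cvgrPdist_le => e e0.
have d0 : 0 < b - a + 1 by rewrite ltr_wpDl// subr_ge0.
near=> t; rewrite distrC -RintegralB; [|exact: measurable_cc|
  exact/continuous_integrable_cc/continuous_slice..].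
apply: (@le_trans _ _ (e / (b - a + 1) * (b - a))).
  have c : continuous (fun x : R => F t x - F t0 x).
    have ct y : continuous (F y) by exact: continuous_slice.
    by move=> x; exact: (continuousB (ct t x) (ct t0 x)).
  apply: (le_norm_Rintegral_cc ab c).
  move=> x abx; apply: ltW; move: x abx; near: t.
  by apply: near_uniform_cc => //; rewrite divr_gt0.
by rewrite -mulrA ler_piMr ?(ltW e0)// mulrC ler_pdivrMr// mul1r lerDl.
Unshelve. all: by end_near. Qed.

(** The integrable bound for the derivative that differentiation under the
    integral asks for is constant: the derivative is close to its value at
    [s], uniformly on the interval. *)
Lemma is_derive_param_integral (F F' : R -> R -> R) (a b : R) :
  (forall s x, is_derive s (1 : R) (F^~ x) (F' s x)) -> (forall s, continuous (F s)) ->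
  continuous (fun z : R * R => F' z.1 z.2) ->
  forall s, is_derive s (1 : R) (fun s => \int[mu]_(x in `[a, b]) F s x)
                           (\int[mu]_(x in `[a, b]) F' s x).
Proof.
move=> dF cF cF' s.
have [B hB] : exists B : R, forall x, `[a, b]%classic x -> `|F' s x| <= B.
  have cs : continuous (fun x => `|F' s x|).
    by move=> x; apply: continuous_comp; [exact: continuous_slice|exact: norm_continuous].
  have /compact_bounded[M [_ hM]] := continuous_compact (continuous_subspaceT cs) (@segment_compact R a b).
  exists (M + 1) => x abx.
  have := hM (M + 1); rewrite ltrDl => /(_ ltr01 `|F' s x|).
  by rewrite /= normr_id; apply; exists x.
have [d /= d0 hd] : \forall t \near s, forall x, `[a, b]%classic x -> `|F' t x| <= B + 1.
  have := near_uniform_cc a b s cF' ltr01.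
  apply: filterS => t H x abx; have := H x abx => h.
  by rewrite -(subrK (F' s x) (F' t x)) addrC (le_trans (ler_normD _ _))// lerD ?hB// ltW.
have Id t : `]s - d, s + d[%classic t -> ball s d t.
  by rewrite ball_itv.
have Is : `]s - d, s + d[%classic s by rewrite /= in_itv /= ltrBlDr !ltrDl d0.
have i1 t : `]s - d, s + d[%classic t -> mu.-integrable `[a, b] (EFin \o F t).
  by move=> _; exact: continuous_integrable_cc.
have i2 t x : `]s - d, s + d[%classic t -> `[a, b]%classic x -> derivable (F^~ x) t 1.
  by move=> _ _; case: (dF t x).
have B0 : 0 <= `|B + 1| by [].
have iB : mu.-integrable `[a, b] (EFin \o cst `|B + 1|).
  by apply: continuous_integrable_cc => x; exact: cst_continuous.
have E t x : partial1of2 F t x = F' t x.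
  by rewrite partial1of2E; case: (dF t x).
have i3 t x : `]s - d, s + d[%classic t -> `[a, b]%classic x ->
    `|partial1of2 F t x| <= cst `|B + 1| x.
  by move=> /Id st abx; rewrite E; exact: le_trans (hd _ st _ abx) (ler_norm _).
split; first exact: (derivable_under_integral (measurable_cc a b) Is i1 i2 (fun=> B0) iB i3).
rewrite -derive1E (differentiation_under_integral (measurable_cc a b) Is i1 i2 (fun=> B0) iB i3).
by apply: eq_Rintegral => x _; rewrite E.
Qed.

End ParametricIntegral.

(** * Derivatives of complex-valued functions of a real variable *)

Section ComplexDerivative.
Variable R : realType.
Local Notation mu := (@lebesgue_measure R).
Implicit Types (F G : R -> R[i]).

(** Derivatives of complex-valued functions are taken for both components,
    with the derivative as an argument: products and sums of derivatives are
    then computed without proofs of derivability inside terms. *)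
Definition cderiv G G' : Prop := forall a : R,
  is_derive a (1 : R) (fun x => complex.Re (G x)) (complex.Re (G' a)) /\
  is_derive a (1 : R) (fun x => complex.Im (G x)) (complex.Im (G' a)).

Lemma is_derive_continuous (h h' : R -> R) :
  (forall a : R, is_derive a (1 : R) h (h' a)) -> continuous h.
Proof.
move=> dh a; apply: differentiable_continuous; apply/derivable1_diffP.
by case: (dh a).
Qed.

Lemma cderiv_ccont G G' : cderiv G G' -> ccont G.
Proof.
by move=> dG; split; [apply: (@is_derive_continuous _ (fun a => complex.Re (G' a)))|
  apply: (@is_derive_continuous _ (fun a => complex.Im (G' a)))] => a; have [] := dG a.
Qed.

Lemma cderiv_cst (z : R[i]) : cderiv (fun=> z) (fun=> 0).
Proof. by move=> a; split; exact: is_derive_cst. Qed.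

Lemma cderivD F F' G G' : cderiv F F' -> cderiv G G' ->
  cderiv (fun a => F a + G a) (fun a => F' a + G' a).
Proof.
move=> dF dG a; have [f1 f2] := dF a; have [g1 g2] := dG a; split.
  rewrite ReD; have -> : (fun x => complex.Re (F x + G x)) =
    (fun x => complex.Re (F x)) + (fun x => complex.Re (G x)).
    by apply/funext => x; rewrite ReD.
  exact: is_deriveD.
rewrite ImD; have -> : (fun x => complex.Im (F x + G x)) =
  (fun x => complex.Im (F x)) + (fun x => complex.Im (G x)).
  by apply/funext => x; rewrite ImD.
exact: is_deriveD.
Qed.

Lemma cderivM F F' G G' : cderiv F F' -> cderiv G G' ->
  cderiv (fun a => F a * G a) (fun a => F' a * G a + F a * G' a).
Proof.
move=> dF dG a; have [f1 f2] := dF a; have [g1 g2] := dG a; split.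
  have -> : (fun x => complex.Re (F x * G x)) =
    (fun x => complex.Re (F x)) * (fun x => complex.Re (G x)) -
    (fun x => complex.Im (F x)) * (fun x => complex.Im (G x)).
    by apply/funext => x; rewrite Defs.ReM.
  apply: (@is_derive_eq _ _ _ _ _ _ _ _ (is_deriveB (is_deriveM f1 g1) (is_deriveM f2 g2))).
  by rewrite ReD !Defs.ReM /GRing.scale /=; ring.
have -> : (fun x => complex.Im (F x * G x)) =
  (fun x => complex.Re (F x)) * (fun x => complex.Im (G x)) +
  (fun x => complex.Im (F x)) * (fun x => complex.Re (G x)).
  by apply/funext => x; rewrite Defs.ImM.
apply: (@is_derive_eq _ _ _ _ _ _ _ _ (is_deriveD (is_deriveM f1 g2) (is_deriveM f2 g1))).
by rewrite ImD !Defs.ImM /GRing.scale /=; ring.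
Qed.

Lemma cderiv_ext F F' G G' : cderiv F F' -> F =1 G -> F' =1 G' -> cderiv G G'.
Proof. by move=> dF /funext <- /funext <-. Qed.

Lemma cderivZ (z : R[i]) G G' : cderiv G G' -> cderiv (fun a => z * G a) (fun a => z * G' a).
Proof.
move=> dG; apply: cderiv_ext (cderivM (cderiv_cst z) dG) _ _ => // a.
by rewrite mul0r add0r.
Qed.

Lemma cderivB F F' G G' : cderiv F F' -> cderiv G G' ->
  cderiv (fun a => F a - G a) (fun a => F' a - G' a).
Proof.
move=> dF dG; apply: cderiv_ext (cderivD dF (cderivZ (-1) dG)) _ _ => a; by rewrite mulN1r.
Qed.

Lemma cderiv_sum (I : Type) (r : seq I) (F F' : I -> R -> R[i]) :
  (forall i, cderiv (F i) (F' i)) ->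
  cderiv (fun a => \sum_(i <- r) F i a) (fun a => \sum_(i <- r) F' i a).
Proof.
move=> dF; elim: r => [|i r IH].
  by apply: cderiv_ext (cderiv_cst 0) _ _ => a; rewrite big_nil.
by apply: cderiv_ext (cderivD (dF i) IH) _ _ => a; rewrite big_cons.
Qed.

Lemma is_derive_affine (h h' : R -> R) (c d : R) :
  (forall a : R, is_derive a (1 : R) h (h' a)) ->
  forall a : R, is_derive a (1 : R) (fun x => h (c * x + d)) (c * h' (c * a + d)).
Proof.
move=> dh a; have -> : (fun x => h (c * x + d)) = h \o (fun x => c * x + d) by [].
have d1 : is_derive a (1 : R) (fun x => c * x + d) c.
  have := is_deriveD (is_deriveZ c (is_derive_id a (1 : R))) (is_derive_cst d a (1 : R)).
  by move=> H; apply: (is_derive_eq H); rewrite addr0 /GRing.scale /= mulr1.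
have := @is_derive1_comp _ h (fun x => c * x + d) a _ _ (dh (c * a + d)) d1.
by move=> H; apply: (is_derive_eq H); rewrite mulrC.
Qed.

Lemma cderiv_affine G G' (c d : R) : cderiv G G' ->
  cderiv (fun a => G (c * a + d)) (fun a => c%:C * G' (c * a + d)).
Proof.
move=> dG a; rewrite Defs.ReM Defs.ImM /= !mul0r subr0 addr0; split.
  exact: (is_derive_affine c d (fun x => (dG x).1)).
exact: (is_derive_affine c d (fun x => (dG x).2)).
Qed.

Lemma cderiv_cis (c : R) :
  cderiv (fun a => cis (c * a)) (fun a => (0 +i* c) * cis (c * a)).
Proof.
move=> a; rewrite /cis /= !mul0r sub0r add0r.
have := is_derive_affine c 0 (@is_derive_cos R) a.
have := is_derive_affine c 0 (@is_derive_sin R) a.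
rewrite addr0 mulrN.
by under eq_fun do rewrite addr0; move=> h1; under eq_fun do rewrite addr0.
Qed.

Lemma cintegrable_cc (a b : R) G : ccont G -> cintegrable `[a, b] G.
Proof. by move=> [g1 g2]; split; exact: continuous_integrable_cc. Qed.

Lemma is_derive_Rintegral (h h' : R -> R) (a b : R) : a <= b ->
  (forall x : R, is_derive x (1 : R) h (h' x)) -> continuous h' ->
  \int[mu]_(x in `[a, b]) h' x = h b - h a.
Proof.
rewrite le_eqVlt => /predU1P[->|ab] dh ch'.
  by rewrite set_itv1 Rintegral_set1 subrr.
rewrite /Rintegral (continuous_FTC2 ab (F := h)) //.
- exact: continuous_subspaceT.
- split.
  + by move=> x _; case: (dh x).
  + by apply: cvg_at_right_filter; exact: is_derive_continuous dh a.
  + by apply: cvg_at_left_filter; exact: is_derive_continuous dh b.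
- by move=> x _; rewrite derive1E; case: (dh x).
Qed.

Lemma cint_cderiv G G' (a b : R) : a <= b -> cderiv G G' -> ccont G' ->
  cint `[a, b] G' = G b - G a.
Proof.
move=> ab dG [c1 c2]; rewrite /cint.
rewrite (is_derive_Rintegral ab (fun x => (dG x).1) c1).
rewrite (is_derive_Rintegral ab (fun x => (dG x).2) c2).
by case: (G a) (G b) => [? ?] [? ?].
Qed.

Lemma cabs_cint_cc_le (a b : R) G (B : R) : a <= b -> ccont G ->
  (forall x, `[a, b]%classic x -> cabs (G x) <= B) ->
  cabs (cint `[a, b] G) <= 2 * (B * (b - a)).
Proof.
move=> ab [g1 g2] GB; apply: le_trans (cabs_le _) _; rewrite mulr_natl mulr2n /=.
apply: lerD; apply: le_norm_Rintegral_cc => // x abx; apply: le_trans (GB x abx).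
  exact: Re_le_cabs.
exact: Im_le_cabs.
Qed.

Lemma cabs_cint01_le G (B : R) : ccont G ->
  (forall x, 0 <= x <= 1 -> cabs (G x) <= B) ->
  cabs (cint `[0, 1] G) <= 2 * B.
Proof.
move=> cG GB; have := cabs_cint_cc_le (@ler01 R) cG (B := B); rewrite subr0 mulr1; apply.
by move=> x /=; rewrite in_itv /=; exact: GB.
Qed.

(** The mean value theorem holds for the two components, at different points;
    hence the factor 2. *)
Lemma cderiv_le G G' (a b B : R) : a <= b -> cderiv G G' ->
  (forall x, a <= x <= b -> cabs (G' x) <= B) ->
  cabs (G b - G a) <= 2 * (B * (b - a)).
Proof.
move=> ab dG GB; apply: le_trans (cabs_le _) _; rewrite mulr_natl mulr2n.
have H (h h' : R -> R) : (forall x : R, is_derive x (1 : R) h (h' x)) ->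
    (forall x, a <= x <= b -> `|h' x| <= B) -> `|h b - h a| <= B * (b - a).
  move=> dh hB; have [|c] := MVT_segment ab (fun x _ => dh x).
    exact: continuous_subspaceT (is_derive_continuous dh).
  rewrite in_itv /= => /hB cB ->; rewrite normrM (ger0_norm (x := b - a)) ?subr_ge0//.
  by rewrite ler_wpM2r// subr_ge0.
rewrite ReD ImD !raddfN; apply: lerD.
  apply: (H _ _ (fun x => (dG x).1)) => x /GB; exact/le_trans/Re_le_cabs.
apply: (H _ _ (fun x => (dG x).2)) => x /GB; exact/le_trans/Im_le_cabs.
Qed.

Lemma cderiv_param_cint01 (F F' : R -> R -> R[i]) :
  (forall x, cderiv (F^~ x) (F'^~ x)) -> (forall s, ccont (F s)) ->
  ccont (fun z : R * R => F' z.1 z.2) ->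
  cderiv (fun s => cint `[0, 1] (F s)) (fun s => cint `[0, 1] (F' s)).
Proof.
move=> dF cF [c1 c2] s; split.
  exact: (@is_derive_param_integral _ (fun s x => complex.Re (F s x))
    (fun s x => complex.Re (F' s x)) _ _ (fun s x => (dF x s).1) (fun s => (cF s).1) c1).
exact: (@is_derive_param_integral _ (fun s x => complex.Im (F s x))
    (fun s x => complex.Im (F' s x)) _ _ (fun s x => (dF x s).2) (fun s => (cF s).2) c2).
Qed.

Lemma cderiv0_cst G : cderiv G (fun=> 0) -> forall a b, G a = G b.
Proof.
move=> dG a b; wlog ab : a b / a <= b.
  by move=> W; have [/W//|/ltW/W] := leP a b.
apply/esym/eqP; rewrite -subr_eq0; apply/eqP/cabs_eq0/le_anti; rewrite cabs_ge0 andbT.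
have := @cderiv_le _ _ a b 0 ab dG; rewrite mul0r mulr0; apply => x _.
by rewrite cabs0.
Qed.

(** The derivative of the left-hand side in [c] is [G (1 + c) - G c]. *)
Lemma cint01_shift G G' (c : R) : cderiv G G' -> ccont G' ->
  (forall a, G (a + 1) = G a) -> cint `[0, 1] (fun a => G (a + c)) = cint `[0, 1] G.
Proof.
move=> dG cG' pG; have cG := cderiv_ccont dG.
have cadd : continuous (fun z : R * R => z.1 + z.2) by move=> z; exact: add_continuous.
have dK : cderiv (fun s => cint `[0, 1] (fun a => G (a + s))) (fun=> 0).
  apply: cderiv_ext (cderiv_param_cint01 (F := fun s a => G (a + s))
    (F' := fun s a => G' (a + s)) _ _ _) _ _ => //.
  - move=> x; apply: cderiv_ext (cderiv_affine 1 x dG) _ _ => a; rewrite !mul1r addrC//.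
  - move=> s; apply: (ccont_comp (h := fun a : R => a + s)) => // a.
    by apply: continuousD; [exact: cvg_id|exact: cvg_cst].
  - apply: (ccont_comp (h := fun z : R * R => z.2 + z.1)) => // z.
    by under eq_fun do rewrite addrC; exact: cadd.
  - move=> s; rewrite (@cint_cderiv (fun a => G (a + s))) //.
    + by rewrite add0r (addrC 1) pG subrr.
    + by apply: cderiv_ext (cderiv_affine 1 s dG) _ _ => a; rewrite !mul1r.
    + apply: (ccont_comp (h := fun a : R => a + s)) => // a.
      by apply: continuousD; [exact: cvg_id|exact: cvg_cst].
have := cderiv0_cst dK c 0; move=> ->; apply: eq_cint => a _; by rewrite addr0.
Qed.

(** By induction on [N], the mean value inequality being applied to the
    remainder of order [N], whose derivative is a remainder of lower order.
    The factor [2 ^+ N.+1] comes from splitting into real and imaginary parts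
    at each step. *)
Lemma cderiv_taylor (N : nat) (phi : nat -> R -> R[i]) (B : R) :
  (forall i, cderiv (phi i) (phi i.+1)) ->
  (forall x, 0 <= x <= 1 -> cabs (phi N.+1 x) <= B) ->
  forall x, 0 <= x <= 1 ->
  cabs (phi 0 x - \sum_(i < N.+1) (x ^+ i / i`!%:R)%:C * phi i 0) <= 2 ^+ N.+1 * B.
Proof.
elim: N phi => [|N IH] phi dphi phiB x /andP[x0 x1].
  rewrite big_ord1 expr0 divr1 mul1r expr1.
  have B0 : 0 <= B by apply: le_trans (cabs_ge0 _) (phiB 0 _); rewrite lexx ler01.
  apply: le_trans (cderiv_le (B := B) x0 (dphi 0%N) _) _.
    by move=> y /andP[y0 yx]; apply: phiB; rewrite y0 (le_trans yx).
  by rewrite ler_pM2l// ler_piMr// subr0.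
have B0 : 0 <= B by apply: le_trans (cabs_ge0 _) (phiB 0 _); rewrite lexx ler01.
pose r y := phi 0%N y - \sum_(i < N.+2) (y ^+ i / i`!%:R)%:C * phi i 0.
pose r' y := phi 1%N y - \sum_(i < N.+1) (y ^+ i / i`!%:R)%:C * phi i.+1 0.
have dr : cderiv r r'.
  apply: cderivB => //.
  apply: cderiv_ext (@cderiv_sum _ (index_enum 'I_N.+2)
    (fun i y => (y ^+ i / i`!%:R)%:C * phi i 0)
    (fun i y => (i%:R * y ^+ i.-1 / i`!%:R)%:C * phi i 0) _) _ _ => //.
    move=> i; apply: cderiv_ext (cderivM (G' := fun=> 0)
      (F' := fun y => (i%:R * y ^+ i.-1 / i`!%:R)%:C) _ (cderiv_cst (phi i 0))) _ _ => //.
      move=> a; split; last exact: is_derive_cst.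
      have := is_deriveZ (i`!%:R^-1 : R) (is_deriveX i (is_derive_id a (1 : R))).
      have -> : (i`!%:R^-1 : R) \*: (id : R -> R) ^+ i = (fun x => x ^+ i / i`!%:R).
        by apply/funext => y; rewrite /= -[(_ ^+ i) y]/(_) /GRing.scale/= mulrC fctE.
      by move=> H; apply: (is_derive_eq H); rewrite /GRing.scale /= mulr1 mulrC mulr_natl.
    by move=> a; rewrite mulr0 addr0.
  move=> y; rewrite big_ord_recl mul0r mul0r mul0r add0r; apply: eq_bigr => i _.
  congr (_ * _); rewrite lift0 /= factS natrM invfM mulrA; congr (_%:C).
  by rewrite [_ * y ^+ i]mulrC mulfK// pnatr_eq0.
have r0 : r 0 = 0.
  rewrite /r big_ord_recl expr0 fact0 divr1 mul1r big1 ?addr0 ?subrr// => i _.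
  by rewrite lift0 expr0n /= mul0r mul0r.
rewrite -/(r x) -[r x]subr0 -r0; apply: le_trans (cderiv_le (B := 2 ^+ N.+1 * B) x0 dr _) _.
  move=> y /andP[y0 yx]; apply: (IH (fun i => phi i.+1)) => //.
  by rewrite y0 (le_trans yx).
rewrite [2 ^+ N.+2]exprS -(mulrA 2) ler_pM2l// subr0 ler_piMr// mulr_ge0//.
Qed.

End ComplexDerivative.

(** * Calculus of smooth functions of several variables *)

Lemma near_continuous (T U : topologicalType) (f g : T -> U) (x : T) :
  (\forall v \near x, f v = g v) -> continuous_at x g -> continuous_at x f.
Proof.
rewrite /continuous_at => fg; rewrite (nbhs_singleton fg) => cg; apply: cvg_trans cg.
by apply: near_eq_cvg; apply: filterS fg => v ->.
Qed.

Section CoordinateLines.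
Variables (R : realType) (m : nat).
Implicit Types (f g : 'rV[R]_m -> R[i]) (u : 'rV[R]_m) (j : 'I_m).

Local Notation e := (delta_mx 0).

(** A global form of [pderiv]: the restriction of [f] to every line in the
    direction of the [j]-th axis has derivative [f']. *)
Definition has_pderiv j f f' : Prop := forall u,
  cderiv (fun s => f (u + s *: e j)) (fun s => f' (u + s *: e j)).

Lemma derive_line (h : 'rV[R]_m -> R) (u v : 'rV[R]_m) (s : R) :
  (fun t : R => t^-1 *: ((h \o shift (u + s *: v)) (t *: v) - h (u + s *: v))) =
  (fun t : R => t^-1 *: (((fun s => h (u + s *: v)) \o shift s) (t *: 1) - h (u + s *: v))).
Proof.
apply/funext => t /=; congr (_ *: (h _ - _)).
by rewrite [t%:A]mulr1 scalerDl addrCA.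
Qed.

Lemma is_derive_line (h : 'rV[R]_m -> R) (u v : 'rV[R]_m) (s d : R) :
  is_derive (u + s *: v) v h d <-> is_derive s (1 : R) (fun s => h (u + s *: v)) d.
Proof.
split=> -[H1 H2]; split.
- by move: H1; rewrite /derivable derive_line.
- by rewrite -H2 /derive derive_line.
- by move: H1; rewrite /derivable derive_line.
- by rewrite -H2 /derive derive_line.
Qed.

Lemma has_pderivE j f f' : has_pderiv j f f' <->
  forall u, is_derive u (e j) (fun v => complex.Re (f v)) (complex.Re (f' u)) /\
            is_derive u (e j) (fun v => complex.Im (f v)) (complex.Im (f' u)).
Proof.
split=> [H u|H u s]; last first.
  by have [h1 h2] := H (u + s *: e j); split; apply/is_derive_line.
have [h1 h2] := H u 0; rewrite -[u]addr0 -(scale0r (e j)); split.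
  by apply/(is_derive_line (fun v => complex.Re (f v))).
by apply/(is_derive_line (fun v => complex.Im (f v))).
Qed.

Lemma has_pderiv_pderiv j f f' : has_pderiv j f f' -> pderiv j f = f'.
Proof.
move=> /has_pderivE H; apply/funext => u; have [[_ h1] [_ h2]] := H u.
by rewrite /pderiv h1 h2; case: (f' u).
Qed.

Lemma regular1_has_pderiv j f : regular1 f -> has_pderiv j f (pderiv j f).
Proof.
move=> [[_ f1] [_ f2]]; apply/has_pderivE => u; rewrite /pderiv /=.
by split; exact: derivableP.
Qed.

Lemma regular1_ccont f : regular1 f -> ccont f.
Proof. by move=> [[f1 _] [f2 _]]. Qed.

Lemma smooth_has_pderiv j f : smooth f -> has_pderiv j f (pderiv j f).
Proof. by move/smooth_regular1; exact: regular1_has_pderiv. Qed.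

Lemma smooth_ccont f : smooth f -> ccont f.
Proof. by move/smooth_regular1; exact: regular1_ccont. Qed.

Lemma smooth_pderivs l f : smooth f -> smooth (pderivs l f).
Proof. by move=> sf; elim: l => [|j l IH]; [exact: sf|exact: smooth_pderiv]. Qed.

(** Smoothness by coinduction: it is enough to exhibit a family of continuous
    functions that contains [f] and is closed under partial derivatives.
    Compositions, reciprocals and cutoff functions are all treated in this
    way, with a family suited to the function. *)
Lemma smooth_closed (F : set ('rV[R]_m -> R[i])) :
  (forall f, F f -> ccont f /\ forall j, exists2 f', F f' & has_pderiv j f f') ->
  forall f, F f -> smooth f.
Proof.
move=> FP; apply: smooth_coind => f /FP[[c1 c2] df]; split=> [|j].
  split; split=> // j u; have [f' _ /has_pderivE/(_ u)[h1 h2]] := df j; first by case: h1.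
  by case: h2.
by have [f' Ff' /has_pderiv_pderiv ->] := df j.
Qed.

Lemma smooth_add f g : smooth f -> smooth g -> smooth (fun u => f u + g u).
Proof. exact: smoothD. Qed.

Lemma smooth_mul f g : smooth f -> smooth g -> smooth (fun u => f u * g u).
Proof. exact: smoothM. Qed.

Lemma smooth_const (z : R[i]) : smooth ((fun=> z) : 'rV[R]_m -> R[i]).
Proof. exact: smooth_cst. Qed.

Lemma has_pderivD j f f' g g' : has_pderiv j f f' -> has_pderiv j g g' ->
  has_pderiv j (fun u => f u + g u) (fun u => f' u + g' u).
Proof. by move=> df dg u; exact: cderivD (df u) (dg u). Qed.

Lemma has_pderivM j f f' g g' : has_pderiv j f f' -> has_pderiv j g g' ->
  has_pderiv j (fun u => f u * g u) (fun u => f' u * g u + f u * g' u).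
Proof. by move=> df dg u; exact: cderivM (df u) (dg u). Qed.

Lemma has_pderiv_cst j (z : R[i]) : has_pderiv j (fun=> z) (fun=> 0).
Proof. by move=> u; exact: cderiv_cst. Qed.

Lemma smooth_sum (I : Type) (r : seq I) (P : pred I) (F : I -> 'rV[R]_m -> R[i]) :
  (forall i, P i -> smooth (F i)) -> smooth (fun u => \sum_(i <- r | P i) F i u).
Proof.
move=> sF; elim: r => [|i r IH].
  by under eq_fun do rewrite big_nil; exact: smooth_const.
under eq_fun do rewrite big_cons.
by case: (boolP (P i)) => [Pi|_]; [exact: smooth_add (sF i Pi) IH|exact: IH].
Qed.

Lemma smooth_prod (I : Type) (r : seq I) (P : pred I) (F : I -> 'rV[R]_m -> R[i]) :
  (forall i, P i -> smooth (F i)) -> smooth (fun u => \prod_(i <- r | P i) F i u).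
Proof.
move=> sF; elim: r => [|i r IH].
  by under eq_fun do rewrite big_nil; exact: smooth_const.
under eq_fun do rewrite big_cons.
by case: (boolP (P i)) => [Pi|_]; [exact: smooth_mul (sF i Pi) IH|exact: IH].
Qed.

Lemma smooth_coord j : smooth (fun u : 'rV[R]_m => (u 0 j)%:C).
Proof.
apply: (@smooth_form _ _ (fun u => u 0 j)) => [u v|a u|].
- by rewrite mxE.
- by rewrite mxE.
- exact: coord_continuous.
Qed.

Lemma smooth_pderiv_real j (h : 'rV[R]_m -> R) : 
  pderiv j (fun u => (h u)%:C) = fun u => ('D_(e j) h u)%:C.
Proof.
by apply/funext => u; rewrite /pderiv /=; rewrite (derive_cst (0 : R)).
Qed.

(** The family [a * cis h] with [a] smooth is closed under differentiation. *)
Lemma smooth_cis (h : 'rV[R]_m -> R) : smooth (fun u => (h u)%:C) ->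
  smooth (fun u => cis (h u)).
Proof.
move=> sh; apply: (@smooth_closed [set f | exists2 a, smooth a & f = fun u => a u * cis (h u)]);
  last by exists (fun=> 1); [exact: smooth_const|apply/funext => u; rewrite mul1r].
move=> _ [a sa ->]; split.
  by apply: ccontM; [exact: smooth_ccont|apply: ccont_cis; case: (smooth_ccont sh)].
move=> j; exists (fun u => (pderiv j a u + a u * (0 +i* 'D_(e j) h u)) * cis (h u)).
  exists (fun u => pderiv j a u + a u * (0 +i* 'D_(e j) h u)); last by [].
  apply: smooth_add; first exact: smooth_pderiv.
  apply: smooth_mul; first exact: sa.
  have -> : (fun u => 0 +i* 'D_(e j) h u) = (fun u => (0 +i* 1) * pderiv j (fun u => (h u)%:C) u).
    apply/funext => u; rewrite smooth_pderiv_real /=.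
    by apply/eqP; rewrite eq_complex /= !mul0r mulr0 subr0 mul1r add0r !eqxx.
  by apply: smooth_mul; [exact: smooth_const|exact: smooth_pderiv].
have -> : (fun u => (pderiv j a u + a u * (0 +i* 'D_(e j) h u)) * cis (h u)) =
   (fun u => pderiv j a u * cis (h u) + a u * ((0 +i* 'D_(e j) h u) * cis (h u))).
  by apply/funext => u; rewrite mulrDl mulrA.
apply: has_pderivM; first exact: smooth_has_pderiv.
have /has_pderivE dh := smooth_has_pderiv j sh.
apply/has_pderivE => u; have [/= h1 _] := dh u.
rewrite -[u]addr0 -(scale0r (e j)) in h1 *.
move/is_derive_line : h1 => h1; rewrite !mul0r sub0r add0r; split; apply/is_derive_line.
  have := is_derive1_comp (is_derive_cos _) h1.
  by move=> H; apply: (is_derive_eq H); rewrite mulNr mulrC.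
have := is_derive1_comp (is_derive_sin _) h1.
by move=> H; apply: (is_derive_eq H); rewrite mulrC.
Qed.

(** The family [a * h ^- n] with [a] smooth is closed under differentiation; a
    power of [h] in the denominator keeps the derivatives in this form without
    quotients of quotients. *)
Lemma smooth_inv (h : 'rV[R]_m -> R) : smooth (fun u => (h u)%:C) ->
  (forall u, h u != 0) -> smooth (fun u => (h u)^-1%:C).
Proof.
move=> sh h0.
apply: (@smooth_closed [set f | exists n a, smooth a /\
    f = fun u => a u * ((h u)^-1 ^+ n)%:C]); last first.
  exists 1%N, (fun=> 1); split; first exact: smooth_const.
  by apply/funext => u; rewrite mul1r expr1.
have [ch _] := smooth_ccont sh.
move=> _ [n [a [sa ->]]]; split.
  apply: ccontM; first exact: smooth_ccont.
  apply: ccont_real => u; apply: (@continuous_comp _ _ _ (fun u => (h u)^-1) (fun x : R => x ^+ n)).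
    exact: continuousV (h0 u) (ch u).
  exact: exprn_continuous.
move=> j; exists (fun u => (pderiv j a u * (h u)%:C - a u * (n%:R * 'D_(e j) h u)%:C) * ((h u)^-1 ^+ n.+1)%:C).
  exists n.+1, (fun u => pderiv j a u * (h u)%:C - a u * (n%:R * 'D_(e j) h u)%:C); split; last by [].
  have -> : (fun u => pderiv j a u * (h u)%:C - a u * (n%:R * 'D_(e j) h u)%:C) =
     (fun u => pderiv j a u * (h u)%:C + a u * ((- n%:R) * pderiv j (fun u => (h u)%:C) u)).
    apply/funext => u; rewrite smooth_pderiv_real /=; congr (_ + _).
    by rewrite rmorphM /= rmorph_nat mulNr mulrN.
  apply: smooth_add; first by apply: smooth_mul; [exact: smooth_pderiv|exact: sh].
  apply: smooth_mul; first exact: sa.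
  by apply: smooth_mul; [exact: smooth_const|exact: smooth_pderiv].
have -> : (fun u => (pderiv j a u * (h u)%:C - a u * (n%:R * 'D_(e j) h u)%:C) * ((h u)^-1 ^+ n.+1)%:C) =
   (fun u => pderiv j a u * ((h u)^-1 ^+ n)%:C + a u * (- (n%:R * (h u)^-1 ^+ n.+1 * 'D_(e j) h u))%:C).
  apply/funext => u; rewrite mulrBl; congr (_ + _).
    rewrite -mulrA exprS -rmorphM /=; congr (_ * _%:C).
    by rewrite mulrA mulfV// mul1r.
  case: (a u) => p q; apply/eqP; rewrite eq_complex /=.
  by apply/andP; split; apply/eqP; ring.
apply: has_pderivM; first exact: smooth_has_pderiv.
have /has_pderivE dh := smooth_has_pderiv j sh.
apply/has_pderivE => u; have [/= h1 _] := dh u.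
split; last exact: is_derive_cst.
have E : u + 0 *: e j = u by rewrite scale0r addr0.
rewrite -E in h1 *; move/is_derive_line : h1 => h1; apply/is_derive_line.
have h0' : h (u + 0 *: e j) != 0 by [].
have := is_deriveX n (is_deriveV h0' h1).
have -> : ((fun s : R => (h (u + s *: e j))^-1) : R -> R) ^+ n =
    (fun s : R => (h (u + s *: e j))^-1 ^+ n) by apply/funext => s; rewrite fctE.
set y := h (u + 0 *: e j); set d := 'D_(e j) _ _ => H; apply: (is_derive_eq H).
rewrite -[LHS]/(n%:R * y^-1 ^+ n.-1 * (- y ^- 2 * d)).
case: n {H sa} => [|n]; first by rewrite !mul0r oppr0.
by rewrite /= -exprVn; set x := y^-1; rewrite (exprS x n.+1) (exprS x n); ring.
Qed.

(** The derivatives of functions that agree near a point agree near this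
    point, so that the property reproduces itself under differentiation. *)
Lemma smooth_local f :
  (forall u, exists2 g, smooth g & \forall v \near u, f v = g v) -> smooth f.
Proof.
apply: (@smooth_coind _ _ [set f | forall u, exists2 g, smooth g & \forall v \near u, f v = g v]).
move=> {}f Ff.
have nf u g (P : R[i] -> R) : (\forall v \near u, f v = g v) -> \forall v \near u, P (f v) = P (g v).
  by apply: filterS => v ->.
split.
  split; split=> [u|j u]; have [g sg fg] := Ff u; have [[c1 d1] [c2 d2]] := smooth_regular1 sg.
  - exact: near_continuous (nf u g (@complex.Re R) fg) (c1 u).
  - apply: (@near_eq_derivable _ _ _ (fun v => complex.Re (g v))); last exact: d1.
    by apply: filterS (nf u g (@complex.Re R) fg) => v ->.
  - exact: near_continuous (nf u g (@complex.Im R) fg) (c2 u).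
  - apply: (@near_eq_derivable _ _ _ (fun v => complex.Im (g v))); last exact: d2.
    by apply: filterS (nf u g (@complex.Im R) fg) => v ->.
move=> j u; have [g sg fg] := Ff u; exists (pderiv j g); first exact: smooth_pderiv.
have := near_join fg; apply: filterS => v fgv; rewrite /pderiv; congr (_ +i* _).
  by apply: near_eq_derive => //; exact: (nf v g (@complex.Re R)).
by apply: near_eq_derive => //; exact: (nf v g (@complex.Im R)).
Qed.

End CoordinateLines.

(** * Substitution of coordinates *)

Section CoordinateSubstitution.
Variables (R : realType).

Local Notation e := (delta_mx 0).

Lemma has_pderiv_ext (m : nat) (j : 'I_m) (f f' g g' : 'rV[R]_m -> R[i]) :
  has_pderiv j f f' -> f =1 g -> f' =1 g' -> has_pderiv j g g'.
Proof. by move=> df /funext <- /funext <-. Qed.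

(** Maps that are affine in each coordinate separately and move only one
    coordinate at a time: embeddings of coordinate subspaces, projections,
    translations, dilations of one coordinate. For them the chain rule has a
    single term. *)
Lemma smooth_comp (p q : nat) (L : 'rV[R]_p -> 'rV[R]_q) (sg : 'I_p -> 'I_q)
    (a : 'I_p -> 'rV[R]_p -> R) (F : 'rV[R]_q -> R[i]) :
  continuous L -> (forall j, smooth (fun u => (a j u)%:C)) ->
  (forall j u s, L (u + s *: e j) = L u + (s * a j u) *: e (sg j)) ->
  smooth F ->
  smooth (fun u => F (L u)) /\
  forall j, pderiv j (fun u => F (L u)) = fun u => (a j u)%:C * pderiv (sg j) F (L u).
Proof.
move=> cL sa La sF.
have aE j u s : a j (u + s *: e j) = a j u.
  have := La j u (s + 1).
  have -> : u + (s + 1) *: e j = u + s *: e j + 1 *: e j by rewrite scalerDl addrA.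
  rewrite !La -addrA => /addrI; rewrite -scalerDl.
  by move=> /matrixP/(_ 0 (sg j)); rewrite !mxE !eqxx !mulr1 mulrDl !mul1r => /addrI.
have H (G : 'rV[R]_q -> R[i]) j : smooth G ->
    has_pderiv j (fun u => G (L u)) (fun u => (a j u)%:C * pderiv (sg j) G (L u)).
  move=> sG u; have := cderiv_affine (a j u) 0 (smooth_has_pderiv (sg j) sG (L u)).
  by move=> dG; apply: cderiv_ext dG _ _ => s; rewrite addr0 (mulrC _ s) La ?aE.
split; last by move=> j; apply: has_pderiv_pderiv; exact: H.
apply: (@smooth_closed _ _ [set f | exists (r : seq (('rV[R]_p -> R[i]) * ('rV[R]_q -> R[i]))),
   (forall z, List.In z r -> smooth z.1 /\ smooth z.2) /\
   f = fun u => \sum_(z <- r) z.1 u * z.2 (L u)]); last first.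
  exists [:: (fun=> 1, F)]; split.
    by move=> z [<-|[]]; split; [exact: smooth_const|exact: sF].
  by apply/funext => u; rewrite big_seq1 mul1r.
move=> _ [r [sr ->]].
have cFL (G : 'rV[R]_q -> R[i]) : smooth G -> ccont (fun u => G (L u)).
  by move=> /smooth_ccont; exact: ccont_comp.
elim: r sr => [|[b G] r IH] sr.
  under [X in ccont X]eq_fun do rewrite big_nil.
  split; first exact: ccont_cst.
  move=> j; exists (fun=> 0); first by exists [::]; split => //; apply/funext => u; rewrite big_nil.
  by apply: has_pderiv_ext (has_pderiv_cst j 0) _ _ => u; rewrite ?big_nil.
have [/= sb sG] := sr (b, G) (or_introl erefl).
have [cr dr] := IH (fun z h => sr z (or_intror h)); split.
  under eq_fun do rewrite big_cons.
  by apply: ccontD cr; apply: ccontM; [exact: smooth_ccont|exact: cFL].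
move=> j; have [f' [r' [sr' ->]] df'] := dr j.
exists (fun u => \sum_(z <- [:: (pderiv j b, G), (fun u => b u * (a j u)%:C, pderiv (sg j) G) & r']) z.1 u * z.2 (L u)).
  eexists; split; last by reflexivity.
  move=> z [<-|[<-|/sr'//]]; first by split; [exact: smooth_pderiv|exact: sG].
  by split; [apply: smooth_mul; [exact: sb|exact: sa]|exact: smooth_pderiv].
apply: has_pderiv_ext (has_pderivD (has_pderivM (smooth_has_pderiv j sb) (H G j sG)) df') _ _.
  by move=> u; rewrite big_cons.
by move=> u; rewrite !big_cons /= addrA mulrA.
Qed.

Section Upd.
Variable m : nat.
Implicit Types (u : 'rV[R]_m) (i j : 'I_m).

Definition upd u j (a : R) : 'rV[R]_m := \row_i (if i == j then a else u 0 i).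

Lemma updE u j a i : upd u j a 0 i = if i == j then a else u 0 i.
Proof. by rewrite mxE. Qed.

Lemma upd_id u j : upd u j (u 0 j) = u.
Proof. by apply/rowP => i; rewrite updE; case: eqP => // ->. Qed.

Lemma upd_line u j a s : upd u j (a + s) = upd u j a + s *: e j.
Proof.
apply/rowP => i; rewrite updE !mxE eqxx /=.
by case: eqP => _; rewrite ?mulr1 ?mulr0 ?addr0.
Qed.

Lemma upd_line_same u j a s : upd (u + s *: e j) j a = upd u j a.
Proof.
apply/rowP => i; rewrite !updE; case: eqVneq => // ij.
by rewrite !mxE eqxx (negbTE ij) mulr0 addr0.
Qed.

Lemma upd_line_other u i j a s : i != j -> upd (u + s *: e i) j a = upd u j a + s *: e i.
Proof.
move=> ij; apply/rowP => l; rewrite !mxE eqxx /=.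
by case: (eqVneq l j) => // ->; rewrite eq_sym (negbTE ij) mulr0 addr0.
Qed.

Lemma upd_linear u j a : upd u j a = u + (a - u 0 j) *: e j.
Proof.
apply/rowP => i; rewrite !mxE eqxx /=; case: eqVneq => [->|_]; rewrite ?mulr1 ?mulr0 ?addr0//.
by rewrite addrC subrK.
Qed.

Lemma continuous_rV (T : topologicalType) (f : T -> 'rV[R]_m) :
  (forall i, continuous (fun t => f t 0 i)) -> continuous f.
Proof.
move=> cf t; apply/cvg_ballP => eps e0.
have : \forall y \near t, forall i, ball (f t 0 i) eps (f y 0 i).
  by apply: filter_forall => i; have /cvg_ballP/(_ _ e0) := cf i t.
by apply: filterS => y H; split=> // i j; rewrite (ord1 i).
Qed.

Lemma continuous_updE j : continuous (fun z : 'rV[R]_m * R => upd z.1 j z.2).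
Proof.
apply: continuous_rV => i; under eq_fun do rewrite updE.
case: eqP => _ [u a]; first exact: cvg_snd.
apply: (@continuous_comp _ _ _ fst (fun u : 'rV[R]_m => u 0 i)); first exact: cvg_fst.
exact: coord_continuous.
Qed.

Lemma continuous_upd u j : continuous (upd u j).
Proof.
move=> a; apply: (@continuous_comp _ _ _ (fun a : R => (u, a)) (fun z : 'rV[R]_m * R => upd z.1 j z.2)).
  exact: (cvg_pair (cvg_cst u) (@cvg_id _ _)).
exact: continuous_updE.
Qed.

Lemma continuous_upd1 j a : continuous (fun u => upd u j a).
Proof.
apply: continuous_rV => i; under eq_fun do rewrite updE.
by case: eqP => _; [exact: cst_continuous|exact: coord_continuous].
Qed.

Lemma ccont_slice (h : 'rV[R]_m -> R[i]) u j : ccont h -> ccont (fun a => h (upd u j a)).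
Proof. exact/ccont_comp/continuous_upd. Qed.

Lemma cderiv_slice (h h' : 'rV[R]_m -> R[i]) u j : has_pderiv j h h' ->
  cderiv (fun a => h (upd u j a)) (fun a => h' (upd u j a)).
Proof.
move=> dh; apply: cderiv_ext (dh (upd u j 0)) _ _ => a; by rewrite -upd_line add0r.
Qed.

End Upd.
End CoordinateSubstitution.

(** * Derivatives along lines *)

Section ChainRule.
Variable R : realType.
Local Notation e := (delta_mx 0).

Lemma mean_value_point (g g' : R -> R) (t h : R) :
  (forall x : R, is_derive x (1 : R) g (g' x)) ->
  exists2 c, `|c - t| <= `|h| & g (t + h) - g t = g' c * h.
Proof.
move=> dg; have cg := is_derive_continuous dg.
have [h0|h0] := leP 0 h.
  have [|c] := @MVT_segment R g g' t (t + h) _ (fun x _ => dg x) (continuous_subspaceT cg).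
    by rewrite lerDl.
  have -> : t + h - t = h by rewrite addrC addKr.
  rewrite in_itv /= => /andP[tc ch] gE; exists c => //.
  by rewrite !ger0_norm ?subr_ge0// lerBlDr addrC.
have [|c] := @MVT_segment R g g' (t + h) t _ (fun x _ => dg x) (continuous_subspaceT cg).
  by rewrite gerDl ltW.
rewrite in_itv /= => /andP[tc ch] gE; exists c.
  by rewrite distrC ger0_norm ?subr_ge0// ltr0_norm// lerBlDr addrC -lerBlDr opprK.
by rewrite -opprB gE opprD addrA subrr sub0r mulrN opprK.
Qed.

(** The increment of [K] along the diagonal splits into one in the first
    variable, which the mean value theorem expresses by a value of [K1]
    nearby, and one in the second variable from the point itself. Continuity
    of one of the two partial derivatives is therefore enough. *)
Lemma is_derive_diagonal (K K1 K2 : R -> R -> R) :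
  (forall t s, is_derive s (1 : R) (K^~ t) (K1 s t)) ->
  (forall s t, is_derive t (1 : R) (K s) (K2 s t)) ->
  continuous (fun z : R * R => K1 z.1 z.2) ->
  forall t, is_derive t (1 : R) (fun t => K t t) (K1 t t + K2 t t).
Proof.
move=> dK1 dK2 cK1 t.
suff H : (fun h : R => h^-1 *: (K (h *: 1 + t) (h *: 1 + t) - K t t)) @ 0^' --> (K1 t t + K2 t t : R^o).
  by split; [apply/cvg_ex; exists (K1 t t + K2 t t)|exact: cvg_lim].
have -> : (fun h : R => h^-1 *: (K (h *: 1 + t) (h *: 1 + t) - K t t)) =
   (fun h : R => h^-1 *: (K (h *: 1 + t) (h *: 1 + t) - K t (h *: 1 + t))) +
   (fun h : R => h^-1 *: (K t (h *: 1 + t) - K t t)).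
  by apply/funext => h; rewrite fctE -scalerDr subrKA.
apply: cvgD; last first.
  by have [h1 h2] := dK2 t t; rewrite -h2; exact: h1.
apply/cvgrPdist_le => eps eps0.
have /cvgrPdist_le/(_ _ eps0)/= [[U V] /= [[d1 d10 Ud] [d2 d20 Vd]] UV] := cK1 (t, t).
near=> h; have h0 : h != 0 by near: h; exact: nbhs_dnbhs_neq.
have [c ct] := @mean_value_point (K^~ (h *: 1 + t)) (K1^~ (h *: 1 + t)) t h (dK1 _).
rewrite [h%:A]mulr1 (addrC h t) => ->; rewrite [_ *: _]mulrC mulfK//.
apply: (UV (c, t + h)); split => /=.
  apply: Ud => /=; rewrite distrC (le_lt_trans ct)//; near: h.
  exact: dnbhs0_lt.
apply: Vd => /=; rewrite opprD addrA subrr sub0r normrN; near: h.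
exact: dnbhs0_lt.
Unshelve. all: by end_near. Qed.

Lemma continuous_affine_line (m : nat) (u v w : 'rV[R]_m) :
  continuous (fun z : R * R => u + z.1 *: v + z.2 *: w).
Proof.
apply: continuous_rV => i z.
under eq_fun do rewrite !mxE.
have c1 : continuous_at z (fun z : R * R => z.1 * v 0 i).
  exact: (continuousM (@cvg_fst _ _ _ _ _) (cvg_cst _)).
have c2 : continuous_at z (fun z : R * R => z.2 * w 0 i).
  exact: (continuousM (@cvg_snd _ _ _ _ _) (cvg_cst _)).
exact: (continuousD (continuousD (cvg_cst (u 0 i)) c1) c2).
Qed.

(** By induction on the number of coordinates that move with [t], each new
    coordinate being added by [is_derive_diagonal]. *)
Lemma cderiv_direction (m : nat) (f : 'rV[R]_m -> R[i]) (u v : 'rV[R]_m) : smooth f ->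
  cderiv (fun t => f (u + t *: v)) (fun t => \sum_i (v 0 i)%:C * pderiv i f (u + t *: v)).
Proof.
move=> sf.
suff H (r : seq 'I_m) : forall w, cderiv (fun t => f (w + t *: \sum_(i <- r) v 0 i *: e i))
    (fun t => \sum_(i <- r) (v 0 i)%:C * pderiv i f (w + t *: \sum_(i <- r) v 0 i *: e i)).
  by have := H (index_enum 'I_m) u; rewrite -row_sum_delta.
elim: r => [|j r IH] w.
  apply: cderiv_ext (cderiv_cst (f w)) _ _ => t; by rewrite !big_nil ?scaler0 ?addr0.
set d := \sum_(i <- r) _ in IH *.
pose K s t := f (w + s *: (v 0 j *: e j) + t *: d).
pose K1 s t := (v 0 j)%:C * pderiv j f (w + s *: (v 0 j *: e j) + t *: d).
pose K2 s t := \sum_(i <- r) (v 0 i)%:C * pderiv i f (w + s *: (v 0 j *: e j) + t *: d).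
have dK1 t : cderiv (K^~ t) (K1^~ t).
  apply: cderiv_ext (cderiv_affine (v 0 j) 0 (smooth_has_pderiv j sf (w + t *: d))) _ _ => s.
    by rewrite addr0 /K scalerA mulrC addrAC.
  by rewrite addr0 /K1 scalerA mulrC addrAC [s * _]mulrC mulrC.
have dK2 s : cderiv (K s) (K2 s) by exact: IH.
have [c1 c2] : ccont (fun z : R * R => K1 z.1 z.2).
  apply: ccontM; first exact: ccont_cst.
  apply: (ccont_comp (h := fun z : R * R => w + z.1 *: (v 0 j *: e j) + z.2 *: d)).
    exact: continuous_affine_line.
  exact/smooth_ccont/smooth_pderiv.
have E t : w + t *: \sum_(i <- j :: r) v 0 i *: e i = w + t *: (v 0 j *: e j) + t *: d.
  by rewrite big_cons scalerDr addrA.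
apply: (@cderiv_ext _ (fun t => K t t) (fun t => K1 t t + K2 t t)) => [t|t|t]; last 2 first.
- by rewrite E.
- by rewrite big_cons E.
split.
  rewrite ReD; exact: (@is_derive_diagonal (fun s t => complex.Re (K s t)) (fun s t => complex.Re (K1 s t))
    (fun s t => complex.Re (K2 s t)) (fun t s => (dK1 t s).1) (fun s t => (dK2 s t).1) c1).
rewrite ImD; exact: (@is_derive_diagonal (fun s t => complex.Im (K s t)) (fun s t => complex.Im (K1 s t))
    (fun s t => complex.Im (K2 s t)) (fun t s => (dK1 t s).2) (fun s t => (dK2 s t).2) c2).
Qed.

End ChainRule.

(** * Uniform bounds and periodicity *)

Section Bounds.
Variables (R : realType) (m : nat).
Implicit Types (h : 'rV[R]_m -> R[i]) (u : 'rV[R]_m).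
Local Notation e := (delta_mx 0).

Lemma ccont_bound_compact (T : topologicalType) (f : T -> R[i]) (K : set T) :
  compact K -> ccont f -> exists2 B : R, 0 <= B & forall x, K x -> cabs (f x) <= B.
Proof.
move=> cK /ccont_cabs cf.
have /compact_bounded[M [_ hM]] := continuous_compact (continuous_subspaceT cf) cK.
exists (`|M| + 1) => [|u Ku]; first by rewrite addr_ge0.
have := hM (`|M| + 1); rewrite (le_lt_trans (ler_norm M)) ?ltrDl// => /(_ isT (cabs (f u))).
by rewrite /= ger0_norm ?cabs_ge0//; apply; exists u.
Qed.

Lemma compact_unit_cube : compact [set u : 'rV[R]_m | forall i, 0 <= u 0 i <= 1].
Proof.
have := @rV_compact R m (fun=> `[0, 1]%classic) (fun=> @segment_compact R 0 1).
by congr compact; apply/seteqP; split=> u H i; have := H i; rewrite /= in_itv.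
Qed.

Lemma smooth_bound_compact h (K : set 'rV[R]_m) r : compact K -> smooth h ->
  exists2 B : R, 0 <= B & forall l u, (size l <= r)%N -> K u -> cabs (pderivs l h u) <= B.
Proof.
move=> cK; elim: r h => [|r IH] h sh.
  have [B B0 hB] := ccont_bound_compact cK (smooth_ccont sh).
  by exists B => // l u; rewrite leqn0 => /nilP -> /hB.
have [B B0 hB] := ccont_bound_compact cK (smooth_ccont sh).
have H j : {B : R | 0 <= B /\ forall l u, (size l <= r)%N -> K u -> cabs (pderivs l (pderiv j h) u) <= B}.
  by apply/cid; have [C C0 hC] := IH _ (smooth_pderiv j sh); exists C.
pose Bj j := sval (H j); exists (B + \sum_j Bj j) => [|l u].
  by rewrite addr_ge0// sumr_ge0// => j _; case: (svalP (H j)).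
case/lastP: l => [_ /hB|l j].
  by move/le_trans; apply; rewrite lerDl sumr_ge0// => j _; case: (svalP (H j)).
rewrite size_rcons /pderivs foldr_rcons => lr Ku.
have [_ /(_ l u lr Ku)/le_trans] := svalP (H j); apply.
rewrite -/(Bj j) (bigD1 j)//= addrCA lerDl addr_ge0// sumr_ge0// => i _.
by case: (svalP (H i)).
Qed.

Definition periodic j h : Prop := forall u, h (u + e j) = h u.

Lemma periodic_int j h (z : int) u : periodic j h -> h (u + z%:~R *: e j) = h u.
Proof.
move=> ph; have H n v : h (v + n%:R *: e j) = h v.
  elim: n => [|n IH]; first by rewrite scale0r addr0.
  by rewrite -natr1 scalerDl scale1r addrA ph.
case: z => n; first exact: H.
by rewrite NegzE mulrNz scaleNr -[_%:~R]/(n.+1%:R) -[LHS](H n.+1) subrK.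
Qed.

Lemma periodic_pderiv i j h : periodic j h -> periodic j (pderiv i h).
Proof.
move=> ph u; have E : (fun v => h (v + e j)) = h by apply/funext => v; exact: ph.
by have /(congr1 (fun g => g u)) := pderiv_translate i h (e j); rewrite E => ->.
Qed.

Lemma periodic_pderivs l j h : periodic j h -> periodic j (pderivs l h).
Proof. by move=> ph; elim: l => [|i l IH]; [exact: ph|exact: periodic_pderiv]. Qed.

(** One point [v] serves for all functions at once, in particular for a
    function together with its derivatives. *)
Lemma reduce_mod1 (s : seq 'I_m) u : exists v,
  [/\ forall h, (forall j, j \in s -> periodic j h) -> h v = h u,
      forall j, j \in s -> 0 <= v 0 j <= 1 &
      forall j, j \notin s -> v 0 j = u 0 j].
Proof.
elim: s => [|i s [v [hv sv nv]]]; first by exists u.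
pose z := Num.floor (v 0 i).
have vE : upd v i (v 0 i - z%:~R) = v + (- z)%:~R *: e i.
  by rewrite upd_linear addrAC subrr sub0r mulrNz.
exists (upd v i (v 0 i - z%:~R)); split.
- move=> h ph; rewrite vE periodic_int; last by apply: ph; rewrite mem_head.
  by apply: hv => j js; apply: ph; rewrite inE js orbT.
- move=> j; rewrite inE updE; case: eqVneq => [_ _|_ /= /sv//].
  by rewrite subr_ge0 floor_le/= lerBlDl -[X in _ + X]/(1%:~R) -intrD ltW// floorD1_gt.
- by move=> j; rewrite inE negb_or updE => /andP[/negbTE -> /nv].
Qed.

End Bounds.

(** * Integration over one coordinate *)

Section CoordinateIntegral.
Variables (R : realType) (m : nat).
Implicit Types (h g : 'rV[R]_m -> R[i]) (u : 'rV[R]_m) (D : set R) (j l : 'I_m).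
Local Notation e := (delta_mx 0).

Definition coord_int D j h : 'rV[R]_m -> R[i] := fun u => cint D (fun a => h (upd u j a)).

Lemma ccont_joint_upd h j : ccont h -> ccont (fun z : 'rV[R]_m * R => h (upd z.1 j z.2)).
Proof. exact/ccont_comp/continuous_updE. Qed.

Lemma ccont_coord_int h j (a b : R) : a <= b -> ccont h -> ccont (coord_int `[a, b] j h).
Proof.
move=> ab /(ccont_joint_upd j)[c1 c2]; split.
  exact: (@continuous_param_integral _ _ (fun u x => complex.Re (h (upd u j x))) _ _ ab c1).
exact: (@continuous_param_integral _ _ (fun u x => complex.Im (h (upd u j x))) _ _ ab c2).
Qed.

Lemma coord_int_line D j h u s : coord_int D j h (u + s *: e j) = coord_int D j h u.
Proof. by apply: eq_cint => a _; rewrite upd_line_same. Qed.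

Local Notation A := (coord_int `[0, 1]).

Lemma has_pderiv_coord_int j l h h' : l != j -> ccont h -> ccont h' -> has_pderiv l h h' ->
  has_pderiv l (A j h) (A j h').
Proof.
move=> lj ch ch' dh u.
apply: (@cderiv_param_cint01 _ (fun s a => h (upd (u + s *: e l) j a))
  (fun s a => h' (upd (u + s *: e l) j a))) => [a|s|].
- by apply: cderiv_ext (dh (upd u j a)) _ _ => s; rewrite upd_line_other.
- exact: ccont_slice.
- apply: (ccont_comp (h := fun z : R * R => upd (u + z.1 *: e l) j z.2)) => //.
  have -> : (fun z : R * R => upd (u + z.1 *: e l) j z.2) =
      (fun z => upd u j 0 + z.1 *: e l + z.2 *: e j).
    by apply/funext => z; rewrite upd_line_other// addrAC -upd_line add0r.
  exact: continuous_affine_line.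
Qed.

Lemma coord_int_cst0 D (mD : measurable (D : set (measurableTypeR R))) j :
  coord_int D j (fun=> 0) = fun=> 0.
Proof. by apply/funext => u; exact: cint0. Qed.

Lemma coord_int01_0 j : A j (fun=> 0) = fun=> 0.
Proof. by rewrite coord_int_cst0//; exact: measurable_cc. Qed.

(** The family of all [A j h] together with 0 is closed under differentiation:
    derivatives in the other variables pass under the integral, the one in the
    [j]-th variable vanishes. *)
Lemma smooth_coord_int j h : smooth h -> smooth (A j h).
Proof.
move=> sh; apply: (@smooth_closed _ _ [set f | exists2 g, smooth g & f = A j g]);
  last by exists h; [exact: sh|].
move=> _ [g sg ->]; split; first exact: ccont_coord_int (ler01) (smooth_ccont sg).
move=> l; have [->|lj] := eqVneq l j.
  exists (A j (fun=> 0)); first by exists (fun=> 0); [exact: smooth_const|].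
  move=> u; apply: cderiv_ext (cderiv_cst (A j g u)) _ _ => s; first by rewrite coord_int_line.
  by rewrite coord_int01_0.
exists (A j (pderiv l g)); first by exists (pderiv l g); [exact: smooth_pderiv|].
apply: has_pderiv_coord_int => //; [exact: smooth_ccont|exact/smooth_ccont/smooth_pderiv|].
exact: smooth_has_pderiv.
Qed.

Lemma pderiv_coord_int j l h : l != j -> smooth h ->
  pderiv l (A j h) = A j (pderiv l h).
Proof.
move=> lj sh; apply/has_pderiv_pderiv/has_pderiv_coord_int => //.
- exact: smooth_ccont.
- exact/smooth_ccont/smooth_pderiv.
- exact: smooth_has_pderiv.
Qed.

Lemma pderiv_coord_int_same j h : pderiv j (A j h) = fun=> 0.
Proof.
apply: has_pderiv_pderiv => u; apply: cderiv_ext (cderiv_cst (A j h u)) _ _ => // s.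
by rewrite coord_int_line.
Qed.

Lemma pderivs_coord_int j (r : seq 'I_m) h : smooth h ->
  pderivs r (A j h) = if j \in r then fun=> 0 else A j (pderivs r h).
Proof.
move=> sh; elim: r => [//|i r IH]; rewrite [LHS]/= IH inE.
case: (boolP (j \in r)) => jr; first by rewrite orbT; exact: pderiv_cst.
rewrite orbF; case: eqVneq => [->|ji]; first exact: pderiv_coord_int_same.
by rewrite pderiv_coord_int; [|rewrite eq_sym|exact: smooth_pderivs].
Qed.

Lemma cabs_coord_int_le j h B u : ccont h ->
  (forall a, 0 <= a <= 1 -> cabs (h (upd u j a)) <= B) -> cabs (A j h u) <= 2 * B.
Proof. by move=> ch hB; apply: cabs_cint01_le => //; exact: ccont_slice. Qed.

(** The fundamental theorem of calculus over one period. *)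
Lemma coord_int_pderiv j h : smooth h -> periodic j h -> A j (pderiv j h) = fun=> 0.
Proof.
move=> sh ph; apply/funext => u; rewrite /coord_int.
rewrite (cint_cderiv ler01 (cderiv_slice u (smooth_has_pderiv j sh))).
  by rewrite -[X in upd u j X]add0r upd_line scale1r ph subrr.
exact/ccont_slice/smooth_ccont/smooth_pderiv.
Qed.

Lemma coord_int_addf j h g : ccont h -> ccont g ->
  A j (fun u => h u + g u) = fun u => A j h u + A j g u.
Proof.
move=> ch cg; apply/funext => u; by rewrite /coord_int cintD//; exact/cintegrable_cc/ccont_slice.
Qed.

Lemma coord_int_scale j (c : 'rV[R]_m -> R[i]) h : ccont h ->
  (forall u a, c (upd u j a) = c u) ->
  A j (fun u => c u * h u) = fun u => c u * A j h u.
Proof.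
move=> ch cj; apply/funext => u; rewrite /coord_int -cintZ; last exact/cintegrable_cc/ccont_slice.
  by apply: eq_cint => a _; rewrite cj.
exact: measurable_cc.
Qed.

Lemma coord_int_bigsum j (I : Type) (r : seq I) (P : pred I) (F : I -> 'rV[R]_m -> R[i]) :
  (forall i, P i -> ccont (F i)) ->
  A j (fun u => \sum_(i <- r | P i) F i u) = fun u => \sum_(i <- r | P i) A j (F i) u.
Proof.
move=> cF; apply/funext => u; rewrite /coord_int cint_sum//.
by move=> i Pi; exact/cintegrable_cc/ccont_slice/cF.
Qed.

Lemma periodic_coord_int D i j h : periodic i h -> periodic i (coord_int D j h).
Proof.
move=> ph u; have [->|ij] := eqVneq i j.
  by rewrite -[e j]scale1r coord_int_line.
by apply: eq_cint => a _; rewrite -[e i]scale1r upd_line_other// scale1r ph.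
Qed.

End CoordinateIntegral.

Section IteratedCoordinateIntegral.
Variable R : realType.
Local Notation Ai := (coord_int).

(** The iterated integral over [d] variables, written with operators that all
    act on functions of the same [m] variables. Derivatives and integrals in
    different variables can then be exchanged without reordering the arguments
    of the function. *)
Definition coord_ints (m d : nat) (D : set R) (io : 'I_d -> 'I_m) (s : seq 'I_d)
  (h : 'rV[R]_m -> R[i]) : 'rV[R]_m -> R[i] := foldr (fun i => coord_int D (io i)) h s.

Lemma cintegralS (D : set R) d (g : 'rV[R]_d.+1 -> R[i]) :
  cintegral D g = cint D (fun a => cintegral D (fun v : 'rV[R]_d => g (row_mx (const_mx a : 'rV_1) v))).
Proof. by []. Qed.

(** The bridge between integrals over vectors, built by recursion on the
    dimension, and iterated coordinate integrals; [L] completes the variables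
    of integration by the parameters [u]. *)
Lemma cintegral_coord_ints (m d : nat) (D : set R) (io : 'I_d -> 'I_m)
    (F : 'rV[R]_m -> R[i]) (u : 'rV[R]_m) (L : 'rV[R]_d -> 'rV[R]_m) :
  (forall v i, L v 0 (io i) = v 0 i) ->
  (forall v i', (forall i, io i != i') -> L v 0 i' = u 0 i') ->
  cintegral D (fun v => F (L v)) = coord_ints D io (enum 'I_d) F u.
Proof.
elim: d io u L => [|d IH] io u L L1 L2.
  rewrite [X in coord_ints _ _ X](_ : _ = [::]) /=; last by apply: size0nil; rewrite size_enum_ord.
  rewrite /cintegral /=; have -> : L 0 = u by apply/rowP => i; apply: L2; case.
  by case: (F u).
rewrite cintegralS enum_ordSl /= /coord_int; apply: eq_cint => a _.
rewrite (IH (io \o lift ord0) (upd u (io ord0) a)) /=.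
- by rewrite /coord_ints foldr_map.
- move=> v i; rewrite /= L1 (_ : lift ord0 i = rshift 1 i); last exact: val_inj.
  exact: (row_mxEr (const_mx a : 'rV[R]_1) v 0 i).
- move=> v i' ni; rewrite updE; case: eqVneq => [->|i'0].
    rewrite L1 (_ : ord0 = lshift d (ord0 : 'I_1)); last exact: val_inj.
    by rewrite (row_mxEl (const_mx a : 'rV[R]_1) v 0 ord0) mxE.
  apply: L2 => i; case: (unliftP ord0 i) => [i1|] ->; first exact: ni.
  by rewrite eq_sym.
Qed.

Section Unit.
Variables (m d : nat) (io : 'I_d -> 'I_m).
Implicit Types (h g : 'rV[R]_m -> R[i]) (u : 'rV[R]_m) (s : seq 'I_d).
Local Notation AA := (coord_ints `[0, 1] io).

Lemma ccont_coord_ints s h : ccont h -> ccont (AA s h).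
Proof. by move=> ch; elim: s => //= i s; exact: ccont_coord_int ler01. Qed.

Lemma smooth_coord_ints s h : smooth h -> smooth (AA s h).
Proof. by move=> sh; elim: s => [|i s IH]; [exact: sh|exact: smooth_coord_int]. Qed.

Lemma pderiv_coord_ints l s h : (forall i, io i != l) -> smooth h ->
  pderiv l (AA s h) = AA s (pderiv l h).
Proof.
move=> nl sh; elim: s => // i s IH /=; rewrite -IH pderiv_coord_int; first by [].
  by rewrite eq_sym.
exact: smooth_coord_ints.
Qed.

Lemma coord_ints0 s : AA s (fun=> 0) = fun=> 0.
Proof. by elim: s => //= i s ->; exact: coord_int01_0. Qed.

Lemma coord_ints_addf s h g : ccont h -> ccont g ->
  AA s (fun u => h u + g u) = fun u => AA s h u + AA s g u.
Proof.
move=> ch cg; elim: s => // i s IH /=; rewrite IH coord_int_addf//; exact: ccont_coord_ints.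
Qed.

Lemma coord_ints_scale s (c : 'rV[R]_m -> R[i]) h : ccont h ->
  (forall u i a, i \in s -> c (upd u (io i) a) = c u) ->
  AA s (fun u => c u * h u) = fun u => c u * AA s h u.
Proof.
move=> ch; elim: s => // i s IH cj /=; rewrite IH => [|u l a ls]; last first.
  by apply: cj; rewrite inE ls orbT.
rewrite coord_int_scale//; first exact: ccont_coord_ints.
by move=> u a; apply: cj; rewrite mem_head.
Qed.

Lemma coord_ints_bigsum s (I : Type) (r : seq I) (P : pred I) (F : I -> 'rV[R]_m -> R[i]) :
  (forall i, P i -> ccont (F i)) ->
  AA s (fun u => \sum_(i <- r | P i) F i u) = fun u => \sum_(i <- r | P i) AA s (F i) u.
Proof.
move=> cF; elim: s => // i s IH /=; rewrite IH coord_int_bigsum//.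
by move=> l Pl; apply: ccont_coord_ints; exact: cF.
Qed.

(** The bound is required only where all integrated coordinates lie in the
    unit interval, which is all that the integral sees. *)
Lemma cabs_coord_ints_cc_le s h B u : ccont h ->
  (forall v : 'rV[R]_m, (forall l, (forall i, i \in s -> io i != l) -> v 0 l = u 0 l) ->
    (forall i, i \in s -> 0 <= v 0 (io i) <= 1) -> cabs (h v) <= B) ->
  cabs (AA s h u) <= 2 ^+ size s * B.
Proof.
move=> ch; elim: s u => [|i s IH] u hB /=; first by rewrite expr0 mul1r hB.
rewrite exprS -mulrA; apply: cabs_coord_int_le; first exact: ccont_coord_ints.
move=> a a01; apply: IH => v vu v01; apply: hB => [l nl|j].
  rewrite vu => [|j js]; last by apply: nl; rewrite inE js orbT.
  by rewrite updE eq_sym (negbTE (nl i (mem_head _ _))).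
rewrite inE => /predU1P[->|/v01//].
have [/hasP[l ls /eqP il]|/hasPn nl] := boolP (has (fun l => io l == io i) s).
  by rewrite -il; exact: v01.
by rewrite vu// updE eqxx.
Qed.

Lemma cabs_coord_ints_le s h B u : ccont h ->
  (forall v : 'rV[R]_m, (forall l, (forall i, io i != l) -> v 0 l = u 0 l) -> cabs (h v) <= B) ->
  cabs (AA s h u) <= 2 ^+ size s * B.
Proof.
move=> ch hB; apply: cabs_coord_ints_cc_le => // v vu _; apply: hB => l nl.
by apply: vu => i _; exact: nl.
Qed.

(** The inner integrations commute with the derivative, the [i]-th one
    annihilates it, and the outer ones keep the function zero. *)
Lemma coord_ints_pderiv s i h : i \in s -> smooth h -> (forall j, j \in s -> periodic (io j) h) ->
  injective io -> AA s (pderiv (io i) h) = fun=> 0.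
Proof.
move=> is_ sh ph iI; elim: s is_ ph => // j s IH; rewrite inE => is_ ph /=.
have sA := smooth_coord_ints s sh.
have pA l : l \in s -> periodic (io l) h by move=> ls; apply: ph; rewrite inE ls orbT.
have [ins|nis] := boolP (i \in s).
  by rewrite IH//; exact: coord_int01_0.
move: is_; rewrite (negbTE nis) orbF => /eqP ij; subst j.
have -> : AA s (pderiv (io i) h) = pderiv (io i) (AA s h).
  elim: s {IH ph sA pA} nis => // j s IH; rewrite inE negb_or => /andP[ij nis] /=.
  rewrite IH// pderiv_coord_int; [by []|by rewrite (inj_eq iI)|].
  exact: smooth_coord_ints.
apply: coord_int_pderiv => //.
elim: s {IH nis sA pA} ph => [|j s IH] ph; first by apply: ph; rewrite mem_head.
apply/periodic_coord_int/IH => l; rewrite inE => ls; apply: ph.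
by rewrite !inE; case/orP: ls => ->; rewrite ?orbT.
Qed.

Lemma coord_ints_indep s h u (v : 'rV[R]_m) : (forall i, i \in s) ->
  (forall l, (forall i, io i != l) -> v 0 l = u 0 l) -> AA s h v = AA s h u.
Proof.
move=> alls uv; have H (r : seq 'I_d) (w w' : 'rV[R]_m) : (forall l, (forall i, i \in r -> io i != l) -> w' 0 l = w 0 l) ->
    AA r h w' = AA r h w.
  elim: r w w' => [|i r IH] w w' ww.
    by congr h; apply/rowP => l; apply: ww.
  apply: eq_cint => a _; apply: IH => l nl; rewrite !updE; case: eqVneq => // li.
  by apply: ww => j; rewrite inE => /predU1P[->|/nl//]; rewrite eq_sym.
by apply: H => l nl; apply: uv => i; exact: nl.
Qed.

End Unit.
End IteratedCoordinateIntegral.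

(** * Fourier series of periodic functions of one variable *)

Section UnitCircle.
Variable R : realType.

(** Either [cos x] is less than 1/2, and the real part alone is large enough
    because [pi] is at most 4; or [sin x = x * cos c] with [c] in between, and
    [cos c] is at least 1/2. *)
Lemma chord_ge (x : R) : 0 <= x <= pi -> x / 8 <= cabs (cis x - 1).
Proof.
move=> /andP[x0 xpi].
have pi4 : (pi : R) <= 4.
  by have := @pihalf_lt2 R; rewrite ltr_pdivrMr// -natrM => /ltW.
have [c12|c12] := leP (1 / 2) (cos x); last first.
  apply: le_trans (Re_le_cabs _); rewrite ReD /= distrC.
  apply: le_trans (ler_norm _); lra.
have [c] := @MVT_segment R sin cos 0 x x0 (fun y _ => is_derive_sin y) (continuous_subspaceT (@continuous_sin R)).
rewrite in_itv /= sin0 !subr0 => /andP[c0 cx] sE.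
apply: le_trans (Im_le_cabs _); rewrite ImD /= oppr0 addr0.
apply: le_trans (ler_norm _); rewrite sE.
have : cos x <= cos c.
  by rewrite leNgt ltr_cos ?in_itv /= ?x0 ?c0 ?xpi ?(le_trans cx)// -leNgt.
by move=> h; nra.
Qed.

Lemma chord_ge_norm (x : R) : `|x| <= pi -> `|x| / 8 <= cabs (cis x - 1).
Proof.
move=> xpi; have [x0|x0] := leP 0 x.
  by move: xpi; rewrite ger0_norm// => xpi; apply: chord_ge; rewrite x0.
move: xpi; rewrite ltr0_norm// => xpi; apply: le_trans (chord_ge _) _; first by rewrite oppr_ge0 ltW.
by rewrite cisN -cabs_conj rmorphB /= conjCK rmorph1.
Qed.

Lemma cis_neq1 (x : R) : 0 < x < 2 * pi -> cis x != 1.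
Proof.
move=> /andP[x0 x2]; apply/eqP => x1.
have [xpi|xpi] := leP x pi.
  have := @chord_ge x; rewrite (ltW x0) xpi x1 subrr cabs0 => /(_ isT).
  by rewrite leNgt divr_gt0.
have := @chord_ge (2 * pi - x).
have -> : cis (2 * pi - x) = 1.
  by rewrite cisD cisN x1 -[2 * pi]mulr1 (cis_nat R 1) mul1r rmorph1.
have h : 0 <= 2 * pi - x <= pi by apply/andP; split; lra.
by move=> /(_ h); rewrite subrr cabs0 leNgt divr_gt0 ?subr_gt0.
Qed.

Lemma sum_cis_geom (x : R) (n : nat) :
  (cis x - 1) * (\sum_(j < n) cis (j%:R * x)) = cis (n%:R * x) - 1.
Proof.
rewrite cisXn subrX1; congr (_ * _); apply: eq_bigr => j _; exact: cisXn.
Qed.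

(** A geometric sum, which telescopes to 0 unless the ratio is 1. *)
Lemma sum_roots_of_unity (k : nat) (q : nat) : (0 < k)%N ->
  \sum_(i < k) cis (2 * pi * q%:R * (i%:R / k%:R)) = (if (k %| q)%N then k%:R else 0 : R[i]).
Proof.
move=> k0; have k0R : (k%:R : R) != 0 by rewrite pnatr_eq0 -lt0n.
case: ifPn => kq.
  have [d ->] := dvdnP kq.
  rewrite (eq_bigr (fun=> 1)) ?sumr_const ?card_ord// => i _.
  rewrite natrM; have -> : 2 * pi * (d%:R * k%:R) * (i%:R / k%:R) = 2 * pi * (d * i)%N%:R :> R.
    by rewrite natrM; field.
  exact: cis_nat.
pose x : R := 2 * pi * (q %% k)%:R / k%:R.
have E (i : nat) : cis (2 * pi * q%:R * (i%:R / k%:R)) = cis (i%:R * x).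
  rewrite {1}(divn_eq q k) natrD natrM.
  have -> : 2 * pi * ((q %/ k)%:R * k%:R + (q %% k)%:R) * (i%:R / k%:R) =
      2 * pi * (q %/ k * i)%N%:R + i%:R * x :> R by rewrite natrM /x; field.
  by rewrite cisD cis_nat mul1r.
under eq_bigr do rewrite E.
have : cis x != 1.
  have pi0 := @pi_gt0 R; have q0 : (0 < q %% k)%N by rewrite lt0n.
  apply: cis_neq1; apply/andP; split; first by rewrite /x !mulr_gt0 ?invr_gt0 ?ltr0n.
  rewrite /x ltr_pdivrMr ?ltr0n// ltr_pM2l ?mulr_gt0//.
  by rewrite ltr_nat ltn_mod.
rewrite -subr_eq0 => x1; apply/eqP; have := sum_cis_geom x k.
have -> : k%:R * x = 2 * pi * (q %% k)%:R by rewrite /x; field.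
by rewrite cis_nat subrr => /eqP; rewrite mulf_eq0 (negbTE x1).
Qed.

(** Comparison with a telescoping sum. *)
Lemma sum_inv_sqr (n : nat) : \sum_(j < n) ((1 + j%:R) ^- 2 : R) <= 2.
Proof.
suff H : \sum_(j < n) ((1 + j%:R) ^- 2 : R) + (if n is 0 then 0 else n%:R^-1) <= 2.
  by apply: le_trans H; rewrite lerDl; case: n => // n; rewrite invr_ge0.
elim: n => [|[|n] IH]; first by rewrite big_ord0 addr0.
  by rewrite big_ord1 addr0 expr1n !invr1.
rewrite big_ord_recr /=; apply: le_trans IH; rewrite -addrA lerD2l.
set x : R := n.+1%:R; have x0 : 0 < x by rewrite ltr0n.
have -> : n.+2%:R = x + 1 :> R by rewrite /x natr1.
have x10 : 0 < x + 1 by lra.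
rewrite -subr_ge0 (_ : _ - _ = (x * (x + 1) ^+ 2)^-1); first by rewrite invr_ge0 mulr_ge0 ?exprn_ge0 ?ltW.
by rewrite (addrC 1 x); field; rewrite !gt_eqF.
Qed.

(** Comparison with a telescoping sum. *)
Lemma sum_inv_cube (m n : nat) :
  \sum_(i < n) ((1 + (m + i)%:R) ^- 3 : R) <= 2 * (1 + m%:R) ^- 2.
Proof.
suff H : \sum_(i < n) ((1 + (m + i)%:R) ^- 3 : R) + 2 * (1 + (m + n)%:R) ^- 2 <= 2 * (1 + m%:R) ^- 2.
  by apply: le_trans H; rewrite lerDl mulr_ge0// invr_ge0 exprn_ge0.
elim: n => [|n IH]; first by rewrite big_ord0 addn0 add0r.
rewrite big_ord_recr /=; apply: le_trans IH; rewrite -addrA lerD2l addnS -natr1.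
set x : R := (m + n)%:R; have x0 : 0 <= x by [].
rewrite -subr_ge0 (_ : _ - _ = (2 * (1 + x) * (2 * x + 3) - (2 + x) ^+ 2) / ((1 + x) ^+ 3 * (2 + x) ^+ 2)).
  by apply: divr_ge0; [nra|rewrite mulr_ge0// exprn_ge0//; lra].
by field; apply/andP; split; apply: lt0r_neq0; lra.
Qed.

End UnitCircle.

(** * Fejer's theorem with a rate *)

Section FourierSeries.
Variable R : realType.
Implicit Types (G : R -> R[i]) (p : int).

Definition fcoef G p : R[i] := cint `[0, 1] (fun a => G a * cis (- (2 * pi * p%:~R) * a)).

(** Three derivatives give cubic decay of the Fourier coefficients, which
    makes the errors in [partial_sum_vs_fejer] summable. The common bound [B]
    allows the rates below to be uniform in [G], hence in parameters. *)
Record tame3 (B : R) (G G1 G2 G3 : R -> R[i]) : Prop := Tame3 {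
  tame_d1 : cderiv G G1;
  tame_d2 : cderiv G1 G2;
  tame_d3 : cderiv G2 G3;
  tame_c3 : ccont G3;
  tame_p0 : forall a, G (a + 1) = G a;
  tame_p1 : forall a, G1 (a + 1) = G1 a;
  tame_p2 : forall a, G2 (a + 1) = G2 a;
  tame_b0 : forall a, cabs (G a) <= B;
  tame_b1 : forall a, cabs (G1 a) <= B;
  tame_b2 : forall a, cabs (G2 a) <= B;
  tame_b3 : forall a, cabs (G3 a) <= B }.

Lemma ccont_cislin (c : R) : ccont (fun a => cis (c * a)).
Proof. exact: cderiv_ccont (cderiv_cis c). Qed.

Lemma cabs_fcoef_le G p B : ccont G -> (forall a, cabs (G a) <= B) -> cabs (fcoef G p) <= 2 * B.
Proof.
move=> cG GB; apply: cabs_cint01_le; first exact/ccontM/ccont_cislin.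
by move=> x _; rewrite cabsM cabs_cis mulr1.
Qed.

Lemma cis_int_period p (a : R) : cis (- (2 * pi * p%:~R) * (a + 1)) = cis (- (2 * pi * p%:~R) * a).
Proof. by rewrite mulrDr mulr1 cisD -mulrN -mulrNz cis_int mulr1. Qed.

Lemma fcoef_deriv G G' p : cderiv G G' -> ccont G' -> (forall a, G (a + 1) = G a) ->
  fcoef G' p = (0 +i* (2 * pi * p%:~R)) * fcoef G p.
Proof.
move=> dG cG' pG; have cG := cderiv_ccont dG; pose c : R := - (2 * pi * p%:~R).
have dE := cderivM dG (cderiv_cis c).
have c1 : ccont (fun a => G' a * cis (c * a)) by exact/ccontM/ccont_cislin.
have c2 : ccont (fun a => G a * cis (c * a)) by exact/ccontM/ccont_cislin.
have c3 : ccont (fun a => G a * ((0 +i* c) * cis (c * a))).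
  by apply: ccontM => //; apply: ccontM; [exact: ccont_cst|exact: ccont_cislin].
have := cint_cderiv ler01 dE (ccontD c1 c3).
rewrite -[X in G X]add0r pG -[X in cis (c * X)]add0r cis_int_period subrr.
rewrite cintD; [|exact: measurable_cc|exact: cintegrable_cc..].
move/eqP; rewrite addr_eq0 => /eqP E; rewrite /fcoef -/c E.
have -> : 2 * pi * p%:~R = - c by rewrite opprK.
rewrite -cintZ; [|exact: measurable_cc|exact: cintegrable_cc].
have -> : cint `[0, 1] (fun a => G a * ((0 +i* c) * cis (c * a))) =
    cint `[0, 1] (fun a => (0 +i* c) * (G a * cis (c * a))).
  by apply: eq_cint => a _; rewrite mulrCA.
rewrite -mulN1r -cintZ; [|exact: measurable_cc|]; last first.
  by apply: cintegrable_cc; apply: ccontM => //; exact: ccont_cst.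
apply: eq_cint => a _; rewrite mulrA mulN1r; congr (_ * _).
by apply/eqP; rewrite eq_complex /= oppr0 !eqxx.
Qed.

Lemma absz_intr p : `|(p%:~R : R)| = `|p|%N%:R.
Proof. by rewrite -intr_norm -natr_absz. Qed.

(** Three integrations by parts. *)
Lemma fcoef_decay B G G1 G2 G3 p : tame3 B G G1 G2 G3 ->
  cabs (fcoef G p) <= 2 * B * (1 + `|p|%N%:R) ^- 3.
Proof.
move=> t; have B0 : 0 <= B := le_trans (cabs_ge0 _) (tame_b0 t 0).
have x1 : 0 < 1 + `|p|%N%:R :> R by rewrite ltr_pwDl.
rewrite ler_pdivlMr ?exprn_gt0//.
have [->|p0] := eqVneq p 0.
  rewrite absz0 addr0 expr1n mulr1.
  exact: cabs_fcoef_le (cderiv_ccont (tame_d1 t)) (tame_b0 t).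
apply: le_trans (cabs_fcoef_le p (tame_c3 t) (tame_b3 t)).
rewrite (fcoef_deriv _ (tame_d3 t) (tame_c3 t) (tame_p2 t)).
rewrite (fcoef_deriv _ (tame_d2 t) (cderiv_ccont (tame_d3 t)) (tame_p1 t)).
rewrite (fcoef_deriv _ (tame_d1 t) (cderiv_ccont (tame_d2 t)) (tame_p0 t)).
rewrite !cabsM cabs_imag; set y := `|2 * pi * _|; set w := cabs _.
have -> : y * (y * (y * w)) = y ^+ 3 * w by ring.
rewrite [w * _]mulrC ler_wpM2r ?cabs_ge0// /y.
rewrite ler_pXn2r ?nnegrE ?ltW//; rewrite normrM absz_intr ger0_norm ?mulr_ge0 ?pi_ge0//.
have pi2 := @pi_ge2 R; have : 1 <= `|p|%N%:R :> R by rewrite ler1n absz_gt0.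
  by move=> h; nra.
by rewrite !mulr_gt0 ?pi_gt0// ltr0n absz_gt0.
Qed.

Lemma fcoef_one p : fcoef (fun=> 1) p = (p == 0)%:R.
Proof.
have [->|p0] := eqVneq p 0.
  rewrite /fcoef; transitivity (cint `[0, 1] (fun=> 1 : R[i])).
    by apply: eq_cint => a _; rewrite mulr0 oppr0 mul0r cis0 mulr1.
  have := @cint_cderiv R (fun a => a%:C) (fun=> 1) 0 1 ler01 _ (ccont_cst _ _).
  rewrite subr0 => ->//; move=> a; split; [exact: is_derive_id|exact: is_derive_cst].
have := @fcoef_deriv (fun=> 1) (fun=> 0) p (cderiv_cst 1) (ccont_cst _ _) (fun=> erefl).
have -> : fcoef (fun=> 0) p = 0.
  rewrite /fcoef -[RHS](@cint0 R `[0, 1]); last exact: measurable_cc.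
  by apply: eq_cint => a _; rewrite mul0r.
move/esym/eqP; rewrite mulf_eq0 eq_complex /= eqxx /= => /orP[|/eqP//].
by rewrite !mulf_eq0 pnatr_eq0 /= gt_eqF ?pi_gt0//= intr_eq0 (negbTE p0).
Qed.

Lemma fcoef_cis p q : fcoef (fun a => cis (2 * pi * q%:~R * a)) p = (p == q)%:R.
Proof.
rewrite -subr_eq0 -fcoef_one; apply: eq_cint => a _; rewrite mul1r -cisD; congr cis.
by rewrite rmorphB /=; ring.
Qed.

(** Two applications of [cderiv_le], each of which costs a factor 2. *)
Lemma quadratic_vanishing q q1 q2 (B : R) : cderiv q q1 -> cderiv q1 q2 ->
  q 0 = 0 -> q1 0 = 0 -> (forall a, cabs (q2 a) <= B) -> forall x, cabs (q x) <= 4 * B * x ^+ 2.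
Proof.
have H q' q1' q2' : cderiv q' q1' -> cderiv q1' q2' -> q' 0 = 0 -> q1' 0 = 0 ->
    (forall a, cabs (q2' a) <= B) -> forall x, 0 <= x -> cabs (q' x) <= 4 * B * x ^+ 2.
  move=> d1 d2 q0 q10 qB x x0.
  have h1 y : 0 <= y -> cabs (q1' y) <= 2 * (B * y).
    move=> y0; have := cderiv_le (B := B) y0 d2 (fun a _ => qB a).
    by rewrite q10 !subr0.
  have B0 : 0 <= B := le_trans (cabs_ge0 _) (qB 0).
  have := cderiv_le (B := 2 * (B * x)) x0 d1 _; rewrite q0 !subr0.
  have -> : 2 * (2 * (B * x) * x) = 4 * B * x ^+ 2 by ring.
  apply => y /andP[y0 yx]; apply: le_trans (h1 y y0) _.
  by rewrite ler_pM2l// ler_wpM2l.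
move=> d1 d2 q0 q10 qB x; have [x0|x0] := leP 0 x; first exact: H d1 d2 q0 q10 qB x x0.
have := H (fun a => q (-1 * a + 0)) _ _ (cderiv_affine (-1) 0 d1)
  (cderivZ (-1)%:C (cderiv_affine (-1) 0 d2)) _ _ _ (- x).
have -> : q x = q (-1 * - x + 0) by rewrite mulrNN mul1r addr0.
rewrite sqrrN; apply.
- by rewrite mulr0 addr0.
- by rewrite mulr0 addr0 q10 mulr0.
- by move=> a; rewrite !cabsM cabs_real normrN1 !mul1r.
- by rewrite oppr_ge0 ltW.
Qed.

(** The Fejer kernel of order [L], times [L]. *)
Let fejer (L : nat) (a : R) : R[i] := \sum_(j < L) \sum_(l < L) cis (- (2 * pi * (l%:Z - j%:Z)%:~R) * a).

Let fejerE (L : nat) (a : R) : fejer L a = (cabs (\sum_(j < L) cis (j%:R * (2 * pi * a))) ^+ 2)%:C.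
Proof.
rewrite cabs_sqrC rmorph_sum /= mulr_suml; apply: eq_bigr => j _.
rewrite mulr_sumr; apply: eq_bigr => l _; rewrite -cisN -cisD; congr cis.
by rewrite rmorphB /=; ring.
Qed.

(** The inner sum is geometric, so that its product with the chord is bounded
    by 2. *)
Let fejer_chord (L : nat) (a : R) : cabs (cis (2 * pi * a) - 1) ^+ 2 * cabs (fejer L a) <= 4.
Proof.
rewrite fejerE cabs_real ger0_norm ?sqr_ge0// -exprMn -cabsM sum_cis_geom.
rewrite (_ : 4 = 2 ^+ 2) ?ler_pXn2r ?nnegrE ?cabs_ge0//; last by rewrite -natrX.
by apply: le_trans (cabsB _ _) _; rewrite cabs_cis cabs1.
Qed.

Let ccont_fejer L : ccont (fejer L).
Proof. by apply: ccont_sum => j _; apply: ccont_sum => l _; exact: ccont_cislin. Qed.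

Let cint_fejer G (L : nat) : ccont G ->
  cint `[0, 1] (fun a => G a * fejer L a) = \sum_(j < L) \sum_(l < L) fcoef G (l%:Z - j%:Z).
Proof.
move=> cG; transitivity (cint `[0, 1] (fun a => \sum_(j < L) \sum_(l < L)
    (G a * cis (- (2 * pi * (l%:Z - j%:Z)%:~R) * a)))).
  apply: eq_cint => a _; rewrite /fejer mulr_sumr; apply: eq_bigr => j _.
  by rewrite mulr_sumr.
have c1 p : ccont (fun a => G a * cis (- (2 * pi * p%:~R) * a)).
  by apply: ccontM => //; exact: ccont_cislin.
rewrite cint_sum; [|exact: measurable_cc|by move=> j _; apply: cintegrable_cc; apply: ccont_sum => l _; exact: c1].
apply: eq_bigr => j _; rewrite cint_sum//.
by move=> l _; exact: cintegrable_cc.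
Qed.

(** Fejer's theorem at 0, with a rate. After subtraction of a suitable
    trigonometric polynomial of degree 1, [G] vanishes to second order at the
    integers, and there it compensates the singularity of the kernel. *)
Lemma fejer_rate : exists2 C : R, 0 <= C & forall B G G1 G2 G3, tame3 B G G1 G2 G3 ->
  forall L, (0 < L)%N ->
  cabs (\sum_(j < L) \sum_(l < L) fcoef G (l%:Z - j%:Z) - L%:R * G 0) <= C * B.
Proof.
pose C0 : R := 1 + 2 * pi.
have pi2 := @pi_ge2 R; have C00 : 0 <= C0 by rewrite /C0; lra.
exists (2 * (4 * C0 * 16 * 4)) => [|B G G1 G2 G3 t L L0]; first by rewrite !mulr_ge0.
have B0 : 0 <= B := le_trans (cabs_ge0 _) (tame_b0 t 0).
have cG := cderiv_ccont (tame_d1 t).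
pose c : R := 2 * pi.
(* The multiple of the sine that has the same derivative at 0 as [G]. *)
pose z : R[i] := G1 0 / (0 +i* (2 * c)).
have c0 : 0 < c by rewrite /c; lra.
have zE : z * (0 +i* (2 * c)) = G1 0.
  rewrite /z mulfVK// eq_complex /= negb_and; apply/orP; right.
  by rewrite mulf_neq0// gt_eqF.
have zB : cabs z * (2 * c) <= B.
  have := congr1 (@cabs R) zE; rewrite cabsM cabs_imag ger0_norm; last by lra.
  by move=> ->; exact: (tame_b1 t).
pose s a := cis (c * a) - cis (- c * a).
pose s1 a := (0 +i* c) * cis (c * a) - (0 +i* (- c)) * cis (- c * a).
pose s2 a := (0 +i* c) * ((0 +i* c) * cis (c * a)) - (0 +i* (- c)) * ((0 +i* (- c)) * cis (- c * a)).
have ds : cderiv s s1 by apply: cderivB; exact: cderiv_cis.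
have ds1 : cderiv s1 s2 by apply: cderivB; apply: cderivZ; exact: cderiv_cis.
pose q a := G a - G 0 - z * s a.
have dq : cderiv q (fun a => G1 a - 0 - z * s1 a).
  by apply: cderivB (cderivZ z ds); apply: cderivB (tame_d1 t) (cderiv_cst _).
have dq1 : cderiv (fun a => G1 a - 0 - z * s1 a) (fun a => G2 a - 0 - z * s2 a).
  by apply: cderivB (cderivZ z ds1); apply: cderivB (tame_d2 t) (cderiv_cst _).
have q2B a : cabs (G2 a - 0 - z * s2 a) <= C0 * B.
  rewrite subr0 (le_trans (cabsB _ _))// /C0 mulrDl mul1r lerD ?(tame_b2 t)// cabsM.
  have : cabs (s2 a) <= c * c + c * c.
    apply: le_trans (cabsB _ _) _.
    by rewrite !cabsM !cabs_cis !cabs_imag normrN (ger0_norm (ltW c0)) !mulr1.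
  move=> h; apply: le_trans (ler_wpM2l (cabs_ge0 z) h) _.
  have -> : cabs z * (c * c + c * c) = c * (cabs z * (2 * c)) by ring.
  by rewrite ler_wpM2l// ltW.
have q0 : q 0 = 0 by rewrite /q /s !mulr0 cis0 !subrr mulr0 subrr.
have q10 : G1 0 - 0 - z * s1 0 = 0.
  have -> : s1 0 = 0 +i* (2 * c).
    rewrite /s1 !mulr0 cis0 !mulr1; apply/eqP; rewrite eq_complex /= oppr0 addr0 eqxx /=.
    by apply/eqP; ring.
  by rewrite zE subr0 subrr.
have qx := quadratic_vanishing dq dq1 q0 q10 q2B.
have pq a : q (a + 1) = q a.
  rewrite /q /s (tame_p0 t); congr (_ - _ * _); congr (_ - _).
    have := cis_int_period (-1) a; rewrite mulrN1 opprK; exact.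
  have := cis_int_period 1 a; rewrite mulr1; exact.
(* By periodicity [a] may be moved to [-1/2, 1/2], where the chord controls
   the distance to 0. *)
have qF a : 0 <= a <= 1 -> cabs (q a * fejer L a) <= 4 * C0 * 16 * 4 * B.
  move=> /andP[a0 a1]; have [b [bE b12 be]] : exists b, [/\ q a = q b, `|b| <= 1 / 2 & cis (2 * pi * b) = cis (2 * pi * a)].
    have [a12|a12] := leP a (1 / 2); first by exists a; rewrite ger0_norm.
    exists (a - 1); split; first by rewrite -[in LHS](subrK 1 a) pq.
      by rewrite ler0_norm; lra.
    by rewrite mulrBr cisD mulr1 -mulrN1 (cis_int R (-1)) mulr1.
  have ch : `|b| <= 4 * cabs (cis (2 * pi * a) - 1).
    rewrite -be; have := @chord_ge_norm R (2 * pi * b).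
    rewrite normrM (ger0_norm (x := 2 * pi)); last by lra.
    move=> /(_ _) h; have {}h := h ltac:(have bb := normr_ge0 b; nra).
    by have bb := normr_ge0 b; nra.
  rewrite cabsM bE; apply: le_trans (ler_wpM2r (cabs_ge0 _) (qx b)) _.
  rewrite -(real_normK (num_real b)).
  have h2 : `|b| ^+ 2 <= 16 * cabs (cis (2 * pi * a) - 1) ^+ 2.
    rewrite (_ : 16 = 4 ^+ 2); last by rewrite -natrX.
    by rewrite -exprMn ler_pXn2r ?nnegrE ?mulr_ge0 ?cabs_ge0.
  have h3 := fejer_chord L a; have h4 := cabs_ge0 (fejer L a).
  have h5 : `|b| ^+ 2 * cabs (fejer L a) <= 64.
    by apply: le_trans (ler_wpM2r h4 h2) _; rewrite -(mulrA 16); lra.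
  have -> : 4 * C0 * 16 * 4 * B = 4 * (C0 * B) * 64 by ring.
  by rewrite -(mulrA (4 * (C0 * B))) ler_wpM2l// !mulr_ge0.
have cs : ccont s := cderiv_ccont ds.
have cq : ccont q := cderiv_ccont dq.
have cF := ccont_fejer L.
(* The two exponentials of the sine have the same Fejer mean at 0 and cancel;
   the constant contributes [L * G 0]. *)
have : cint `[0, 1] (fun a => q a * fejer L a) =
    \sum_(j < L) \sum_(l < L) fcoef G (l%:Z - j%:Z) - L%:R * G 0.
  have -> : cint `[0, 1] (fun a => q a * fejer L a) =
      cint `[0, 1] (fun a => G a * fejer L a) - G 0 * cint `[0, 1] (fun a => 1 * fejer L a)
      - z * (cint `[0, 1] (fun a => cis (2 * pi * 1%:~R * a) * fejer L a)
             - cint `[0, 1] (fun a => cis (2 * pi * (-1)%:~R * a) * fejer L a)).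
    have mcc := @measurable_cc R 0 1.
    have i1 (H : R -> R[i]) : ccont H -> cintegrable `[0, 1] (fun a => H a * fejer L a).
      by move=> cH; apply: cintegrable_cc; exact: ccontM.
    have i2 := i1 _ cG; have i3 := i1 _ (ccont_cst _ 1).
    have i4 := i1 _ (ccont_cislin (2 * pi * 1%:~R)).
    have i5 := i1 _ (ccont_cislin (2 * pi * (-1)%:~R)).
    rewrite -cintB// -!cintZ//; last by apply: cintegrable_cc; apply: ccontB; apply: ccontM => //; exact: ccont_cislin.
    rewrite -cintB//; last exact: cintegrableZ.
    rewrite -cintB//; last 2 first.
    - by apply: cintegrable_cc; apply: ccontB; [exact: ccontM|apply: ccontM; [exact: ccont_cst|apply: ccontM => //; exact: ccont_cst]].
    - by apply: cintegrable_cc; apply: ccontM; [exact: ccont_cst|apply: ccontB; apply: ccontM => //; exact: ccont_cislin].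
    apply: eq_cint => a _; rewrite /q /s /c mulr1 mulrN1; ring.
  rewrite !cint_fejer//; [|exact: ccont_cislin..|exact: ccont_cst].
  have E (p : int) : \sum_(j < L) \sum_(l < L) fcoef (fun a => cis (2 * pi * p%:~R * a)) (l%:Z - j%:Z) =
     \sum_(j < L) \sum_(l < L) ((l%:Z - j%:Z == p)%:R : R[i]).
    by apply: eq_bigr => j _; apply: eq_bigr => l _; rewrite fcoef_cis.
  have -> : \sum_(j < L) \sum_(l < L) fcoef (fun a => cis (2 * pi * 1%:~R * a)) (l%:Z - j%:Z) =
      \sum_(j < L) \sum_(l < L) fcoef (fun a => cis (2 * pi * (-1)%:~R * a)) (l%:Z - j%:Z).
    rewrite !E exchange_big /=.
    by apply: eq_bigr => j _; apply: eq_bigr => l _; rewrite -eqr_opp opprB.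
  rewrite subrr mulr0 subr0 mulrC; congr (_ - _ * _).
  rewrite (eq_bigr (fun=> 1)) ?sumr_const ?card_ord// => j _.
  rewrite (bigD1 j)//= fcoef_one subrr eqxx big1 ?addr0// => l lj.
  by rewrite fcoef_one subr_eq0 eqz_nat (inj_eq val_inj) (negbTE lj).
move=> <-; rewrite -mulrA; apply: cabs_cint01_le => //; exact: ccontM.
Qed.

End FourierSeries.

Section Aliasing.
Variable R : realType.
Implicit Types (G : R -> R[i]) (p : int).

Lemma cabs_nat (n : nat) : cabs (n%:R : R[i]) = n%:R.
Proof. by rewrite -(rmorph_nat (real_complex R)) cabs_real ger0_norm. Qed.

(** The double sum consists of [L] windows of length [L], and the [j]-th one
    misses only frequencies beyond [j] on one side and beyond [L - j] on the
    other. Cubic decay makes what is missing of order [j ^- 2] and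
    [(L - j) ^- 2], which is summable. *)
Lemma partial_sum_vs_fejer B G G1 G2 G3 (L : nat) : tame3 B G G1 G2 G3 ->
  cabs (L%:R * \sum_(q < L.*2) fcoef G (q%:Z - L%:Z) -
        \sum_(j < L) \sum_(l < L) fcoef G (l%:Z - j%:Z)) <= 16 * B.
Proof.
move=> t; have B0 : 0 <= B := le_trans (cabs_ge0 _) (tame_b0 t 0).
pose F (q : nat) := fcoef G (q%:Z - L%:Z).
have dec p := fcoef_decay p t.
have tail m n (H : nat -> int) : (forall i, (i < n)%N -> `|H i|%N = (m + i)%N) ->
    cabs (\sum_(0 <= i < n) fcoef G (H i)) <= 4 * B * (1 + m%:R) ^- 2.
  move=> Hm; rewrite big_mkord; apply: le_trans (cabs_sum _ _ _) _.
  apply: (@le_trans _ _ (\sum_(i < n) 2 * B * (1 + (m + i)%:R) ^- 3)).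
    by apply: ler_sum => i _; rewrite -Hm.
  rewrite -mulr_sumr (_ : 4 * B * _ = 2 * B * (2 * (1 + m%:R) ^- 2)); last by ring.
  by rewrite ler_wpM2l ?mulr_ge0//; exact: sum_inv_cube.
have bound (j : nat) : (j < L)%N -> cabs (\sum_(q < L.*2) F q - \sum_(l < L) fcoef G (l%:Z - j%:Z))
    <= 4 * B * (1 + j%:R) ^- 2 + 4 * B * (1 + (L - j.+1)%:R) ^- 2.
  move=> jL; rewrite -(big_mkord xpredT F) (@big_cat_nat _ _ _ (L - j)%N)//=; last first.
    by rewrite -addnn; apply: leq_trans (leq_subr _ _) (leq_addr _ _).
  rewrite (@big_cat_nat _ _ _ (L.*2 - j)%N (L - j)%N)/=; [|by rewrite -addnn -addnBA ?leq_addl// ltnW|exact: leq_subr].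
  have -> : \sum_(L - j <= q < L.*2 - j) F q = \sum_(l < L) fcoef G (l%:Z - j%:Z).
    rewrite -{1}[(L - j)%N]add0n big_addn (_ : (L.*2 - j - (L - j) = L)%N); last by lia.
    by rewrite big_mkord; apply: eq_bigr => l _; rewrite /F; congr fcoef; lia.
  have E (a b c : R[i]) : a + (b + c) - b = a + c by ring.
  rewrite E.
  apply: le_trans (cabsD _ _) _; apply: lerD.
    rewrite big_nat_rev /=.
    apply: le_trans (tail j.+1 _ (fun i => (0 + (L - j) - i.+1)%N%:Z - L%:Z) _) _.
      by move=> i iL; lia.
    rewrite ler_wpM2l ?mulr_ge0// lef_pV2 ?posrE ?exprn_gt0 ?ltr_pwDl//.
    by rewrite ler_pXn2r ?nnegrE ?addr_ge0// lerD2l ler_nat.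
  rewrite -{1}[(L.*2 - j)%N]add0n big_addn.
  apply: le_trans (tail (L - j)%N _ (fun i => (i + (L.*2 - j))%N%:Z - L%:Z) _) _.
    by move=> i iL; lia.
  rewrite ler_wpM2l ?mulr_ge0// lef_pV2 ?posrE ?exprn_gt0 ?ltr_pwDl//.
  by rewrite ler_pXn2r ?nnegrE ?addr_ge0// lerD2l ler_nat; lia.
have -> : L%:R * \sum_(q < L.*2) F q - \sum_(j < L) \sum_(l < L) fcoef G (l%:Z - j%:Z)
   = \sum_(j < L) (\sum_(q < L.*2) F q - \sum_(l < L) fcoef G (l%:Z - j%:Z)).
  by rewrite sumrB sumr_const card_ord mulr_natl.
apply: le_trans (cabs_sum _ _ _) _; apply: (@le_trans _ _ (\sum_(j < L)
  (4 * B * (1 + j%:R) ^- 2 + 4 * B * (1 + (L - j.+1)%:R) ^- 2))).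
  by apply: ler_sum => j _; exact: bound.
rewrite big_split /= -!mulr_sumr.
have h1 := @sum_inv_sqr R L.
have h2 : \sum_(j < L) ((1 + (L - j.+1)%:R) ^- 2 : R) <= 2.
  rewrite (reindex_inj rev_ord_inj) /=; apply: le_trans h1; apply: ler_sum => j _.
  by rewrite subnSK// subKn// ltnW.
have -> : 16 * B = 4 * B * 2 + 4 * B * 2 by ring.
by apply: lerD; rewrite ler_wpM2l// mulr_ge0.
Qed.

(** Fejer means converge with rate [1 / L], and by the preceding comparison
    partial sums differ from them by as little. *)
Lemma fourier_rate0 : exists2 C : R, 0 <= C & forall B G G1 G2 G3, tame3 B G G1 G2 G3 ->
  forall L, (0 < L)%N ->
  cabs (\sum_(q < L.*2) fcoef G (q%:Z - L%:Z) - G 0) <= C * B / L%:R.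
Proof.
have [C C0 HC] := fejer_rate R; exists (16 + C) => [|B G G1 G2 G3 t L L0]; first by rewrite addr_ge0.
have LR : 0 < L%:R :> R by rewrite ltr0n.
rewrite ler_pdivlMr//.
have -> : cabs (\sum_(q < L.*2) fcoef G (q%:Z - L%:Z) - G 0) * L%:R =
   cabs (L%:R * \sum_(q < L.*2) fcoef G (q%:Z - L%:Z) - L%:R * G 0).
  by rewrite -mulrBr cabsM cabs_nat mulrC.
rewrite -(subrKA (\sum_(j < L) \sum_(l < L) fcoef G (l%:Z - j%:Z))) mulrDl.
by apply: le_trans (cabsD _ _) _; apply: lerD; [exact: partial_sum_vs_fejer t|exact: HC t L L0].
Qed.

Lemma tame3_shift B G G1 G2 G3 c : tame3 B G G1 G2 G3 ->
  tame3 B (fun a => G (a + c)) (fun a => G1 (a + c)) (fun a => G2 (a + c)) (fun a => G3 (a + c)).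
Proof.
have sh F F' : cderiv F F' -> cderiv (fun a => F (a + c)) (fun a => F' (a + c)).
  by move=> dF; apply: cderiv_ext (cderiv_affine 1 c dF) _ _ => a; rewrite !mul1r.
case=> d1 d2 d3 c3 p0 p1 p2 b0 b1 b2 b3; split => //; try exact: sh.
- apply: (ccont_comp (h := fun a : R => a + c)) c3 => a.
  exact: (continuousD (@cvg_id _ _) (cvg_cst _)).
- by move=> a; rewrite addrAC.
- by move=> a; rewrite addrAC.
- by move=> a; rewrite addrAC.
Qed.

Lemma fcoef_shift B G G1 G2 G3 c p : tame3 B G G1 G2 G3 ->
  fcoef (fun a => G (a + c)) p = cis (2 * pi * p%:~R * c) * fcoef G p.
Proof.
move=> t; pose E a : R[i] := cis (- (2 * pi * p%:~R) * a).
have dE := cderivM (tame_d1 t) (cderiv_cis (- (2 * pi * p%:~R))).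
have cE : ccont E by exact: ccont_cislin.
have cG := cderiv_ccont (tame_d1 t); have cG1 := cderiv_ccont (tame_d2 t).
have cdE : ccont (fun a => G1 a * E a + G a * ((0 +i* - (2 * pi * p%:~R)) * E a)).
  by apply: ccontD; [exact: ccontM|apply: ccontM => //; apply: ccontM => //; exact: ccont_cst].
have pE a : G (a + 1) * E (a + 1) = G a * E a by rewrite (tame_p0 t) /E cis_int_period.
rewrite /fcoef -(cint01_shift c dE cdE pE) -cintZ; [|exact: measurable_cc|]; last first.
  apply: cintegrable_cc; apply: (ccont_comp (h := fun a : R => a + c)) (ccontM cG cE) => a.
  exact: (continuousD (@cvg_id _ _) (cvg_cst _)).
apply: eq_cint => a _; rewrite mulrCA -cisD; congr (_ * cis _); ring.
Qed.

Lemma sum_multiples (V : nmodType) (k n : nat) (F : nat -> V) : (0 < k)%N ->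
  \sum_(0 <= q < n * k | (k %| q)%N) F q = \sum_(0 <= b < n) F (b * k)%N.
Proof.
move=> k0; elim: n => [|n IH]; first by rewrite mul0n !big_geq.
rewrite big_nat_recr//= -IH mulSn addnC (@big_cat_nat _ _ _ (n * k)%N)//=; last exact: leq_addr.
congr (_ + _); rewrite -{1}[(n * k)%N]add0n big_addn addKn.
rewrite big_ltn_cond// add0n dvdn_mull// big1_seq ?addr0// => i /andP[].
rewrite mem_index_iota dvdn_addl ?dvdn_mull// => ki /andP[i0 ik].
by move: ki => /dvdn_leq; rewrite i0 leqNgt ik => /(_ isT).
Qed.

(** Poisson summation on the circle: the Fourier coefficients of index
    divisible by [k] sum up to the mean of the values at the [k]-th roots of
    unity. Orthogonality of characters selects these indices from the partial
    sums at the [k] translates of [G]. *)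
Lemma alias_rate (k : nat) : (0 < k)%N -> exists2 C : R, 0 <= C &
  forall B G G1 G2 G3, tame3 B G G1 G2 G3 -> forall M, (0 < M)%N ->
  cabs (\sum_(b < M.*2) fcoef G ((b * k)%N%:Z - (M * k)%N%:Z) -
        k%:R^-1 * \sum_(i < k) G (i%:R / k%:R)) <= C * B / M%:R.
Proof.
move=> k0; have [C C0 HC] := fourier_rate0; exists C => // B G G1 G2 G3 t M M0.
have kR : 0 < k%:R :> R by rewrite ltr0n.
have kC : (k%:R : R[i]) != 0 by rewrite pnatr_eq0 -lt0n.
have B0 : 0 <= B := le_trans (cabs_ge0 _) (tame_b0 t 0).
have -> : \sum_(b < M.*2) fcoef G ((b * k)%N%:Z - (M * k)%N%:Z) =
    k%:R^-1 * \sum_(i < k) \sum_(q < (M * k).*2)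
      cis (2 * pi * (q%:Z - (M * k)%N%:Z)%:~R * (i%:R / k%:R)) * fcoef G (q%:Z - (M * k)%N%:Z).
  rewrite exchange_big /= -(big_mkord xpredT (fun q => \sum_(i < k)
     cis (2 * pi * (q%:Z - (M * k)%N%:Z)%:~R * (i%:R / k%:R)) * fcoef G (q%:Z - (M * k)%N%:Z))).
  rewrite -(big_mkord xpredT (fun b => fcoef G ((b * k)%N%:Z - (M * k)%N%:Z))).
  rewrite -(sum_multiples M.*2 (fun q => fcoef G (q%:Z - (M * k)%N%:Z)) k0).
  rewrite -muln2 mulnAC muln2 mulr_sumr big_mkcond /=; apply: eq_bigr => q _.
  rewrite -mulr_suml (eq_bigr (fun i : 'I_k => cis (2 * pi * q%:R * (i%:R / k%:R)))); last first.
    move=> i _; rewrite rmorphB /= -!pmulrn natrM.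
    have -> : 2 * pi * (q%:R - M%:R * k%:R) * (i%:R / k%:R) = 2 * pi * q%:R * (i%:R / k%:R) + - (2 * pi * (M * i)%N%:R) :> R.
      by rewrite natrM; field; rewrite gt_eqF.
    by rewrite cisD cisN cis_nat rmorph1 mulr1.
  by rewrite sum_roots_of_unity//; case: ifP => _; rewrite ?mul0r ?mulr0// mulrA mulVf ?mul1r.
rewrite -mulrBr -sumrB cabsM cabsV cabs_nat.
rewrite mulrC ler_pdivrMr//; apply: le_trans (cabs_sum _ _ _) _.
apply: (@le_trans _ _ (\sum_(i < k) C * B / M%:R)); last by rewrite sumr_const card_ord mulr_natr.
apply: ler_sum => i _; have ti := tame3_shift (i%:R / k%:R) t.
have := HC _ _ _ _ _ ti (M * k)%N; rewrite muln_gt0 M0 k0 add0r => /(_ isT) h.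
under eq_bigr do rewrite -(fcoef_shift _ _ t).
apply: le_trans h _; rewrite ler_wpM2l ?mulr_ge0//.
by rewrite lef_pV2 ?posrE ?ltr0n ?muln_gt0 ?M0// ler_nat leq_pmulr.
Qed.

End Aliasing.

(** * Fourier series in several variables, one coordinate at a time *)

Section MultipleAliasing.
Variables (R : realType) (m d : nat) (io : 'I_d -> 'I_m).
Hypothesis ioI : injective io.
Implicit Types (h g : 'rV[R]_m -> R[i]) (u : 'rV[R]_m) (s : seq 'I_d).
Local Notation e := (delta_mx 0).

Lemma smooth_cis_coord (j : 'I_m) (c : R) : smooth (fun u : 'rV[R]_m => cis (c * u 0 j)).
Proof.
apply: smooth_cis; have -> : (fun u : 'rV[R]_m => (c * u 0 j)%:C) = (fun u => c%:C * (u 0 j)%:C).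
  by apply/funext => u; rewrite -rmorphM.
by apply: smooth_mul; [exact: smooth_const|exact: smooth_coord].
Qed.

Section Kernel.
Variable k : nat.
Hypothesis k0 : (0 < k)%N.

Definition dirichlet (M : nat) (a : R) : R[i] :=
  \sum_(b < M.*2) cis (- (2 * pi * ((b * k)%N%:Z - (M * k)%N%:Z)%:~R) * a).

(** The integral operator of the Dirichlet kernel in the [j]-th variable, and
    the average over [k]-th parts of the period that it approximates. *)
Definition dir_op M j h : 'rV[R]_m -> R[i] :=
  coord_int `[0, 1] (io j) (fun u => h u * dirichlet M (u 0 (io j))).

Definition avg_op j h : 'rV[R]_m -> R[i] :=
  fun u => k%:R^-1 * \sum_(i < k) h (upd u (io j) (i%:R / k%:R)).

Lemma smooth_dirichlet M (j : 'I_m) : smooth (fun u : 'rV[R]_m => dirichlet M (u 0 j)).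
Proof. by apply: smooth_sum => b _; exact: smooth_cis_coord. Qed.

Lemma smooth_dir_op M j h : smooth h -> smooth (dir_op M j h).
Proof.
by move=> sh; apply: smooth_coord_int; apply: smooth_mul; [exact: sh|exact: smooth_dirichlet].
Qed.

Lemma pderivs_mul_indep (r : seq 'I_m) (j : 'I_m) h (c : R -> R[i]) : smooth h ->
  smooth (fun u : 'rV[R]_m => c (u 0 j)) -> j \notin r ->
  pderivs r (fun u => h u * c (u 0 j)) = fun u => pderivs r h u * c (u 0 j).
Proof.
move=> sh sc; elim: r => // i r IH; rewrite inE negb_or => /andP[ji /IH /= ->].
apply: has_pderiv_pderiv => u.
have := has_pderivM (smooth_has_pderiv i (smooth_pderivs r sh)) (smooth_has_pderiv i sc) u.
move=> H; apply: cderiv_ext H _ _ => // s.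
suff -> : pderiv i (fun u : 'rV[R]_m => c (u 0 j)) = fun=> 0 by rewrite mulr0 addr0.
apply: has_pderiv_pderiv => v; apply: cderiv_ext (cderiv_cst (c (v 0 j))) _ _ => // t.
by rewrite !mxE eqxx /= (negbTE ji) mulr0 addr0.
Qed.

Lemma pderivs_dir_op M j (r : seq 'I_m) h : smooth h ->
  pderivs r (dir_op M j h) = if io j \in r then fun=> 0 else dir_op M j (pderivs r h).
Proof.
move=> sh; rewrite pderivs_coord_int; last by apply: smooth_mul; [exact: sh|exact: smooth_dirichlet].
case: ifPn => // nr; rewrite (pderivs_mul_indep sh (smooth_dirichlet M (io j)) nr); reflexivity.
Qed.

Lemma periodic_dir_op M i j h : periodic (io i) h -> periodic (io i) (dir_op M j h).
Proof.
move=> ph; have [->|ij] := eqVneq i j.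
  by move=> u; rewrite -[e (io j)]scale1r /dir_op coord_int_line.
apply: periodic_coord_int => u; rewrite ph; congr (_ * dirichlet _ _).
by rewrite !mxE eqxx /= (inj_eq ioI) eq_sym (negbTE ij) addr0.
Qed.

Lemma dir_opE M j h u : ccont h -> dir_op M j h u =
  \sum_(b < M.*2) fcoef (fun a => h (upd u (io j) a)) ((b * k)%N%:Z - (M * k)%N%:Z).
Proof.
move=> ch; have cs := ccont_slice u (io j) ch.
transitivity (cint `[0, 1] (fun a => \sum_(b < M.*2) (h (upd u (io j) a) *
    cis (- (2 * pi * ((b * k)%N%:Z - (M * k)%N%:Z)%:~R) * a)))).
  by apply: eq_cint => a _; rewrite updE eqxx mulr_sumr.
rewrite cint_sum//; move=> b _; apply: cintegrable_cc; apply: ccontM => //.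
exact: ccont_cislin.
Qed.

(** [W] is the set of points on which an approximation is meant to be uniform.
    It has to be stable under changes of the integrated coordinates, while the
    remaining ones may stay in a compact set. *)
Definition bounded_on (W : set 'rV[R]_m) (r : nat) h (B : R) : Prop :=
  forall l u, (size l <= r)%N -> W u -> cabs (pderivs l h u) <= B.

Definition stable_set (W : set 'rV[R]_m) : Prop :=
  forall u j a, W u -> W (upd u (io j) a).

Lemma bounded_on_pderivs W r l h B : bounded_on W (r + size l) h B ->
  bounded_on W r (pderivs l h) B.
Proof.
move=> hB l' u lr Wu; rewrite /pderivs -foldr_cat; apply: hB => //.
by rewrite size_cat leq_add2r.
Qed.

Lemma tame3_slice W j h B u : stable_set W -> W u -> smooth h -> periodic (io j) h ->
  bounded_on W 3 h B ->
  tame3 B (fun a => h (upd u (io j) a)) (fun a => pderiv (io j) h (upd u (io j) a))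
    (fun a => pderivs [:: io j; io j] h (upd u (io j) a))
    (fun a => pderivs [:: io j; io j; io j] h (upd u (io j) a)).
Proof.
move=> sW Wu sh ph hB.
have p1 g : periodic (io j) g -> forall a, g (upd u (io j) (a + 1)) = g (upd u (io j) a).
  by move=> pg a; rewrite upd_line scale1r pg.
have s1 := smooth_pderiv (io j) sh; have s2 := smooth_pderiv (io j) s1.
split; try by (apply: p1; do ?apply: periodic_pderiv; exact: ph).
- exact/cderiv_slice/smooth_has_pderiv.
- exact/cderiv_slice/smooth_has_pderiv.
- exact/cderiv_slice/smooth_has_pderiv.
- exact/ccont_slice/smooth_ccont/smooth_pderiv.
- by move=> a; apply: (hB [::]) => //; exact: sW.
- by move=> a; apply: (hB [:: io j]) => //; exact: sW.
- by move=> a; apply: (hB [:: io j; io j]) => //; exact: sW.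
- by move=> a; apply: (hB [:: io j; io j; io j]) => //; exact: sW.
Qed.

Lemma cabs_avg_op_le W j h B u : stable_set W -> W u -> (forall v, W v -> cabs (h v) <= B) ->
  cabs (avg_op j h u) <= B.
Proof.
move=> sW Wu hB; rewrite cabsM cabsV cabs_nat mulrC ler_pdivrMr ?ltr0n//.
apply: le_trans (cabs_sum _ _ _) _.
apply: (@le_trans _ _ (\sum_(i < k) B)); last by rewrite sumr_const card_ord mulr_natr.
by apply: ler_sum => i _; apply/hB/sW.
Qed.

(** This is [alias_rate] on each line parallel to the [j]-th axis; the
    constant depends only on the bound for three derivatives. *)
Lemma dir_op_rate : exists2 C : R, 0 <= C & forall W j h B M, stable_set W -> smooth h ->
  periodic (io j) h -> (0 < M)%N -> bounded_on W 3 h B ->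
  forall u, W u -> cabs (dir_op M j h u - avg_op j h u) <= C * B / M%:R.
Proof.
have [C C0 HC] := @alias_rate R k k0; exists C => // W j h B M sW sh ph M0 hB u Wu.
rewrite dir_opE; last exact: smooth_ccont.
exact: HC (tame3_slice sW Wu sh ph hB) M M0.
Qed.

Definition dir_ops M s h := foldr (dir_op M) h s.
Definition avg_ops s h := foldr avg_op h s.

Lemma smooth_dir_ops M s h : smooth h -> smooth (dir_ops M s h).
Proof. by move=> sh; elim: s => [|j s IH]; [exact: sh|exact: smooth_dir_op]. Qed.

Lemma periodic_dir_ops M s h i : periodic (io i) h -> periodic (io i) (dir_ops M s h).
Proof. by move=> ph; elim: s => [|j s IH]; [exact: ph|exact: periodic_dir_op]. Qed.

(** Derivatives in the integrated variable vanish, and the others commute with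
    the operator, which is bounded in terms of three further derivatives
    because it is close to an average. Each application thus costs three
    derivatives and a constant. *)
Lemma dir_ops_bounded : exists2 C : R, 0 <= C & forall W s h B M r, stable_set W -> smooth h ->
  (forall j, periodic (io j) h) -> (0 < M)%N -> bounded_on W (r + 3 * size s) h B ->
  bounded_on W r (dir_ops M s h) (C ^+ size s * B).
Proof.
have [C C0 HC] := dir_op_rate; exists (1 + C) => [|W s h B M r sW sh ph M0]; first by rewrite addr_ge0.
elim: s r => [|j s IH] r hB; first by rewrite expr0 mul1r; rewrite addn0 in hB.
move=> l u lr Wu; set g := dir_ops M s h.
have sg : smooth g by exact: smooth_dir_ops.
have gB : bounded_on W (r + 3) g ((1 + C) ^+ size s * B).
  by apply: IH; move: hB; rewrite /= mulnS addnA.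
have B0 : 0 <= (1 + C) ^+ size s * B by exact: le_trans (cabs_ge0 _) (gB [::] u _ Wu).
rewrite [dir_ops _ _ _]/(dir_op M j g) pderivs_dir_op; last exact: sg.
rewrite exprS -mulrA; case: ifPn => _; first by rewrite cabs0 mulr_ge0// addr_ge0.
rewrite -(subrK (avg_op j (pderivs l g) u) (dir_op _ _ _ _)) mulrDl mul1r addrC.
have lB : bounded_on W 3 (pderivs l g) ((1 + C) ^+ size s * B).
  by apply: bounded_on_pderivs => l' v; rewrite addnC => l'r; apply: gB; apply: leq_trans l'r _; rewrite leq_add2r.
apply: le_trans (cabsD _ _) _; apply: lerD.
  by apply: (cabs_avg_op_le j sW Wu) => v Wv; exact: (lB [::]).
apply: le_trans (HC W j _ _ M sW (smooth_pderivs l sg) _ M0 lB u Wu) _.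
  by apply: periodic_pderivs; exact: periodic_dir_ops.
by rewrite -mulrA ler_wpM2l// ler_pdivrMr ?ltr0n// ler_peMr// ler1n.
Qed.

(** Operators are replaced by averages one at a time: averages do not increase
    errors, and the earlier operators keep derivatives bounded. *)
Lemma dir_ops_rate s : exists2 C : R, 0 <= C & forall W h B M, stable_set W -> smooth h ->
  (forall j, periodic (io j) h) -> (0 < M)%N -> bounded_on W (3 * size s) h B ->
  forall u, W u -> cabs (dir_ops M s h u - avg_ops s h u) <= C * B / M%:R.
Proof.
have [C1 C10 H1] := dir_op_rate; have [C2 C20 H2] := dir_ops_bounded.
elim: s => [|j s [C C0 HC]].
  by exists 0 => // W h B M *; rewrite subrr cabs0 !mul0r.
exists (C1 * C2 ^+ size s + C) => [|W h B M sW sh ph M0 hB u Wu].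
  by rewrite addr_ge0// mulr_ge0// exprn_ge0.
set g := dir_ops M s h.
have gB : bounded_on W 3 g (C2 ^+ size s * B).
  by apply: H2 => //; move: hB; rewrite /= mulnS.
rewrite [dir_ops _ _ _]/(dir_op M j g) [avg_ops _ _]/(avg_op j (avg_ops s h)).
rewrite -(subrKA (avg_op j g u)) !mulrDl; apply: le_trans (cabsD _ _) _; apply: lerD.
  rewrite -(mulrA C1).
  exact: (H1 W j g _ M sW (smooth_dir_ops M s sh) (periodic_dir_ops M s (ph j)) M0 gB u Wu).
rewrite /avg_op -mulrBr -sumrB.
apply: (cabs_avg_op_le (h := fun v => g v - avg_ops s h v) j sW Wu) => v Wv.
apply: (HC W) => //.
by move=> l w lr; apply: hB; apply: leq_trans lr _; rewrite leq_pmul2l.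
Qed.

(** The kernels of the other variables are constants for each integration. *)
Lemma dir_ops_coord_ints M s h : uniq s -> ccont h ->
  dir_ops M s h = coord_ints `[0, 1] io s (fun u => h u * \prod_(j <- s) dirichlet M (u 0 (io j))).
Proof.
have cdir (j : 'I_m) : ccont (fun u : 'rV[R]_m => dirichlet M (u 0 j)).
  exact/smooth_ccont/smooth_dirichlet.
elim: s => [_ ch|j s IH /= /andP[js us] ch].
  by apply/funext => u; rewrite /= big_nil mulr1.
rewrite IH// /dir_op; congr (coord_int _ _ _).
set F := fun u => h u * _.
have cF : ccont F by apply: ccontM => //; apply: ccont_prod => i _; exact: cdir.
have -> : (fun u => h u * \prod_(i <- j :: s) dirichlet M (u 0 (io i))) =
    (fun u => dirichlet M (u 0 (io j)) * F u).
  by apply/funext => u; rewrite big_cons mulrCA.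
rewrite (coord_ints_scale (c := fun u => dirichlet M (u 0 (io j))))//; last first.
  by move=> u i a is_; rewrite updE (inj_eq ioI); case: eqVneq is_ js => // -> ->.
by apply/funext => u; rewrite mulrC.
Qed.

(** Changing one entry of [b] to a new value and remembering the old one is an
    involution; hence summing over [b] and a new value of the entry amounts to
    counting each [b] as many times as there are values. *)
Lemma sum_ffun_update (H : {ffun 'I_d -> 'I_k} -> 'I_k -> R[i]) (j : 'I_d) :
  (forall (b : {ffun 'I_d -> 'I_k}) i c, H [ffun x => if x == j then i else b x] c = H b c) ->
  \sum_(i < k) \sum_b H b i = k%:R * \sum_b H b (b j).
Proof.
move=> Hj; rewrite exchange_big /= pair_bigA /=.
pose sw (z : {ffun 'I_d -> 'I_k} * 'I_k) := ([ffun x => if x == j then z.2 else z.1 x], z.1 j).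
have swK : involutive sw.
  move=> [b i]; rewrite /sw /= ffunE eqxx; congr (_, _).
  by apply/ffunP => x; rewrite !ffunE; case: eqP => // ->.
rewrite (reindex_inj (inv_inj swK)) /= mulr_sumr.
under eq_bigr do rewrite Hj.
rewrite -(pair_bigA _ (fun b _ => H b (b j))) /=; apply: eq_bigr => b _.
by rewrite sumr_const card_ord mulr_natl.
Qed.

Lemma avg_opsE h u (L : {ffun 'I_d -> 'I_k} -> 'rV[R]_m) :
  (forall b j, L b 0 (io j) = (b j)%:R / k%:R) ->
  (forall b i, (forall j, io j != i) -> L b 0 i = u 0 i) ->
  avg_ops (enum 'I_d) h u = (k%:R ^+ d)^-1 * \sum_b h (L b).
Proof.
move=> L1 L2.
pose G s (b : {ffun 'I_d -> 'I_k}) u := foldl (fun v j => upd v (io j) ((b j)%:R / k%:R)) u s.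
have kC : (k%:R : R[i]) != 0 by rewrite pnatr_eq0 -lt0n.
have H s : uniq s -> forall u, avg_ops s h u = (k%:R ^+ d)^-1 * \sum_b h (G s b u).
  elim: s => [_ v|j s IH /= /andP[js us] v].
    rewrite /G /= sumr_const card_ffun !card_ord -(mulr_natl (h v)) natrX.
    by rewrite mulrA mulVf ?mul1r// expf_neq0.
  have -> : avg_op j (avg_ops s h) v = k%:R^-1 * \sum_(i < k)
      (k%:R ^+ d)^-1 * \sum_b h (G s b (upd v (io j) (i%:R / k%:R))).
    by congr (_ * _); apply: eq_bigr => i _; exact: IH.
  rewrite -mulr_sumr mulrCA; congr (_ * _).
  rewrite (sum_ffun_update (j := j) (H := fun b i => h (G s b (upd v (io j) (i%:R / k%:R))))).
    by rewrite mulrA mulVf// mul1r.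
  move=> b i c; congr h; move: (upd v _ _) => w.
  elim: s js {IH us} w => //= x s IH; rewrite inE negb_or => /andP[jx js] w.
  by rewrite IH// ffunE eq_sym (negbTE jx).
rewrite H ?enum_uniq//; congr (_ * _); apply: eq_bigr => b _; congr h.
have Gin s w j : uniq s -> j \in s -> G s b w 0 (io j) = (b j)%:R / k%:R.
  elim: s w => //= x s IH w /andP[xs us]; rewrite inE => /predU1P[->|js]; last exact: IH.
  elim: s xs {IH us} (upd w _ _) (updE w (io x) ((b x)%:R / k%:R) (io x)) => [_ w' ->|y s IH].
    by rewrite eqxx.
  rewrite inE negb_or => /andP[xy xs] w' w'x; apply: (IH xs).
  by rewrite updE (inj_eq ioI) (negbTE xy).
have Gout s w i : (forall j, io j != i) -> G s b w 0 i = w 0 i.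
  move=> ni; elim: s w => //= x s IH w; rewrite IH updE eq_sym.
  by rewrite (negbTE (ni x)).
apply/rowP => i; have [/existsP[j /eqP <-]|/existsPn ni] := boolP [exists j, io j == i].
  by rewrite L1 Gin ?enum_uniq// mem_enum.
by rewrite Gout// L2.
Qed.

End Kernel.
End MultipleAliasing.

(** * Rapidly decreasing functions and integrals over the whole space *)

Section LineIntegral.
Variable R : realType.
Local Notation mu := (@lebesgue_measure R).
Implicit Types (g : R -> R[i]).

(** The weight that measures decay: its integrals over intervals are
    differences of [atan]. *)
Definition cauchy_weight (a : R) : R := (1 + a ^+ 2)^-1.
Local Notation w := cauchy_weight.

Lemma weight_gt0 a : 0 < w a.
Proof. by rewrite invr_gt0 ltr_pwDl// sqr_ge0. Qed.

Lemma continuous_weight : continuous w.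
Proof. exact: continuous_oneDsqrV. Qed.

Lemma integral_weight : (\int[mu]_x (w x)%:E = (pi : R)%:E)%E.
Proof.
rewrite ge0_symfun_integralT.
- have -> : [set x : R | 0 <= x] = `[0, +oo[%classic.
    by apply/seteqP; split => x /=; rewrite in_itv /= andbT.
  by rewrite integral0y_oneDsqr -EFinM mulrCA divff// mulr1.
- by move=> x; exact/ltW/weight_gt0.
- exact: continuous_weight.
- by move=> x; rewrite /w /= sqrrN.
Qed.

Lemma measurable_weight : measurable_fun setT w.
Proof. exact: continuous_measurable_fun continuous_weight. Qed.

Lemma integrable_weight : mu.-integrable setT (EFin \o w).
Proof.
apply/integrableP; split; first by apply/measurable_EFinP; exact: measurable_weight.
under eq_integral => x _ do rewrite /= ger0_norm ?(ltW (weight_gt0 x))//.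
by rewrite integral_weight ltry.
Qed.

Definition box (M : nat) : set R := `[- M%:R, M%:R].

Lemma measurable_box M : measurable (box M : set (measurableTypeR R)).
Proof. exact: measurable_cc. Qed.

(** The integral of the weight outside [box M], see [Rintegral_weight_compl]. *)
Definition weight_tail (M : nat) : R := pi - 2 * atan M%:R.

Lemma Rintegral_weight : \int[mu]_(a in setT) w a = pi.
Proof. by rewrite /Rintegral integral_weight. Qed.

Lemma box_le M : (- M%:R : R) <= M%:R.
Proof. by apply: (@le_trans _ _ 0); rewrite ?oppr_le0. Qed.

Lemma Rintegral_weight_box M : \int[mu]_(a in box M) w a = 2 * atan M%:R.
Proof.
rewrite (is_derive_Rintegral (h := atan) (box_le M) _ continuous_weight).
by rewrite atanN opprK; ring.
Qed.

Lemma weight_tail_ge0 M : 0 <= weight_tail M.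
Proof.
rewrite subr_ge0; have := @atan_ltpi2 R M%:R; rewrite ltr_pdivlMr// mulrC.
exact: ltW.
Qed.

Lemma weight_tail_cvg0 (e : R) : 0 < e -> exists2 M : nat, (0 < M)%N & weight_tail M <= e.
Proof.
move=> e0; have e20 : 0 < e / 2 by rewrite divr_gt0.
have /cvgrPdist_lt/(_ _ e20)[N [_ HN]] := @cvgy_atan R.
have [M NM] : exists M : nat, N < M%:R.
  by exists (Num.truncn N).+1; exact: truncnS_gt.
exists M.+1 => //; have := HN M.+1%:R; rewrite (lt_trans NM) ?ltr_nat// => /(_ isT).
move=> /ltr_normlW; rewrite /weight_tail => h; lra.
Qed.

Section Dominated.
Variables (g : R -> R[i]) (C : R).
Hypotheses (cg : ccont g) (gC : forall a, cabs (g a) <= C * w a).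

Let iCw : mu.-integrable setT (EFin \o (fun a => C * w a)).
Proof. by have := integrableZl measurableT C integrable_weight; apply: eq_integrable. Qed.

Let C0 : 0 <= C.
Proof.
have := le_trans (cabs_ge0 _) (gC 0); rewrite pmulr_lge0//; exact: weight_gt0.
Qed.

Lemma dominated_cintegrable (D : set R) : measurable (D : set (measurableTypeR R)) ->
  cintegrable D g.
Proof.
move=> mD; apply: (cintegrable_le mD (G := fun a => C * w a)) => //.
exact: integrableS measurableT mD _ iCw.
Qed.

Let le_on (D : set R) : measurable (D : set (measurableTypeR R)) ->
  cabs (cint D g) <= 2 * (C * \int[mu]_(a in D) w a).
Proof.
move=> mD; have iD : mu.-integrable D (EFin \o (fun a => C * w a)).
  exact: integrableS measurableT mD _ iCw.
have := cabs_cint_le mD (dominated_cintegrable mD) iD (fun a _ => gC a).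
by rewrite RintegralZl//; exact: integrableS measurableT mD _ integrable_weight.
Qed.

Lemma Rintegral_weight_compl M : \int[mu]_(a in ~` box M) w a = weight_tail M.
Proof.
have mB := measurable_box M; have mC := measurableC mB.
have := @Rintegral_setU _ _ _ mu _ _ w mB mC.
rewrite setUv => /(_ integrable_weight); rewrite Rintegral_weight Rintegral_weight_box.
by rewrite /weight_tail => ->; [rewrite addrC addKr|exact/disj_setPCl].
Qed.

Lemma cabs_cint_setT_le : cabs (cint setT g) <= 2 * pi * C.
Proof.
have -> : 2 * pi * C = 2 * (C * pi) by ring.
by rewrite -Rintegral_weight; exact: le_on measurableT.
Qed.

Lemma cabs_cint_box_le M : cabs (cint (box M) g) <= 2 * pi * C.
Proof.
apply: le_trans (le_on (measurable_box M)) _; rewrite Rintegral_weight_box -mulrA.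
rewrite ler_pM2l// mulrC ler_wpM2r//.
by have := weight_tail_ge0 M; rewrite /weight_tail subr_ge0.
Qed.

Lemma cint_setT_box M : cabs (cint setT g - cint (box M) g) <= 2 * C * weight_tail M.
Proof.
have mB := measurable_box M; have mC := measurableC mB.
have [i1 i2] := dominated_cintegrable measurableT.
have -> : cint setT g - cint (box M) g = cint (~` box M) g.
  rewrite {1}/cint -(setUv (box M)).
  rewrite !Rintegral_setU ?setUv//; try exact/disj_setPCl.
  by rewrite /cint; apply/eqP; rewrite eq_complex /=; apply/andP; split; apply/eqP; rewrite addrAC subrr add0r.
by apply: le_trans (le_on mC) _; rewrite Rintegral_weight_compl mulrA.
Qed.

End Dominated.

(** The integrals over boxes are continuous and converge uniformly. *)
Lemma ccont_cint_setT (T : topologicalType) (F : T -> R -> R[i]) (C : R) :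
  ccont (fun z : T * R => F z.1 z.2) -> (forall t a, cabs (F t a) <= C * w a) ->
  ccont (fun t => cint setT (F t)).
Proof.
move=> cF FC; have cFt t : ccont (F t).
  apply: (ccont_comp (h := fun a : R => (t, a))) cF => a.
  exact: (cvg_pair (cvg_cst t) (@cvg_id _ _)).
suff H (p : R[i] -> R) : (forall z z', `|p z - p z'| <= cabs (z - z')) ->
    (forall M, continuous (fun t => p (cint (box M) (F t)))) ->
    continuous (fun t => p (cint setT (F t))).
  have [c1 c2] := cF; split.
    apply: (H (@complex.Re R)) => [z z'|M]; first by rewrite -raddfN -ReD; exact: Re_le_cabs.
    exact: (@continuous_param_integral _ _ (fun t a => complex.Re (F t a)) _ _ (box_le M) c1).
  apply: (H (@complex.Im R)) => [z z'|M]; first by rewrite -raddfN -ImD; exact: Im_le_cabs.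
  exact: (@continuous_param_integral _ _ (fun t a => complex.Im (F t a)) _ _ (box_le M) c2).
move=> pL pM t0; apply/cvgrPdist_lt => e e0.
have C0 : 0 <= C.
  by have := le_trans (cabs_ge0 _) (FC t0 0); rewrite pmulr_lge0//; exact: weight_gt0.
have d0 : 0 < e / 4 / (2 * C + 1) by rewrite !divr_gt0// ltr_wpDl// mulr_ge0.
have [M _ Md] := weight_tail_cvg0 d0.
have tl t : cabs (cint setT (F t) - cint (box M) (F t)) <= e / 4.
  apply: le_trans (cint_setT_box (cFt t) (FC t) M) _.
  apply: le_trans (ler_wpM2l _ Md) _; first by rewrite mulr_ge0.
  by rewrite mulrC mulrAC ler_pdivrMr ?ltr_wpDl ?mulr_ge0// ler_wpM2l ?lerDl// divr_ge0 ?ltW.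
have e20 : 0 < e / 2 by rewrite divr_gt0.
have /cvgrPdist_lt/(_ _ e20) := pM M t0; apply: filterS => t ht.
have h1 := le_trans (pL _ _) (tl t0); have h2 := le_trans (pL _ _) (tl t).
rewrite -(subrKA (p (cint (box M) (F t0)))) (le_lt_trans (ler_normD _ _))//.
have h3 := ler_distD (p (cint (box M) (F t))) (p (cint (box M) (F t0))) (p (cint setT (F t))).
rewrite distrC in h2; lra.
Qed.

(** The primitive is written as an integral over a fixed interval so that the
    rule for parametric integrals applies. *)
Lemma exists_primitive g g' : cderiv g g' -> ccont g' -> exists G, cderiv G g.
Proof.
move=> dg cg'; have cg := cderiv_ccont dg.
have cmul : continuous (fun z : R * R => z.1 * z.2).
  by move=> z; exact: (continuousM (@cvg_fst _ _ _ _ _) (@cvg_snd _ _ _ _ _)).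
have cid : ccont (fun x : R => x%:C) by apply: ccont_real => x; exact: cvg_id.
have dS a : cderiv (fun x => g (x * a)) (fun x => a%:C * g' (x * a)).
  by apply: cderiv_ext (cderiv_affine a 0 dg) _ _ => x; rewrite addr0 (mulrC a x).
have d1 : cderiv (fun x : R => x%:C) (fun=> 1).
  by move=> x; split; [exact: is_derive_id|exact: is_derive_cst].
have dF a := cderivM d1 (dS a).
exists (fun x => cint `[0, 1] (fun a => x%:C * g (x * a))).
have cs (x : R) (f : R -> R[i]) : ccont f -> ccont (fun a : R => f (x * a)).
  move=> cf; apply: (ccont_comp (h := fun a : R => x * a)) cf => a.
  exact: (continuousM (cvg_cst _) (@cvg_id _ _)).
apply: cderiv_ext (cderiv_param_cint01 (F := fun x a => x%:C * g (x * a)) dF _ _) _ _ => //.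
- by move=> x; apply: ccontM; [exact: ccont_cst|exact: cs].
- apply: ccontD.
    by apply: ccontM; [exact: ccont_cst|exact: (ccont_comp cmul cg)].
  apply: ccontM; first by apply: ccont_real => z; exact: cvg_fst.
  apply: ccontM; first by apply: ccont_real => z; exact: cvg_snd.
  exact: (ccont_comp cmul cg').
move=> x.
have dA : cderiv (fun a => a%:C * g (x * a)) (fun a => 1 * g (x * a) + x%:C * (a%:C * g' (x * a))).
  have dxa : cderiv (fun a => g (x * a)) (fun a => x%:C * g' (x * a)).
    by apply: cderiv_ext (cderiv_affine x 0 dg) _ _ => a; rewrite addr0.
  by apply: cderiv_ext (cderivM d1 dxa) _ _ => a //; rewrite mulrCA.
rewrite (cint_cderiv ler01 dA); first by rewrite mulr1 mul1r mul0r subr0.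
apply: ccontD; first by apply: ccontM; [exact: ccont_cst|exact: cs].
by apply: ccontM; [exact: ccont_cst|apply: ccontM => //; exact: cs].
Qed.

(** Both sides are telescoping increments of a primitive. *)
Lemma cint_box_sum g g' (M : nat) : cderiv g g' -> ccont g' ->
  cint (box M) g = \sum_(b < M.*2) cint `[0, 1] (fun a => g (a + (b%:R - M%:R))).
Proof.
move=> dg cg'; have [G dG] := exists_primitive dg cg'; have cg := cderiv_ccont dg.
rewrite (cint_cderiv (box_le M) dG cg).
under eq_bigr => b _.
  have -> : cint `[0, 1] (fun a => g (a + (b%:R - M%:R))) = G (b.+1%:R - M%:R) - G (b%:R - M%:R).
    rewrite (cint_cderiv (G := fun a => G (a + (b%:R - M%:R))) ler01).
    - by rewrite add0r addrA [1 + _]addrC natr1.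
    - by apply: cderiv_ext (cderiv_affine 1 (b%:R - M%:R) dG) _ _ => a; rewrite !mul1r.
    - apply: (ccont_comp (h := fun a : R => a + (b%:R - M%:R))) cg => a.
      exact: (continuousD (@cvg_id _ _) (cvg_cst _)).
  over.
rewrite -(big_mkord xpredT (fun b => G (b.+1%:R - M%:R) - G (b%:R - M%:R))).
by rewrite telescope_sumr// sub0r -addnn natrD addrK.
Qed.

End LineIntegral.

(** * Iterated integrals of functions dominated by the weight *)

Section SpaceIntegral.
Variables (R : realType) (m d : nat) (io : 'I_d -> 'I_m).
Hypothesis ioI : injective io.
Implicit Types (h g : 'rV[R]_m -> R[i]) (u : 'rV[R]_m) (s : seq 'I_d).
Local Notation w := (@cauchy_weight R).

Definition weight s u : R := \prod_(i <- s) w (u 0 (io i)).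

Lemma weight_ge0 s u : 0 <= weight s u.
Proof. by apply: prodr_ge0 => i _; exact/ltW/weight_gt0. Qed.

(** Quadratic decay in each coordinate of [s] is inherited, for the remaining
    coordinates, by integrals over one of them: this is what makes iterated
    integrals over the whole space amenable to induction. *)
Definition dominated s h C : Prop := ccont h /\ forall u, cabs (h u) <= C * weight s u.

(** The domains of integration in use: the line, and the boxes that
    approximate it. For both, the integral of the weight is at most [pi]. *)
Definition good_domain (D : set R) : Prop := D = setT \/ exists M, D = box M.

Lemma good_domainT : good_domain setT. Proof. by left. Qed.
Lemma good_domain_box M : good_domain (box M). Proof. by right; exists M. Qed.

Lemma good_domain_measurable D : good_domain D -> measurable (D : set (measurableTypeR R)).
Proof. by move=> [->|[M ->]]; [exact: measurableT|exact: measurable_box]. Qed.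

Lemma weight_upd i s u a : i \notin s -> weight s (upd u (io i) a) = weight s u.
Proof.
move=> is_; apply: eq_big_seq => j js; rewrite updE (inj_eq ioI).
by case: eqVneq js is_ => // -> ->.
Qed.

Lemma dominated_slice i s h C u : i \notin s -> dominated (i :: s) h C ->
  ccont (fun a => h (upd u (io i) a)) /\
  forall a, cabs (h (upd u (io i) a)) <= (C * weight s u) * w a.
Proof.
move=> is_ [ch hC]; split; first exact: ccont_slice.
by move=> a; have := hC (upd u (io i) a); rewrite /weight big_cons updE eqxx -/(weight _ _) weight_upd// mulrA mulrAC.
Qed.

Lemma dominated_coord_int D i s h C : good_domain D -> i \notin s -> dominated (i :: s) h C ->
  dominated s (coord_int D (io i) h) (2 * pi * C).
Proof.
move=> gD is_ hd; split; last first.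
  move=> u; have [c1 c2] := dominated_slice u is_ hd; rewrite -mulrA.
  by case: gD => [->|[M ->]]; [exact: cabs_cint_setT_le|exact: cabs_cint_box_le].
have [ch hC] := hd; case: gD => [->|[M ->]]; last first.
  exact: ccont_coord_int (box_le R M) ch.
apply: (@ccont_cint_setT _ _ (fun u a => h (upd u (io i) a)) C).
  exact: ccont_joint_upd.
have C0 : 0 <= C.
  have := le_trans (cabs_ge0 _) (hC 0); rewrite pmulr_lge0//.
  by apply: prodr_gt0 => j _; exact: weight_gt0.
move=> u a; have [_ c2] := dominated_slice u is_ hd.
apply: le_trans (c2 a) _; rewrite ler_wpM2r//; first exact/ltW/weight_gt0.
rewrite ler_piMr// /weight; apply: prodr_ile1 => j _.
rewrite (ltW (weight_gt0 _))//= invf_le1 ?lerDl ?sqr_ge0//.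
by rewrite ltr_pwDl// sqr_ge0.
Qed.

Lemma dominated_perm s s' h C : perm_eq s s' -> dominated s h C -> dominated s' h C.
Proof. by move=> ss [ch hC]; split=> // u; rewrite /weight -(perm_big _ ss); exact: hC. Qed.

(** The statement keeps the coordinates [s'] that are not yet integrated, as
    the induction needs. *)
Lemma dominated_coord_ints D s s' h C : good_domain D -> uniq (s ++ s') -> dominated (s ++ s') h C ->
  dominated s' (coord_ints D io s h) ((2 * pi) ^+ size s * C).
Proof.
move=> gD; elim: s s' => [|i s IH] s' /=; first by rewrite expr0 mul1r.
move=> /andP[is_ us] hd; rewrite exprS -mulrA.
have p : perm_eq (i :: s ++ s') (s ++ i :: s').
  by rewrite -cat1s catA [X in perm_eq _ X](_ : _ = s ++ [:: i] ++ s')// catA perm_cat2r perm_catC.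
apply: dominated_coord_int => //; first by move: is_; rewrite mem_cat negb_or => /andP[].
apply: IH; first by rewrite -(perm_uniq p) /= is_.
exact: dominated_perm p hd.
Qed.

Lemma dominated_add s h g C C' : dominated s h C -> dominated s g C' ->
  dominated s (fun u => h u + g u) (C + C').
Proof.
move=> [ch hC] [cg gC]; split; first exact: ccontD.
by move=> u; rewrite mulrDl (le_trans (cabsD _ _))// lerD.
Qed.

Lemma dominated_scale s (c : R[i]) h C : dominated s h C -> dominated s (fun u => c * h u) (cabs c * C).
Proof.
move=> [ch hC]; split; first exact/ccontM/ch/ccont_cst.
by move=> u; rewrite cabsM -mulrA ler_wpM2l ?cabs_ge0.
Qed.

Lemma dominated_bounded_mul s h g C B : dominated s h C -> ccont g -> (forall u, cabs (g u) <= B) ->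
  dominated s (fun u => g u * h u) (B * C).
Proof.
move=> [ch hC] cg gB; split; first exact: ccontM.
by move=> u; rewrite cabsM -mulrA ler_pM ?cabs_ge0.
Qed.

Lemma coord_ints_linear D s (c : R[i]) h g C C' : good_domain D -> uniq s ->
  dominated s h C -> dominated s g C' ->
  coord_ints D io s (fun u => c * h u + g u) =
  fun u => c * coord_ints D io s h u + coord_ints D io s g u.
Proof.
move=> gD us; suff H s1 s2 : uniq (s1 ++ s2) -> forall h g C C', dominated (s1 ++ s2) h C ->
    dominated (s1 ++ s2) g C' -> coord_ints D io s1 (fun u => c * h u + g u) =
    fun u => c * coord_ints D io s1 h u + coord_ints D io s1 g u.
  by move=> dh dg; apply: (H s [::] _ _ _ C C'); rewrite cats0.
elim: s1 s2 => // i s1 IH s2 /= /andP[is_ us'] {}h {}g {}C {}C' dh dg.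
have p : perm_eq (i :: s1 ++ s2) (s1 ++ i :: s2).
  by rewrite -cat1s -(cat1s i s2) perm_catCA.
have u' : uniq (s1 ++ i :: s2) by rewrite -(perm_uniq p) /= is_.
have d1 := dominated_perm p dh; have d2 := dominated_perm p dg.
rewrite (IH (i :: s2) u' _ _ _ _ d1 d2).
have i2 : i \notin s2 by move: is_; rewrite mem_cat negb_or => /andP[].
apply/funext => u; have mD := good_domain_measurable gD.
have [c1 e1] := dominated_slice u i2 (dominated_coord_ints gD u' d1).
have [c2 e2] := dominated_slice u i2 (dominated_coord_ints gD u' d2).
have j1 := dominated_cintegrable c1 e1 mD; have j2 := dominated_cintegrable c2 e2 mD.
by rewrite /coord_int cintD//; [rewrite cintZ|exact: cintegrableZ].
Qed.

(** Replacing the line by a box in one coordinate costs the tail of the weight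
    there, while the decay in the other coordinates keeps the remaining
    integrals bounded. *)
Lemma coord_ints_box_approx s h C : uniq s -> dominated s h C -> exists2 C' : R, 0 <= C' &
  forall M u, cabs (coord_ints setT io s h u - coord_ints (box M) io s h u) <= C' * weight_tail R M.
Proof.
suff H s1 s2 : uniq (s1 ++ s2) -> dominated (s1 ++ s2) h C -> exists2 C' : R, 0 <= C' &
    forall M u, cabs (coord_ints setT io s1 h u - coord_ints (box M) io s1 h u) <=
    C' * weight_tail R M * weight s2 u.
  move=> us dh; have [||C' C'0 H'] := H s [::]; rewrite ?cats0//.
  by exists C' => // M u; have := H' M u; rewrite /weight big_nil mulr1.
elim: s1 s2 => [|i s1 IH] s2 /=.
  by exists 0 => // M u; rewrite subrr cabs0 !mul0r.
move=> /andP[is_ us'] dh.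
have p : perm_eq (i :: s1 ++ s2) (s1 ++ i :: s2).
  by rewrite -cat1s -(cat1s i s2) perm_catCA.
have u' : uniq (s1 ++ i :: s2) by rewrite -(perm_uniq p) /= is_.
have d1 := dominated_perm p dh.
have [C1 C10 H1] := IH (i :: s2) u' d1.
have i2 : i \notin s2 by move: is_; rewrite mem_cat negb_or => /andP[].
pose C2 := (2 * pi) ^+ size s1 * C.
have dT := dominated_coord_ints good_domainT u' d1.
exists (2 * `|C2| + 2 * pi * C1) => [|M u].
  by rewrite addr_ge0// mulr_ge0// mulr_ge0// pi_ge0.
have dB := dominated_coord_ints (good_domain_box M) u' d1.
have [c1 e1] := dominated_slice u i2 dT; have [c2 e2] := dominated_slice u i2 dB.
set T1 := coord_ints setT io s1 h in H1 dT c1 e1 *; set B1 := coord_ints (box M) io s1 h in H1 dB c2 e2 *.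
have j1 := dominated_cintegrable c1 e1 (measurable_box M).
have j2 := dominated_cintegrable c2 e2 (measurable_box M).
rewrite -(subrKA (coord_int (box M) (io i) T1 u)).
have -> : (2 * `|C2| + 2 * pi * C1) * weight_tail R M * weight s2 u =
  `|C2| * (2 * weight_tail R M * weight s2 u) + 2 * pi * (C1 * weight_tail R M * weight s2 u) by ring.
apply: le_trans (cabsD _ _) _; apply: lerD.
  apply: le_trans (cint_setT_box c1 e1 M) _.
  have -> : 2 * ((2 * pi) ^+ size s1 * C * weight s2 u) * weight_tail R M =
    C2 * (2 * weight_tail R M * weight s2 u) by rewrite /C2; ring.
  by rewrite ler_wpM2r ?ler_norm// !mulr_ge0 ?weight_ge0 ?weight_tail_ge0.
rewrite /coord_int -cintB//; last exact: measurable_box.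
have cd : ccont (fun a => T1 (upd u (io i) a) - B1 (upd u (io i) a)) by exact: ccontB.
apply: le_trans (cabs_cint_box_le (C := C1 * weight_tail R M * weight s2 u) cd _ M) _.
  move=> a; have := H1 M (upd u (io i) a).
  rewrite /weight big_cons updE eqxx -/(weight _ _) weight_upd// => /le_trans; apply.
  by rewrite -/(weight s2 u) mulrCA mulrC.
by [].
Qed.

(** At each integration, continuity turns positivity at one point into
    positivity of the integral. *)
Lemma coord_ints_gt0 s h C u : uniq s -> (forall i, i \in s -> u 0 (io i) = 0) -> dominated s h C ->
  (forall v, 0 <= complex.Re (h v)) -> 0 < complex.Re (h u) ->
  0 < complex.Re (coord_ints setT io s h u).
Proof.
suff H s1 s2 : uniq (s1 ++ s2) -> dominated (s1 ++ s2) h C -> (forall v, 0 <= complex.Re (h v)) ->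
    (forall v, 0 <= complex.Re (coord_ints setT io s1 h v)) /\
    (forall u, (forall i, i \in s1 -> u 0 (io i) = 0) -> 0 < complex.Re (h u) ->
      0 < complex.Re (coord_ints setT io s1 h u)).
  move=> us u0 dh h0; have [||_ H'] := H s [::] _ _ h0; rewrite ?cats0//.
  exact: H'.
elim: s1 s2 => [|i s1 IH] s2 //=.
move=> /andP[is_ us'] dh h0.
have p : perm_eq (i :: s1 ++ s2) (s1 ++ i :: s2).
  by rewrite -cat1s -(cat1s i s2) perm_catCA.
have u' : uniq (s1 ++ i :: s2) by rewrite -(perm_uniq p) /= is_.
have d1 := dominated_perm p dh.
have i2 : i \notin s2 by move: is_; rewrite mem_cat negb_or => /andP[].
have [T0 T1] := IH (i :: s2) u' d1 h0.
have dT := dominated_coord_ints good_domainT u' d1.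
split=> [v|{}u u0 hu]; first exact: Rintegral_ge0.
have [[c1 c1'] e1] := dominated_slice u i2 dT.
have [j1 _] := dominated_cintegrable (conj c1 c1') e1 measurableT.
set g := fun a : R => complex.Re (coord_ints setT io s1 h (upd u (io i) a)).
have g0 : 0 < g 0.
  have E : upd u (io i) 0 = u by have := upd_id u (io i); rewrite (u0 i (mem_head _ _)).
  rewrite /g E; apply: T1 => // j js.
  by apply: u0; rewrite inE js orbT.
have [e /= e0 He] : \forall a \near (0 : R), g 0 / 2 < g a.
  have /cvgrPdist_lt/(_ (g 0 / 2)) := c1 0; rewrite divr_gt0// => /(_ isT).
  by apply: filterS => a /ltr_normlW; rewrite -/(g 0) -/(g a); lra.
rewrite -[X in 0 < X]/(\int[lebesgue_measure]_(a in setT) g a).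
have mI := @measurable_cc R 0 (e / 2).
apply: (@lt_le_trans _ _ (\int[lebesgue_measure]_(a in `[0, e / 2]) (g 0 / 2))).
  have -> : \int[lebesgue_measure]_(a in `[0, e / 2]) (g 0 / 2) =
      g 0 / 2 * fine (lebesgue_measure (`[0, e / 2]%classic : set R)).
    exact: (Rintegral_cst lebesgue_measure mI).
  rewrite lebesgue_measure_itv /= lte_fin divr_gt0//= subr0.
  by rewrite !mulr_gt0// invr_gt0.
have iI : lebesgue_measure.-integrable `[0, e / 2] (EFin \o g) by exact: integrableS measurableT mI _ j1.
apply: (@le_trans _ _ (\int[lebesgue_measure]_(a in `[0, e / 2]) g a)).
  apply: le_Rintegral => //.
    by apply: continuous_integrable_cc => x; exact: cst_continuous.
  move=> a /=; rewrite in_itv /= => /andP[a0 a1]; apply/ltW/He => /=.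
  by rewrite sub0r normrN ger0_norm// (le_lt_trans a1)// ltr_pdivrMr// ltr_pMr// ltr1n.
have mC := measurableC mI.
have := @Rintegral_setU _ _ _ lebesgue_measure _ _ g mI mC.
rewrite setUv => /(_ j1) ->; last exact/disj_setPCl.
by rewrite lerDl; apply: Rintegral_ge0 => a _; exact: T0.
Qed.

End SpaceIntegral.

(** * Sections of the prequantum bundle in the Weil-Brezin picture *)

Section WeilBrezin.
Variables (R : realType) (n k : nat).
Local Notation e := (delta_mx 0).
Local Notation ix := (@lshift n n).
Local Notation iy := (@rshift n n).
Local Notation vec := 'rV[R]_(n + n).
Implicit Types (t : section R n k) (F : vec -> R[i]) (u : vec).

Definition xy u : R := \sum_i xc u i * yc u i.

(** In this gauge sections are periodic in [x] and the covariant derivative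
    along [y] is the plain one. *)
Definition gauge (f : vec -> R[i]) : vec -> R[i] := fun u => cis (k%:R * pi * xy u) * f u.

Lemma tildeE t (x y : 'rV[R]_n) : tilde t x y = gauge t (row_mx x y).
Proof.
rewrite /tilde /gauge /xy; congr (cis (_ * _) * _); apply: eq_bigr => i _.
by rewrite /xc /yc row_mxEl row_mxEr.
Qed.

Lemma has_pderiv_real_smooth (h : vec -> R) j (d : vec -> R) : smooth (fun u => (h u)%:C) ->
  has_pderiv j (fun u => (h u)%:C) (fun u => (d u)%:C) ->
  has_pderiv j (fun u => cis (h u)) (fun u => (0 +i* d u) * cis (h u)).
Proof.
move=> sh dh u s; have [/= d1 _] := dh u s; split => /=.
  have := is_derive1_comp (is_derive_cos _) d1.
  by move=> H; apply: (is_derive_eq H) => /=; ring.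
have := is_derive1_comp (is_derive_sin _) d1.
by move=> H; apply: (is_derive_eq H) => /=; ring.
Qed.

Lemma smooth_xc i : smooth (fun u : vec => (xc u i)%:C).
Proof. exact: smooth_coord. Qed.

Lemma smooth_yc i : smooth (fun u : vec => (yc u i)%:C).
Proof. exact: smooth_coord. Qed.

Lemma smooth_xy c : smooth (fun u : vec => (c * xy u)%:C).
Proof.
have -> : (fun u : vec => (c * xy u)%:C) = (fun u => c%:C * \sum_i ((xc u i)%:C * (yc u i)%:C)).
  apply/funext => u; rewrite rmorphM rmorph_sum /=; congr (_ * _).
  by apply: eq_bigr => i _; rewrite rmorphM.
apply: smooth_mul; first exact: smooth_const.
by apply: smooth_sum => i _; apply: smooth_mul; [exact: smooth_xc|exact: smooth_yc].
Qed.

Lemma smooth_gauge F : smooth F -> smooth (gauge F).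
Proof. by move=> sF; apply: smooth_mul; [apply: smooth_cis; exact: smooth_xy|exact: sF]. Qed.

Lemma xc_line u j s i : xc (u + s *: e j) i = xc u i + s * (ix i == j)%:R.
Proof. by rewrite /xc !mxE eqxx. Qed.

Lemma yc_line u j s i : yc (u + s *: e j) i = yc u i + s * (iy i == j)%:R.
Proof. by rewrite /yc !mxE eqxx. Qed.

Lemma xy_line_x u j s : xy (u + s *: e (ix j)) = xy u + s * yc u j.
Proof.
rewrite /xy (bigD1 j)//= [in RHS](bigD1 j)//= xc_line yc_line eqxx.
rewrite (eq_bigr (fun i => xc u i * yc u i)) => [|i ij].
  by rewrite eq_rlshift mulr0 addr0 mulr1; ring.
by rewrite xc_line yc_line eq_rlshift (inj_eq (@lshift_inj _ _)) (negbTE ij) !mulr0 !addr0.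
Qed.

Lemma xy_line_y u j s : xy (u + s *: e (iy j)) = xy u + s * xc u j.
Proof.
rewrite /xy (bigD1 j)//= [in RHS](bigD1 j)//= xc_line yc_line eqxx.
rewrite (eq_bigr (fun i => xc u i * yc u i)) => [|i ij].
  by rewrite eq_lrshift mulr0 addr0 mulr1; ring.
by rewrite xc_line yc_line eq_lrshift (inj_eq (@rshift_inj _ _)) (negbTE ij) !mulr0 !addr0.
Qed.

Lemma conn_formx i u : conn_form (ix i) u = yc u i.
Proof. by rewrite /conn_form (unsplitK (inl i)). Qed.

Lemma conn_formy i u : conn_form (iy i) u = - xc u i.
Proof. by rewrite /conn_form (unsplitK (inr i)). Qed.

Lemma lattice_delta j : lattice R (delta_mx 0 j) = delta_mx 0 j :> vec.
Proof. by apply/matrixP => a b; rewrite !mxE; case: (_ && _). Qed.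

Lemma omega_delta_r u j : omega u (e j) = conn_form j u.
Proof.
have omegaC (v w : vec) : omega v w = - omega w v.
  by rewrite /omega -sumrN; apply: eq_bigr => i _; ring.
by rewrite omegaC omega_delta opprK.
Qed.

(** For a generator of the lattice the sign [alpha] is 1. *)
Lemma section_period t u j : t (u + e j) = cis (- (k%:R * pi * conn_form j u)) * t u.
Proof.
rewrite -[in LHS]lattice_delta qper_quasi /multiplier lattice_delta omega_delta_r.
rewrite /alpha big1 => [|i _]; first by rewrite expr0z expr1n mul1r.
rewrite !mxE /=; have [<-|] := eqVneq (ix i) j; last by rewrite mul0r.
by rewrite eq_rlshift mulr0.
Qed.

Lemma gauge_period_x t i : periodic (ix i) (gauge t).
Proof.
move=> u; rewrite /gauge section_period conn_formx -[e (ix i)]scale1r xy_line_x mulrA -cisD.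
by congr (cis _ * _); ring.
Qed.

Lemma gauge_period_y t i u : gauge t (u + e (iy i)) = cis (2 * pi * (k%:R * xc u i)) * gauge t u.
Proof.
rewrite /gauge section_period conn_formy -[e (iy i)]scale1r xy_line_y mulrA [RHS]mulrA -!cisD.
by congr (cis _ * _); ring.
Qed.

Lemma gaugeM (f : torus_fun R n) t : gauge (section_mul f t) = fun u => f u * gauge t u.
Proof. by apply/funext => u; rewrite /gauge mulrCA. Qed.

Lemma gaugeD (c : R[i]) t t' : gauge (c *: t + t')%R = fun u => c * gauge t u + gauge t' u.
Proof.
apply/funext => u; rewrite /gauge -[X in _ * X]/(c * t u + t' u).
by rewrite mulrDr mulrCA.
Qed.

Lemma has_pderiv_gauge F j d : smooth F ->
  (forall u s, xy (u + s *: e j) = xy u + s * d u) ->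
  (smooth (fun u => (d u)%:C)) ->
  has_pderiv j (gauge F) (fun u => cis (k%:R * pi * xy u) *
    (pderiv j F u + (0 +i* (k%:R * pi)) * (d u)%:C * F u)).
Proof.
move=> sF dE sd.
have hx : has_pderiv j (fun u => (k%:R * pi * xy u)%:C) (fun u => (k%:R * pi * d u)%:C).
  move=> u; apply: cderiv_ext (@cderiv_affine _ (fun x => x%:C) (fun=> 1) (k%:R * pi * d u) (k%:R * pi * xy u) _) _ _ => [x|s|s].
  - by split; [exact: is_derive_id|exact: is_derive_cst].
  - by rewrite dE; congr (_%:C); ring.
  - rewrite mulr1; congr (_%:C); congr (_ * _).
    have h1 := dE u s; have h2 := dE (u + s *: e j) 1; have h3 := dE u (s + 1).
    have : xy (u + (s + 1) *: e j) = xy (u + s *: e j + 1 *: e j) by rewrite scalerDl addrA.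
    by rewrite h3 h2 h1 => h; lra.
have := has_pderivM (has_pderiv_real_smooth (smooth_xy _) hx) (smooth_has_pderiv j sF).
move/has_pderiv_ext; apply => u //.
have -> : 0 +i* (k%:R * pi * d u) = (0 +i* (k%:R * pi)) * (d u)%:C.
  by apply/eqP; rewrite eq_complex /= !mulr0 !mul0r subrr add0r !eqxx.
by rewrite /=; ring.
Qed.

(** The derivative of the phase [k * pi * xy] along [y] is exactly the
    connection form. *)
Lemma gauge_nabla_y t i : gauge (nabla (iy i) t) = pderiv (iy i) (gauge t).
Proof.
have := has_pderiv_gauge (qper_smooth t) (fun u s => xy_line_y u i s) (smooth_xc i).
move/has_pderiv_pderiv ->; apply/funext => u; congr (_ * _).
by rewrite -[LHS]/(nabla_fun k _ _ _) /nabla_fun conn_formy rmorphN mulrN mulNr opprK.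
Qed.

(** Here the derivative of the phase has the opposite sign to the connection
    form, whence the factor 2. *)
Lemma gauge_nabla_x t i : gauge (nabla (ix i) t) =
  fun u => pderiv (ix i) (gauge t) u - (0 +i* (2 * (k%:R * pi))) * (yc u i)%:C * gauge t u.
Proof.
have := has_pderiv_gauge (qper_smooth t) (fun u s => xy_line_x u i s) (smooth_yc i).
move/has_pderiv_pderiv ->; apply/funext => u; rewrite /gauge.
rewrite -[X in _ * X = _]/(nabla_fun k _ _ _) /nabla_fun conn_formx.
have -> : 0 +i* (2 * (k%:R * pi)) = (0 +i* (k%:R * pi)) + (0 +i* (k%:R * pi)) :> R[i].
  by apply/eqP; rewrite eq_complex /= addr0 eqxx /=; apply/eqP; ring.
by ring.
Qed.

Definition character (p : 'I_n -> int) u : R[i] := cis (- (2 * pi * \sum_i (p i)%:~R * xc u i)).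

(** The Fourier coefficient in [x] is kept as a function of [x] and [y] that
    is constant in [x]; it can then be differentiated and integrated in [y] by
    the same operators as the function itself. *)
Definition fourier_x p F : vec -> R[i] :=
  coord_ints `[0, 1] ix (enum 'I_n) (fun u => F u * character p u).

Lemma smooth_character p : smooth (character p).
Proof.
apply: smooth_cis; have -> : (fun u : vec => (- (2 * pi * \sum_i (p i)%:~R * xc u i))%:C) =
    (fun u => \sum_i (- (2 * pi * (p i)%:~R))%:C * (xc u i)%:C).
  apply/funext => u; rewrite mulr_sumr -sumrN rmorph_sum /=; apply: eq_bigr => i _.
  by rewrite -rmorphM /=; congr (_%:C); ring.
by apply: smooth_sum => i _; apply: smooth_mul; [exact: smooth_const|exact: smooth_xc].
Qed.

Lemma character_line_y p u j s : character p (u + s *: e (iy j)) = character p u.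
Proof.
congr (cis (- (_ * _))); apply: eq_bigr => i _.
by rewrite xc_line eq_lrshift mulr0 addr0.
Qed.

Lemma character_line_x p u j s : character p (u + s *: e (ix j)) =
  cis (- (2 * pi * (p j)%:~R * s)) * character p u.
Proof.
rewrite /character -cisD; congr cis; rewrite (bigD1 j)//= [in RHS](bigD1 j)//=.
rewrite (eq_bigr (fun i => (p i)%:~R * xc u i)) => [|i ij].
  by rewrite xc_line eqxx mulr1; ring.
by rewrite xc_line (inj_eq (@lshift_inj _ _)) (negbTE ij) mulr0 addr0.
Qed.

Lemma periodic_character p j : periodic (ix j) (character p).
Proof.
move=> u; rewrite -[e _]scale1r character_line_x mulr1 -mulrN -mulrNz cis_int.
by rewrite mul1r.
Qed.

Lemma pderiv_character_y p j : pderiv (iy j) (character p) = fun=> 0.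
Proof.
apply: has_pderiv_pderiv => u; apply: cderiv_ext (cderiv_cst (character p u)) _ _ => // s.
by rewrite character_line_y.
Qed.

Lemma pderiv_character_x p j :
  pderiv (ix j) (character p) = fun u => (0 +i* (- (2 * pi * (p j)%:~R))) * character p u.
Proof.
apply: has_pderiv_pderiv => u.
have := cderivM (cderiv_cis (- (2 * pi * (p j)%:~R))) (cderiv_cst (character p u)).
move=> H; apply: cderiv_ext H _ _ => s.
  by rewrite character_line_x mulNr.
by rewrite character_line_x mulr0 addr0 mulrA mulNr.
Qed.

Lemma smooth_fourier_arg p F : smooth F -> smooth (fun u => F u * character p u).
Proof. by move=> sF; apply: smooth_mul; [exact: sF|exact: smooth_character]. Qed.

Lemma smooth_fourier_x p F : smooth F -> smooth (fourier_x p F).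
Proof. by move=> sF; apply: smooth_coord_ints; exact: smooth_fourier_arg. Qed.

Lemma pderiv_fourier_y p F j : smooth F ->
  pderiv (iy j) (fourier_x p F) = fourier_x p (pderiv (iy j) F).
Proof.
move=> sF; rewrite /fourier_x pderiv_coord_ints; last exact: smooth_fourier_arg.
  congr (coord_ints _ _ _ _); apply: has_pderiv_pderiv.
  have := has_pderivM (smooth_has_pderiv (iy j) sF) (smooth_has_pderiv (iy j) (smooth_character p)).
  by move/has_pderiv_ext; apply => // u; rewrite pderiv_character_y mulr0 addr0.
by move=> i; rewrite eq_lrshift.
Qed.

Lemma fourier_xD p (c : R[i]) F G : ccont F -> ccont G ->
  fourier_x p (fun u => c * F u + G u) = fun u => c * fourier_x p F u + fourier_x p G u.
Proof.
move=> cF cG; have cc := smooth_ccont (smooth_character p); rewrite /fourier_x.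
have -> : (fun u => (c * F u + G u) * character p u) =
    (fun u => c * (F u * character p u) + G u * character p u).
  by apply/funext => u; rewrite mulrDl mulrA.
rewrite coord_ints_addf; [|by apply: ccontM; [exact: ccont_cst|exact: ccontM]|exact: ccontM].
rewrite (coord_ints_scale (c := fun=> c))//; exact: ccontM.
Qed.

Lemma fourier_x_scale p (c : vec -> R[i]) F : ccont F ->
  (forall u i a, c (upd u (ix i) a) = c u) ->
  fourier_x p (fun u => c u * F u) = fun u => c u * fourier_x p F u.
Proof.
move=> cF ci; rewrite /fourier_x -(coord_ints_scale (c := c)) => [||u i a _]; last exact: ci.
  by congr (coord_ints _ _ _ _); apply/funext => u; rewrite mulrA.
by apply: ccontM => //; exact/smooth_ccont/smooth_character.
Qed.

Lemma yc_upd_x u i a j : yc (upd u (ix i) a) j = yc u j.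
Proof. by rewrite /yc updE eq_rlshift. Qed.

Lemma xc_upd_y u i a j : xc (upd u (iy i) a) j = xc u j.
Proof. by rewrite /xc updE eq_lrshift. Qed.

Lemma fourier_x_pderiv p F j : smooth F -> (forall i, periodic (ix i) F) ->
  fourier_x p (pderiv (ix j) F) = fun u => (0 +i* (2 * pi * (p j)%:~R)) * fourier_x p F u.
Proof.
move=> sF pF; have sc := smooth_character p.
have H := @coord_ints_pderiv R _ n ix (enum 'I_n) j (fun u => F u * character p u)
  (mem_enum _ _) (smooth_fourier_arg p sF) _ (@lshift_inj _ _).
have {H} : fourier_x p (fun u => (0 +i* (- (2 * pi * (p j)%:~R))) * F u + pderiv (ix j) F u) = fun=> 0.
  rewrite -H => [|i _ u]; last by rewrite pF periodic_character.
  rewrite /fourier_x; congr (coord_ints _ _ _ _); apply/esym/has_pderiv_pderiv.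
  have := has_pderivM (smooth_has_pderiv (ix j) sF) (smooth_has_pderiv (ix j) sc).
  by move/has_pderiv_ext; apply => // u; rewrite pderiv_character_x; ring.
rewrite fourier_xD; [|exact: smooth_ccont|exact/smooth_ccont/smooth_pderiv].
move=> H; apply/funext => u; have /(congr1 (fun g : vec -> R[i] => g u)) := H.
move/eqP; rewrite addrC addr_eq0 => /eqP ->; rewrite -mulNr; congr (_ * _).
by apply/eqP; rewrite eq_complex /= oppr0 opprK !eqxx.
Qed.

End WeilBrezin.

Section CoordIntsComp.
Variables (R : realType).

(** Substitution of [L] when it maps the integrated coordinates to one another
    unchanged, and the others arbitrarily. *)
Lemma coord_ints_comp (m m' d : nat) (D : set R) (io : 'I_d -> 'I_m) (io' : 'I_d -> 'I_m') s
    (h : 'rV[R]_m' -> R[i]) (L : 'rV[R]_m -> 'rV[R]_m') u :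
  (forall v i a, i \in s -> L (upd v (io i) a) = upd (L v) (io' i) a) ->
  coord_ints D io s (fun v => h (L v)) u = coord_ints D io' s h (L u).
Proof.
elim: s u => //= i s IH u HL; apply: eq_cint => a _.
rewrite IH => [|v l b ls]; last by apply: HL; rewrite inE ls orbT.
by rewrite HL// mem_head.
Qed.

Lemma upd_translate m (u v : 'rV[R]_m) j a : upd u j a + v = upd (u + v) j (a + v 0 j).
Proof. by apply/rowP => i; rewrite mxE !updE mxE; case: eqVneq => [->|]. Qed.

Lemma coord_ints_periodic_translate (m d : nat) (io : 'I_d -> 'I_m) s (h : 'rV[R]_m -> R[i])
    (v u : 'rV[R]_m) : smooth h -> (forall i, periodic (io i) h) ->
  coord_ints `[0, 1] io s (fun w => h (w + v)) u = coord_ints `[0, 1] io s h (u + v).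
Proof.
move=> sh ph; elim: s u => //= i s IH u; rewrite /coord_int.
set K := coord_ints _ _ _ h.
have sK : smooth K by exact: smooth_coord_ints.
have pK : periodic (io i) K.
  by rewrite /K; elim: s {IH K sK} => [|j s IH] /=; [exact: ph|exact: periodic_coord_int].
rewrite -(@cint01_shift R (fun a => K (upd (u + v) (io i) a)) _ (v 0 (io i)) (cderiv_slice _ (smooth_has_pderiv (io i) sK))).
- by apply: eq_cint => a _; rewrite IH upd_translate.
- exact/ccont_slice/smooth_ccont/smooth_pderiv.
- by move=> a; rewrite upd_line scale1r pK.
Qed.

End CoordIntsComp.

(** * Poisson summation for twisted-periodic functions *)

Section PoissonSummation.
Variables (R : realType) (n k : nat).
Hypothesis k0 : (0 < k)%N.
Local Notation e := (delta_mx 0).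
Local Notation ix := (@lshift n n).
Local Notation iy := (@rshift n n).
Local Notation vec := 'rV[R]_(n + n).
Implicit Types (u : vec) (s : seq 'I_n).

Definition node (b : {ffun 'I_n -> 'I_k}) : vec := row_mx (\row_i ((b i)%:R / k%:R)) 0.

Lemma xc_node b i : xc (node b) i = (b i)%:R / k%:R.
Proof. by rewrite /xc row_mxEl mxE. Qed.

Section Twisted.
Variable G : vec -> R[i].
Hypotheses (sG : smooth G) (pG : forall i, periodic (ix i) G)
  (tG : forall i u, G (u + e (iy i)) = cis (2 * pi * (k%:R * xc u i)) * G u).

(** The product of [G] with [cis (- (2 * pi * (k * xy)))] is periodic in the
    coordinates of [y]. *)
Lemma twisted_int (z : int) i u :
  G (u + z%:~R *: e (iy i)) = cis (2 * pi * (k%:R * (z%:~R * xc u i))) * G u.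
Proof.
pose H v := cis (- (2 * pi * (k%:R * xy v))) * G v.
have pH : periodic (iy i) H.
  move=> v; rewrite /H tG -[e _]scale1r xy_line_y mulrA -cisD; congr (cis _ * _).
  by ring.
have := periodic_int z u pH; rewrite /H xy_line_y => /(congr1 (fun y => cis (2 * pi * (k%:R * (xy u + z%:~R * xc u i))) * y)).
rewrite mulrA -cisD subrr cis0 mul1r => ->; rewrite mulrA -cisD; congr (cis _ * _).
by ring.
Qed.

Definition shifted_kernel M (a : R) : R[i] :=
  \sum_(b < M.*2) cis (2 * pi * (k%:R * ((b%:Z - M%:Z)%:~R * a))).

(** The integers from [-M] to [M-1] are not symmetric around 0, whence the
    phase. *)
Lemma shifted_kernelE M a : shifted_kernel M a = cis (- (2 * pi * k%:R) * a) * dirichlet k M a.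
Proof.
rewrite /shifted_kernel /dirichlet mulr_sumr (reindex_inj rev_ord_inj) /=.
apply: eq_bigr => b _; rewrite -cisD; congr cis.
have -> : (M.*2 - b.+1)%N%:Z = M.*2%:Z - b.+1%:Z by rewrite subzn.
have E2 : M.*2%:R = M%:R + M%:R :> R by rewrite -addnn natrD.
by rewrite !intrB -!pmulrn !natrM E2 -natr1; ring.
Qed.

Lemma smooth_shifted_kernel M j : smooth (fun u : vec => shifted_kernel M (xc u j)).
Proof.
apply: smooth_sum => b _.
have -> : (fun u : vec => cis (2 * pi * (k%:R * ((b%:Z - M%:Z)%:~R * xc u j)))) =
    (fun u => cis ((2 * pi * k%:R * (b%:Z - M%:Z)%:~R) * u 0 (ix j))).
  by apply/funext => u; congr cis; rewrite /xc; ring.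
exact: smooth_cis_coord.
Qed.

Variable p : 'I_n -> int.

Definition box_integrand M s u := G u * character p u * \prod_(j <- s) shifted_kernel M (xc u j).

Lemma smooth_box_integrand M s : smooth (box_integrand M s).
Proof.
apply: smooth_mul; first exact: smooth_fourier_arg.
by apply: smooth_prod => j _; exact: smooth_shifted_kernel.
Qed.

Lemma box_integrand_line M s j z u :
  box_integrand M s (u + z%:~R *: e (iy j)) =
  cis (2 * pi * (k%:R * (z%:~R * xc u j))) * box_integrand M s u.
Proof.
rewrite /box_integrand twisted_int character_line_y -!mulrA; congr (_ * (_ * (_ * _))).
by apply: eq_bigr => i _; rewrite xc_line eq_lrshift mulr0 addr0.
Qed.

Local Notation Ax := (coord_ints `[0, 1] ix (enum 'I_n)).

(** Integrating over all translates of the unit cube in [y] multiplies the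
    integrand by a Dirichlet kernel in [x], because translations in [y] act on
    [G] by characters in [x]. *)
Lemma coord_ints_box_fourier M s : uniq s ->
  coord_ints (box M) iy s (fourier_x p G) =
  coord_ints `[0, 1] iy s (Ax (box_integrand M s)).
Proof.
elim: s => [_|j s IH /= /andP[js us]].
  by rewrite /= /fourier_x; congr (coord_ints _ _ _ _); apply/funext => u; rewrite /box_integrand big_nil mulr1.
rewrite IH//; set A := coord_ints _ _ _ _.
have sA : smooth A by apply: smooth_coord_ints; apply: smooth_coord_ints; exact: smooth_box_integrand.
pose ph (b : 'I_M.*2) u := cis (2 * pi * (k%:R * ((b%:Z - M%:Z)%:~R * xc u j))).
pose Ab b := coord_ints `[0, 1] iy s (Ax (fun u => ph b u * box_integrand M s u)).
have sph b : ccont (fun u => ph b u * box_integrand M s u).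
  apply: ccontM; last exact/smooth_ccont/smooth_box_integrand.
  have -> : ph b = (fun u => cis ((2 * pi * k%:R * (b%:Z - M%:Z)%:~R) * u 0 (ix j))).
    by apply/funext => u; congr cis; rewrite /xc; ring.
  exact/smooth_ccont/smooth_cis_coord.
have cAb b : ccont (Ax (fun u => ph b u * box_integrand M s u)) by exact: ccont_coord_ints.
transitivity (coord_int `[0, 1] (iy j) (fun u => \sum_b Ab b u)); last first.
  rewrite /Ab -coord_ints_bigsum => [|b _]; last exact: cAb.
  congr (coord_int _ _ (coord_ints _ _ _ _)).
  rewrite -coord_ints_bigsum => [|b _]; last exact: sph.
  congr (coord_ints _ _ _ _); apply/funext => u.
  by rewrite [RHS]/box_integrand big_cons mulrCA -/(box_integrand M s u) mulr_suml.
rewrite coord_int_bigsum => [|b _]; last by exact: ccont_coord_ints.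
apply/funext => u; rewrite /coord_int.
rewrite (cint_box_sum M (cderiv_slice u (smooth_has_pderiv (iy j) sA))); last first.
  exact/ccont_slice/smooth_ccont/smooth_pderiv.
apply: eq_bigr => b _; apply: eq_cint => a _; rewrite upd_line.
have -> : (b%:R - M%:R : R) = (b%:Z - M%:Z)%:~R by rewrite intrB -!pmulrn.
set z := (_ - _)%R; move: (upd u (iy j) a) => v.
rewrite /A /Ab -(@coord_ints_comp R _ _ n `[0, 1] iy iy s _ (fun v => v + z%:~R *: e (iy j))); last first.
  move=> w i c is_; rewrite upd_translate !mxE eqxx /= (inj_eq (@rshift_inj _ _)).
  by case: eqVneq is_ js => [->|_ _ _] => [-> //|]; rewrite mulr0 addr0.
congr (coord_ints _ _ _ _ _); apply/funext => w.
rewrite -(@coord_ints_comp R _ _ n `[0, 1] ix ix _ _ (fun v => v + z%:~R *: e (iy j))); last first.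
  by move=> x i c _; rewrite upd_translate !mxE eqxx /= eq_lrshift mulr0 addr0.
by congr (coord_ints _ _ _ _ _); apply/funext => x; exact: box_integrand_line.
Qed.

Variable C : R.
Hypothesis dG : dominated iy (enum 'I_n) (fourier_x p G) C.

(** As the box grows, the left-hand side is approximated by
    [coord_ints_box_fourier], thanks to the decay of the Fourier coefficient.
    There the Dirichlet kernels converge to averages over the points of order
    [k], uniformly in [y]. *)
Lemma integral_fourier_x u :
  coord_ints setT iy (enum 'I_n) (fourier_x p G) u =
  (k%:R ^+ n)^-1 * \sum_b character p (node b) * coord_ints `[0, 1] iy (enum 'I_n) G (node b).
Proof.
(* The additional characters of frequency [k] are the phases of
   [shifted_kernelE]; they equal 1 at the points of order [k]. *)
pose h u := G u * character p u * \prod_(j <- enum 'I_n) cis (- (2 * pi * k%:R) * u 0 (ix j)).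
have sh : smooth h.
  apply: smooth_mul; first exact: smooth_fourier_arg.
  by apply: smooth_prod => j _; exact: smooth_cis_coord.
have phx i : periodic (ix i) h.
  move=> v; rewrite /h pG periodic_character; congr (_ * _); apply: eq_bigr => j _.
  rewrite !mxE eqxx /= (inj_eq (@lshift_inj _ _)); case: eqVneq => _; last by rewrite addr0.
  rewrite mulrDr cisD mulr1; have -> : - (2 * pi * k%:R) = 2 * pi * (- k%:Z)%:~R :> R by rewrite mulrNz; ring.
  by rewrite cis_int mulr1.
pose W : set vec := [set v | forall j, 0 <= v 0 (iy j) <= 1].
have sW : stable_set ix W by move=> v j a Wv i; rewrite updE eq_rlshift; exact: Wv.
have [B B0 hB] := smooth_bound_compact (3 * size (enum 'I_n)) (@compact_unit_cube R (n + n)) sh.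
have bW : bounded_on W (3 * size (enum 'I_n)) h B.
  move=> l v lr Wv; have [v' [E v01 vv']] := reduce_mod1 [seq ix i | i <- enum 'I_n] v.
  rewrite -E => [|_ /mapP[i _ ->]]; last exact: periodic_pderivs.
  apply: hB => // i /=; case: (split_ordP i) => j ->.
    by apply: v01; apply: map_f; rewrite mem_enum.
  by rewrite vv' ?Wv//; apply/negP => /mapP[i' _ /eqP]; rewrite eq_rlshift.
have ch := smooth_ccont sh.
have [C2 C20 HC2] := dir_ops_rate R (@lshift_inj n n) k0 (enum 'I_n).
have [C1 C10 HC1] := coord_ints_box_approx (@rshift_inj n n) (enum_uniq _) dG.
set Y := coord_ints `[0, 1] iy (enum 'I_n).
have cavg s : ccont (avg_ops ix k s h).
  elim: s => // j s IH; apply: ccontM; first exact: ccont_cst.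
  apply: ccont_sum => i _; apply: (ccont_comp (h := fun u => upd u (ix j) _)) IH.
  exact: continuous_upd1.
have Eu : coord_ints setT iy (enum 'I_n) (fourier_x p G) u = Y (avg_ops ix k (enum 'I_n) h) u.
  apply/eqP; rewrite -subr_eq0; apply/eqP/cabs_eq0/le_anti; rewrite cabs_ge0 andbT.
  apply/ler_addgt0Pr => eps eps0; rewrite add0r.
  (* The sum of the constants of the two errors, plus 1 to make it positive. *)
  pose c := C1 + 2 ^+ n * (C2 * B) + 1.
  have c0 : 0 < c by rewrite ltr_pwDr// addr_ge0// mulr_ge0// ?exprn_ge0// mulr_ge0.
  have ec : 0 < eps / c by exact: divr_gt0.
  have key M : (0 < M)%N -> cabs (coord_ints setT iy (enum 'I_n) (fourier_x p G) u -
      Y (avg_ops ix k (enum 'I_n) h) u) <= C1 * weight_tail R M + 2 ^+ n * (C2 * B / M%:R).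
    move=> M0; rewrite -(subrKA (coord_ints (box M) iy (enum 'I_n) (fourier_x p G) u)).
    apply: le_trans (cabsD _ _) _; apply: lerD; first exact: HC1.
    rewrite coord_ints_box_fourier ?enum_uniq//.
    have -> : Ax (box_integrand M (enum 'I_n)) = dir_ops ix k M (enum 'I_n) h.
      rewrite (dir_ops_coord_ints (@lshift_inj n n))//; last exact: enum_uniq.
      congr (coord_ints _ _ _ _); apply/funext => v; rewrite /box_integrand /h -[RHS]mulrA -big_split /=.
      by congr (_ * _); apply: eq_bigr => j _; exact: shifted_kernelE.
    have cd : ccont (dir_ops ix k M (enum 'I_n) h) by exact/smooth_ccont/smooth_dir_ops.
    have -> : Y (dir_ops ix k M (enum 'I_n) h) u - Y (avg_ops ix k (enum 'I_n) h) u =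
        Y (fun v => dir_ops ix k M (enum 'I_n) h v - avg_ops ix k (enum 'I_n) h v) u.
      rewrite (_ : (fun v => _ - _) = (fun v => dir_ops ix k M (enum 'I_n) h v + (-1) * avg_ops ix k (enum 'I_n) h v)).
        rewrite /Y coord_ints_addf//; last by apply: ccontM => //; exact: ccont_cst.
        by rewrite (coord_ints_scale (c := fun=> -1))// mulN1r.
      by apply/funext => v; rewrite mulN1r.
    have -> : (2 : R) ^+ n = 2 ^+ size (enum 'I_n) by rewrite size_enum_ord.
    apply: cabs_coord_ints_cc_le => [|v _ v01]; first exact: ccontB.
    apply: (HC2 W h B M) => //.
    by move=> j; apply: v01; rewrite mem_enum.
  have [M M0 HM] := weight_tail_cvg0 ec.
  have [M2 HM2] : exists M2 : nat, c / eps < M2%:R.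
    by exists (Num.truncn (c / eps)).+1; exact: truncnS_gt.
  have M20 : (0 < M2)%N.
    by rewrite -(ltr_nat R); apply: lt_trans HM2; rewrite divr_gt0.
  have M3 : (0 < maxn M M2)%N by rewrite leq_max M0.
  apply: le_trans (key _ M3) _.
  have t1 : weight_tail R (maxn M M2) <= eps / c.
    apply: le_trans HM; rewrite lerD2l lerN2 ler_pM2l// le_atan// ler_nat.
    exact: leq_maxl.
  have t2 : (maxn M M2)%:R^-1 <= eps / c.
    rewrite -[eps / c]invf_div lef_pV2 ?posrE ?divr_gt0 ?ltr0n//.
    by apply: le_trans (ltW HM2) _; rewrite ler_nat leq_maxr.
  have -> : eps = (C1 + 2 ^+ n * (C2 * B) + 1) * (eps / c) by rewrite -/c mulrCA divff ?mulr1 ?gt_eqF.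
  rewrite !mulrDl -[leLHS]addr0; apply: lerD; last by rewrite mul1r ltW.
  apply: lerD; first by rewrite ler_wpM2l.
  by rewrite mulrA ler_wpM2l// mulr_ge0// ?exprn_ge0// mulr_ge0.
rewrite Eu.
pose L (b : {ffun 'I_n -> 'I_k}) (v : vec) : vec := row_mx (\row_i ((b i)%:R / k%:R)) (rsubmx v).
have Lx b v j : L b v 0 (ix j) = (b j)%:R / k%:R by rewrite row_mxEl mxE.
have Ly b v j : L b v 0 (iy j) = v 0 (iy j) by rewrite row_mxEr mxE.
have hL b v : h (L b v) = character p (node b) * G (L b v).
  rewrite /h big1 => [|j _].
    rewrite mulr1 mulrC; congr (_ * _); rewrite /character; congr (cis (- (_ * _))).
    by apply: eq_bigr => i _; rewrite xc_node /xc Lx.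
  rewrite Lx; have -> : - (2 * pi * k%:R) * ((b j)%:R / k%:R) = 2 * pi * (- (b j)%:Z)%:~R :> R.
    by rewrite mulrNz; field; rewrite pnatr_eq0 -lt0n.
  by rewrite cis_int.
have -> : avg_ops ix k (enum 'I_n) h = fun v => (k%:R ^+ n)^-1 * \sum_b character p (node b) * G (L b v).
  apply/funext => v; rewrite (@avg_opsE R _ n ix (@lshift_inj n n) k k0 h v (fun b => L b v)).
  - by congr (_ * _); apply: eq_bigr => b _; exact: hL.
  - by move=> b j; exact: Lx.
  - move=> b i ni; case: (split_ordP i) ni => j -> ni.
      by have := ni j; rewrite eqxx.
    by rewrite Ly.
have cL b : ccont (fun v => G (L b v)).
  apply: (ccont_comp (h := L b)) (smooth_ccont sG); apply: continuous_rV => i.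
  case: (split_ordP i) => j ->.
    by under eq_fun do rewrite Lx; exact: cst_continuous.
  by under eq_fun do rewrite Ly; exact: coord_continuous.
have cc b : ccont (fun v => character p (node b) * G (L b v)) by apply: ccontM => //; exact: ccont_cst.
rewrite /Y (coord_ints_scale (c := fun=> (k%:R ^+ n)^-1))//; last by apply: ccont_sum => b _; exact: cc.
congr (_ * _); rewrite coord_ints_bigsum => [|b _]; last exact: cc.
apply: eq_bigr => b _; rewrite (coord_ints_scale (c := fun=> character p (node b)))//; congr (_ * _).
rewrite (@coord_ints_comp R _ _ n `[0, 1] iy iy _ _ (L b)) => [|v i a _].
  apply: coord_ints_indep => [i|l nl]; first by rewrite mem_enum.
  case: (split_ordP l) nl => j -> nl.
    by rewrite Lx -(xc_node b j).
  by have := nl j; rewrite eqxx.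
apply/rowP => l; rewrite updE; case: (split_ordP l) => j ->.
  by rewrite !Lx eq_lrshift.
by rewrite !Ly updE.
Qed.

End Twisted.
End PoissonSummation.

(** * The Weil-Brezin transform *)

Section WeilBrezinTransform.
Variables (R : realType) (n k : nat).
Hypothesis k0 : (0 < k)%N.
Local Notation e := (delta_mx 0).
Local Notation ix := (@lshift n n).
Local Notation iy := (@rshift n n).
Local Notation vec := 'rV[R]_(n + n).
Local Notation Z := (Zkn n k).
Implicit Types (t : section R n k) (u : vec) (m : Z).
Local Notation w := (@cauchy_weight R).

Let kR : (k%:R : R) != 0. Proof. by rewrite pnatr_eq0 -lt0n. Qed.

Definition wb_shift m : vec := row_mx 0 (hbar R k *: \row_i (m i)%:R).
Definition freq m : 'I_n -> int := fun i => (m i : nat)%:Z.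

Lemma xcD u v i : xc (u + v) i = xc u i + xc v i.
Proof. by rewrite /xc mxE. Qed.

Lemma ycD u v i : yc (u + v) i = yc u i + yc v i.
Proof. by rewrite /yc mxE. Qed.

Lemma xc_row (x y : 'rV[R]_n) i : xc (row_mx x y) i = x 0 i.
Proof. by rewrite /xc row_mxEl. Qed.

Lemma yc_row (x y : 'rV[R]_n) i : yc (row_mx x y) i = y 0 i.
Proof. by rewrite /yc row_mxEr. Qed.

Lemma yc_shift m i : yc (wb_shift m) i = (m i)%:R / k%:R.
Proof. by rewrite /yc row_mxEr !mxE mulrC. Qed.

Lemma xc_shift m i : xc (wb_shift m) i = 0.
Proof. by rewrite /xc row_mxEl mxE. Qed.

Lemma vecP u (v : vec) : (forall i, xc u i = xc v i) -> (forall i, yc u i = yc v i) -> u = v.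
Proof.
move=> hx hy; apply/rowP => l; case: (split_ordP l) => i ->.
  exact: hx.
exact: hy.
Qed.

(** The coefficient of index [m] is evaluated at a translate by [m / k]; in
    the gauge it is a plain Fourier coefficient. *)
Lemma weil_brezin_fourier t m y :
  weil_brezin t m y = fourier_x (freq m) (gauge k t) (row_mx 0 y + wb_shift m).
Proof.
rewrite /weil_brezin /fourier_x add_row_mx addr0.
set v := row_mx _ _.
rewrite -(@cintegral_coord_ints _ _ _ `[0, 1] ix (fun u => gauge k t u * character (freq m) u) v
  (fun x => row_mx x (y + hbar R k *: \row_i (m i)%:R))).
- congr (cintegral _ _); apply/funext => x; rewrite tildeE; congr (_ * cis (- (_ * _))).
  by apply: eq_bigr => i _; rewrite /xc row_mxEl.
- by move=> x i; rewrite row_mxEl.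
- move=> x l nl; case: (split_ordP l) nl => i -> nl.
    by have := nl i; rewrite eqxx.
  by rewrite /v !row_mxEr.
Qed.

Lemma fourier_x_indep p (F : vec -> R[i]) u v : (forall i, yc u i = yc v i) -> fourier_x p F u = fourier_x p F v.
Proof.
move=> uv; apply: coord_ints_indep => [i|l nl]; first by rewrite mem_enum.
case: (split_ordP l) nl => i -> nl.
  by have := nl i; rewrite eqxx.
exact: uv.
Qed.

Lemma weil_brezin_rsub t m u :
  weil_brezin t m (rsubmx u) = fourier_x (freq m) (gauge k t) (u + wb_shift m).
Proof.
rewrite weil_brezin_fourier; apply: fourier_x_indep => i.
by rewrite /yc [LHS]mxE [RHS]mxE row_mxEr mxE.
Qed.

Lemma fourier_x_translate p (F : vec -> R[i]) (v u : vec) : (forall i, xc v i = 0) ->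
  fourier_x p (fun w => F (w + v)) u = fourier_x p F (u + v).
Proof.
move=> v0; rewrite /fourier_x -(@coord_ints_comp R _ _ n `[0, 1] ix ix _ _ (fun w => w + v)).
  congr (coord_ints _ _ _ _ _); apply/funext => x; congr (_ * cis (- (_ * _))).
  by apply: eq_bigr => i _; rewrite /xc mxE -/(xc v i) v0 addr0.
by move=> x i a _; rewrite upd_translate -/(xc v i) v0 addr0.
Qed.

(** In the gauge the covariant derivative along [y] is a partial derivative,
    and it commutes with Fourier coefficients in [x]. *)
Lemma smooth_weil_brezin_pderiv t m : smooth (weil_brezin t m) /\
  forall j, pderiv j (weil_brezin t m) = weil_brezin (nabla (iy j) t) m.
Proof.
have sg := smooth_gauge k (qper_smooth t).
have [||j y s||sF dF] := @smooth_comp R n (n + n) (fun y => row_mx 0 y + wb_shift m) (fun j => iy j)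
    (fun _ _ => 1) (fourier_x (freq m) (gauge k t)).
- apply: continuous_rV => l; case: (split_ordP l) => i ->.
    by under eq_fun do rewrite mxE row_mxEl mxE; exact: cst_continuous.
  under eq_fun do rewrite mxE row_mxEr.
  move=> y; apply: (@continuousD _ _ _ (fun y : 'rV[R]_n => y 0 i) (fun=> wb_shift m 0 (iy i))).
    exact: coord_continuous.
  exact: cst_continuous.
- by move=> j; exact: smooth_const.
- apply: vecP => i.
    by rewrite xc_line !xcD !xc_row eq_lrshift mulr0 addr0.
  by rewrite yc_line !ycD !yc_row !mxE eqxx mulr1 (inj_eq (@rshift_inj _ _)) addrAC.
- exact: smooth_fourier_x.
have E : weil_brezin t m = fun y => fourier_x (freq m) (gauge k t) (row_mx 0 y + wb_shift m).
  by apply/funext => y; rewrite weil_brezin_fourier.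
rewrite E; split=> [|j]; first exact: sF.
rewrite dF; apply/funext => y; rewrite mul1r pderiv_fourier_y; last exact: sg.
by rewrite weil_brezin_fourier gauge_nabla_y.
Qed.

Lemma smooth_weil_brezin t m : smooth (weil_brezin t m).
Proof. by have [] := smooth_weil_brezin_pderiv t m. Qed.

Lemma ccont_gauge t : ccont (gauge k t).
Proof. exact/smooth_ccont/smooth_gauge/qper_smooth. Qed.

Lemma weil_brezinD (c : R[i]) t t' m y :
  weil_brezin (c *: t + t') m y = c * weil_brezin t m y + weil_brezin t' m y.
Proof. by rewrite !weil_brezin_fourier gaugeD fourier_xD//; exact: ccont_gauge. Qed.

(** Integration by parts turns the derivative into the frequency [m], and the
    connection form contributes [y + m / k]; the two frequencies cancel. *)
Lemma weil_brezin_nabla_x t m i y : weil_brezin (nabla (ix i) t) m y =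
  (0 +i* (- (2 * (k%:R * pi) * y 0 i))) * weil_brezin t m y.
Proof.
rewrite !weil_brezin_fourier gauge_nabla_x.
have sg := smooth_gauge k (qper_smooth t).
have -> : (fun u => pderiv (ix i) (gauge k t) u - (0 +i* (2 * (k%:R * pi))) * (yc u i)%:C * gauge k t u) =
    (fun u => (- (0 +i* (2 * (k%:R * pi)))) * ((yc u i)%:C * gauge k t u) + pderiv (ix i) (gauge k t) u).
  by apply/funext => u; ring.
rewrite fourier_xD; last exact/smooth_ccont/smooth_pderiv; last first.
  by apply: ccontM; [exact/smooth_ccont/smooth_yc|exact: ccont_gauge].
rewrite (@fourier_x_scale R n _ (fun u => (yc u i)%:C)); last first.
- by move=> u j a; rewrite yc_upd_x.
- exact: ccont_gauge.
rewrite fourier_x_pderiv//; last exact: gauge_period_x.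
rewrite mulrA -mulrDl; congr (_ * _).
rewrite [yc _ i]mxE row_mxEr -/(yc _ i) yc_shift /freq.
apply/eqP; rewrite eq_complex /= !(mulr0, mul0r, mulrN1, mulNr, oppr0, addr0, subr0, add0r) eqxx /=; apply/eqP.
by rewrite -pmulrn; field.
Qed.

Lemma cabs_gauge (F : vec -> R[i]) u : cabs (gauge k F u) = cabs (F u).
Proof. by rewrite cabsM cabs_cis mul1r. Qed.

(** The multipliers have modulus 1, so that the modulus descends to the torus. *)
Lemma cabs_section_le t (B : R) :
  (forall u, (forall j, 0 <= u 0 j <= 1) -> cabs (t u) <= B) -> forall u, cabs (t u) <= B.
Proof.
move=> tB u; have [v [E v01 _]] := reduce_mod1 (enum 'I_(n + n)) u.
have := E (fun u => (cabs (t u))%:C) => /(_ _)/(congr1 (@complex.Re R)) /= <-.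
  by apply: tB => j; apply: v01; rewrite mem_enum.
by move=> j _ x; rewrite section_period cabsM cabs_cis mul1r.
Qed.

Lemma section_bounded t : exists2 B : R, 0 <= B & forall u, cabs (t u) <= B.
Proof.
have [B B0 hB] := smooth_bound_compact 0 (@compact_unit_cube R (n + n)) (qper_smooth t).
by exists B => //; apply: cabs_section_le => u u01; exact: (hB [::]).
Qed.

Lemma cabs_weil_brezin_le t B m y : (forall u, cabs (t u) <= B) -> cabs (weil_brezin t m y) <= 2 ^+ n * B.
Proof.
move=> tB; rewrite weil_brezin_fourier.
have -> : (2 : R) ^+ n = 2 ^+ size (enum 'I_n) by rewrite size_enum_ord.
apply: cabs_coord_ints_le => [|v _]; first by apply: ccontM; [exact: ccont_gauge|exact/smooth_ccont/smooth_character].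
by rewrite cabsM cabs_cis mulr1 cabs_gauge.
Qed.

(** Covariant derivatives along [x] multiply the coefficients by
    [- 2 * pi * k * y] times the imaginary unit; this operator multiplies them
    by [1 + y ^+ 2]. *)
Definition gain_weight i t : section R n k :=
  (((2 * (k%:R * pi)) ^- 2)%:C * -1) *: nabla (ix i) (nabla (ix i) t) + t.

Lemma weil_brezin_gain i t m y :
  weil_brezin (gain_weight i t) m y = (1 + y 0 i ^+ 2)%:C * weil_brezin t m y.
Proof.
rewrite weil_brezinD !weil_brezin_nabla_x mulrA mulrA -[X in _ + X]mul1r -mulrDl; congr (_ * _).
apply/eqP; rewrite eq_complex /= !(mulr0, mul0r, mulrN1, mulNr, oppr0, addr0, subr0, add0r) eqxx andbT; apply/eqP.
have p0 : (pi : R) != 0 by rewrite gt_eqF// pi_gt0.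
have a0 : 2 * (k%:R * pi) != 0 :> R by rewrite !mulf_neq0.
by move: (2 * (k%:R * pi)) a0 => a a0; field.
Qed.

(** The coefficients of any section are bounded; applied to the section after
    [gain_weight] in all coordinates, this bound becomes decay. *)
Lemma weil_brezin_decay t m : exists2 C : R, 0 <= C &
  forall y, cabs (weil_brezin t m y) <= C * \prod_(i <- enum 'I_n) w (y 0 i).
Proof.
have [B B0 hB] := section_bounded (foldr gain_weight t (enum 'I_n)).
exists (2 ^+ n * B) => [|y]; first by rewrite mulr_ge0// exprn_ge0.
have E s : weil_brezin (foldr gain_weight t s) m y = (\prod_(i <- s) (1 + y 0 i ^+ 2))%:C * weil_brezin t m y.
  elim: s => [|i s IH] /=; first by rewrite big_nil mul1r.
  by rewrite weil_brezin_gain IH big_cons mulrA -rmorphM.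
have := cabs_weil_brezin_le m y hB; rewrite E cabsM cabs_real.
have P0 : 0 < \prod_(i <- enum 'I_n) (1 + y 0 i ^+ 2).
  by apply: prodr_gt0 => i _; rewrite ltr_pwDl// sqr_ge0.
rewrite gtr0_norm// prodfV -ler_pdivlMl// mulrC; exact.
Qed.

Lemma dominated_weil_brezin t m : exists2 C : R, 0 <= C &
  dominated id (enum 'I_n) (weil_brezin t m) C.
Proof.
have [C C0 hC] := weil_brezin_decay t m; exists C => //; split=> //.
exact/smooth_ccont/smooth_weil_brezin.
Qed.

(** ** Restriction to the fibres over the points of order [k] *)

(** [fiber b] moves a point, along [x], into the fibre over [b / k]. There the
    gauge is periodic in [y] as well. *)
Definition fiber (b : Z) u : vec := row_mx (\row_i ((b i)%:R / k%:R)) (rsubmx u).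

Lemma xc_fiber b u i : xc (fiber b u) i = (b i)%:R / k%:R.
Proof. by rewrite /xc row_mxEl mxE. Qed.

Lemma yc_fiber b u i : yc (fiber b u) i = yc u i.
Proof. by rewrite /yc row_mxEr mxE. Qed.

Lemma smooth_fiber b (F : vec -> R[i]) : smooth F -> smooth (fun u => F (fiber b u)).
Proof.
move=> sF; have [||j u s||//] := @smooth_comp R (n + n) (n + n) (fiber b) id (fun j _ => (n <= j)%:R) F.
- apply: continuous_rV => l; case: (split_ordP l) => i ->.
    by under eq_fun do rewrite -/(xc _ i) xc_fiber; exact: cst_continuous.
  by under eq_fun do rewrite -/(yc _ i) yc_fiber; exact: coord_continuous.
- by move=> j; exact: smooth_const.
- case: (split_ordP j) => i ->.
    have -> : (n <= ix i)%N = false by apply/negbTE; rewrite -ltnNge /=; exact: ltn_ord.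
    rewrite mulr0 scale0r addr0.
    by apply: vecP => l; rewrite ?xc_fiber ?yc_fiber// yc_line eq_rlshift mulr0 addr0.
  rewrite leq_addr mulr1.
  by apply: vecP => l; rewrite ?xc_line ?yc_line ?xc_fiber ?yc_fiber ?yc_line ?eq_lrshift ?mulr0 ?addr0.
- exact: sF.
Qed.

Lemma fiber_upd b u i a : fiber b (upd u (iy i) a) = upd (fiber b u) (iy i) a.
Proof.
apply: vecP => l; first by rewrite xc_upd_y !xc_fiber.
by rewrite yc_fiber /yc !updE -/(yc (fiber b u) l) yc_fiber.
Qed.

Lemma fiber_node b : fiber b (node R b) = node R b.
Proof. by apply: vecP => i; rewrite ?xc_fiber ?xc_node ?yc_fiber. Qed.

Lemma cis_gridpoint (b : Z) i (z : int) : cis (2 * pi * (k%:R * (z%:~R * ((b i)%:R / k%:R)))) = 1 :> R[i].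
Proof.
have -> : 2 * pi * (k%:R * (z%:~R * ((b i)%:R / k%:R))) = 2 * pi * (z * (b i)%:Z)%:~R :> R.
  by rewrite intrM -pmulrn; field.
exact: cis_int.
Qed.

Lemma periodic_gauge_fiber b t i : periodic (iy i) (fun u => gauge k t (fiber b u)).
Proof.
move=> u; have -> : fiber b (u + e (iy i)) = fiber b u + e (iy i).
  rewrite -[e _]scale1r; apply: vecP => l; rewrite ?xc_line ?yc_line ?xc_fiber ?yc_fiber ?yc_line//.
  by rewrite eq_lrshift mulr0 addr0.
rewrite gauge_period_y xc_fiber -[(b i)%:R / _]mul1r -[1]/(1%:~R).
by rewrite cis_gridpoint mul1r.
Qed.

(** The mean in [y] of the gauged section over the point [b / k]. *)
Definition fiber_mean t (b : Z) : R[i] := coord_ints `[0, 1] iy (enum 'I_n) (gauge k t) (node R b).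

Lemma fiber_mean_fiber t b : fiber_mean t b =
  coord_ints `[0, 1] iy (enum 'I_n) (fun u => gauge k t (fiber b u)) (node R b).
Proof.
rewrite (@coord_ints_comp R _ _ n `[0, 1] iy iy _ _ (fiber b)) ?fiber_node// => u i a _.
exact: fiber_upd.
Qed.

Definition character_node m (b : Z) : R[i] := cis (- (2 * pi * \sum_i (m i)%:R * ((b i)%:R / k%:R))).

(** Poisson summation for the Weil-Brezin coefficients. It expresses the
    functional that defines [sigma_check] by integrals over compact fibres,
    where functions and derivatives of sections are easy to handle. *)
Lemma integral_weil_brezin t m : cintegral setT (weil_brezin t m) =
  (k%:R ^+ n)^-1 * \sum_b character_node m b * fiber_mean t b.
Proof.
pose G u := gauge k t (u + wb_shift m).
have sg := smooth_gauge k (qper_smooth t).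
have sG : smooth G.
  have [||j u s||//] := @smooth_comp R (n + n) (n + n) (fun u => u + wb_shift m) id (fun _ _ => 1) (gauge k t).
  - by move=> u; exact: (continuousD (@cvg_id _ _) (cvg_cst _)).
  - by move=> j; exact: smooth_const.
  - by rewrite mulr1 addrAC.
  - exact: sg.
have FG u : fourier_x (freq m) G u = weil_brezin t m (rsubmx u).
  by rewrite fourier_x_translate ?weil_brezin_rsub//; exact: xc_shift.
have [C C0 hC] := weil_brezin_decay t m.
have dG : dominated iy (enum 'I_n) (fourier_x (freq m) G) C.
  split; first exact/smooth_ccont/smooth_fourier_x.
  move=> u; rewrite FG; apply: le_trans (hC _) _; rewrite ler_wpM2l//.
  by rewrite le_eqVlt; apply/orP; left; apply/eqP; apply: eq_bigr => i _; rewrite mxE.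
have -> : cintegral setT (weil_brezin t m) = coord_ints setT iy (enum 'I_n) (fourier_x (freq m) G) 0.
  rewrite -(@cintegral_coord_ints _ _ _ setT iy (fourier_x (freq m) G) 0 (fun y => row_mx 0 y)).
  - by congr (cintegral _ _); apply/funext => y; rewrite FG row_mxKr.
  - by move=> y i; rewrite row_mxEr.
  - move=> y l nl; case: (split_ordP l) nl => i -> nl.
      by rewrite !row_mxEl !mxE.
    by have := nl i; rewrite eqxx.
rewrite (integral_fourier_x k0 sG _ _ dG).
- congr (_ * _); apply: eq_bigr => b _; congr (_ * _).
    by congr (cis (- (_ * _))); apply: eq_bigr => i _; rewrite xc_node.
  rewrite fiber_mean_fiber.
  have -> : coord_ints `[0, 1] iy (enum 'I_n) G (node R b) =
      coord_ints `[0, 1] iy (enum 'I_n) (fun u => G (fiber b u)) (node R b).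
    by rewrite (@coord_ints_comp R _ _ n `[0, 1] iy iy _ _ (fiber b)) ?fiber_node// => u i a _; exact: fiber_upd.
  have -> : (fun u => G (fiber b u)) = (fun u => gauge k t (fiber b (u + wb_shift m))).
    apply/funext => u; congr (gauge k t _); apply: vecP => l.
      by rewrite xc_fiber [xc _ _]mxE -/(xc _ l) -/(xc _ l) xc_fiber xc_shift addr0.
    by rewrite yc_fiber [yc _ _]mxE [RHS]mxE -/(yc _ l) -/(yc _ l) yc_fiber.
  rewrite (@coord_ints_periodic_translate R _ n iy _ (fun u => gauge k t (fiber b u))).
  - apply: coord_ints_indep => [i|l nl]; first by rewrite mem_enum.
    case: (split_ordP l) nl => i -> nl.
      by rewrite mxE -/(xc (wb_shift m) i) xc_shift addr0.
    by have := nl i; rewrite eqxx.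
  - exact: smooth_fiber.
  - exact: periodic_gauge_fiber.
- by move=> i u; rewrite /G addrAC gauge_period_x.
- move=> i u; rewrite /G addrAC gauge_period_y; congr (cis (_ * (_ * _)) * _).
  by rewrite [LHS]mxE -/(xc _ i) -/(xc _ i) xc_shift addr0.
Qed.

(** The integral of a derivative over a period. *)
Lemma fiber_mean_nabla_y t i b : fiber_mean (nabla (iy i) t) b = 0.
Proof.
rewrite fiber_mean_fiber.
pose h u := gauge k t (fiber b u).
have sg := smooth_gauge k (qper_smooth t).
have -> : (fun u => gauge k (nabla (iy i) t) (fiber b u)) = pderiv (iy i) h.
  apply/esym/has_pderiv_pderiv => u.
  have := smooth_has_pderiv (iy i) sg (fiber b u) => H.
  have Ef s : fiber b (u + s *: e (iy i)) = fiber b u + s *: e (iy i).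
    by apply: vecP => l; rewrite ?xc_line ?yc_line ?xc_fiber ?yc_fiber ?yc_line// eq_lrshift mulr0 addr0.
  apply: cderiv_ext H _ _ => s; first by rewrite /h Ef.
  by rewrite Ef gauge_nabla_y.
rewrite (@coord_ints_pderiv R _ n iy); first by [].
- by rewrite mem_enum.
- exact: smooth_fiber.
- by move=> j _; exact: periodic_gauge_fiber.
- exact: rshift_inj.
Qed.

Lemma cabs_fiber_mean_le t B b : (forall u, cabs (t u) <= B) -> cabs (fiber_mean t b) <= 2 ^+ n * B.
Proof.
move=> tB.
have -> : (2 : R) ^+ n = 2 ^+ size (enum 'I_n) by rewrite size_enum_ord.
by apply: cabs_coord_ints_le => [|v _]; [exact: ccont_gauge|rewrite cabs_gauge].
Qed.

Lemma fiber_meanD (c : R[i]) t t' b : fiber_mean (c *: t + t') b = c * fiber_mean t b + fiber_mean t' b.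
Proof.
rewrite /fiber_mean gaugeD coord_ints_addf; [|by apply: ccontM; [exact: ccont_cst|exact: ccont_gauge]|exact: ccont_gauge].
by rewrite (coord_ints_scale (c := fun=> c))//; exact: ccont_gauge.
Qed.

End WeilBrezinTransform.

(** * Cutoff functions *)

Section Cutoff.
Variable R : realType.
Implicit Types (p : {poly R}) (x : R).

(** The functions that vanish to infinite order at 0 and are smooth for that
    reason. Polynomial factors make the family closed under differentiation. *)
Definition flat p x : R := if 0 < x then p.[x^-1] * expR (- x^-1) else 0.

(** The exponential dominates every monomial by its power series. *)
Lemma poly_le_exp p : exists2 C : R, 0 <= C & forall s, 0 <= s -> `|p.[s]| <= C * expR s.
Proof.
exists (\sum_(i < size p) `|p`_i| * (i`!)%:R) => [|s s0].
  by apply: sumr_ge0 => i _; exact: mulr_ge0.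
rewrite horner_coef mulr_suml; apply: le_trans (ler_norm_sum _ _ _) _.
apply: ler_sum => i _; rewrite normrM -mulrA ler_wpM2l// ger0_norm ?exprn_ge0//.
case: (nat_of_ord i) => [|d].
  by rewrite expr0 fact0 mul1r; have := expR_ge1Dx s; apply: le_trans; rewrite lerDl.
rewrite -ler_pdivrMl ?ltr0n ?fact_gt0//; apply: le_trans (expR_ge1Dxn d s0).
by rewrite mulrC lerDr.
Qed.

(** Two extra powers of [x^-1] are absorbed by the exponential; the quadratic
    bound gives the derivative at 0. *)
Lemma flat_le p : exists2 C : R, 0 <= C & forall x, `|flat p x| <= C * x ^+ 2.
Proof.
have [C C0 hC] := poly_le_exp (p * 'X^2); exists C => // x; rewrite /flat.
case: ltrP => x0; last by rewrite normr0 mulr_ge0 ?sqr_ge0.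
have := hC x^-1; rewrite invr_ge0 (ltW x0) => /(_ isT).
have -> : `|(p * 'X^2).[x^-1]| = `|p.[x^-1]| / x ^+ 2.
  by rewrite hornerM hornerXn exprVn normrM (@ger0_norm _ (x ^- 2))// invr_ge0 sqr_ge0.
have -> : `|p.[x^-1] * expR (- x^-1)| = `|p.[x^-1]| / expR x^-1.
  by rewrite expRN normrM (@ger0_norm _ (expR x^-1)^-1)// invr_ge0 expR_ge0.
by rewrite ler_pdivrMr ?exprn_gt0// ler_pdivrMr ?expR_gt0// mulrAC.
Qed.

Definition flat_deriv p : {poly R} := 'X^2 * (p - p^`()).

Lemma is_derive_flat p x : is_derive x (1 : R) (flat p) (flat (flat_deriv p) x).
Proof.
have [x0|x0|->] := ltrgtP x 0.
- rewrite {2}/flat ltNge (ltW x0) /=.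
  apply: (near_eq_is_derive _ (is_derive_cst (0 : R) x (1 : R))).
  by near=> y; rewrite /flat ltNge ltW//; near: y; exact: lt_nbhsl.
- have xn : x != 0 by rewrite gt_eqF.
  have dV := is_deriveV xn (is_derive_id x (1 : R)).
  have d1 := is_derive1_comp (is_derive_poly p (x^-1)) dV.
  have d2 := is_derive1_comp (g := fun y : R => - y^-1) (is_derive_expR (- x^-1)) (is_deriveN dV).
  have E : flat (flat_deriv p) x = p.[x^-1] *: (expR (- x^-1) * - (- x ^- 2)%:A) +
      expR (- x^-1) *: (p^`().[x^-1] * (- x ^- 2)%:A).
    rewrite /flat x0 /flat_deriv !hornerE /= /GRing.scale /= exprVn.
    by ring.
  rewrite E; apply: (near_eq_is_derive _ (is_deriveM d1 d2)).
  by near=> y; rewrite /flat ifT//; near: y; exact: lt_nbhsr.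
- have [C C0 hC] := flat_le p.
  have f0 q : flat q 0 = 0 by rewrite /flat ltxx.
  rewrite f0.
  have H : h^-1 *: (flat p (h *: 1 + 0) - flat p 0) @[h --> 0^'] --> (0 : R).
    apply/cvgrPdist_le => e e0; near=> h.
    have h0 : h != 0 by near: h; exact: nbhs_dnbhs_neq.
    rewrite f0 subr0 addr0 sub0r normrN /GRing.scale /= mulr1 normrM normfV.
    rewrite mulrC ler_pdivrMr ?normr_gt0//; apply: le_trans (hC h) _.
    have -> : h ^+ 2 = `|h| * `|h| by rewrite -normrM -expr2 ger0_norm ?sqr_ge0.
    rewrite mulrA ler_wpM2r//.
    have : `|h| <= e / (C + 1).
      near: h; apply: dnbhs0_le; rewrite divr_gt0// ltr_wpDl//.
    rewrite ler_pdivlMr ?ltr_wpDl//; apply: le_trans.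
    by rewrite mulrC ler_wpM2l// lerDl.
  by split; [apply/cvg_ex; exists 0|apply/cvg_lim].
Unshelve. all: by end_near. Qed.

Lemma cderiv_flat p : cderiv (fun x => (flat p x)%:C) (fun x => (flat (flat_deriv p) x)%:C).
Proof. by move=> x; split; [exact: is_derive_flat|exact: is_derive_cst]. Qed.

Lemma ccont_flat p : ccont (fun x => (flat p x)%:C).
Proof. exact: cderiv_ccont (cderiv_flat p). Qed.

Section Space.
Variable m : nat.
Implicit Types (u : 'rV[R]_m) (j : 'I_m).

Lemma smooth_flat p (a b : R) j : smooth (fun u => (flat p (a * u 0 j + b))%:C).
Proof.
apply: (@smooth_closed _ _ [set f | exists q (c : R), f = fun u => (c * flat q (a * u 0 j + b))%:C]);
  last by exists p, 1; apply/funext => u; rewrite mul1r.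
move=> _ [q [c ->]]; split.
  have -> : (fun u => (c * flat q (a * u 0 j + b))%:C) = (fun u => c%:C * (flat q (a * u 0 j + b))%:C).
    by apply/funext => u; rewrite rmorphM.
  apply: ccontM; first exact: ccont_cst.
  apply: (ccont_comp (h := fun u : 'rV[R]_m => a * u 0 j + b)) (ccont_flat q) => u.
  apply: (@continuousD _ _ _ (fun u : 'rV[R]_m => a * u 0 j) (fun=> b)); last exact: cst_continuous.
  apply: (@continuousM _ _ (fun=> a) (fun u : 'rV[R]_m => u 0 j)); first exact: cst_continuous.
  exact: coord_continuous.
move=> i; exists (fun u => (c * (a * (j == i)%:R) * flat (flat_deriv q) (a * u 0 j + b))%:C).
  by exists (flat_deriv q), (c * (a * (j == i)%:R)).
move=> u; have := cderiv_affine (a * (j == i)%:R) (a * u 0 j + b) (cderiv_flat q).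
move=> /(cderivZ c%:C) H; apply: cderiv_ext H _ _ => s.
  by rewrite !mxE eqxx /= rmorphM; congr (_ * (flat q _)%:C); ring.
by rewrite !mxE eqxx /= !rmorphM /= !mulrA; congr (_ * (flat _ _)%:C); ring.
Qed.

Lemma flat1_ge0 x : 0 <= flat 1 x.
Proof. by rewrite /flat; case: ifP => // _; rewrite hornerC mul1r expR_ge0. Qed.

Lemma flat1_gt0 x : 0 < x -> 0 < flat 1 x.
Proof. by move=> x0; rewrite /flat x0 hornerC mul1r expR_gt0. Qed.

(** A smooth step from 0 to 1; the denominator is positive because one of [x]
    and [1 - x] is. *)
Definition step x : R := flat 1 x / (flat 1 x + flat 1 (1 - x)).

Lemma step_den x : 0 < flat 1 x + flat 1 (1 - x).
Proof.
have [x0|x0] := ltrP 0 x; first by rewrite ltr_pwDl ?flat1_gt0 ?flat1_ge0.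
by rewrite ltr_wpDl ?flat1_ge0 ?flat1_gt0// subr_gt0 (le_lt_trans x0).
Qed.

Lemma step_ge0 x : 0 <= step x.
Proof. by rewrite divr_ge0 ?flat1_ge0// ltW// step_den. Qed.

Lemma step0 x : x <= 0 -> step x = 0.
Proof. by move=> x0; rewrite /step {1}/flat ltNge x0 mul0r. Qed.

Lemma step1 x : 1 <= x -> step x = 1.
Proof.
move=> x1; have z : flat 1 (1 - x) = 0 by rewrite /flat subr_gt0 ltNge x1.
by rewrite /step z addr0 divff// gt_eqF// flat1_gt0// (lt_le_trans _ x1).
Qed.

Lemma smooth_step (a b : R) j : smooth (fun u => (step (a * u 0 j + b))%:C).
Proof.
have s1 := smooth_flat 1 a b j.
have s2 : smooth (fun u => (flat 1 (1 - (a * u 0 j + b)))%:C).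
  have := smooth_flat 1 (- a) (1 - b) j.
  by congr smooth; apply/funext => u; congr (flat _ _)%:C; ring.
have s3 : smooth (fun u => (flat 1 (a * u 0 j + b) + flat 1 (1 - (a * u 0 j + b)))%:C).
  have := smooth_add s1 s2; congr smooth; apply/funext => u; exact/esym/rmorphD.
have s4 := smooth_inv s3 (fun u => lt0r_neq0 (step_den _)).
have := smooth_mul s1 s4; congr smooth; apply/funext => u; exact/esym/rmorphM.
Qed.

(** A product of ascending and descending steps in each coordinate. *)
Lemma exists_cutoff (L : R) : exists chi : 'rV[R]_m -> R,
  [/\ smooth (fun u => (chi u)%:C), forall u, 0 <= chi u,
      forall u, (forall j, `|u 0 j| <= L) -> chi u = 1 &
      forall u j, L + 1 <= `|u 0 j| -> chi u = 0].
Proof.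
exists (fun u => \prod_j (step (1 * u 0 j + (L + 1)) * step (- 1 * u 0 j + (L + 1)))); split.
- have : smooth (fun u => \prod_j ((step (1 * u 0 j + (L + 1)))%:C * (step (- 1 * u 0 j + (L + 1)))%:C)).
    by apply: smooth_prod => j _; apply: smooth_mul; exact: smooth_step.
  congr smooth; apply/funext => u; rewrite rmorph_prod; apply: eq_bigr => j _.
  exact/esym/rmorphM.
- by move=> u; apply: prodr_ge0 => j _; rewrite mulr_ge0 ?step_ge0.
- move=> u uL; apply: big1 => j _; have := uL j; rewrite ler_norml => /andP[h1 h2].
  by rewrite !step1 ?mulr1//; lra.
- move=> u j uL; rewrite (bigD1 j)//=; suff -> : step (1 * u 0 j + (L + 1)) * step (- 1 * u 0 j + (L + 1)) = 0 by rewrite mul0r.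
  move: uL; rewrite ler_normr => /orP[h|h].
    by rewrite (step0 (x := - 1 * _ + _)) ?mulr0//; lra.
  by rewrite step0 ?mul0r//; lra.
Qed.

End Space.
End Cutoff.

(** * Sections with a prescribed Weil-Brezin coefficient *)

Section LatticeSums.
Variables (R : realType) (n : nat).

Definition lattice_box (B : nat) : seq 'rV[int]_n :=
  map (fun f : {ffun 'I_n -> 'I_B.*2.+1} => \row_i ((f i : nat)%:Z - B%:Z))
    (enum {: {ffun 'I_n -> 'I_B.*2.+1}}).

Lemma uniq_lattice_box B : uniq (lattice_box B).
Proof.
rewrite map_inj_uniq ?enum_uniq// => f g /rowP fg; apply/ffunP => i; apply: val_inj.
by have := fg i; rewrite !mxE => /addIr[].
Qed.

Lemma mem_lattice_box B (b : 'rV[int]_n) : (forall i, `|b 0 i| <= B%:Z) -> b \in lattice_box B.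
Proof.
move=> bB; apply/mapP; exists [ffun i => inord (absz (b 0 i + B%:Z))]; first by rewrite mem_enum.
by apply/rowP => i; rewrite mxE ffunE; move: (b 0 i) (bB i) => z zB; rewrite inordK; lia.
Qed.

(** Sums over the whole lattice are reduced to sums over boxes, which do not
    depend on the box as soon as it contains the support. *)
Lemma fsum_box (f : 'rV[int]_n -> R[i]) B :
  (forall b, f b != 0 -> forall i, `|b 0 i| <= B%:Z) ->
  \sum_(b \in setT) f b = \sum_(b <- lattice_box B) f b.
Proof.
move=> fB; rewrite fsbig_supp; apply: fsbig_fwiden.
- by move=> b [_ /eqP b0]; exact/mem_lattice_box/fB.
- exact: uniq_lattice_box.
- move=> b [_ /= nb]; apply/eqP; case: eqVneq => // b0; exfalso; apply: nb; split=> //.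
  exact/eqP.
Qed.

End LatticeSums.

Section Surjectivity.
Variables (R : realType) (n k : nat).
Hypothesis k0 : (0 < k)%N.
Local Notation e := (delta_mx 0).
Local Notation ix := (@lshift n n).
Local Notation iy := (@rshift n n).
Local Notation vec := 'rV[R]_(n + n).
Local Notation Z := (Zkn n k).
Implicit Types (u : vec).


Lemma coord_ints_eq (m d : nat) (D : set R) (io : 'I_d -> 'I_m) s (h g : 'rV[R]_m -> R[i]) (u : 'rV[R]_m) :
  (forall v : 'rV[R]_m, (forall l, (forall i, io i != l) -> v 0 l = u 0 l) -> h v = g v) ->
  coord_ints D io s h u = coord_ints D io s g u.
Proof.
elim: s u => [|i s IH] u hg; first exact: hg.
apply: eq_cint => a _; apply: IH => v vu; apply: hg => l nl.
by rewrite vu// updE eq_sym (negbTE (nl i)).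
Qed.

(** Orthogonality of the characters of the torus, for the constant one. *)
Lemma fourier_x_cst p u : fourier_x p (fun=> 1 : R[i]) u = ([forall i, p i == 0] : bool)%:R.
Proof.
have s1 : smooth (fun _ : vec => 1 : R[i]) by exact: (@smooth_const R (n + n)).
have [/forallP p0|] := boolP [forall i, p i == 0]; last first.
  rewrite negb_forall => /existsP[j pj].
  have := @fourier_x_pderiv R n p (fun=> 1) j s1 (fun i v => erefl).
  rewrite pderiv_cst => /(congr1 (fun g : vec -> R[i] => g u)).
  rewrite [in LHS]/fourier_x (_ : (fun v => _) = fun=> 0); last by apply/funext => v; rewrite mul0r.
  rewrite coord_ints0 => /esym/eqP; rewrite mulf_eq0 => /orP[|/eqP //].
  rewrite eq_complex /= eqxx /= !mulf_eq0 intr_eq0 (negbTE pj) orbF pnatr_eq0 /=.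
  by rewrite gt_eqF// pi_gt0.
have E1 a : coord_ints `[0, 1] ix a (fun=> 1 : R[i]) = fun=> 1.
  elim: a => //= i a ->; apply/funext => v; rewrite /coord_int.
  have d1 : cderiv (fun x : R => x%:C) (fun=> 1).
    by move=> x; split; [exact: is_derive_id|exact: is_derive_cst].
  by rewrite (cint_cderiv ler01 d1 (ccont_cst _ _)) subr0.
rewrite /fourier_x (_ : (fun v => _) = fun=> 1) ?E1//.
apply/funext => v; rewrite mul1r /character big1 ?mulr0 ?oppr0 ?cis0// => i _.
by rewrite (eqP (p0 i)) mul0r.
Qed.

Lemma characterD (p q : 'I_n -> int) u : character p u * character q u = character (fun i => p i + q i) u.
Proof.
rewrite /character -cisD; congr cis; rewrite -opprD -mulrDr -big_split; congr (- (_ * _)).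
by apply: eq_bigr => i _; rewrite intrD mulrDl.
Qed.

Section Construction.
Variables (phi : 'rV[R]_n -> R[i]) (L : R) (c : Z).
Hypotheses (sphi : smooth phi) (phi0 : forall (y : 'rV[R]_n) j, L <= `|y 0 j| -> phi y = 0).

Definition dual_freq (b : 'rV[int]_n) i : int := - ((c i : nat)%:Z + k%:Z * b 0 i).

Definition shift_arg (b : 'rV[int]_n) u : 'rV[R]_n :=
  rsubmx u - (map_mx intr b + \row_i ((c i)%:R / k%:R)).

Lemma shift_argE b u i : shift_arg b u 0 i = yc u i - ((b 0 i)%:~R + (c i)%:R / k%:R).
Proof. by rewrite !mxE. Qed.

Definition poisson_term u (b : 'rV[int]_n) : R[i] :=
  phi (shift_arg b u) * character (dual_freq b) u.

(** The inverse of the transform: a sum over translates of [phi] by the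
    lattice, each with the character that makes the result twisted-periodic.
    Its Fourier coefficient of frequency [c + k * b] is the translate of [phi]
    by [b + c / k]. *)
Definition poisson_sum u : R[i] := \sum_(b \in setT) poisson_term u b.

Lemma smooth_shift_arg b : smooth (fun u => phi (shift_arg b u)).
Proof.
have [||j u s||//] := @smooth_comp R (n + n) n (shift_arg b)
   (fun j => match fintype.split j with inl i => i | inr i => i end) (fun j _ => (n <= j)%:R) phi.
- apply: continuous_rV => i.
  under eq_fun do rewrite shift_argE.
  move=> u; apply: (@continuousB _ _ _ (fun u : vec => yc u i) (fun=> (b 0 i)%:~R + (c i)%:R / k%:R)).
    exact: coord_continuous.
  exact: cst_continuous.
- by move=> j; exact: smooth_const.
- apply/rowP => l; rewrite shift_argE yc_line [RHS]mxE shift_argE !mxE eqxx /=.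
  rewrite addrAC; congr (_ + _).
  rewrite -{1 2}(splitK j); case: (fintype.split j) => i /=.
    have -> : (n <= i)%N = false by apply/negbTE; rewrite -ltnNge ltn_ord.
    by rewrite eq_rlshift !mulr0 mul0r.
  by rewrite (inj_eq (@rshift_inj _ _)) leq_addr mulr1.
- exact: sphi.
Qed.

Lemma smooth_poisson_term b : smooth (poisson_term ^~ b).
Proof. by apply: smooth_mul; [exact: smooth_shift_arg|exact: smooth_character]. Qed.

(** The argument of [phi] in the term of index [b] is [y - b - c / k]; only
    boundedly many [b] keep it bounded when [y] stays bounded. *)
Lemma poisson_term_box (Y : R) : exists B : nat, forall u, (forall i, `|yc u i| <= Y) ->
  forall b, poisson_term u b != 0 -> forall i, `|b 0 i| <= B%:Z.
Proof.
exists (Num.truncn (Y + L + 2)).+1 => u uY b b0 i.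
have : `|shift_arg b u 0 i| < L.
  rewrite ltNge; apply: contra b0 => h; rewrite /poisson_term (phi0 h) mul0r//.
rewrite shift_argE => hb.
have c1 : (0 <= (c i)%:R / k%:R :> R) && ((c i)%:R / k%:R <= 1 :> R).
  rewrite divr_ge0//= ler_pdivrMr ?ltr0n// mul1r ler_nat ltnW//; exact: ltn_ord.
have : `|(b 0 i)%:~R : R| < Y + L + 2.
  have := uY i; move: hb c1; move: (_%:~R : R) (_ / _) (yc u i) => r q y.
  by rewrite !ltr_norml ler_norml => /andP[h1 h2] /andP[h3 h4] /andP[h5 h6]; apply/andP; split; lra.
move=> /lt_trans/(_ (truncnS_gt _)); rewrite -intr_norm -[X in _ < X]/((Num.truncn (Y + L + 2)).+1%:Z%:~R).
by rewrite ltr_int => /ltW.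
Qed.

Lemma poisson_sum_box (Y : R) : exists B, forall u, (forall i, `|yc u i| <= Y) ->
  poisson_sum u = \sum_(b <- lattice_box n B) poisson_term u b.
Proof. by have [B HB] := poisson_term_box Y; exists B => u uY; exact/fsum_box/HB. Qed.

(** Each point has a neighbourhood on which the sum is finite, over a fixed
    range. *)
Lemma smooth_poisson_sum : smooth poisson_sum.
Proof.
apply: smooth_local => u.
pose Y := \sum_i (`|yc u i| + 1).
have [B HB] := poisson_sum_box Y.
exists (fun v => \sum_(b <- lattice_box n B) poisson_term v b).
  by apply: smooth_sum => b _; exact: smooth_poisson_term.
have : \forall v \near u, forall i : 'I_n, `|yc v i - yc u i| < 1.
  have H (i : 'I_n) : \forall v \near u, `|yc v i - yc u i| < 1; last exact: (@filter_forall _ _ _ _ (nbhs_filter u) H).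
  have /cvgrPdist_lt/(_ 1 ltr01) := @coord_continuous R 1 (n + n) 0 (iy i) u.
  by apply: filterS => v; rewrite distrC.
apply: filterS => v hv; apply: HB => i.
apply: (@le_trans _ _ (`|yc u i| + 1)).
  rewrite -(subrK (yc u i) (yc v i)) addrC; apply: le_trans (ler_normD _ _) _.
  by rewrite lerD2l ltW.
rewrite /Y (bigD1 i)//= lerDl; apply: sumr_ge0 => j _; exact: addr_ge0.
Qed.

(** A translation of [y] by the lattice shifts the index of summation, and the
    characters of the shifted terms differ by the twist. *)
Lemma poisson_sum_lattice (l : 'rV[int]_(n + n)) u :
  poisson_sum (u + lattice R l) =
  cis (2 * pi * (k%:R * \sum_i (l 0 (iy i))%:~R * xc u i)) * poisson_sum u.
Proof.
pose d : 'rV[int]_n := rsubmx l.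
have bij : bijective (fun b : 'rV[int]_n => b + d).
  by exists (fun b => b - d) => b; rewrite ?addrK ?subrK.
have T b : poisson_term (u + lattice R l) (b + d) =
    cis (2 * pi * (k%:R * \sum_i (l 0 (iy i))%:~R * xc u i)) * poisson_term u b.
  rewrite /poisson_term mulrCA; congr (_ * _).
    congr phi; apply/rowP => i; rewrite !shift_argE ycD /lattice.
    by rewrite [yc (map_mx _ _) i]mxE [(b + d) 0 i]mxE [d 0 i]mxE intrD; ring.
  rewrite /character -cisD.
  pose z := \sum_i (c i)%:Z * l 0 (ix i) + k%:Z * \sum_i (b 0 i + d 0 i) * l 0 (ix i).
  rewrite -[RHS]mulr1 -(cis_int R z) -cisD; congr cis.
  rewrite /z intrD intrM !rmorph_sum /= !mulr_sumr -!sumrN -!big_split /=.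
  rewrite mulr_sumr -big_split /=.
  apply: eq_bigr => i _; rewrite /dual_freq xcD /lattice [xc (map_mx _ _) i]mxE [(b + d) 0 i]mxE [d 0 i]mxE.
  by rewrite !(intrD, intrM, mulrNz) -!pmulrn; ring.
rewrite /poisson_sum (reindex_fsbigT _ _ bij).
under [LHS]eq_fsbigr do rewrite T.
pose Y := \sum_i `|yc u i|.
have uY i : `|yc u i| <= Y by rewrite /Y (bigD1 i)//= lerDl sumr_ge0.
have [B HB] := poisson_term_box Y.
rewrite (fsum_box (HB u uY)) (@fsum_box R n _ B) ?mulr_sumr// => b.
by rewrite mulf_eq0 negb_or => /andP[_ /(HB u uY)].
Qed.

End Construction.
End Surjectivity.

Section PrescribedCoefficient.
Variables (R : realType) (n k : nat).
Hypothesis k0 : (0 < k)%N.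
Local Notation ix := (@lshift n n).
Local Notation iy := (@rshift n n).
Local Notation vec := 'rV[R]_(n + n).
Local Notation Z := (Zkn n k).


Lemma cis_sign (z : int) : (-1) ^ z = cis (pi * z%:~R) :> R[i].
Proof.
have E (d : nat) : (-1) ^+ d = cis (pi * d%:R) :> R[i] by rewrite mulrC cisXn cis_pi.
case: z => d; first exact: E.
rewrite NegzE -exprz_inv invrN1 /= -[_ ^ _]/((-1) ^+ d.+1) E mulrNz mulrN cisN.
by rewrite -[_%:~R]/(d.+1%:R) -E rmorphXn rmorphN1.
Qed.

(** The converse of [gauge_period_x] and [gauge_period_y]: the multiplier is
    the twist of the gauged function times the quotient of the phases of the
    gauge. *)
Lemma section_of_gauge (F : vec -> R[i]) : smooth F ->
  (forall l u, F (u + lattice R l) = cis (2 * pi * (k%:R * \sum_i (l 0 (iy i))%:~R * xc u i)) * F u) ->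
  exists t : section R n k, gauge k t = F.
Proof.
move=> sF tF.
have H : (fun u => cis (- (k%:R * pi) * xy u) * F u) \in quasi_periodic (@multiplier R n k).
  apply/asboolP; split.
    by apply: smooth_mul; [apply: smooth_cis; exact: smooth_xy|exact: sF].
  move=> l u; rewrite tF /multiplier mulrA [RHS]mulrA; congr (_ * _).
  rewrite /alpha cis_sign -cisXn -!cisD.
  pose ad := \sum_i l 0 (ix i) * l 0 (iy i).
  rewrite -[LHS]mulr1 -(cis_int R (k%:Z * ad)) -cisD; congr cis.
  have -> : xy (u + lattice R l) = xy u + \sum_i (l 0 (iy i))%:~R * xc u i
      + \sum_i (l 0 (ix i))%:~R * yc u i + ad%:~R.
    rewrite /ad rmorph_sum /= /xy -!big_split /=; apply: eq_bigr => i _.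
    by rewrite xcD ycD /lattice [xc (map_mx _ _) i]mxE [yc (map_mx _ _) i]mxE intrM; ring.
  have -> : omega u (lattice R l) = \sum_i (l 0 (ix i))%:~R * yc u i - \sum_i (l 0 (iy i))%:~R * xc u i.
    rewrite -sumrB /omega; apply: eq_bigr => i _.
    by rewrite /lattice [xc (map_mx _ _) i]mxE [yc (map_mx _ _) i]mxE; ring.
  by rewrite -[X in pi * X%:~R]/ad intrM -pmulrn; ring.
exists (QPer H); apply/funext => u; rewrite /gauge /= mulrA -cisD.
by rewrite (_ : _ + _ = 0) ?cis0 ?mul1r//; ring.
Qed.

Lemma fourier_x_poisson_term (phi : 'rV[R]_n -> R[i]) (c : Z) b p u : smooth phi ->
  fourier_x p (fun v => poisson_term phi c v b) u =
  phi (shift_arg c b u) * ([forall i, p i + dual_freq c b i == 0] : bool)%:R.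
Proof.
move=> sphi; rewrite -(fourier_x_cst _ u).
have s1 := smooth_character R (dual_freq c b).
have -> : fourier_x p (fun v => poisson_term phi c v b) =
    fun u => phi (shift_arg c b u) * fourier_x p (character (dual_freq c b)) u.
  rewrite -(@fourier_x_scale R n p (fun v => phi (shift_arg c b v))) => [//||v i a].
    exact: smooth_ccont.
  by congr phi; apply/rowP => j; rewrite !shift_argE yc_upd_x.
congr (_ * _); rewrite /fourier_x; congr (coord_ints _ _ _ _ _); apply/funext => v.
by rewrite mulrC characterD mul1r.
Qed.

(** Both indices are representatives in the range from 0 to [k - 1], so that
    equality modulo [k] is equality. *)
Lemma dual_freq_eq0 (c c' : Z) b :
  [forall i, freq c' i + dual_freq c b i == 0] = (c' == c) && (b == 0).
Proof.
apply/forallP/andP => [H|[/eqP -> /eqP ->] i]; last first.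
  by rewrite /freq /dual_freq mxE mulr0 addr0 subrr.
have Hi i : (c' i : nat) = (c i : nat) /\ b 0 i = 0.
  have := H i; rewrite /freq /dual_freq => /eqP; have := ltn_ord (c i); have := ltn_ord (c' i).
  move: (nat_of_ord (c i)) (nat_of_ord (c' i)) (b 0 i) => x y z yk xk E.
  have z0 : z = 0 by nia.
  by split=> //; move: E; rewrite z0; lia.
split; apply/eqP; first by apply/ffunP => i; apply: val_inj; have [] := Hi i.
by apply/rowP => i; rewrite mxE; have [] := Hi i.
Qed.

(** The Weil-Brezin coefficients can be prescribed independently; bounded
    support makes the sum that inverts the transform locally finite. *)
Lemma exists_section (phi : 'rV[R]_n -> R[i]) (L : R) (c : Z) : smooth phi ->
  (forall (y : 'rV[R]_n) j, L <= `|y 0 j| -> phi y = 0) ->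
  exists t : section R n k, forall c' y, weil_brezin t c' y = (c' == c)%:R * phi y.
Proof.
move=> sphi phi0.
have [t tE] := section_of_gauge (smooth_poisson_sum k0 c sphi phi0) (poisson_sum_lattice k0 c phi0).
exists t => c' y; rewrite weil_brezin_fourier// tE.
set u := row_mx 0 y + wb_shift R c'.
have [B HB] := poisson_sum_box k0 c phi0 (\sum_i `|yc u i|).
have HB' := HB.
have -> : fourier_x (freq c') (poisson_sum phi c) u =
    fourier_x (freq c') (fun v => \sum_(b <- lattice_box n B) poisson_term phi c v b) u.
  apply: coord_ints_eq => v vu; congr (_ * _); apply: HB => i.
  have -> : yc v i = yc u i by apply: vu => j; rewrite eq_lrshift.
  by rewrite (bigD1 i)//= lerDl sumr_ge0.
have -> : fourier_x (freq c') (fun v => \sum_(b <- lattice_box n B) poisson_term phi c v b) u =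
    \sum_(b <- lattice_box n B) fourier_x (freq c') (fun v => poisson_term phi c v b) u.
  rewrite /fourier_x.
  transitivity (coord_ints `[0, 1] ix (enum 'I_n) (fun v => \sum_(b <- lattice_box n B) (poisson_term phi c v b * character (freq c') v)) u).
    by congr (coord_ints _ _ _ _ _); apply/funext => v; rewrite mulr_suml.
  rewrite coord_ints_bigsum// => b _; apply: ccontM; last exact/smooth_ccont/smooth_character.
  exact/smooth_ccont/smooth_poisson_term.
under eq_bigr => b _ do rewrite fourier_x_poisson_term// dual_freq_eq0.
have [/eqP cc|cc] := boolP (c' == c); last by rewrite big1 ?mul0r// => b _; rewrite mulr0.
rewrite (bigD1_seq 0) ?uniq_lattice_box//=; last by apply: mem_lattice_box => i; rewrite mxE normr0.
rewrite big1 => [|b /negbTE ->]; last by rewrite mulr0.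
rewrite eqxx mulr1 addr0 mul1r; congr phi; apply/rowP => i.
by rewrite shift_argE ycD yc_row yc_shift mxE add0r cc addrK.
Qed.

End PrescribedCoefficient.

(** * Distributions supported at the origin *)

Section Hadamard.
Variables (R : realType) (n : nat).
Local Notation e := (delta_mx 0).
Implicit Types (phi psi : 'rV[R]_n -> R[i]) (y : 'rV[R]_n) (i : 'I_n).

(** The quotient is the integral from 0 to 1 of the derivative of [phi] along
    the segment that scales the [i]-th coordinate. *)
Lemma hadamard phi i : smooth phi -> exists2 q, smooth q &
  forall y, phi y - phi (upd y i 0) = (y 0 i)%:C * q y.
Proof.
move=> sphi; pose lst : 'I_(n + 1) := rshift n ord0.
(* [L] multiplies the [i]-th coordinate by the additional, last variable. *)
pose L (v : 'rV[R]_(n + 1)) : 'rV[R]_n := upd (lsubmx v) i (v 0 lst * v 0 (lshift 1 i)).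
have LE v l : L v 0 l = if l == i then v 0 lst * v 0 (lshift 1 i) else v 0 (lshift 1 l).
  by rewrite updE mxE.
have cL : continuous L.
  apply: continuous_rV => l; under eq_fun do rewrite LE.
  case: eqVneq => _; last exact: coord_continuous.
  by move=> v; apply: (@continuousM _ _ (fun v : 'rV[R]_(n + 1) => v 0 lst) (fun v => v 0 (lshift 1 i)));
    exact: coord_continuous.
pose a (j : 'I_(n + 1)) (v : 'rV[R]_(n + 1)) : R :=
  if fintype.split j is inl l then if l == i then v 0 lst else 1 else v 0 (lshift 1 i).
pose sg (j : 'I_(n + 1)) : 'I_n := if fintype.split j is inl l then l else i.
have [|j v s||sF _] := @smooth_comp R (n + 1) n L sg a (pderiv i phi) cL.
- move=> j; rewrite /a; case: (fintype.split j) => [l|_]; last exact: smooth_coord.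
  by case: eqP => _; [exact: smooth_coord|exact: smooth_const].
- apply/rowP => l; rewrite LE [RHS]mxE LE !mxE !eqxx /= /a /sg -{1 2 3}(splitK j).
  case: (fintype.split j) => [l'|o] /=.
    rewrite eq_rlshift !(inj_eq (@lshift_inj _ _)) mulr0 addr0.
    case: (eqVneq l i) => [->|li]; first by case: (eqVneq l' i) => _ /=; ring.
    case: (eqVneq l l') => [ll|_] /=; last by ring.
    by rewrite -ll (negbTE li); ring.
  by rewrite ord1 eqxx !eq_lrshift; case: (eqVneq l i) => _ /=; ring.
- exact: smooth_pderiv.
have sI := smooth_coord_int lst sF.
have [|||sq _] := @smooth_comp R n (n + 1) (fun y => row_mx y 0) (fun l => lshift 1 l) (fun _ _ => 1) _ _ _ _ sI.
- apply: continuous_rV => l; case: (split_ordP l) => l' ->.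
    by under eq_fun do rewrite row_mxEl; exact: coord_continuous.
  by under eq_fun do rewrite row_mxEr; exact: cst_continuous.
- by move=> j; exact: smooth_const.
- move=> j y s; apply/rowP => l; rewrite mulr1; case: (split_ordP l) => l' ->.
    by rewrite [RHS]mxE !row_mxEl !mxE eqxx /= (inj_eq (@lshift_inj _ _)).
  by rewrite [RHS]mxE !row_mxEr !mxE eqxx /= eq_rlshift mulr0 addr0.
exists (fun y => coord_int `[0, 1] lst (fun u => pderiv i phi (L u)) (row_mx y 0)); first exact: sq.
move=> y; pose G := fun x : R => phi (upd y i (y 0 i * x + 0)).
have dG := cderiv_affine (y 0 i) 0 (cderiv_slice y (smooth_has_pderiv i sphi)).
have -> : phi y - phi (upd y i 0) = G 1 - G 0.
  by rewrite /G mulr1 mulr0 !addr0 upd_id.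
have cs : ccont (fun x : R => pderiv i phi (upd y i (y 0 i * x + 0))).
  apply: (ccont_comp (h := fun x : R => y 0 i * x + 0) _ (ccont_slice y i (smooth_ccont (smooth_pderiv i sphi)))) => x.
  exact: (continuousD (continuousM (cvg_cst _) (@cvg_id _ _)) (cvg_cst _)).
rewrite -(cint_cderiv ler01 dG); last by apply: ccontM; [exact: ccont_cst|exact: cs].
rewrite cintZ; [|exact: measurable_cc|exact: cintegrable_cc].
apply: (congr1 (fun z => (y 0 i)%:C * z)).
rewrite /coord_int; apply: eq_cint => x _.
apply: (congr1 (pderiv i phi)).
apply/rowP => l.
rewrite LE !updE eqxx row_mxEl addr0 eq_lrshift mulrC; case: eqP => // _.
by rewrite eq_lrshift row_mxEl.
Qed.

Lemma smooth_upd phi i (a : R) : smooth phi -> smooth (fun y => phi (upd y i a)).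
Proof.
move=> sphi; have [||j y s||//] := @smooth_comp R n n (fun y => upd y i a) id (fun j _ => (j != i)%:R) phi.
- exact: continuous_upd1.
- by move=> j; exact: smooth_const.
- apply/rowP => l; rewrite updE [RHS]mxE updE !mxE eqxx /=.
  case: (eqVneq l i) => [->|li]; first by case: (eqVneq j i) => _ /=; ring.
  case: (eqVneq l j) => [lj|_] /=; last by ring.
  by rewrite -lj li !mulr1.
- exact: sphi.
Qed.

(** Vanishing on a neighbourhood passes to the derivatives, on the interior of
    this neighbourhood. *)
Lemma pderivs_near0 m (f : 'rV[R]_m -> R[i]) l (u : 'rV[R]_m) :
  (\forall v \near u, f v = 0) -> \forall v \near u, pderivs l f v = 0.
Proof.
move=> f0; elim: l => // j l /near_join; apply: filterS => v Hv /=; rewrite /pderiv.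
have H (P : R[i] -> R) : \forall w \near v, P (pderivs l f w) = P 0 by apply: filterS Hv => w ->.
rewrite (near_eq_derive (f := fun w => complex.Re (pderivs l f w)) (g := fun=> 0 : R) _ (H (@complex.Re R))).
by rewrite (near_eq_derive (f := fun w => complex.Im (pderivs l f w)) (g := fun=> 0 : R) _ (H (@complex.Im R))) !derive_cst.
Qed.

Definition bounded_support psi : Prop := exists L : R, forall y j, L <= `|y 0 j| -> psi y = 0.

Lemma compact_bounded (K : set 'rV[R]_n) : compact K -> exists L : R, forall y j, K y -> `|y 0 j| <= L.
Proof.
move=> cK; have H j : {B : R | 0 <= B /\ forall y, K y -> `|y 0 j| <= B}.
  apply/cid; have [B B0 hB] := ccont_bound_compact cK (smooth_ccont (@smooth_coord R n j)).
  by exists B; split=> // y Ky; rewrite -cabs_real; exact: hB.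
exists (\sum_j sval (H j)) => y j Ky; have [B0 /(_ y Ky) hB] := svalP (H j).
by apply: le_trans hB _; rewrite (bigD1 j)//= lerDl sumr_ge0// => l _; case: (svalP (H l)).
Qed.

Section PointSupport.
Variable A : functional_Rn R n.
Hypothesis cA : compactly_supported A.

(** Linearity in the pointwise form that the functions below have. *)
Lemma cs_linear (a : R[i]) phi psi : smooth phi -> smooth psi ->
  A (fun y => a * phi y + psi y) = a * A phi + A psi.
Proof. by move: cA => [lA _]; exact: lA. Qed.

Lemma cs0 : A (fun=> 0) = 0.
Proof.
have s0 : smooth (fun _ : 'rV[R]_n => 0 : R[i]) by exact: smooth_const.
have := cs_linear 1 s0 s0; rewrite (_ : (fun y => _) = fun=> 0) => [/esym|]; last first.
  by apply/funext => y; rewrite mulr0 addr0.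
by rewrite mul1r -[RHS]addr0 => /addrI.
Qed.

Lemma cs_scale (a : R[i]) phi : smooth phi -> A (fun y => a * phi y) = a * A phi.
Proof.
move=> sphi; have := cs_linear a sphi (@smooth_const R n 0); rewrite cs0 addr0 => <-.
by congr A; apply/funext => y; rewrite addr0.
Qed.

(** The product with a cutoff that equals 1 near the support differs from the
    function by one that vanishes near the support, with all its derivatives. *)
Lemma cs_cutoff : exists chi : 'rV[R]_n -> R, [/\ smooth (fun y => (chi y)%:C),
  bounded_support (fun y => (chi y)%:C) &
  forall phi, smooth phi -> A (fun y => (chi y)%:C * phi y) = A phi].
Proof.
have [_ [M [C [K [cK AK]]]]] := cA.
have [L KL] := compact_bounded cK.
have [chi [schi chi0 chi1 chiL]] := exists_cutoff n (L + 1).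
exists chi; split=> [//||phi sphi]; first by exists (L + 1 + 1) => y j /chiL ->.
have sd : smooth (fun y => -1 * ((chi y)%:C * phi y) + phi y).
  by apply: smooth_add; [apply: smooth_mul; [exact: smooth_const|apply: smooth_mul; [exact: schi|exact: sphi]]|exact: sphi].
have := AK _ 0 sd; rewrite mulr0 => H.
have {H} : A (fun y => -1 * ((chi y)%:C * phi y) + phi y) = 0.
  apply/cabs_eq0/le_anti; rewrite cabs_ge0 andbT; apply: H => l y _ Ky.
  suff /(pderivs_near0 l)/nbhs_singleton -> : \forall v \near y, -1 * ((chi v)%:C * phi v) + phi v = 0.
    by rewrite cabs0.
  have H (j : 'I_n) : \forall v \near y, `|(v : 'rV[R]_n) 0 j - y 0 j| < 1.
    have /cvgrPdist_lt/(_ 1 ltr01) := @coord_continuous R 1 n 0 j y.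
    by apply: filterS => v; rewrite distrC.
  have := @filter_forall _ _ _ _ (nbhs_filter y) H; apply: filterS => v hv.
  rewrite chi1 ?mul1r ?mulN1r ?addNr// => j.
  rewrite -(subrK (y 0 j) (v 0 j)) addrC; apply: le_trans (ler_normD _ _) _.
  by rewrite lerD ?KL ?ltW.
rewrite cs_linear; [|by apply: smooth_mul; [exact: schi|exact: sphi]|exact: sphi].
by rewrite mulN1r addrC => /eqP; rewrite subr_eq0 => /eqP ->.
Qed.

(** A compactly supported distribution killed by the coordinates is a multiple
    of the Dirac distribution: by [hadamard] the coordinates of the argument
    can be replaced by 0 one after the other. The cutoff is there because the
    hypothesis speaks of functions of bounded support, the only ones that are
    known to be coefficients of sections. *)
Lemma point_support phi :
  (forall i psi, smooth psi -> bounded_support psi -> A (fun y => (y 0 i)%:C * psi y) = 0) ->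
  smooth phi -> A phi = A (fun=> 1) * phi 0.
Proof.
move=> A0 sphi; have [chi [schi bchi chiA]] := cs_cutoff.
pose zero s y := foldl (fun y i => upd y i 0) y s.
have H s f : smooth f -> smooth (fun y => f (zero s y)) /\
    A (fun y => (chi y)%:C * f (zero s y)) = A (fun y => (chi y)%:C * f y).
  move=> sf; elim: s => [|i s [sz IH]] /=; first by split; [exact: sf|].
  split; first exact: (smooth_upd i 0 sz).
  rewrite -IH; have [q sq qE] := hadamard i sz.
  have s1 : smooth (fun y => (chi y)%:C * f (zero s y)) by apply: smooth_mul; [exact: schi|exact: sz].
  have s2 : smooth (fun y => (chi y)%:C * q y) by apply: smooth_mul; [exact: schi|exact: sq].
  have s3 : smooth (fun y => (y 0 i)%:C * ((chi y)%:C * q y)) by apply: smooth_mul; [exact: smooth_coord|exact: s2].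
  have -> : (fun y => (chi y)%:C * f (zero s (upd y i 0))) =
      (fun y => -1 * ((y 0 i)%:C * ((chi y)%:C * q y)) + (chi y)%:C * f (zero s y)).
    by apply/funext => y; rewrite mulN1r [_ * (_ * q y)]mulrCA -qE mulrBr opprB subrK.
  rewrite cs_linear; [|exact: s3|exact: s1].
  rewrite A0 ?mulr0 ?add0r//.
  by have [L chiL] := bchi; exists L => y j /chiL ->; rewrite mul0r.
have z0 y : zero (enum 'I_n) y = 0.
  have Z s w i : (zero s w) 0 i = if i \in s then 0 else w 0 i.
    elim: s w => // j s IH w /=; rewrite IH inE updE; case: (i \in s); first by rewrite orbT.
    by rewrite orbF.
  by apply/rowP => i; rewrite Z mem_enum mxE.
have [_] := H (enum 'I_n) phi sphi; rewrite -(chiA phi sphi) => <-.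
have s1 : smooth (fun _ : 'rV[R]_n => 1 : R[i]) by exact: smooth_const.
rewrite -(chiA _ s1) mulrC -cs_scale; last by apply: smooth_mul; [exact: schi|exact: s1].
by congr A; apply/funext => y; rewrite z0 mulr1 mulrC.
Qed.

End PointSupport.
End Hadamard.

(** * Integrals over the whole space as functionals *)

Section SpaceFunctionals.
Variables (R : realType) (n : nat).
Implicit Types (phi psi g : 'rV[R]_n -> R[i]) (y : 'rV[R]_n).
Local Notation w := (@cauchy_weight R).
Local Notation E := (enum 'I_n).
Local Notation dom := (dominated id E).

Lemma cintegralE (D : set R) g : cintegral D g = coord_ints D id E g 0.
Proof. by rewrite -(@cintegral_coord_ints R n n D id g 0 id)// => v i ni; have := ni i; rewrite eqxx. Qed.

Lemma cintegral_linear (c : R[i]) g h C C' : dom g C -> dom h C' ->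
  cintegral setT (fun y => c * g y + h y) = c * cintegral setT g + cintegral setT h.
Proof.
move=> dg dh; rewrite !cintegralE.
by rewrite (coord_ints_linear (@inj_id _) c (good_domainT R) (enum_uniq _) dg dh).
Qed.

Lemma dominated0 (C : R) : 0 <= C -> dom (fun _ : 'rV[R]_n => 0 : R[i]) C.
Proof.
move=> C0; split; first exact: ccont_cst.
by move=> y; rewrite cabs0 mulr_ge0// weight_ge0.
Qed.

Lemma cintegral0 : cintegral setT (fun _ : 'rV[R]_n => 0) = 0 :> R[i].
Proof.
have d0 := dominated0 (lexx 0); have := cintegral_linear 1 d0 d0.
rewrite (_ : (fun y => 1 * 0 + 0) = fun _ : 'rV[R]_n => 0 : R[i]); last by apply/funext => y; rewrite mulr0 addr0.
by rewrite mul1r -[LHS]addr0 => /addrI <-.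
Qed.

Lemma cintegral_scale (c : R[i]) g C : dom g C ->
  cintegral setT (fun y => c * g y) = c * cintegral setT g.
Proof.
move=> dg; have := cintegral_linear c dg (dominated0 (lexx 0)); rewrite cintegral0 addr0 => <-.
by congr cintegral; apply/funext => y; rewrite addr0.
Qed.

Lemma dominated_sum (I : Type) (r : seq I) (F : I -> 'rV[R]_n -> R[i]) :
  (forall i, exists C, dom (F i) C) -> exists C, dom (fun y => \sum_(i <- r) F i y) C.
Proof.
move=> dF; elim: r => [|i r [C dC]].
  by exists 0; rewrite (_ : (fun y => _) = fun=> 0); [exact: dominated0|apply/funext => y; rewrite big_nil].
have [C' dC'] := dF i; exists (C' + C); have := dominated_add dC' dC.
by congr (dominated _ _ _ _); apply/funext => y; rewrite big_cons.
Qed.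

Lemma cintegral_sum (I : Type) (r : seq I) (F : I -> 'rV[R]_n -> R[i]) :
  (forall i, exists C, dom (F i) C) ->
  cintegral setT (fun y => \sum_(i <- r) F i y) = \sum_(i <- r) cintegral setT (F i).
Proof.
move=> dF; elim: r => [|i r IH].
  by rewrite big_nil -[RHS]cintegral0; congr cintegral; apply/funext => y; rewrite big_nil.
have [C' dC'] := dF i; have [C dC] := dominated_sum r dF.
rewrite big_cons -IH -[cintegral setT (F i)]mul1r -(cintegral_linear 1 dC' dC).
by congr cintegral; apply/funext => y; rewrite big_cons mul1r.
Qed.

Lemma cint_conj (D : set R) (f : R -> R[i]) : cintegrable D f -> measurable (D : set (measurableTypeR R)) ->
  cint D (fun a => (f a)^*) = (cint D f)^*.
Proof.
move=> [i1 i2] mD; rewrite /cint; apply/eqP; rewrite eq_complex; apply/andP; split; apply/eqP => /=.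
  by congr (Rintegral _ _ _); apply/funext => a; case: (f a).
transitivity (Rintegral lebesgue_measure D (fun a => -1 * complex.Im (f a))).
  by congr (Rintegral _ _ _); apply/funext => a; rewrite mulN1r; case: (f a).
by rewrite RintegralZl// mulN1r.
Qed.

Lemma dominated_conj s g C : dominated id s g C -> dominated id s (fun y => (g y)^*) C.
Proof.
move=> [cg gC]; split; first exact: ccont_conj.
by move=> y; rewrite cabs_conj.
Qed.

Lemma cintegral_conj g C : dom g C -> cintegral setT (fun y => (g y)^*) = (cintegral setT g)^*.
Proof.
move=> dg; rewrite !cintegralE.
suff H s1 s2 : uniq (s1 ++ s2) -> dominated id (s1 ++ s2) g C ->
    coord_ints setT id s1 (fun y => (g y)^*) = fun y => (coord_ints setT id s1 g y)^*.
  by rewrite (H E [::]) ?cats0 ?enum_uniq.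
elim: s1 s2 => // i s1 IH s2 us' dh.
have p : perm_eq (i :: s1 ++ s2) (s1 ++ i :: s2).
  by rewrite -cat1s -(cat1s i s2) perm_catCA.
have u' : uniq (s1 ++ i :: s2) by rewrite -(perm_uniq p).
have d1 := dominated_perm p dh.
transitivity (coord_int setT i (coord_ints setT id s1 (fun y => (g y)^*))); first by [].
rewrite (IH (i :: s2) u' d1).
have i2 : i \notin s2 by move: us'; rewrite /= mem_cat negb_or => /andP[/andP[]].
apply/funext => u.
have [c1 e1] := dominated_slice (@inj_id _) u i2 (dominated_coord_ints (@inj_id _) (good_domainT R) u' d1).
by rewrite /= /coord_int cint_conj//; exact: (dominated_cintegrable c1 e1 measurableT).
Qed.

Lemma cabs_cintegral_le g C : dom g C -> cabs (cintegral setT g) <= (2 * pi) ^+ n * C.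
Proof.
move=> dg; rewrite cintegralE.
have u' : uniq (E ++ [::]) by rewrite cats0 enum_uniq.
have d' : dominated id (E ++ [::]) g C by rewrite cats0.
have [_] := dominated_coord_ints (@inj_id _) (good_domainT R) u' d'.
by move/(_ 0); rewrite /weight big_nil mulr1 size_enum_ord.
Qed.

(** This is how bump functions detect the value of a continuous function at 0,
    in [regular_inj]. *)
Lemma cintegral_gt0 g C : dom g C -> (forall y, 0 <= complex.Re (g y)) -> 0 < complex.Re (g 0) ->
  0 < complex.Re (cintegral setT g).
Proof.
move=> dg g0 gp; rewrite cintegralE.
by apply: (coord_ints_gt0 (@inj_id _) (enum_uniq _) _ dg) => // i _; rewrite mxE.
Qed.

Lemma bounded_support_bounded g : ccont g -> bounded_support g -> exists2 B : R, 0 <= B & forall y, cabs (g y) <= B.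
Proof.
move=> cg [L gL]; pose a := `|L|.
have ca : ccont (fun y => g (\row_j (2 * a * y 0 j - a))).
  apply: (ccont_comp (h := fun y : 'rV[R]_n => \row_j (2 * a * y 0 j - a))) cg.
  apply: continuous_rV => j; under eq_fun do rewrite mxE.
  move=> y; apply: (@continuousB _ _ _ (fun y : 'rV[R]_n => 2 * a * y 0 j) (fun=> a)); last exact: cst_continuous.
  by apply: (@continuousM _ _ (fun=> 2 * a) (fun y : 'rV[R]_n => y 0 j)); [exact: cst_continuous|exact: coord_continuous].
have [B B0 hB] := ccont_bound_compact (@compact_unit_cube R n) ca.
exists B => // y; have [/existsP[j]|/existsPn yL] := boolP [exists j, L <= `|y 0 j|].
  by move/gL => ->; rewrite cabs0.
case: (eqVneq a 0) => [a0|a0].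
  have [->|[j _]] : y = \row_j (2 * a * (0 : 'rV[R]_n) 0 j - a) \/ exists j : 'I_n, True.
  - case: (pickP (fun _ : 'I_n => true)) => [j _|n0]; first by right; exists j.
    by left; apply/rowP => j; have := n0 j.
  - by apply: hB => j; rewrite mxE lexx ler01.
  by have := yL j; rewrite -ltNge (_ : L = 0) ?normr_lt0//; apply/eqP; rewrite -normr_eq0 -/a a0.
have ap : 0 < a by rewrite lt_def a0 normr_ge0.
have -> : y = \row_j (2 * a * (\row_j ((y 0 j + a) / (2 * a))) 0 j - a).
  by apply/rowP => j; rewrite !mxE mulrC divfK ?addrK// mulf_neq0.
apply: hB => j; rewrite mxE.
have : `|y 0 j| <= a by have := yL j; rewrite -ltNge => /ltW /le_trans; apply; exact: ler_norm.
rewrite ler_norml => /andP[h1 h2]; apply/andP; split; first by apply: divr_ge0; lra.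
by rewrite ler_pdivrMr ?mulr_gt0//; lra.
Qed.

Lemma prod_weightK y s : (\prod_(i <- s) (1 + y 0 i ^+ 2)) * weight id s y = 1.
Proof.
rewrite /weight -big_split /=; apply: big1 => i _.
by rewrite mulfV// gt_eqF// ltr_pwDl// sqr_ge0.
Qed.

Lemma le_prod_weight y s (a b : R) : \prod_(i <- s) (1 + y 0 i ^+ 2) * a <= b -> a <= b * weight id s y.
Proof.
move=> ab; have -> : a = \prod_(i <- s) (1 + y 0 i ^+ 2) * a * weight id s y.
  by rewrite mulrAC prod_weightK mul1r.
by rewrite ler_wpM2r// weight_ge0.
Qed.

Lemma dominated_bounded_support g : ccont g -> bounded_support g -> exists C, dom g C.
Proof.
move=> cg bg; pose h y := (\prod_(i <- E) (1 + y 0 i ^+ 2))%:C * g y.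
have ch : ccont h.
  apply: ccontM => //.
  rewrite (_ : (fun y => _) = fun y : 'rV[R]_n => \prod_(i <- E) (1 + (y 0 i)%:C * (y 0 i)%:C)).
    apply: ccont_prod => i _; apply: ccontD; first exact: ccont_cst.
    by apply: ccontM; exact/smooth_ccont/smooth_coord.
  by apply/funext => y; rewrite rmorph_prod; apply: eq_bigr => i _; rewrite rmorphD rmorph1 rmorphXn expr2.
have bh : bounded_support h by have [L gL] := bg; exists L => y j /gL gy; rewrite /h gy mulr0.
have [B B0 hB] := bounded_support_bounded ch bh.
exists B; split=> // y; have := hB y; rewrite /h cabsM cabs_real ger0_norm; last first.
  by apply: prodr_ge0 => i _; rewrite addr_ge0// sqr_ge0.
exact: le_prod_weight.
Qed.

Lemma cabs_monomial2 i b y (z : R[i]) :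
  cabs ((monomial [:: i, i & b] y)%:C * z) = y 0 i ^+ 2 * cabs ((monomial b y)%:C * z).
Proof.
rewrite /monomial !big_cons mulrA -expr2 rmorphM -mulrA cabsM cabs_real ger0_norm//.
exact: sqr_ge0.
Qed.

(** Each factor [1 + y ^+ 2] splits the bound into two, one of which has a
    longer monomial. *)
Lemma schwartz_weight phi (M : nat) B :
  (forall b l y, (size b <= M)%N -> (size l <= M)%N -> cabs ((monomial b y)%:C * pderivs l phi y) <= B) ->
  forall s b y, (size b + 2 * size s <= M)%N ->
    (\prod_(i <- s) (1 + y 0 i ^+ 2)) * cabs ((monomial b y)%:C * phi y) <= 2 ^+ size s * B.
Proof.
move=> hB; elim=> [|i s IH] b y /=.
  by rewrite big_nil mul1r expr0 mul1r muln0 addn0 => bM; exact: (hB b [::]).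
move=> bM; rewrite big_cons [2 ^+ (size s).+1]exprS -!mulrA.
have -> : 2 * (2 ^+ size s * B) = 2 ^+ size s * B + 2 ^+ size s * B by ring.
rewrite mulrDl mul1r; apply: lerD; first by apply: IH; lia.
rewrite mulrCA; apply: le_trans (IH [:: i, i & b] y _); last by rewrite /=; lia.
rewrite ler_wpM2l//; first by apply: prodr_ge0 => j _; rewrite addr_ge0// sqr_ge0.
by rewrite cabs_monomial2.
Qed.

Lemma schwartz_dominated phi B :
  smooth phi -> (forall b l y, (size b <= n.*2)%N -> (size l <= n.*2)%N -> cabs ((monomial b y)%:C * pderivs l phi y) <= B) ->
  dom phi (2 ^+ n * B).
Proof.
move=> sphi hB; split; first exact: smooth_ccont.
move=> y; have := @schwartz_weight phi n.*2 B hB E [::] y.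
rewrite size_enum_ord /= add0n mul2n leqnn => /(_ isT).
by rewrite /monomial big_nil mul1r; exact: le_prod_weight.
Qed.

Lemma schwartz_weight_ex phi : schwartz phi -> forall s b, exists B : R, forall y,
  (\prod_(i <- s) (1 + y 0 i ^+ 2)) * cabs ((monomial b y)%:C * phi y) <= B.
Proof.
move=> [sphi hphi]; elim=> [|i s IH] b.
  by have [B hB] := hphi b [::]; exists B => y; rewrite big_nil mul1r; exact: hB.
have [B1 h1] := IH b; have [B2 h2] := IH [:: i, i & b].
exists (B1 + B2) => y; rewrite big_cons -mulrA mulrDl mul1r; apply: lerD => //.
rewrite mulrCA; apply: le_trans (h2 y).
rewrite ler_wpM2l//; first by apply: prodr_ge0 => j _; rewrite addr_ge0// sqr_ge0.
by rewrite cabs_monomial2.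
Qed.

Lemma schwartz_dominated_ex phi : schwartz phi -> exists C, dom phi C.
Proof.
move=> sphi; have [B hB] := schwartz_weight_ex sphi E [::].
exists B; split=> [|y]; first by have [/smooth_ccont] := sphi.
have := hB y; rewrite /monomial big_nil mul1r => h.
by by rewrite -[leLHS]mul1r -(prod_weightK y E) [leLHS]mulrAC ler_wpM2r// weight_ge0.
Qed.

(** The integral is bounded by the decay of the test function, which [2 * n]
    powers of the coordinates control. *)
Lemma tempered_regular g Bg : ccont g -> (forall y, cabs (g y) <= Bg) -> tempered (regular g).
Proof.
move=> cg gB; split=> [a phi psi /schwartz_dominated_ex[C dC] /schwartz_dominated_ex[C' dC']|].
  rewrite /regular -(cintegral_linear a (dominated_bounded_mul dC cg gB) (dominated_bounded_mul dC' cg gB)).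
  congr cintegral; apply/funext => y; rewrite -[X in g y * X]/(a * phi y + psi y); ring.
exists n.*2, ((2 * pi) ^+ n * (Bg * 2 ^+ n)) => phi B [sphi _] hB.
rewrite -!mulrA [Bg * _]mulrA -mulrA.
exact: cabs_cintegral_le (dominated_bounded_mul (schwartz_dominated sphi hB) cg gB).
Qed.

End SpaceFunctionals.

(** * The coefficients of the basis of constant sections *)

Section FiberFunctions.
Variables (R : realType) (n k : nat).
Hypothesis k0 : (0 < k)%N.
Local Notation e := (delta_mx 0).
Local Notation ix := (@lshift n n).
Local Notation iy := (@rshift n n).
Local Notation vec := 'rV[R]_(n + n).
Local Notation Z := (Zkn n k).
Implicit Types (t : section R n k) (u : vec) (b c j m : Z) (chi : torus_fun R n).

Let kR : (k%:R : R) != 0. Proof. by rewrite pnatr_eq0 -lt0n. Qed.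
Let kC : (k%:R : R[i]) != 0. Proof. by rewrite pnatr_eq0 -lt0n. Qed.

Lemma linear_sum (V : lmodType R[i]) (F : V -> R[i]) (I : Type) (r : seq I) (a : I -> R[i])
    (x : I -> V) : (forall (a : R[i]) (v v' : V), F (a *: v + v') = a * F v + F v') ->
  F (\sum_(i <- r) a i *: x i) = \sum_(i <- r) a i * F (x i).
Proof.
move=> FD; have F0 : F 0 = 0.
  have := FD (-1) 0 0; rewrite scaleN1r oppr0 addr0 mulN1r addNr; exact.
by elim: r => [|i r IH]; rewrite ?big_nil// !big_cons FD IH.
Qed.

Lemma torus_periodic chi l : periodic l chi.
Proof. by move=> u; rewrite -lattice_delta qper_quasi mul1r. Qed.

Lemma torus_bounded chi : exists2 B : R, 0 <= B & forall u, cabs (chi u) <= B.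
Proof.
have [B B0 hB] := smooth_bound_compact 0 (@compact_unit_cube R (n + n)) (qper_smooth chi).
exists B => // u; have [v [E v01 _]] := reduce_mod1 (enum 'I_(n + n)) u.
rewrite -E => [|l _]; last exact: torus_periodic.
by apply: (hB [::]) => //= l; apply: v01; rewrite mem_enum.
Qed.

Lemma fiber_fun_subproof j chi : (fun u => chi (fiber j u)) \in quasi_periodic (@mult1 R n).
Proof.
apply/asboolP; split; first exact: smooth_fiber (qper_smooth chi).
move=> l u; have -> : fiber j (u + lattice R l) = fiber j u + lattice R (row_mx 0 (rsubmx l)).
  apply: vecP => i; rewrite ?xcD ?ycD ?xc_fiber ?yc_fiber ?ycD.
    by rewrite /lattice [xc (map_mx _ _) i]mxE row_mxEl mxE addr0.
  by rewrite /lattice ![yc (map_mx _ _) i]mxE row_mxEr mxE.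
by rewrite qper_quasi !mul1r.
Qed.

(** The function [chi] frozen over the points of order [k]: it is constant in
    [x], hence it commutes with taking Weil-Brezin coefficients. *)
Definition fiber_fun j chi : torus_fun R n := QPer (fiber_fun_subproof j chi).

(** A function of [y] alone passes through the Fourier coefficients in [x]. *)
Lemma weil_brezin_fiber j chi t c y : weil_brezin (section_mul (fiber_fun j chi) t) c y =
  chi (fiber j (row_mx 0 y + wb_shift R c)) * weil_brezin t c y.
Proof.
rewrite !weil_brezin_fourier gaugeM.
rewrite (@fourier_x_scale R n _ (fun u => fiber_fun j chi u))//; first exact: ccont_gauge.
move=> u i a /=; congr (chi _); apply: vecP => l; rewrite ?xc_fiber ?yc_fiber//.
exact: yc_upd_x.
Qed.

(** Over the point [b / k] the function and its frozen version agree. *)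
Lemma fiber_mean_mul_fiber chi t b :
  fiber_mean (section_mul (fiber_fun b chi) t) b = fiber_mean (section_mul chi t) b.
Proof.
rewrite !fiber_mean_fiber !gaugeM; congr (coord_ints _ _ _ _ _); apply/funext => u.
congr (chi _ * _); apply: vecP => l; rewrite ?xc_fiber ?yc_fiber//.
Qed.

(** The relative phase of the coefficients of index [m] and [c] over the point
    [j / k]. *)
Definition phase m c j : R[i] := character_node R m j * (character_node R c j)^*.

Lemma cis_period (a : R) (z : nat) : cis (2 * pi * a) = cis (2 * pi * (a + z%:R)).
Proof.
have -> : 2 * pi * (a + z%:R) = 2 * pi * a + 2 * pi * z%:R by ring.
by rewrite cisD cis_nat mulr1.
Qed.

(** Orthogonality of the characters of the group of points of order [k], one
    coordinate at a time by distributivity. *)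
Lemma sum_characters b j : \sum_c character_node R c b * (character_node R c j)^* =
  k%:R ^+ n * ((b == j) : bool)%:R.
Proof.
pose F (i : 'I_n) (a : 'I_k) : R[i] := cis (2 * pi * (a%:R * (((j i)%:R - (b i)%:R) / k%:R))).
transitivity (\prod_i \sum_a F i a).
  rewrite (bigA_distr_bigA F) /=; apply: eq_bigr => c _.
  rewrite /F /character_node -cisN -cisD opprK -cis_sum; congr cis.
  rewrite -mulr_sumr -mulrN -mulrDr addrC -sumrB; congr (_ * _).
  by apply: eq_bigr => i _; ring.
have FE i : \sum_a F i a = k%:R * ((b i == j i) : bool)%:R.
  have := sum_roots_of_unity R (k + j i - b i) k0.
  have bk := ltn_ord (b i); have jk := ltn_ord (j i).
  have bkj : (b i <= k + j i)%N by lia.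
  rewrite (eq_bigr (F i)) => [->|a _].
    have -> : (k %| k + j i - b i)%N = (b i == j i).
      rewrite -val_eqE /=; apply/idP/eqP => [/dvdnP[q qE]|->]; last by rewrite addnK.
      by move: qE; case: q => [|[|q]]; rewrite ?mulSn; lia.
    by case: eqP => _; rewrite ?mulr1 ?mulr0.
  rewrite /F (cis_period _ a) natrB// natrD; congr cis; field; exact: kR.
rewrite (eq_bigr _ (fun i _ => FE i)) big_split /= prodr_const card_ord; congr (_ * _).
case: eqP => [->|/eqP bj]; first by apply: big1 => i _; rewrite eqxx.
have /existsP[i bji] : [exists i, b i != j i].
  apply: contraR bj => /existsPn H; apply/eqP/ffunP => i; apply/eqP.
  by have := H i; rewrite negbK.
by rewrite (bigD1 i)//= (negbTE bji) mul0r.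
Qed.

(** The discrete Fourier coefficient, of frequency [m - c], of [chi] over the
    points of order [k] at height [y + c / k]. At [y = 0] these are the
    entries of the Toeplitz matrices. *)
Definition coefficient chi m c (y : 'rV[R]_n) : R[i] :=
  (k%:R ^+ n)^-1 * \sum_j phase m c j * chi (fiber j (row_mx 0 y + wb_shift R c)).

(** Moving a function from the section to the coefficients: both sides are
    integrals over the fibres above the points of order [k], by Poisson
    summation, and the characters of the cyclic group are orthogonal. *)
Lemma integral_weil_brezin_mul chi t m : cintegral setT (weil_brezin (section_mul chi t) m) =
  \sum_c cintegral setT (fun y => coefficient chi m c y * weil_brezin t c y).
Proof.
pose T c := \sum_(j <- index_enum Z) ((k%:R ^+ n)^-1 * phase m c j) *: section_mul (fiber_fun j chi) t.
have TE c : (fun y => coefficient chi m c y * weil_brezin t c y) = weil_brezin (T c) c.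
  apply/funext => y; rewrite /T (linear_sum (F := fun t => weil_brezin t c y)); last first.
    by move=> a t1 t2; rewrite weil_brezinD.
  rewrite /coefficient -mulrA mulr_suml mulr_sumr; apply: eq_bigr => j _.
  by rewrite weil_brezin_fiber -!mulrA.
rewrite integral_weil_brezin//.
under [RHS]eq_bigr => c _ do rewrite TE integral_weil_brezin//.
have ME c b : fiber_mean (T c) b =
    \sum_j ((k%:R ^+ n)^-1 * phase m c j) * fiber_mean (section_mul (fiber_fun j chi) t) b.
  by rewrite /T (linear_sum (F := fun t => fiber_mean t b))// => a t1 t2; rewrite fiber_meanD.
under [RHS]eq_bigr => c _ do under eq_bigr => b _ do rewrite ME.
rewrite -mulr_sumr; congr (_ * _); rewrite exchange_big /=; apply: eq_bigr => b _.
under [RHS]eq_bigr => c _ do rewrite mulr_sumr.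
rewrite exchange_big /= (bigD1 b)//= [X in _ + X]big1 ?addr0 => [|j jb].
  rewrite fiber_mean_mul_fiber.
  rewrite (eq_bigr (fun c => (k%:R ^+ n)^-1 * character_node R m b * fiber_mean (section_mul chi t) b *
    (character_node R c b * (character_node R c b)^*))).
    rewrite -mulr_sumr sum_characters eqxx mulr1.
    by field; rewrite expf_neq0.
  by move=> c _; rewrite /phase; ring.
rewrite (eq_bigr (fun c => (k%:R ^+ n)^-1 * character_node R m j * fiber_mean (section_mul (fiber_fun j chi) t) b *
    (character_node R c b * (character_node R c j)^*))).
  by rewrite -mulr_sumr sum_characters eq_sym (negbTE jb) !mulr0.
by move=> c _; rewrite /phase; ring.
Qed.

Lemma smooth_coefficient chi m c : smooth (coefficient chi m c).
Proof.
apply: smooth_mul; first exact: smooth_const.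
apply: smooth_sum => j _; apply: smooth_mul; first exact: smooth_const.
have [||l y s||//] := @smooth_comp R n (n + n) (fun y => row_mx 0 y + wb_shift R c) (fun l => iy l)
    (fun _ _ => 1) (fun u => chi (fiber j u)).
- apply: continuous_rV => l; case: (split_ordP l) => i ->.
    by under eq_fun do rewrite mxE row_mxEl mxE; exact: cst_continuous.
  under eq_fun do rewrite mxE row_mxEr.
  move=> y; apply: (@continuousD _ _ _ (fun y : 'rV[R]_n => y 0 i) (fun=> wb_shift R c 0 (iy i))).
    exact: coord_continuous.
  exact: cst_continuous.
- by move=> l; exact: smooth_const.
- apply: vecP => i.
    by rewrite xc_line !xcD !xc_row eq_lrshift mulr0 addr0.
  by rewrite yc_line !ycD !yc_row !mxE eqxx mulr1 (inj_eq (@rshift_inj _ _)) addrAC.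
- exact: smooth_fiber (qper_smooth chi).
Qed.

Lemma coefficient_bounded chi m c : exists2 B : R, 0 <= B & forall y, cabs (coefficient chi m c y) <= B.
Proof.
have [B B0 hB] := torus_bounded chi.
exists (cabs ((k%:R ^+ n)^-1 : R[i]) * \sum_(j : Z) B) => [|y].
  by rewrite mulr_ge0 ?cabs_ge0// sumr_ge0.
rewrite cabsM ler_wpM2l ?cabs_ge0//; apply: le_trans (cabs_sum _ _ _) _; apply: ler_sum => j _.
by rewrite cabsM /phase cabsM cabs_conj !cabs_cis mulr1 mul1r.
Qed.

End FiberFunctions.

(** * The pairing between the two spaces of polarized sections *)

Section Pairing.
Variables (R : realType) (n k : nat).
Hypothesis k0 : (0 < k)%N.
Local Notation e := (delta_mx 0).
Local Notation ix := (@lshift n n).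
Local Notation iy := (@rshift n n).
Local Notation Z := (Zkn n k).
Local Notation func := (functional R n k).
Local Notation sig := (@sigma R n k).
Local Notation sigc := (@sigma_check R n k).
Implicit Types (t : section R n k) (c m : Z) (psi chi : torus_fun R n) (s : func) (al be : Z -> R[i]).

Let kR : (0 : R) < k%:R. Proof. by rewrite ltr0n. Qed.

Lemma conj_real (x : R) : (x%:C)^* = x%:C :> R[i].
Proof. by apply/eqP; rewrite eq_complex /= oppr0 !eqxx. Qed.

Lemma conj_mul_real (a z : R[i]) (r : R) : (a * r%:C * z^*)^* = a^* * r%:C * z.
Proof. by rewrite rmorphM /= conjCK rmorphM /= conj_real. Qed.

Definition unit_norm : R := 2 `^ (n%:R / 4) * k%:R `^ (n%:R / 2).
Definition theta_const : R := unit_norm * (2 * k%:R) `^ (- (n%:R / 2)).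
Definition check_const : R := unit_norm * 2 `^ (- (n%:R / 2)).

Lemma theta_const_gt0 : 0 < theta_const.
Proof. by rewrite !mulr_gt0// powR_gt0// mulr_gt0. Qed.

Lemma check_const_gt0 : 0 < check_const.
Proof. by rewrite !mulr_gt0// powR_gt0. Qed.

(** The normalizations of the bases and of the half-forms cancel, so that the
    two bases are dual to each other. *)
Lemma constE : theta_const * check_const * rho_pairing R n k = 1.
Proof.
rewrite /theta_const /check_const /unit_norm /rho_pairing powRM ?ltW//.
rewrite !powRN.
have -> : (2 : R) `^ (n%:R / 2) = 2 `^ (n%:R / 4) * 2 `^ (n%:R / 4).
  by rewrite -powRD ?pnatr_eq0 ?implybT//; congr (_ `^ _); field.
have p2 : (2 : R) `^ (n%:R / 4) != 0 by rewrite gt_eqF// powR_gt0.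
have pk : (k%:R : R) `^ (n%:R / 2) != 0 by rewrite gt_eqF// powR_gt0.
by field; rewrite p2 pk.
Qed.

Lemma sigma_value m t : sig m t = theta_const%:C * (weil_brezin t m 0)^*.
Proof.
rewrite -[LHS]/(unit_norm%:C * theta m t) /theta /of_weil_brezin (bigD1 m)//= big1 => [|c cm].
  by rewrite eqxx mul1r addr0 mulrA -rmorphM.
by rewrite eq_sym (negbTE cm) !mul0r.
Qed.

Lemma sigma_check_value m t : sigc m t = check_const%:C * (cintegral setT (weil_brezin t m))^*.
Proof.
rewrite -[LHS]/(unit_norm%:C * theta_check m t) /theta_check /of_weil_brezin (bigD1 m)//= big1 => [|c cm].
  have [C _ dC] := dominated_weil_brezin k0 t m.
  rewrite addr0 /regular -(cintegral_conj dC) eqxx.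
  rewrite (_ : (fun y => _) = fun y => (2 `^ (- (n%:R / 2)))%:C * (weil_brezin t m y)^*); last first.
    by apply/funext => y; rewrite /cst mul1r.
  by rewrite (cintegral_scale _ (dominated_conj dC)) mulrA -rmorphM.
rewrite /regular (_ : (fun y => _) = fun _ : 'rV[R]_n => 0 : R[i]) ?cintegral0//.
by apply/funext => y; rewrite /cst eq_sym (negbTE cm) !mul0r.
Qed.

Definition span (f : Z -> func) al : func := \sum_m al m *: f m.

Lemma spanE f al t : span f al t = \sum_m al m * f m t.
Proof. by rewrite /span fct_sumE. Qed.

(** The form of [exists_section] for functions of bounded support. *)
Lemma bump_section c (phi : 'rV[R]_n -> R[i]) : smooth phi -> bounded_support phi ->
  exists t : section R n k, forall c' y, weil_brezin t c' y = (c' == c)%:R * phi y.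
Proof. by move=> sphi [L hL]; exact: (@exists_section R n k k0 phi L c sphi hL). Qed.

Lemma exists_bump : exists2 chi : 'rV[R]_n -> R,
  smooth (fun y => (chi y)%:C) /\ bounded_support (fun y => (chi y)%:C) &
  (forall y, 0 <= chi y) /\ chi 0 = 1.
Proof.
have [chi [schi chi0 chi1 chiL]] := exists_cutoff n (0 : R).
exists chi; split=> //; first by exists (0 + 1) => y j /chiL ->.
by apply: chi1 => j; rewrite mxE normr0.
Qed.

(** A section with a single nonvanishing coefficient, a bump, isolates one
    summand. *)
Lemma sigma_free al be : span sig al = span sig be -> al =1 be.
Proof.
move=> E c; have [chi [schi bchi] [_ chi0]] := exists_bump.
have [t tE] := bump_section c schi bchi.
have V a : span sig a t = a c * theta_const%:C.
  rewrite spanE (bigD1 c)//= big1 ?addr0 => [|m mc]; rewrite sigma_value tE.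
    by rewrite eqxx mul1r chi0 rmorph1 mulr1.
  by rewrite (negbTE mc) mul0r rmorph0 !mulr0.
have := congr1 (fun s : func => s t) E; rewrite !V => /mulIf; apply.
by rewrite fmorph_eq0 gt_eqF// theta_const_gt0.
Qed.

Lemma sigma_check_free al be : span sigc al = span sigc be -> al =1 be.
Proof.
move=> E c; have [chi [schi bchi] [chi_ge0 chi0]] := exists_bump.
have [t tE] := bump_section c schi bchi.
have [C dC] := dominated_bounded_support (smooth_ccont schi) bchi.
have I0 : 0 < complex.Re (cintegral setT (fun y => (chi y)%:C)).
  by apply: (cintegral_gt0 dC) => //=; rewrite chi0.
pose I := cintegral setT (fun y => (chi y)%:C).
have V a : span sigc a t = a c * (check_const%:C * I^*).
  rewrite spanE (bigD1 c)//= big1 ?addr0 => [|m mc]; rewrite sigma_check_value.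
    congr (_ * (_ * _^*)); congr cintegral; apply/funext => y.
    by rewrite tE eqxx mul1r.
  rewrite (_ : weil_brezin t m = fun _ : 'rV[R]_n => 0 : R[i]) ?cintegral0 ?rmorph0 ?mulr0//.
  by apply/funext => y; rewrite tE (negbTE mc) mul0r.
have := congr1 (fun s : func => s t) E; rewrite !V => /mulIf; apply.
rewrite mulf_neq0//; first by rewrite fmorph_eq0 gt_eqF// check_const_gt0.
rewrite fmorph_eq0; apply/eqP => I00; move: I0; rewrite -/I I00 /=.
by rewrite ltxx.
Qed.

Lemma coordsE (f : Z -> func) al : (forall al be, span f al = span f be -> al =1 be) ->
  coords f (span f al) = al.
Proof.
move=> ff; apply: xget_unique; first by [].
by move=> be E; apply/funext => c; apply/esym; exact: ff.
Qed.

Lemma coords_sigma al : coords sig (span sig al) = al.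
Proof. exact: coordsE sigma_free. Qed.

Lemma coords_sigma_check al : coords sigc (span sigc al) = al.
Proof. exact: coordsE sigma_check_free. Qed.

(** Functionals that are constant along the polarization, tested on the
    coordinate vector fields. *)
Definition x_flat s : Prop := forall i t, s (nabla (ix i) t) = 0.

(** The derivative along [x] multiplies coefficients by [y], which vanishes at
    the origin. *)
Lemma x_flat_span al : x_flat (span sig al).
Proof.
move=> i t; rewrite spanE big1// => m _; rewrite sigma_value weil_brezin_nabla_x//.
by rewrite mxE mulr0 oppr0 mul0r rmorph0 !mulr0.
Qed.

(** Derivatives along [x] act on the coefficients by multiplication with
    coordinates, and the coefficients of sections can be prescribed; so
    [point_support] applies to each [A c]. *)
Lemma flat_point s A : x_flat s -> s = of_weil_brezin A -> (forall c, compactly_supported (A c)) ->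
  forall c phi, smooth phi -> A c phi = A c (fun=> 1) * phi 0.
Proof.
move=> sf sA cA c phi sphi; apply: (point_support (cA c)) => // i psi spsi [L psiL].
have sc : smooth (cconj psi) by exact: smooth_conj.
have bc : bounded_support (cconj psi).
  by exists L => y j /psiL py; rewrite /cconj py rmorph0.
have [t tE] := bump_section c sc bc.
have := sf i t; rewrite sA /of_weil_brezin (bigD1 c)//= big1 ?addr0 => [|c' cc].
  have -> : cconj (weil_brezin (nabla (ix i) t) c) =
      fun y => (0 +i* (2 * (k%:R * pi))) * ((y 0 i)%:C * psi y).
    apply/funext => y; rewrite /cconj weil_brezin_nabla_x// tE eqxx mul1r rmorphM /= conjCK [RHS]mulrA.
    congr (_ * _); apply/eqP; rewrite eq_complex /= mulr0 mul0r subrr opprK eqxx /=.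
    by apply/eqP; ring.
  rewrite (cs_scale (cA c)); last by apply: smooth_mul; [exact: smooth_coord|exact: spsi].
  move/eqP; rewrite mulf_eq0 => /orP[|/eqP//]; rewrite eq_complex /= eqxx /=.
  by rewrite gt_eqF// !mulr_gt0// pi_gt0.
have -> : cconj (weil_brezin (nabla (ix i) t) c') = fun=> 0.
  by apply/funext => y; rewrite /cconj weil_brezin_nabla_x// tE (negbTE cc) mul0r mulr0 rmorph0.
exact: cs0.
Qed.

(** The coefficients at 0 of a section with smooth coefficients are
    determined, since continuous functions are determined by their integrals
    against bump functions. *)
Lemma regular_inj (g g' : Z -> 'rV[R]_n -> R[i]) :
  (forall c, smooth (g c)) -> (forall c, smooth (g' c)) ->
  of_weil_brezin (fun c => regular (g c)) = of_weil_brezin (fun c => regular (g' c)) ->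
  forall c, g c 0 = g' c 0.
Proof.
move=> sg sg' E c; have [chi [schi [L chiL]] [chi_ge0 chi0]] := exists_bump.
pose d y := -1 * g' c y + g c y.
have sd : smooth d by apply: smooth_add; [apply: smooth_mul; [exact: smooth_const|exact: sg']|exact: sg].
(* Testing the difference against itself, localized, gives the integral of a
   nonnegative function. *)
pose phi y := (chi y)%:C * d y.
have sphi : smooth phi by apply: smooth_mul; [exact: schi|exact: sd].
have bphi : bounded_support phi by exists L => y j /chiL h; rewrite /phi h mul0r.
have [t tE] := bump_section c sphi bphi.
have V (h : Z -> 'rV[R]_n -> R[i]) : of_weil_brezin (fun c => regular (h c)) t =
    cintegral setT (fun y => h c y * (phi y)^*).
  rewrite /of_weil_brezin (bigD1 c)//= big1 ?addr0 => [|c' cc]; rewrite /regular.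
    by congr cintegral; apply/funext => y; rewrite /cconj tE eqxx mul1r.
  rewrite (_ : (fun y => _) = fun _ : 'rV[R]_n => 0 : R[i]) ?cintegral0//.
  by apply/funext => y; rewrite /cconj tE (negbTE cc) mul0r rmorph0 mulr0.
have := congr1 (fun s : func => s t) E; rewrite !V => {}E.
have scphi : smooth (fun y => (phi y)^*) by exact: smooth_conj.
have dom (h : 'rV[R]_n -> R[i]) : smooth h -> exists C, dominated id (enum 'I_n) (fun y => h y * (phi y)^*) C.
  move=> sh; apply: dominated_bounded_support; first by apply: ccontM; [exact: smooth_ccont sh|exact: smooth_ccont scphi].
  by have [L' hL] := bphi; exists L' => y j /hL ->; rewrite rmorph0 mulr0.
have [C1 d1] := dom _ (sg c); have [C2 d2] := dom _ (sg' c); have [C3 d3] := dom _ sd.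
have I0 : cintegral setT (fun y => d y * (phi y)^*) = 0.
  rewrite (_ : (fun y => _) = fun y => -1 * (g' c y * (phi y)^*) + g c y * (phi y)^*).
    by rewrite (cintegral_linear _ d2 d1) E mulN1r addNr.
  by apply/funext => y; rewrite /d mulrDl mulrA.
have P y : d y * (phi y)^* = (chi y * cabs (d y) ^+ 2)%:C.
  by rewrite /phi rmorphM /= conj_real mulrCA rmorphM /= cabs_sqrC.
have [//|gg] := eqVneq (g c 0) (g' c 0).
have : 0 < complex.Re (cintegral setT (fun y => d y * (phi y)^*)).
  apply: (cintegral_gt0 d3) => [y|]; rewrite P /=; first by rewrite mulr_ge0 ?sqr_ge0.
  rewrite chi0 mul1r exprn_gt0// lt_def cabs_ge0 andbT; apply: contra gg => /eqP/cabs_eq0.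
  by rewrite /d mulN1r addrC => /eqP; rewrite subr_eq0.
by rewrite I0 /= ltxx.
Qed.

(** By [flat_point] the pairing depends only on the multiples of the Dirac
    distribution in [A], which bump sections recover from [s], and on the
    values of [g] at 0, which [regular_inj] recovers from [b]. *)
Lemma is_pairing_unique s b z z' : x_flat s -> is_pairing s b z -> is_pairing s b z' -> z = z'.
Proof.
move=> sf [A [g [[_ sA] cA [_ bg] sg ->]]] [A' [g' [[_ sA'] cA' [_ bg'] sg' ->]]].
apply: eq_bigr => c _; have scg (h : Z -> 'rV[R]_n -> R[i]) : smooth (h c) -> smooth (cconj (h c)) by exact: smooth_conj.
rewrite (flat_point sf sA cA c (scg g (sg c))) (flat_point sf sA' cA' c (scg g' (sg' c))).
rewrite /cconj (regular_inj sg sg') -?bg -?bg'//; congr (_ * _).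
have [chi [schi bchi] [_ chi0]] := exists_bump.
have [t tE] := bump_section c schi bchi.
have V B : s = of_weil_brezin B -> (forall c, compactly_supported (B c)) -> s t = B c (fun=> 1).
  move=> sB cB; rewrite sB /of_weil_brezin (bigD1 c)//= big1 ?addr0 => [|c' cc].
    have -> : cconj (weil_brezin t c) = fun y => (chi y)%:C.
      by apply/funext => y; rewrite /cconj tE eqxx mul1r conj_real.
    by rewrite (flat_point sf sB cB c schi) chi0 rmorph1 mulr1.
  rewrite (_ : cconj _ = fun=> 0); first exact: cs0.
  by apply/funext => y; rewrite /cconj tE (negbTE cc) mul0r rmorph0.
by rewrite -(V _ sA cA) -(V _ sA' cA').
Qed.

(** The coefficients of [s] are multiples of the Dirac distribution, as are
    those of the [sigma m]. *)
Lemma flat_in_span s b z : x_flat s -> is_pairing s b z -> exists al, s = span sig al.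
Proof.
move=> sf [A [g [[_ sA] cA _ _ _]]].
exists (fun c => A c (fun=> 1) * (theta_const^-1)%:C).
apply/funext => t; rewrite spanE {1}sA; apply: eq_bigr => c _.
have st : smooth (cconj (weil_brezin t c)) by apply: smooth_conj; exact: smooth_weil_brezin.
rewrite (flat_point sf sA cA c st) sigma_value -[RHS]mulrA; congr (_ * _).
by rewrite mulrA -rmorphM /= mulVf ?gt_eqF ?theta_const_gt0// rmorph1 mul1r.
Qed.

(** The smooth Weil-Brezin coefficients of the product of a function with a
    combination of the [sigma_check m]; see [dist_mul_span_check]. *)
Definition pairing_coefficient psi be c (y : 'rV[R]_n) : R[i] :=
  \sum_m be m * check_const%:C * (coefficient (torus_conj psi) m c y)^*.

Lemma smooth_pairing_coefficient psi be c : smooth (pairing_coefficient psi be c).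
Proof.
apply: smooth_sum => m _; apply: smooth_mul; first exact: smooth_const.
apply: smooth_conj; exact: smooth_coefficient.
Qed.

(** By definition the product is tested on the section times the conjugate
    function; [integral_weil_brezin_mul] moves this function to the
    coefficients. *)
Lemma dist_mul_span_check psi be : dist_mul psi (span sigc be) =
  of_weil_brezin (fun c => regular (pairing_coefficient psi be c)).
Proof.
apply/funext => t; rewrite /dist_mul spanE /of_weil_brezin.
have dom m c : exists C, dominated id (enum 'I_n)
    (fun y => coefficient (torus_conj psi) m c y * weil_brezin t c y) C.
  have [C _ dC] := dominated_weil_brezin k0 t c.
  have [B _ hB] := coefficient_bounded (torus_conj psi) m c.
  exists (B * C); apply: (dominated_bounded_mul dC _ hB).
  exact/smooth_ccont/smooth_coefficient.
transitivity (\sum_m \sum_c be m * check_const%:C *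
   (cintegral setT (fun y => coefficient (torus_conj psi) m c y * weil_brezin t c y))^*).
  apply: eq_bigr => m _; rewrite sigma_check_value integral_weil_brezin_mul//.
  by rewrite rmorph_sum mulrA mulr_sumr.
rewrite exchange_big /=; apply: eq_bigr => c _; rewrite /regular.
transitivity (cintegral setT (fun y => \sum_m be m * check_const%:C *
    (coefficient (torus_conj psi) m c y * weil_brezin t c y)^*)); last first.
  congr cintegral; apply/funext => y; rewrite /pairing_coefficient mulr_suml.
  by apply: eq_bigr => m _; rewrite -[RHS]mulrA; congr (_ * _); exact: rmorphM.
rewrite cintegral_sum => [|m].
  apply: eq_bigr => m _; have [C dC] := dom m c.
  by rewrite (cintegral_scale _ (dominated_conj dC)) (cintegral_conj dC).
have [C dC] := dom m c.
by exists (cabs (be m * check_const%:C) * C); exact: dominated_scale (dominated_conj dC).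
Qed.

Lemma pairing_coefficient_bounded psi be c : exists B : R, forall y, cabs (pairing_coefficient psi be c y) <= B.
Proof.
have H m : {B : R | forall y, cabs (coefficient (torus_conj psi) m c y) <= B}.
  by apply/cid; have [B _ hB] := coefficient_bounded (torus_conj psi) m c; exists B.
exists (\sum_m cabs (be m * check_const%:C) * sval (H m)) => y.
apply: le_trans (cabs_sum _ _ _) _; apply: ler_sum => m _.
by rewrite cabsM cabs_conj ler_wpM2l ?cabs_ge0//; exact: (svalP (H m)).
Qed.

Lemma is_pairing_span psi al be : is_pairing (span sig al) (dist_mul psi (span sigc be))
  (\sum_c al c * theta_const%:C * (pairing_coefficient psi be c 0)^*).
Proof.
exists (fun c phi => al c * theta_const%:C * phi 0), (pairing_coefficient psi be).
have lin (c : Z) (P : set ('rV[R]_n -> R[i])) : linear_on P (fun phi => al c * theta_const%:C * phi 0).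
  by move=> a phi phi' _ _; rewrite -[(a *: phi + phi') 0]/(a * phi 0 + phi' 0); ring.
split=> [||||//].
- split=> [c|]; last first.
    apply/funext => t; rewrite spanE /of_weil_brezin; apply: eq_bigr => c _.
    by rewrite sigma_value mulrA.
  split; first exact: lin.
  exists 0%N, (cabs (al c * theta_const%:C)) => phi B _ hB; rewrite cabsM ler_wpM2l ?cabs_ge0//.
  by have := hB [::] [::] 0 isT isT; rewrite /monomial big_nil mul1r.
- move=> c; split; first exact: lin.
  exists 0%N, (cabs (al c * theta_const%:C)), [set 0]; split; first exact: compact_set1.
  by move=> phi B _ hB; rewrite cabsM ler_wpM2l ?cabs_ge0//; exact: (hB [::] 0).
- split; last exact: dist_mul_span_check.
  move=> c; have [B hB] := pairing_coefficient_bounded psi be c.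
  apply: (tempered_regular _ hB); exact/smooth_ccont/smooth_pairing_coefficient.
- by move=> c; exact: smooth_pairing_coefficient.
Qed.

Lemma bks_span psi al be : bks (span sig al) (dist_mul psi (span sigc be)) =
  \sum_c al c * \sum_m (be m)^* * coefficient (torus_conj psi) m c 0.
Proof.
have P := is_pairing_span psi al be.
rewrite /bks /pairing (xget_unique 0 P) => [|z Pz]; last first.
  exact: is_pairing_unique (x_flat_span al) Pz P.
rewrite mulr_suml; apply: eq_bigr => c _; rewrite -!mulrA; congr (_ * _).
rewrite rmorph_sum /= mulr_suml mulr_sumr; apply: eq_bigr => m _.
rewrite conj_mul_real.
transitivity ((theta_const%:C * check_const%:C * (rho_pairing R n k)%:C) *
  ((be m)^* * coefficient (torus_conj psi) m c 0)); first by ring.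
by rewrite -2!rmorphM constE rmorph1 mul1r.
Qed.

(** Such a functional has no pairing with any other, so that the value is the
    default one. *)
Lemma bks_not_span s b : x_flat s -> ~ (exists al, s = span sig al) -> bks s b = 0.
Proof.
move=> sf ns; rewrite /bks /pairing xgetPN ?mul0r// => z Pz.
by apply: ns; exact: flat_in_span sf Pz.
Qed.

End Pairing.

(** * Matrices of the Toeplitz operators *)

Section ToeplitzMatrices.
Variables (R : realType) (n k : nat).
Hypothesis k0 : (0 < k)%N.
Local Notation ix := (@lshift n n).
Local Notation iy := (@rshift n n).
Local Notation Z := (Zkn n k).
Local Notation func := (functional R n k).
Local Notation sig := (@sigma R n k).
Local Notation sigc := (@sigma_check R n k).
Implicit Types (t : section R n k) (c m : Z) (f : torus_fun R n) (s : func) (al be : Z -> R[i]).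

Lemma torus_conjK f : torus_conj (torus_conj f) = f.
Proof. by apply: val_inj; apply/funext => u; rewrite /= /cconj conjCK. Qed.

Lemma dist_nabla_vf_conjE (xi : vector_field R n) s t :
  dist_nabla_vf (vf_conj xi) s t = \sum_j - s (nabla j (section_mul (xi j) t)).
Proof.
rewrite /dist_nabla_vf fct_sumE; apply: eq_bigr => j _.
by rewrite /dist_mul /dist_nabla /vf_conj torus_conjK.
Qed.

Lemma distributional0 s : distributional s -> s 0 = 0.
Proof.
move=> [lin _]; have := lin (-1) 0 0.
by rewrite scaleN1r oppr0 addr0 rmorphN1 mulN1r addNr.
Qed.

Lemma section_mul0 t : section_mul (0 : torus_fun R n) t = 0.
Proof. by apply: val_inj; apply/funext => u; rewrite /= -[LHS]/(0 * t u) mul0r. Qed.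

Lemma nabla0 j : nabla j (0 : section R n k) = 0.
Proof.
apply: val_inj; apply/funext => u; rewrite /= /nabla_fun.
rewrite -[X in _ - _ * X]/(0 : R[i]) mulr0 subr0.
by rewrite -[X in pderiv j X]/(cst 0) pderiv_cst.
Qed.

Lemma torus_one_subproof : (fun=> 1) \in quasi_periodic (@mult1 R n).
Proof. by apply/asboolP; split=> [|l u]; [exact: smooth_const|rewrite mulr1]. Qed.
Definition torus_one : torus_fun R n := QPer torus_one_subproof.

Lemma section_mul1 t : section_mul torus_one t = t.
Proof. by apply: val_inj; apply/funext => u; rewrite /= -[LHS]/(1 * t u) mul1r. Qed.

(** The coordinate vector fields along [x] belong to the polarization. *)
Lemma Hsp_flat s : Hsp s -> x_flat s.
Proof.
move=> [ds ps] i t.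
pose xi : vector_field R n := fun j => if j == ix i then torus_one else 0.
have PTxi : PT xi by move=> l; rewrite /xi eq_rlshift.
have /(congr1 (fun s : func => s t)) := ps xi PTxi.
rewrite dist_nabla_vf_conjE (bigD1 (ix i))//= big1 ?addr0 => [|j ji].
  by rewrite /xi eqxx section_mul1 => /eqP; rewrite oppr_eq0 => /eqP.
by rewrite /xi (negbTE ji) section_mul0 nabla0 distributional0// oppr0.
Qed.

Lemma sigma_check_fiber m t : sigc m t =
  (check_const R n k)%:C * ((k%:R ^+ n)^-1 * \sum_b character_node R m b * fiber_mean t b)^*.
Proof. by rewrite sigma_check_value// integral_weil_brezin. Qed.

(** The [sigma_check m] are combinations of means over fibres that are
    periodic in [y], and these annihilate derivatives along [y]. *)
Lemma span_check_polarized be : Hsp_check (span sigc be).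
Proof.
split; first split.
- move=> a t1 t2; rewrite !spanE mulr_sumr -big_split /=; apply: eq_bigr => m _.
  rewrite !sigma_check_fiber.
  have -> : \sum_b character_node R m b * fiber_mean (a *: t1 + t2) b =
      a * (\sum_b character_node R m b * fiber_mean t1 b) + \sum_b character_node R m b * fiber_mean t2 b.
    rewrite mulr_sumr -big_split /=; apply: eq_bigr => b _.
    by rewrite fiber_meanD mulrDr mulrCA.
  by rewrite mulrDr rmorphD mulrCA rmorphM /=; ring.
- exists 0%N, (\sum_m cabs (be m * ((check_const R n k)%:C * (((k%:R : R[i]) ^+ n)^-1)^*)) * \sum_(b : Z) 2 ^+ n).
  move=> t B hB; have tB : forall u, cabs (t u) <= B.
    by apply: cabs_section_le => // u u01; exact: (hB [::]).
  rewrite spanE mulr_suml; apply: le_trans (cabs_sum _ _ _) _; apply: ler_sum => m _.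
  rewrite sigma_check_fiber; set S := \sum_b _; set x := (k%:R ^+ n)^-1.
  have -> : be m * ((check_const R n k)%:C * (x * S)^*) = be m * ((check_const R n k)%:C * x^*) * S^*.
    by rewrite rmorphM /=; ring.
  rewrite cabsM -[leRHS]mulrA ler_wpM2l ?cabs_ge0//.
  rewrite cabs_conj mulr_suml; apply: le_trans (cabs_sum _ _ _) _; apply: ler_sum => b _.
  by rewrite cabsM cabs_cis mul1r; exact: cabs_fiber_mean_le.
- move=> xi PTxi; apply/funext => t; rewrite dist_nabla_vf_conjE big1// => j _.
  case: (split_ordP j) => i ->.
    rewrite PTxi section_mul0 nabla0 spanE big1 ?oppr0// => m _.
    rewrite sigma_check_fiber big1 ?mulr0 ?rmorph0 ?mulr0// => b _.
    have := fiber_meanD (-1) (0 : section R n k) 0 b.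
    by rewrite scaleN1r oppr0 addr0 mulN1r addNr => ->; rewrite mulr0.
  rewrite spanE big1 ?oppr0// => m _.
  rewrite sigma_check_fiber big1 ?mulr0 ?rmorph0 ?mulr0// => b _.
  by rewrite fiber_mean_nabla_y// mulr0.
Qed.

Lemma span_delta (e : Z -> func) m : e m = span e (fun c => ((c == m) : bool)%:R).
Proof.
rewrite /span (bigD1 m)//= eqxx scale1r big1 ?addr0// => c /negbTE ->.
by rewrite scale0r.
Qed.

(** By [bks_span] the Toeplitz operator has as entries the coefficients at 0. *)
Lemma toeplitz_span f al : toeplitz f (span sig al) =
  span sig (fun m => \sum_c al c * coefficient f m c 0).
Proof.
apply: eq_bigr => m _; congr (_ *: _); rewrite (span_delta sigc m) bks_span// torus_conjK.
apply: eq_bigr => c _; congr (_ * _); rewrite (bigD1 m)//= big1 ?addr0 => [|c' /negbTE ->].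
  by rewrite eqxx rmorph1 mul1r.
by rewrite rmorph0 mul0r.
Qed.

(** The roles of rows and columns are exchanged, hence the function is
    evaluated at height [m / k] instead of [c / k]. *)
Lemma toeplitz_check_span f be : toeplitz_check f (span sigc be) =
  span sigc (fun m => \sum_c be c * (coefficient (torus_conj f) c m 0)^*).
Proof.
apply: eq_bigr => m _; congr (_ *: _); rewrite (span_delta sig m) bks_span//.
rewrite (bigD1 m)//= [X in _ + X]big1 ?addr0 => [|c' /negbTE ->]; last by rewrite mul0r.
rewrite eqxx mul1r rmorph_sum; apply: eq_bigr => c _.
by rewrite rmorphM /= conjCK.
Qed.

(** All pairings take their default value 0. *)
Lemma toeplitz_not_span f s : Hsp s -> ~ (exists al, s = span sig al) -> toeplitz f s = 0.
Proof.
move=> Hs ns; rewrite /toeplitz big1// => m _.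
by rewrite bks_not_span ?scale0r//; exact: Hsp_flat.
Qed.

Lemma span0 (e : Z -> func) : span e (fun=> 0) = 0.
Proof. by rewrite /span big1// => m _; rewrite scale0r. Qed.

Lemma B_map_span be : B_map (span sigc be) = span sig be.
Proof.
rewrite /B_map /basis_map /patch mem_set; last exact: span_check_polarized.
by rewrite coords_sigma_check.
Qed.

Lemma B_inv_span al : Hsp (span sig al) -> B_inv (span sig al) = span sigc al.
Proof. by move=> Hs; rewrite /B_inv /basis_map /patch mem_set// coords_sigma. Qed.

Lemma B_inv_not_span s : Hsp s -> ~ (exists al, s = span sig al) -> B_inv s = 0.
Proof.
move=> Hs ns; rewrite /B_inv /basis_map /patch mem_set//.
rewrite /coords xgetPN => [|al /= sal]; first exact: span0.
by apply: ns; exists al.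
Qed.

(** The phases of the two terms agree; they differ by the function and by the
    height, [m / k] for the first and [c / k] for the second. *)
Definition difference_entry f g m c : R[i] :=
  (coefficient (torus_conj f) c m 0)^* - coefficient g m c 0.

Lemma difference_span f g al : Hsp (span sig al) ->
  (F_GQ (toeplitz_check (k := k) f) - toeplitz g) (span sig al) =
  span sig (fun m => \sum_c difference_entry f g m c * al c).
Proof.
move=> Hs; rewrite -[LHS]/(F_GQ (toeplitz_check f) _ - toeplitz g _) /F_GQ /=.
rewrite B_inv_span// toeplitz_check_span B_map_span toeplitz_span /span -sumrB.
apply: eq_bigr => m _; rewrite -scalerBl -sumrB; congr (_ *: _).
by apply: eq_bigr => c _; rewrite -mulrBr mulrC.
Qed.

(** On polarized functionals outside the span of the [sigma m], coordinates
    and pairings take their default values, and both operators vanish. *)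
Lemma difference_not_span f g s : Hsp s -> ~ (exists al, s = span sig al) ->
  (F_GQ (toeplitz_check (k := k) f) - toeplitz g) s = span sig (fun=> 0).
Proof.
move=> Hs ns; rewrite -[LHS]/(F_GQ (toeplitz_check f) s - toeplitz g s) /F_GQ /=.
rewrite B_inv_not_span// toeplitz_not_span// subr0 -(span0 sigc) toeplitz_check_span B_map_span.
by congr span; apply/funext => m; rewrite big1// => c _; rewrite mul0r.
Qed.

Lemma hnorm_span al : hnorm (span sig al) = Num.sqrt (\sum_m cabs (al m) ^+ 2).
Proof.
rewrite /hnorm /inner coords_sigma//; congr Num.sqrt.
have -> : \sum_m al m * (al m)^* = (\sum_m cabs (al m) ^+ 2)%:C.
  by rewrite rmorph_sum; apply: eq_bigr => m _; exact/esym/cabs_sqrC.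
by [].
Qed.

(** Cauchy-Schwarz with the row as weight, then summation over columns. *)
Lemma schur_test (I : finType) (D : I -> I -> R) (a : I -> R) (X : R) : 0 <= X ->
  (forall i j, 0 <= D i j) -> (forall j, 0 <= a j) ->
  (forall i, \sum_j D i j <= X) -> (forall j, \sum_i D i j <= X) ->
  \sum_i (\sum_j D i j * a j) ^+ 2 <= X ^+ 2 * \sum_j a j ^+ 2.
Proof.
move=> X0 D0 a0 row col.
have cs i : (\sum_j D i j * a j) ^+ 2 <= X * \sum_j D i j * a j ^+ 2.
  pose S := \sum_j D i j; pose V := \sum_j D i j * a j; pose W := \sum_j D i j * a j ^+ 2.
  have W0 : 0 <= W by apply: sumr_ge0 => j _; rewrite mulr_ge0// sqr_ge0.
  have S0 : 0 <= S by exact: sumr_ge0.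
  suff : V ^+ 2 <= S * W by move/le_trans; apply; rewrite ler_wpM2r//; exact: row.
  (* Lagrange's identity for the Cauchy-Schwarz inequality with weights [D i]. *)
  have key : 0 <= \sum_j \sum_l D i j * D i l * (a j - a l) ^+ 2.
    by apply: sumr_ge0 => j _; apply: sumr_ge0 => l _; rewrite mulr_ge0 ?sqr_ge0// mulr_ge0.
  have E : \sum_j \sum_l D i j * D i l * (a j - a l) ^+ 2 = 2 * (S * W - V ^+ 2).
    transitivity (\sum_j \sum_l (D i j * a j ^+ 2 * D i l + D i j * (D i l * a l ^+ 2)
        - 2 * (D i j * a j * (D i l * a l)))).
      by apply: eq_bigr => j _; apply: eq_bigr => l _; ring.
    under eq_bigr => j _ do rewrite sumrB big_split /= -!mulr_sumr.
    by rewrite sumrB big_split /= -!mulr_suml -mulr_sumr -mulr_suml /S /V /W; ring.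
  by move: key; rewrite E pmulr_rge0// subr_ge0.
apply: le_trans (ler_sum _ (fun i _ => cs i)) _.
rewrite -mulr_sumr expr2 -mulrA ler_wpM2l// exchange_big /= mulr_sumr.
by apply: ler_sum => j _; rewrite -mulr_suml ler_wpM2r ?sqr_ge0.
Qed.

(** In the orthonormal basis the norm of the operator is that of its matrix,
    to which [schur_test] applies. *)
Lemma opnorm_difference_le f g (X : R) : 0 <= X ->
  (forall m, \sum_c cabs (difference_entry f g m c) <= X) ->
  (forall c, \sum_m cabs (difference_entry f g m c) <= X) ->
  (opnorm (k := k) (F_GQ (toeplitz_check (k := k) f) - toeplitz g)%R <= X%:E)%E.
Proof.
move=> X0 row col; apply: ge_ereal_sup => _ [s [Hs s1] <-]; rewrite lee_fin.
(* The unit ball consists of combinations of the [sigma m] and of functionals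
   on which the difference vanishes. *)
have [[al sE]|ns] := pselect (exists al, s = span sig al); last first.
  rewrite difference_not_span// hnorm_span big1 ?sqrtr0// => m _.
  by rewrite cabs0 expr0n.
rewrite sE in Hs s1 *; rewrite difference_span// hnorm_span.
rewrite -[leRHS]ger0_norm// -sqrtr_sqr ler_wsqrtr//.
apply: (@le_trans _ _ (\sum_m (\sum_c cabs (difference_entry f g m c) * cabs (al c)) ^+ 2)).
  apply: ler_sum => m _; rewrite ler_sqr ?nnegrE ?cabs_ge0//; last first.
    by apply: sumr_ge0 => c _; rewrite mulr_ge0 ?cabs_ge0.
  by apply: le_trans (cabs_sum _ _ _) _; apply: ler_sum => c _; rewrite cabsM.
apply: le_trans (schur_test X0 _ _ row col) _ => [m c|c|]; try exact: cabs_ge0.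
rewrite ler_piMr ?sqr_ge0//.
move: s1; rewrite hnorm_span => s1.
have S0 : 0 <= \sum_j cabs (al j) ^+ 2 by apply: sumr_ge0 => j _; exact: sqr_ge0.
by rewrite -(sqr_sqrtr S0) expr_le1// sqrtr_ge0.
Qed.

End ToeplitzMatrices.

(** * Taylor expansion of the Fourier coefficients *)

Section FourierTaylor.
Variables (R : realType) (n : nat).
Local Notation ix := (@lshift n n).
Local Notation iy := (@rshift n n).
Local Notation vec := 'rV[R]_(n + n).
Implicit Types (f g : torus_fun R n) (u : vec) (p : 'I_n -> int).
Local Notation w := (@cauchy_weight R).

Lemma torus_ccont g : ccont g.
Proof. exact/smooth_ccont/qper_smooth. Qed.

Lemma fourier_torusD p u (a : R[i]) g g' :
  fourier_x p (a *: g + g')%R u = a * fourier_x p g u + fourier_x p g' u.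
Proof. by rewrite (fourier_xD p a (torus_ccont g) (torus_ccont g')). Qed.

Lemma fourier_torusZ p u (a : R[i]) g : fourier_x p (a *: g)%R u = a * fourier_x p g u.
Proof.
have := linear_sum (F := fun g : torus_fun R n => fourier_x p g u) [:: tt] (fun=> a) (fun=> g)
  (fourier_torusD p u).
by rewrite !big_seq1.
Qed.

Lemma fourier_torus_sum p u (I : Type) (r : seq I) (G : I -> torus_fun R n) :
  fourier_x p (\sum_(i <- r) G i)%R u = \sum_(i <- r) fourier_x p (G i) u.
Proof.
have := linear_sum (F := fun g : torus_fun R n => fourier_x p g u) r (fun=> 1) G
  (fourier_torusD p u).
rewrite (eq_bigr G) => [->|i _]; last by rewrite scale1r.
by apply: eq_bigr => i _; rewrite mul1r.
Qed.

Lemma torus_pderivZ j (a : R[i]) g : torus_pderiv j (a *: g) = a *: torus_pderiv j g.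
Proof.
apply: val_inj; apply/funext => u /=.
rewrite -[LHS]/(pderiv j (fun u => a * g u) u).
rewrite (has_pderiv_pderiv (f' := fun u => a * pderiv j g u))//.
have c0 : has_pderiv j (fun _ : vec => a) (fun=> 0) by move=> v; exact: cderiv_cst.
have := has_pderivM c0 (smooth_has_pderiv j (qper_smooth g)).
by move/has_pderiv_ext; apply => v; rewrite ?mul0r ?add0r.
Qed.

Lemma DeltaZ (a : R[i]) g : Delta (a *: g) = a *: Delta g.
Proof.
rewrite /Delta [RHS]scalerA [a * _]mulrC -[RHS]scalerA; congr (_ *: _); rewrite scaler_sumr; apply: eq_bigr => i _.
by rewrite !torus_pderivZ.
Qed.

Lemma iter_DeltaZ (a : R[i]) i f :
  iter i (fun g => a *: Delta g) f = a ^+ i *: iter i (@Delta R n) f.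
Proof.
by elim: i => [|i IH]; rewrite ?expr0 ?scale1r// iterS IH DeltaZ scalerA exprS.
Qed.

Lemma torus_periodic_x g i : periodic (ix i) g.
Proof. exact: torus_periodic. Qed.

Lemma fourier_torus_pderiv_x p u g j :
  fourier_x p (torus_pderiv (ix j) g) u = (0 +i* (2 * pi * (p j)%:~R)) * fourier_x p g u.
Proof. by rewrite (fourier_x_pderiv p j (qper_smooth g) (torus_periodic_x g)). Qed.

(** On Fourier coefficients in [x], the operator [- hbar Delta] is the
    derivative in the direction [hbar p]: each derivative in [x] contributes
    [2 * pi * p] times the imaginary unit. *)
Lemma fourier_Delta (h : R) p u g : fourier_x p ((- h%:C) *: Delta g)%R u =
  \sum_j (h * (p j)%:~R)%:C * fourier_x p (pderiv (iy j) g) u.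
Proof.
rewrite fourier_torusZ /Delta fourier_torusZ fourier_torus_sum !mulr_sumr.
apply: eq_bigr => j _; rewrite fourier_torus_pderiv_x !mulrA; congr (_ * _).
have p0 : 2 * pi != 0 :> R by rewrite gt_eqF// mulr_gt0// pi_gt0.
apply/eqP; rewrite eq_complex /= !(mulr0, mul0r, oppr0, addr0, subr0, add0r) /= eqxx ?andbT.
by apply/eqP; move: (2 * pi) p0 => x x0; field.
Qed.

(** The operator that multiplies the Fourier coefficient of frequency [p] by
    [1 + p ^+ 2] in one coordinate, as [gain_weight] does for sections. *)
Definition gain_frequency i g : torus_fun R n :=
  (- ((2 * pi) ^- 2)%:C) *: torus_pderiv (ix i) (torus_pderiv (ix i) g) + g.

Lemma fourier_gain i p u g :
  fourier_x p (gain_frequency i g) u = (1 + (p i)%:~R ^+ 2)%:C * fourier_x p g u.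
Proof.
rewrite fourier_torusD !fourier_torus_pderiv_x !mulrA -[X in _ + X]mul1r -mulrDl; congr (_ * _).
have p0 : 2 * pi != 0 :> R by rewrite gt_eqF// mulr_gt0// pi_gt0.
apply/eqP; rewrite eq_complex /= !(mulr0, mul0r, oppr0, addr0, subr0, add0r) /= eqxx ?andbT.
by apply/eqP; move: (2 * pi) p0 => x x0; field.
Qed.

Definition freq_weight p : R := \prod_(i <- enum 'I_n) w (p i)%:~R.

(** As for [weil_brezin_decay]: the coefficients of the function after
    [gain_frequency] in all coordinates are bounded. *)
Lemma fourier_decay g : exists2 A : R, 0 <= A &
  forall p u, cabs (fourier_x p g u) <= A * freq_weight p.
Proof.
have [B B0 hB] := torus_bounded (foldr gain_frequency g (enum 'I_n)).
exists (2 ^+ n * B) => [|p u]; first by rewrite mulr_ge0// exprn_ge0.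
have E s : fourier_x p (foldr gain_frequency g s) u =
    (\prod_(i <- s) (1 + (p i)%:~R ^+ 2))%:C * fourier_x p g u.
  elim: s => [|i s IH] /=; first by rewrite big_nil mul1r.
  by rewrite fourier_gain IH big_cons mulrA -rmorphM.
have bnd : cabs (fourier_x p (foldr gain_frequency g (enum 'I_n)) u) <= 2 ^+ n * B.
  have -> : (2 : R) ^+ n = 2 ^+ size (enum 'I_n) by rewrite size_enum_ord.
  apply: cabs_coord_ints_le => [|v _].
    by apply: ccontM; [exact: torus_ccont|exact/smooth_ccont/smooth_character].
  by rewrite cabsM cabs_cis mulr1.
move: bnd; rewrite E cabsM cabs_real.
have P0 : 0 < \prod_(i <- enum 'I_n) (1 + (p i)%:~R ^+ 2 : R).
  by apply: prodr_gt0 => i _; rewrite ltr_pwDl// sqr_ge0.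
rewrite gtr0_norm// /freq_weight prodfV -ler_pdivlMl// mulrC; exact.
Qed.

Definition shift_direction (h : R) p : vec := row_mx 0 (\row_i (h * (p i)%:~R)).

(** By [fourier_Delta] the transformed function has as Fourier coefficient the
    Taylor polynomial of order [N] of the coefficient of [f] along the segment
    to [u + p / k]. The remainder involves [N.+1] applications of
    [hbar Delta], and its decay in [p] is that of the smooth function [Delta]
    applied [N.+1] times to [f]. *)
Lemma fourier_taylor f N : exists2 A : R, 0 <= A & forall k p u,
  cabs (fourier_x p f (u + shift_direction (hbar R k) p) - fourier_x p (F_DQ k N f) u)
  <= A * hbar R k ^+ N.+1 * freq_weight p.
Proof.
have [A A0 hA] := fourier_decay (iter N.+1 (@Delta R n) f).
exists (2 ^+ N.+1 * A) => [|k p u]; first by rewrite mulr_ge0// exprn_ge0.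
set h := hbar R k; set v := shift_direction h p.
have h0 : 0 <= h by rewrite invr_ge0.
pose G i := iter i (fun g => (- h%:C) *: Delta g) f.
(* By [fourier_Delta], [phi i.+1] is the derivative of [phi i]. *)
pose phi i (s : R) := fourier_x p (G i) (u + s *: v).
have dphi i : cderiv (phi i) (phi i.+1).
  have sG := smooth_fourier_x p (qper_smooth (G i)).
  apply: cderiv_ext (cderiv_direction u v sG) _ _ => // s.
  have -> : phi i.+1 s = \sum_j (h * (p j)%:~R)%:C * fourier_x p (pderiv (iy j) (G i)) (u + s *: v).
    exact: fourier_Delta.
  rewrite big_split_ord /= big1 => [|j _].
    rewrite add0r; apply: eq_bigr => j _; rewrite row_mxEr mxE (pderiv_fourier_y p j (qper_smooth (G i))).
    by [].
  by rewrite row_mxEl mxE mul0r.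
have := @cderiv_taylor R N phi (A * h ^+ N.+1 * freq_weight p) dphi _ 1.
rewrite ler01 lexx => /(_ _ isT) H.
have -> : fourier_x p (F_DQ k N f) u = \sum_(i < N.+1) (1 ^+ i / i`!%:R)%:C * phi i 0.
  rewrite /F_DQ; have := linear_sum (F := fun g : torus_fun R n => fourier_x p g u)
    (index_enum 'I_N.+1) (fun i : 'I_N.+1 => (i`!%:R)^-1) (fun i => G i) (fourier_torusD p u).
  move=> ->; apply: eq_bigr => i _; rewrite /phi scale0r addr0 expr1n mul1r.
  by rewrite fmorphV rmorph_nat.
rewrite -!mulrA mulrA -mulrA [A * _]mulrA.
have -> : fourier_x p f (u + v) = phi 0%N 1 by rewrite /phi scale1r.
apply: H => s _; rewrite /phi /G iter_DeltaZ fourier_torusZ cabsM.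
have -> : cabs ((- h%:C) ^+ N.+1) = h ^+ N.+1.
  by rewrite exprNn cabsM -rmorphXn cabs_real ger0_norm ?exprn_ge0// -(rmorphN1 (real_complex R)) -rmorphXn cabs_real normrX normrN1 expr1n mul1r.
rewrite -mulrA mulrCA ler_wpM2l ?exprn_ge0//; exact: hA.
Qed.

End FourierTaylor.

(** * The matrix entries as sums of Fourier coefficients *)

Section Aliasing.
Variables (R : realType) (n k : nat).
Hypothesis k0 : (0 < k)%N.
Local Notation ix := (@lshift n n).
Local Notation iy := (@rshift n n).
Local Notation vec := 'rV[R]_(n + n).
Local Notation Z := (Zkn n k).
Implicit Types (f g : torus_fun R n) (u : vec) (m c : Z).

Let kR : (k%:R : R) != 0. Proof. by rewrite pnatr_eq0 -lt0n. Qed.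

(** Finitely many of the frequencies that agree with [m - c] modulo [k]; they
    exhaust this class as [M] grows. *)
Definition alias M m c (b : {ffun 'I_n -> 'I_M.*2}) : 'I_n -> int :=
  fun i => (m i : nat)%:Z - (c i : nat)%:Z + ((b i * k)%N%:Z - (M * k)%N%:Z).

Definition freq_diff m c : 'I_n -> int := fun i => (m i : nat)%:Z - (c i : nat)%:Z.

(** Expanding the product of Dirichlet kernels produces all aliases of the
    frequency [m - c]. *)
Lemma character_dirichlet M m c u :
  character (freq_diff m c) u * \prod_(j <- enum 'I_n) dirichlet k M (u 0 (ix j)) =
  \sum_(b : {ffun 'I_n -> 'I_M.*2}) character (alias m c b) u.
Proof.
rewrite big_enum /dirichlet bigA_distr_bigA mulr_sumr; apply: eq_bigr => b _.
rewrite /character -cis_sum -cisD; congr cis.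
rewrite !mulr_sumr -!sumrN -big_split /=; apply: eq_bigr => i _.
by rewrite /alias /freq_diff !intrD /xc; ring.
Qed.

Lemma character_fiber m c j u : character (freq_diff m c) (fiber j u) = phase R m c j.
Proof.
rewrite /phase /character_node -cisN -cisD /character; congr cis.
rewrite opprK -mulrN -mulrN -mulrDr -sumrN -sumrN -big_split; congr (_ * _).
apply: eq_bigr => i _; rewrite xc_fiber /freq_diff intrB -!pmulrn /=; ring.
Qed.

(** This is [dir_ops_rate] for the product of [g] with a character: a discrete
    Fourier coefficient is the sum of the Fourier coefficients of the aliased
    frequencies. *)
Lemma phase_sum_fourier g m c u : exists2 E : R, 0 <= E & forall M, (0 < M)%N ->
  cabs ((k%:R ^+ n)^-1 * \sum_j phase R m c j * g (fiber j u) -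
    \sum_(b : {ffun 'I_n -> 'I_M.*2}) fourier_x (alias m c b) g u) <= E / M%:R.
Proof.
pose H v := g v * character (freq_diff m c) v.
have sH : smooth H by exact: smooth_fourier_arg (qper_smooth g).
have pH l : periodic l H.
  move=> v; rewrite /H torus_periodic; congr (_ * _).
  case: (split_ordP l) => i ->.
    exact: periodic_character.
  by rewrite -[delta_mx _ _]scale1r character_line_y.
have [B B0 hB] := smooth_bound_compact (3 * size (enum 'I_n)) (@compact_unit_cube R (n + n)) sH.
have bH : bounded_on setT (3 * size (enum 'I_n)) H B.
  move=> l v lr _; have [v' [E v01 _]] := reduce_mod1 (enum 'I_(n + n)) v.
  rewrite -E => [|j _]; last by apply: periodic_pderivs; exact: pH.
  by apply: hB => // j /=; apply: v01; rewrite mem_enum.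
have [C C0 HC] := dir_ops_rate R (@lshift_inj n n) k0 (enum 'I_n).
exists (C * B) => [|M M0]; first exact: mulr_ge0.
have := HC setT H B M (fun _ _ _ _ => I) sH (fun j => pH (ix j)) M0 bH u I.
rewrite (dir_ops_coord_ints (@lshift_inj n n) k M (enum_uniq _) (smooth_ccont sH)).
rewrite (@avg_opsE R _ n ix (@lshift_inj n n) k k0 H u (fun b => fiber b u)); last first.
- move=> b i ni; case: (split_ordP i) ni => j -> ni.
    by have := ni j; rewrite eqxx.
  exact: yc_fiber.
- by move=> b j; exact: xc_fiber.
have -> : \sum_(b : Z) H (fiber b u) = \sum_j phase R m c j * g (fiber j u).
  by apply: eq_bigr => j _; rewrite /H character_fiber mulrC.
have -> : coord_ints `[0, 1] ix (enum 'I_n) (fun v => H v * \prod_(j <- enum 'I_n) dirichlet k M (v 0 (ix j))) u =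
    \sum_(b : {ffun 'I_n -> 'I_M.*2}) fourier_x (alias m c b) g u.
  rewrite /fourier_x.
  transitivity (coord_ints `[0, 1] ix (enum 'I_n)
      (fun v => \sum_(b : {ffun 'I_n -> 'I_M.*2}) g v * character (alias m c b) v) u).
    by congr (coord_ints _ _ _ _ _); apply/funext => v; rewrite /H -mulrA character_dirichlet mulr_sumr.
  rewrite coord_ints_bigsum// => b _; apply: ccontM; first exact: torus_ccont.
  exact/smooth_ccont/smooth_character.
by rewrite cabs_distC.
Qed.

(** The reason for the theorem to hold: the height [m / k] of one operator and
    the height [c / k] of the other differ by [p / k] modulo 1 for every
    frequency [p] that contributes to the entry. *)
Lemma wb_shift_alias M m c b : exists l, wb_shift R c + shift_direction (hbar R k) (alias (M := M) m c b) =
  wb_shift R m + lattice R (row_mx 0 l).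
Proof.
exists (\row_i ((b i : nat)%:Z - M%:Z)); apply: vecP => i; rewrite !(xcD, ycD).
  by rewrite !xc_shift xc_row mxE /lattice [xc (map_mx _ _) i]mxE row_mxEl mxE.
rewrite !yc_shift yc_row mxE /lattice [yc (map_mx _ _) i]mxE row_mxEr mxE /alias /hbar.
by rewrite !(intrD, intrB) -!pmulrn !natrM; field; exact: kR.
Qed.

Lemma difference_entry_fourier f g m c : exists2 E : R, 0 <= E & forall M, (0 < M)%N ->
  cabs (difference_entry f g m c) <= E / M%:R +
    \sum_(b : {ffun 'I_n -> 'I_M.*2})
      cabs (fourier_x (alias m c b) f (wb_shift R c + shift_direction (hbar R k) (alias m c b))
        - fourier_x (alias m c b) g (wb_shift R c)).
Proof.
have [E1 E10 h1] := phase_sum_fourier f m c (wb_shift R m).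
have [E2 E20 h2] := phase_sum_fourier g m c (wb_shift R c).
exists (E1 + E2) => [|M M0]; first exact: addr_ge0.
have D1 : (coefficient (torus_conj f) c m 0)^* =
    (k%:R ^+ n)^-1 * \sum_j phase R m c j * f (fiber j (wb_shift R m)).
  rewrite /coefficient rmorphM fmorphV rmorphXn rmorph_nat rmorph_sum; congr (_ * _).
  apply: eq_bigr => j _; rewrite rmorphM /= /cconj conjCK /phase rmorphM /= conjCK mulrC.
  by rewrite row_mx0 add0r mulrC [_ * character_node R m j]mulrC.
have D2 : coefficient g m c 0 = (k%:R ^+ n)^-1 * \sum_j phase R m c j * g (fiber j (wb_shift R c)).
  by rewrite /coefficient row_mx0 add0r.
rewrite /difference_entry D1 D2; set X := _ * _; set Y := (X in _ - X).
have {}h1 := h1 M M0; have {}h2 := h2 M M0; rewrite -/X in h1; rewrite -/Y in h2.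
set F1 := \sum_b _ in h1; set F2 := \sum_b _ in h2.
have -> : X - Y = (X - F1) + (- (Y - F2)) + (F1 - F2) by ring.
apply: le_trans (cabsD _ _) _; apply: lerD.
  rewrite mulrDl; apply: le_trans (cabsD _ _) _; apply: lerD => //.
  by rewrite cabsN.
rewrite /F1 /F2 -sumrB; apply: le_trans (cabs_sum _ _ _) _; apply: ler_sum => b _.
have [l ->] := wb_shift_alias m c b.
have E p v : fourier_x p f (v + lattice R (row_mx 0 l)) = fourier_x p f v.
  rewrite -(@fourier_x_translate R n p f (lattice R (row_mx 0 l)) v) => [|i]; last first.
    by rewrite /lattice [xc _ _]mxE row_mxEl mxE.
  by congr fourier_x; apply/funext => x; rewrite qper_quasi mul1r.
by rewrite E.
Qed.

End Aliasing.

(** * Sums over lattice points *)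

Section LatticeWeights.
Variables (R : realType) (n k : nat).
Local Notation Z := (Zkn n k).

Lemma sum_inj_indicator (I : finType) (z : I -> int) (x : int) : injective z ->
  \sum_i ((z i == x) : bool)%:R <= 1 :> R.
Proof.
move=> zI; have [/existsP[j /eqP zj]|/existsPn nz] := boolP [exists j, z j == x].
  rewrite (bigD1 j)//= zj eqxx big1 ?addr0// => i ij.
  by rewrite -zj (inj_eq zI) (negbTE ij).
by rewrite big1// => i _; rewrite (negbTE (nz i)).
Qed.

(** Each modulus is attained at most twice, and the weights of the natural
    numbers sum up to at most 3. *)
Lemma sum_weight_inj (I : finType) (z : I -> int) : injective z ->
  \sum_i cauchy_weight ((z i)%:~R : R) <= 6.
Proof.
move=> zI; pose T := \max_i absz (z i).
have wE i : cauchy_weight ((z i)%:~R : R) = \sum_(a < T.+1) cauchy_weight (a%:R : R) * ((absz (z i) == a) : bool)%:R.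
  have iT : (absz (z i) < T.+1)%N by rewrite ltnS; exact: (leq_bigmax i).
  rewrite (bigD1 (Ordinal iT))//= eqxx mulr1 big1 ?addr0 => [|a ai].
    rewrite /cauchy_weight; congr (1 + _)^-1.
    by rewrite natr_absz intr_norm real_normK ?num_real.
  suff /negbTE -> : absz (z i) != a by rewrite mulr0.
  by apply: contra ai => /eqP za; apply/eqP/val_inj.
rewrite (eq_bigr _ (fun i _ => wE i)) exchange_big /=.
apply: (@le_trans _ _ (\sum_(a < T.+1) cauchy_weight (a%:R : R) * 2)).
  apply: ler_sum => a _; rewrite -mulr_sumr; apply: ler_wpM2l; first exact/ltW/weight_gt0.
  apply: (@le_trans _ _ (\sum_i (((z i == (a : nat)%:Z) : bool)%:R + ((z i == - (a : nat)%:Z) : bool)%:R))).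
    apply: ler_sum => i _; rewrite -natrD ler_nat.
    case: eqP => //= /eqP za; have : (z i == (a : nat)%:Z) || (z i == - (a : nat)%:Z) by lia.
    by case/orP => ->; rewrite ?addn1.
  by rewrite big_split; apply: lerD; exact: sum_inj_indicator.
rewrite -mulr_suml; have : \sum_(a < T.+1) cauchy_weight (a%:R : R) <= 3; last by lra.
rewrite big_ord_recl /= /cauchy_weight expr0n addr0 invr1.
have -> : (3 : R) = 1 + 2 by ring.
rewrite lerD2l; apply: le_trans (sum_inv_sqr R T); apply: ler_sum => a _.
rewrite lef_pV2 ?posrE ?exprn_gt0 ?ltr_pwDl ?sqr_ge0//.
by rewrite /bump /= add1n -natr1 addrC lerDr.
Qed.

(** The sum is a product over coordinates; in each coordinate the integers are
    distinct, and [sum_weight_inj] applies. *)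
Lemma sum_alias_weight (M : nat) (z : 'I_n -> 'I_k -> 'I_M.*2 -> int) :
  (forall i, injective (fun x : 'I_k * 'I_M.*2 => z i x.1 x.2)) ->
  \sum_(c : Z) \sum_(b : {ffun 'I_n -> 'I_M.*2}) freq_weight R (fun i => z i (c i) (b i)) <= 6 ^+ n.
Proof.
move=> zI; rewrite /freq_weight.
pose w (i : 'I_n) (a : 'I_k) (b : 'I_M.*2) : R := cauchy_weight (z i a b)%:~R.
have -> : \sum_(c : Z) \sum_(b : {ffun 'I_n -> 'I_M.*2}) \prod_(i <- enum 'I_n) w i (c i) (b i) =
    \prod_i \sum_a \sum_b w i a b.
  rewrite bigA_distr_bigA; apply: eq_bigr => c _.
  by rewrite bigA_distr_bigA; apply: eq_bigr => b _; rewrite big_enum.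
have -> : (6 : R) ^+ n = \prod_(i < n) 6 by rewrite prodr_const card_ord.
apply: ler_prod => i _; apply/andP; split.
  by apply: sumr_ge0 => a _; apply: sumr_ge0 => b _; exact/ltW/weight_gt0.
by rewrite pair_bigA /=; apply: (sum_weight_inj (zI i)).
Qed.

(** The class of an alias modulo [k] determines the column, and then its
    position determines the shift. *)
Lemma alias_inj_row M (m : Z) i :
  injective (fun x : 'I_k * 'I_M.*2 => (m i : nat)%:Z - (x.1 : nat)%:Z + ((x.2 * k)%N%:Z - (M * k)%N%:Z)).
Proof.
move=> [a b] [a' b'] /= E; have ak := ltn_ord a; have ak' := ltn_ord a'.
have bb : (b : nat) = b' by nia.
have aa : (a : nat) = a' by move: E; rewrite bb; lia.
by congr (_, _); exact: val_inj.
Qed.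

Lemma alias_inj_column M (c : Z) i :
  injective (fun x : 'I_k * 'I_M.*2 => (x.1 : nat)%:Z - (c i : nat)%:Z + ((x.2 * k)%N%:Z - (M * k)%N%:Z)).
Proof.
move=> [a b] [a' b'] /= E; have ak := ltn_ord a; have ak' := ltn_ord a'.
have bb : (b : nat) = b' by nia.
have aa : (a : nat) = a' by move: E; rewrite bb; lia.
by congr (_, _); exact: val_inj.
Qed.

End LatticeWeights.

Section LimitOfSums.
Variable R : realType.

(** Passage to the limit [M] to infinity. *)
Lemma le_of_le_div (x y E : R) : 0 <= E -> (forall M, (0 < M)%N -> x <= E / M%:R + y) -> x <= y.
Proof.
move=> E0 H; apply/ler_addgt0Pr => e e0.
pose M := (Num.truncn (E / e)).+1.
have M0 : (0 : R) < M%:R by rewrite ltr0n.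
apply: le_trans (H M isT) _; rewrite addrC lerD2l ler_pdivrMr// mulrC -ler_pdivrMr//.
by apply/ltW/truncnS_gt.
Qed.

(** The error terms [E] depend on the entry, in an unspecified manner. They
    disappear in the limit [M] to infinity, which is taken after summation
    because the bound [Y] holds for whole sums. *)
Lemma sum_entries (I : finType) (e : I -> R) (E : I -> R) (S : nat -> I -> R) (Y : R) :
  (forall i, 0 <= E i) ->
  (forall i M, (0 < M)%N -> e i <= E i / M%:R + S M i) ->
  (forall M, \sum_i S M i <= Y) -> \sum_i e i <= Y.
Proof.
move=> E0 H SY; apply: (@le_of_le_div _ _ (\sum_i E i)); first exact: sumr_ge0.
move=> M M0; apply: le_trans (ler_sum _ (fun i _ => H i M M0)) _.
by rewrite big_split -mulr_suml lerD2l.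
Qed.

End LimitOfSums.

(** * The norm of the difference *)

Theorem theorem1p2 (R : realType) (n : nat) (n_gt0 : (0 < n)%N)
    (f : torus_fun R n) (N : nat) :
  exists2 K : R, 0 < K & forall k : nat, (0 < k)%N ->
    (opnorm (k := k)
       (F_GQ (toeplitz_check (k := k) f) - toeplitz (F_DQ k N f))%R
     <= (K * (hbar R k) ^+ N.+1)%:E)%E.
Proof.
have [A A0 hA] := fourier_taylor f N.
(* The constant [A] may be 0, whence [A + 1]. *)
exists ((A + 1) * 6 ^+ n) => [|k k0]; first by rewrite mulr_gt0 ?exprn_gt0// ltr_wpDl.
set h := hbar R k; have h0 : 0 <= h by rewrite invr_ge0.
have hN : 0 <= A * h ^+ N.+1 by rewrite mulr_ge0// exprn_ge0.
set g := F_DQ k N f.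
(* [J] runs through the entries of a row or of a column. *)
have bound (J : Zkn n k -> Zkn n k * Zkn n k) :
    (forall M, \sum_i \sum_(b : {ffun 'I_n -> 'I_M.*2}) freq_weight R (alias (J i).1 (J i).2 b) <= 6 ^+ n) ->
    \sum_i cabs (difference_entry f g (J i).1 (J i).2) <= (A + 1) * 6 ^+ n * h ^+ N.+1.
  move=> HJ.
  have He i : {E : R | 0 <= E /\ forall M, (0 < M)%N ->
      cabs (difference_entry f g (J i).1 (J i).2) <= E / M%:R +
      \sum_(b : {ffun 'I_n -> 'I_M.*2}) A * h ^+ N.+1 * freq_weight R (alias (J i).1 (J i).2 b)}.
    apply/cid; have [E E0 HE] := difference_entry_fourier k0 f g (J i).1 (J i).2.
    exists E; split=> // M M0; apply: le_trans (HE M M0) _; rewrite lerD2l.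
    by apply: ler_sum => b _; exact: hA.
  apply: (@sum_entries R _ _ (fun i => sval (He i)) (fun M i =>
      \sum_(b : {ffun 'I_n -> 'I_M.*2}) A * h ^+ N.+1 * freq_weight R (alias (J i).1 (J i).2 b))).
  - by move=> i; have [] := svalP (He i).
  - by move=> i M M0; have [_] := svalP (He i); apply.
  move=> M; under eq_bigr => i _ do rewrite -mulr_sumr.
  rewrite -mulr_sumr; apply: le_trans (ler_wpM2l hN (HJ M)) _.
  rewrite mulrAC ler_wpM2r ?exprn_ge0// mulrDl lerDl mul1r exprn_ge0//.
apply: opnorm_difference_le => //.
- by rewrite !mulr_ge0 ?exprn_ge0// addr_ge0.
- move=> m; apply: (bound (fun c => (m, c))) => M /=.
  apply: (@sum_alias_weight R n k M (fun i a b =>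
    (m i : nat)%:Z - (a : nat)%:Z + ((b * k)%N%:Z - (M * k)%N%:Z))) => i.
  exact: alias_inj_row.
- move=> c; apply: (bound (fun m => (m, c))) => M /=.
  apply: (@sum_alias_weight R n k M (fun i a b =>
    (a : nat)%:Z - (c i : nat)%:Z + ((b * k)%N%:Z - (M * k)%N%:Z))) => i.
  exact: alias_inj_column.
Qed.
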